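(* Let $D_B\supseteq D_A=D$, $\dim\ker A=n<\infty$, let $\lambda A+B$ be a regular pencil of index $\nu$, and let $f\in C(\mathbb R_+\times D,Y)$ have the structure $$f(t,x)=(Q_1+Q_{20})f(t,x)+\sum_{s=1}^{\nu-2}Q_{2\Sigma,s}f\Big(t,\sum_{j=1}^{\nu-1}x_{2j}^{(j+1)}+\sum_{j=s}^{\nu-2}x_{2\wedge,j}\Big)+\sum_{s=1}^{\nu-1}Q_{2s}^{(s+1)}f\Big(t,\sum_{j=s}^{\nu-1}x_{2j}^{(j+1)}\Big).$$ Assume that there exist open sets $M_{20}\subseteq D_{20}$, $M_{2j}^{(j+1)}\subseteq D_{2j}^{(j+1)}$ and $M_{2\wedge,j}\subseteq D_{2\wedge,j}$ ($j=1,\dots,\nu-2$), $M_{2(\nu-1)}=M_{2(\nu-1)}^{(\nu)}\subseteq D_{2(\nu-1)}$ such that, for $s=1,\dots,\nu-2$, $$Q_{2s}^{(s+1)}f\in C^{\nu-2}\Big(\mathbb R_+\times\big(\dot{+}_{i=s}^{\nu-1}M_{2i}^{(i+1)}\big),Y_{2s}^{(s+1)}\Big),\quad Q_{2\Sigma,s}f\in C^s\Big(\mathbb R_+\times\big(\dot{+}_{i=1}^{\nu-1}M_{2i}^{(i+1)}\,\dot{+}\,\dot{+}_{i=s}^{\nu-2}M_{2\wedge,i}\big),Y_{2\Sigma,s}\Big),$$ and $Q_{2(\nu-1)}f\in C^{\nu-1}(\mathbb R_+\times M_{2(\nu-1)},Y_{2(\nu-1)})$, and such that, with $M_{2\Sigma}=\dot{+}_{i=1}^{\nu-1}M_{2i}^{(i+1)}\,\dot{+}\,\dot{+}_{i=1}^{\nu-2}M_{2\wedge,i}$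 and $M=D_1\dot{+}M_{20}\dot{+}M_{2\Sigma}$, the following conditions hold. 1.a. For each $t\in\mathbb R_+$ there exists a unique $x_{2(\nu-1)}\in M_{2(\nu-1)}$ such that $F_{2(\nu-1)}(t,x_{2(\nu-1)})=0$. 1.b. For each $s=1,\dots,\nu-2$: for each $t\in\mathbb R_+$, $x_{2j}^{(j+1)}\in M_{2j}^{(j+1)}$, $j=s+1,\dots,\nu-1$, there exists a unique $x_{2s}^{(s+1)}\in M_{2s}^{(s+1)}$ such that $F_{2s}^{(s+1)}=0$ at $(t,x_{2j}^{(j+1)},j=s,\dots,\nu-1)$. 1.c. For each $t\in\mathbb R_+$, $x_{2j}^{(j+1)}\in M_{2j}^{(j+1)}$, $j=1,\dots,\nu-1$, $d_{2(\nu-1)}\in D_{2(\nu-1)}$ there exists a unique $x_{2\wedge,\nu-2}\in M_{2\wedge,\nu-2}$ such that $F_{2\Sigma,\nu-2}=0$ at these values. 1.d. For each $s=1,\dots,\nu-3$: for each $t\in\mathbb R_+$, $x_{2j}^{(j+1)}\in M_{2j}^{(j+1)}$, $j=1,\dots,\nu-1$, $x_{2\wedge,i}\in M_{2\wedge,i}$, $i=s+1,\dots,\nu-2$, $d_{2\wedge,s+1}\in D_{2\wedge,s+1}$, $d_{2(s+1)}^{(s+2)}\in D_{2(s+1)}^{(s+2)}$ there exists a unique $x_{2\wedge,s}\in M_{2\wedge,s}$ such that $F_{2\Sigma,s}=0$ at these values. 1.e. For each $t\in\mathbb R_+$, $x_1\in D_1$, $x_{2\Sigma}\in M_{2\Sigma}$,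 $d_{2\wedge,1}\in D_{2\wedge,1}$, $d_{21}^{(2)}\in D_{21}^{(2)}$ there exists a unique $x_{20}\in M_{20}$ such that $F_{20}=0$ at these values. 2.a. For any fixed $\hat t\in\mathbb R_+$, $\hat x_{2(\nu-1)}\in M_{2(\nu-1)}$ satisfying $F_{2(\nu-1)}=0$, the operator $[\partial_x(Q_{2(\nu-1)}f)(\hat t,\hat x_{2(\nu-1)})-Q_{2(\nu-1)}B]P_{2(\nu-1)}|_{D_{2(\nu-1)}}:D_{2(\nu-1)}\to Y_{2(\nu-1)}$ has an inverse in $\mathrm L(Y_{2(\nu-1)},D_{2(\nu-1)})$. 2.b. For each $s=1,\dots,\nu-2$: for any fixed $\hat t\in\mathbb R_+$, $\hat x_{2i}^{(i+1)}\in M_{2i}^{(i+1)}$, $i=s,\dots,\nu-1$, satisfying $F_{2s}^{(s+1)}=0$, the operator $[\partial_x(Q_{2s}^{(s+1)}f)(\hat t,\sum_{i=s}^{\nu-1}\hat x_{2i}^{(i+1)})-Q_{2s}^{(s+1)}B]P_{2s}^{(s+1)}|_{D_{2s}^{(s+1)}}:D_{2s}^{(s+1)}\to Y_{2s}^{(s+1)}$ has an inverse in $\mathrm L(Y_{2s}^{(s+1)},D_{2s}^{(s+1)})$. 2.c. For any fixed $\hat t\in\mathbb R_+$, $\hat x_{2j}^{(j+1)}\in M_{2j}^{(j+1)}$, $j=1,\dots,\nu-1$, $\hat x_{2\wedge,\nu-2}\in M_{2\wedge,\nu-2}$, $\hat d_{2(\nu-1)}\in D_{2(\nu-1)}$ satisfying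 $F_{2\Sigma,\nu-2}=0$, the operator $[\partial_x(Q_{2\Sigma,\nu-2}f)(\hat t,\sum_{j=1}^{\nu-1}\hat x_{2j}^{(j+1)}+\hat x_{2\wedge,\nu-2})-Q_{2\Sigma,\nu-2}B]P_{2\wedge,\nu-2}|_{D_{2\wedge,\nu-2}}:D_{2\wedge,\nu-2}\to Y_{2\Sigma,\nu-2}$ has an inverse in $\mathrm L(Y_{2\Sigma,\nu-2},D_{2\wedge,\nu-2})$. 2.d. For each $s=1,\dots,\nu-3$: for any fixed $\hat t\in\mathbb R_+$, $\hat x_{2j}^{(j+1)}\in M_{2j}^{(j+1)}$, $j=1,\dots,\nu-1$, $\hat x_{2\wedge,i}\in M_{2\wedge,i}$, $i=s,\dots,\nu-2$, $\hat d_{2\wedge,s+1}\in D_{2\wedge,s+1}$, $\hat d_{2(s+1)}^{(s+2)}\in D_{2(s+1)}^{(s+2)}$ satisfying $F_{2\Sigma,s}=0$, the operator $[\partial_x(Q_{2\Sigma,s}f)(\hat t,\sum_{j=1}^{\nu-1}\hat x_{2j}^{(j+1)}+\sum_{i=s}^{\nu-2}\hat x_{2\wedge,i})-Q_{2\Sigma,s}B]P_{2\wedge,s}|_{D_{2\wedge,s}}:D_{2\wedge,s}\to Y_{2\Sigma,s}$ has an inverse in $\mathrm L(Y_{2\Sigma,s},D_{2\wedge,s})$. 2.e. One of the following two conditions holds. (i) The components $Q_1f(t,x_1+x_{20}+x_{2\Sigma})$ and $Q_{20}f(t,x_1+x_{20}+x_{2\Sigma})$ satisfy locally a Lipschitz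 condition with respect to $x_1+x_{20}$ on $\mathbb R_+\times M$; and for any fixed $\hat t\in\mathbb R_+$, $\hat x_1\in D_1$, $\hat x_{20}\in M_{20}$, $\hat x_{2\Sigma}\in M_{2\Sigma}$ (put $\hat x=\hat x_1+\hat x_{20}+\hat x_{2\Sigma}$), $\hat d_{21}^{(2)}\in D_{21}^{(2)}$, $\hat d_{2\wedge,1}\in D_{2\wedge,1}$ satisfying $F_{20}=0$ there exist open neighborhoods $U_{\delta_1}(\hat t)\times U_{\delta_2}(\hat x_1)\times U_{\delta_3}(\hat x_{2\Sigma})\times U_{\delta_4}(\hat d_{21}^{(2)})\times U_{\delta_5}(\hat d_{2\wedge,1})=U_\delta(\hat t,\hat x_1,\hat x_{2\Sigma},\hat d_{21}^{(2)},\hat d_{2\wedge,1})\subset\mathbb R_+\times D_1\times D_{2\Sigma}\times D_{21}^{(2)}\times D_{2\wedge,1}$ and $U_\varepsilon(\hat x_{20})\subset D_{20}$ and an operator $\mathrm Z\in\mathrm L(D_{20},Y_{20})$ (depending on $\hat t,\hat x,\hat d_{21}^{(2)},\hat d_{2\wedge,1}$) having an inverse $\mathrm Z^{-1}\in\mathrm L(Y_{20},D_{20})$ such that for each $(t,x_1,x_{2\Sigma},d_{21}^{(2)},d_{2\wedge,1})$ in the former neighborhood and each $x_{20}',x_{20}''\in U_\varepsilon(\hat x_{20})$ $$\big\|F_{20}(t,x_1,x_{20}',x_{2\Sigma},d_{21}^{(2)},d_{2\wedge,1})-F_{20}(t,x_1,x_{20}'',x_{2\Sigma},d_{21}^{(2)},d_{2\wedge,1})-\mathrm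 Z[x_{20}'-x_{20}'']\big\|\le k(\delta,\varepsilon)\|x_{20}'-x_{20}''\|,$$ where $k(\delta,\varepsilon)$ is such that $\lim_{\delta,\varepsilon\to0}k(\delta,\varepsilon)<\|\mathrm Z^{-1}\|^{-1}$ (the numbers $\delta,\varepsilon>0$ depend on the choice of $\hat t,\hat x,\hat d_{21}^{(2)},\hat d_{2\wedge,1}$). (ii) The components $Q_1f(t,x)$ and $Q_{20}f(t,x)$ have continuous partial derivatives with respect to $x$ on $\mathbb R_+\times M$; and for any fixed $\hat t,\hat x_1,\hat x_{20},\hat x_{2\Sigma},\hat d_{21}^{(2)},\hat d_{2\wedge,1}$ as in (i) satisfying $F_{20}=0$, the operator $[\partial_x(Q_{20}f)(\hat t,\hat x)-Q_{20}B]P_{20}|_{D_{20}}:D_{20}\to Y_{20}$ has an inverse in $\mathrm L(Y_{20},D_{20})$. 3. For any fixed $a_1,a_2>0$, $\displaystyle\sup_{t\in[0,a_1],\ x\in M,\ \|x_1\|\le a_2}\|Q_1f(t,x)\|<\infty$ ($x=x_1+x_{20}+x_{2\Sigma}$). 4. There exist a number $R>0$, a functional $V(w_1)=\max_{i=1,\dots,m}V_i(w_1)$, where $w_1=\widetilde Ax_1\in Y_1$ and $V_i\in C(Y_1,\mathbb R_+)$, $i=1,\dots,m$, are continuously differentiable functionals on $U_R^c(0)=\{w_1\in Y_1:\|w_1\|\ge R\}$, and functionals $U\in C(\mathbb R_+,\mathbb R_+)$, $\psi:\mathbb R_+\to\mathbb R_+$ such that $\psi$ is integrable on each finite interval in $\mathbb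 R_+$, $$\int^\infty\frac{du}{U(u)}=\infty,\qquad\lim_{\|w_1\|\to\infty}V(w_1)=\infty,$$ and for each $t\in\mathbb R_+$, $x_{20}\in M_{20}$, $x_{2\Sigma}\in M_{2\Sigma}$, $w_1\in U_R^c(0)$ $$\big\langle Q_1f(t,\widetilde A^{-1}w_1+x_{20}+x_{2\Sigma})-Q_1B\widetilde A^{-1}w_1,\ \partial_{w_1}V_{j(w_1)}(w_1)\big\rangle\le U(V(w_1))\psi(t),$$ where $j(w_1)\in\{1,\dots,m\}$ is any index for which $V(w_1)=V_{j(w_1)}(w_1)$ for the given $w_1$. Then for each $t_0\in\mathbb R_+$, $x_{0,1}\in D_1$ there exists a unique global solution $x(t)$ of the initial value problem $\frac{d}{dt}[Ax]+Bx=f(t,x)$, $P_1x(t_0)=x_{0,1}$.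
   Context: Notation: $\mathbb R_+=[0,\infty)$; $\mathrm L(E,F)$ is the space of bounded linear operators; $\dot{+}$ is direct sum (for subsets of the summands, the set of sums). $\int^\infty h(u)\,du=\infty$ means that $\int_{u_0}^\infty h(u)\,du$ diverges for any $u_0>0$. $\partial_wV(w)$ is the gradient (derivative) of the functional $V$ and $\langle y,\partial_wV(w)\rangle$ its value on $y$. Setting: $X,Y$ are Banach spaces; $A:D_A\to Y$, $B:D_B\to Y$ are closed linear operators with domains dense in $X$; $\operatorname{range}(A)$ is closed; $D=D_A\cap D_B\neq\{0\}$. The abstract differential-algebraic equation (ADAE) is $\frac{d}{dt}[Ax]+Bx=f(t,x)$, $t>0$. A solution on an interval $J\subseteq\mathbb R_+$ is $x\in C(J,X)$ with $Ax\in C^1(J,Y)$ (if $J=\mathbb R_+$: $Ax\in C^1((0,\infty),Y)$), $x(t)\in D$, satisfying the equation for every $t\in J$. It is global if it exists on $[t_0,\infty)$. As in the underlying local result, solutions of the initial value problem are considered in $M$ (values in $M$). Regular pencil of index $\nu\in\mathbb N$: there is $R>0$ such that for every complex $\lambda$ with $|\lambda|>R$ the operator $\lambda A+B:D\to Y$ has an inverse in $\mathrm L(Y,X)$, and $(A+\mu B)^{-1}$ has a pole of order $\nu$ at $\mu=0$ (equivalently, $(\lambda A+B)^{-1}$ has at $\lambda=\infty$ a pole of order $\nu-1$, or a removable singularity if $\nu=1$). For real spaces this is understood via complexification. Projectors: let $\{\varphi_i^1\}_{i=1}^n$ be a basis of $\ker A\cap D$, and $\{\varphi_i^j\}_{i=1,\dots,n}^{j=1,\dots,m_i}\subset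 D$ a canonical system of root vectors of $A+\mu B$ at $\mu=0$: $A\varphi_i^1=0$, $A\varphi_i^j=-B\varphi_i^{j-1}$ ($j=2,\dots,m_i$), $1\le m_i\le\nu$, $\max_i m_i=\nu$; let $q_i^j\in D_{A^*}\cap D_{B^*}$ satisfy $A^*q_i^{m_i}=0$, $A^*q_i^j=-B^*q_i^{j+1}$ ($j<m_i$), $\langle B\varphi_i^j,q_k^l\rangle=\delta_{ik}\delta_{jl}$. Such systems exist and are fixed. For $s=0,\dots,\nu-1$, $j=s+1,\dots,\nu$: $P_{2s}^{(j)}=\sum_{i:m_i=j}\langle\cdot,B^*q_i^{s+1}\rangle\varphi_i^{s+1}$, $Q_{2s}^{(j)}=\sum_{i:m_i=j}\langle\cdot,q_i^{s+1}\rangle B\varphi_i^{s+1}$, $P_{2s}=\sum_{j=s+1}^\nu P_{2s}^{(j)}$, $Q_{2s}=\sum_{j=s+1}^\nu Q_{2s}^{(j)}$; $P_2=\sum_{s=0}^{\nu-1}P_{2s}$, $Q_2=\sum_{s=0}^{\nu-1}Q_{2s}$, $P_1=I-P_2$, $Q_1=I-Q_2$, $P_{2\Sigma}=\sum_{s=1}^{\nu-1}P_{2s}$; $P_{2\wedge,s}=P_{2s}-P_{2s}^{(s+1)}$, $Q_{2\Sigma,s}=Q_{2s}-Q_{2s}^{(s+1)}$ ($s=0,\dots,\nu-2$). These are bounded projectors on $X$ (the $P$'s) and $Y$ (the $Q$'s). $D$ and $Y$ with an index denote the images of $D$ and $Y$ under the projector with the same index: $D_1=P_1D$, $D_{2s}=P_{2s}D$,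 $D_{2s}^{(j)}=P_{2s}^{(j)}D$, $D_{2\wedge,s}=P_{2\wedge,s}D$, $D_{2\Sigma}=P_{2\Sigma}D$, $Y_1=Q_1Y$, $Y_{2s}=Q_{2s}Y$, $Y_{2s}^{(j)}=Q_{2s}^{(j)}Y$, $Y_{2\Sigma,s}=Q_{2\Sigma,s}Y$; similarly $x_1=P_1x$, $x_{2s}=P_{2s}x$, $x_{2s}^{(j)}=P_{2s}^{(j)}x$, $x_{2\wedge,s}=P_{2\wedge,s}x$, $x_{2\Sigma}=P_{2\Sigma}x$. Thus $x=x_1+x_{20}+x_{2\Sigma}$, $x_{2\Sigma}=\sum_{j=1}^{\nu-1}x_{2j}^{(j+1)}+\sum_{j=1}^{\nu-2}x_{2\wedge,j}$, $x_{2(\nu-1)}=x_{2(\nu-1)}^{(\nu)}$, $Q_{2(\nu-1)}=Q_{2(\nu-1)}^{(\nu)}$. Norms on direct sums are sums of the norms of components. $\widetilde A=A+\sum_{i=1}^n\langle\cdot,B^*q_i^1\rangle B\varphi_i^{m_i}:D\to Y$ has an inverse $\widetilde A^{-1}\in\mathrm L(Y,X)$; it coincides with $A$ on $D_1$ and maps $D_1$ onto $Y_1$. Functions: $F_{2(\nu-1)}(t,x_{2(\nu-1)})=Q_{2(\nu-1)}f(t,x_{2(\nu-1)})-Bx_{2(\nu-1)}$ (used for $\nu\ge2$); $F_{2s}^{(s+1)}(t,x_{2j}^{(j+1)},j=s,\dots,\nu-1)=Q_{2s}^{(s+1)}f(t,\sum_{j=s}^{\nu-1}x_{2j}^{(j+1)})-Bx_{2s}^{(s+1)}$,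 $s=1,\dots,\nu-2$ ($\nu\ge3$); $F_{2\Sigma,\nu-2}(t,x_{2j}^{(j+1)},j=1,\dots,\nu-1,x_{2\wedge,\nu-2},d_{2(\nu-1)})=Q_{2\Sigma,\nu-2}f(t,\sum_{j=1}^{\nu-1}x_{2j}^{(j+1)}+x_{2\wedge,\nu-2})-Bx_{2\wedge,\nu-2}-Ad_{2(\nu-1)}$ ($\nu\ge3$); $F_{2\Sigma,s}(t,x_{2j}^{(j+1)},j=1,\dots,\nu-1,x_{2\wedge,i},i=s,\dots,\nu-2,d_{2(s+1)}^{(s+2)},d_{2\wedge,s+1})=Q_{2\Sigma,s}f(t,\sum_{j=1}^{\nu-1}x_{2j}^{(j+1)}+\sum_{i=s}^{\nu-2}x_{2\wedge,i})-Bx_{2\wedge,s}-A[d_{2(s+1)}^{(s+2)}+d_{2\wedge,s+1}]$, $s=1,\dots,\nu-3$ ($\nu\ge4$); $F_{20}(t,x_1,x_{20},x_{2\Sigma},d_{21}^{(2)},d_{2\wedge,1})=Q_{20}f(t,x_1+x_{20}+x_{2\Sigma})-Bx_{20}-Q_{20}A[d_{21}^{(2)}+d_{2\wedge,1}]$. Sums, objects and conditions with index ranges that are empty for the given $\nu$ are absent: for $\nu=2$, $x_{2\wedge,1}=d_{2\wedge,1}=0$; for $\nu=1$, $x_{2\Sigma}=0$, $d_{21}^{(2)}=d_{2\wedge,1}=0$ and, among the data and conditions of types 1 and 2, only $M_{20}$ and the conditions involving $F_{20}$ remain. Locally Lipschitz with respect to $x$ on $J\times M$: for each $(t',x')\in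 J\times M$ there are open neighborhoods of $t'$, $x'$ and $L\ge0$ with $\|g(t,x^1)-g(t,x^2)\|\le L\|x^1-x^2\|$ for $t$, $x^1,x^2$ in them; ''with respect to $x_1+x_{20}$'' means this for $x^1,x^2$ having the same component $x_{2\Sigma}$. Neighborhoods of an endpoint of a time interval are semi-open intervals. *)

(* Defs.v *)
From mathcomp Require Export all_boot all_order all_algebra.
From mathcomp Require Export complex.
From mathcomp Require Export all_classical all_reals all_analysis.
Export Order.TTheory GRing.Theory Num.Theory.
Export numFieldNormedType.Exports.

Set Implicit Arguments.
Unset Strict Implicit.
Unset Printing Implicit Defensive.

Local Open Scope classical_set_scope.
Local Open Scope ring_scope.

Section BoundedOperators.
Context {R : realType}.

Definition bounded_linear_on (V W : normedModType R) (E : set V) (L : V -> W) :=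
  (forall a x y, E x -> E y -> L (a *: x + y) = a *: L x + L y) /\
  exists C : R, forall x, E x -> `|L x| <= C * `|x|.

(* [L] is a bijection of [E] onto [F] whose inverse [L'] is in L(F, E) *)
Definition is_bounded_inverse (V W : normedModType R) (E : set V) (F : set W)
    (L : V -> W) (L' : W -> V) :=
  [/\ forall x, E x -> F (L x) /\ L' (L x) = x,
      forall y, F y -> E (L' y) /\ L (L' y) = y &
      bounded_linear_on F L'].

Definition boundedly_invertible (V W : normedModType R) (E : set V) (F : set W)
    (L : V -> W) :=
  exists L', is_bounded_inverse E F L L'.

Definition opnorm (V W : normedModType R) (E : set V) (L : V -> W) : R :=
  sup [set `|L x| | x in [set x | E x /\ `|x| <= 1]].

End BoundedOperators.

Section Differentiability.
Context {R : realType} {V W : normedModType R}.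

(* Frechet derivative at [p] of [g] on a set [N] contained in the subspace [E];
   only the values of [g] on [N] and of [L] on [E] matter. *)
Definition frechet_within (N E : set V) (g : V -> W) (p : V) (L : V -> W) :=
  bounded_linear_on E L /\
  forall e : R, 0 < e -> \forall z \near within N (nbhs p),
    `|g z - g p - L (z - p)| <= e * `|z - p|.

Definition op_continuous_on (T : topologicalType) (N : set T) (E : set V)
    (L : T -> V -> W) :=
  forall p, N p -> forall e : R, 0 < e -> \forall z \near within N (nbhs p),
    forall h, E h -> `|L z h - L p h| <= e * `|h|.

Definition C1_on (N E : set V) (g : V -> W) (dg : V -> V -> W) :=
  (forall p, N p -> frechet_within N E g p (dg p)) /\ op_continuous_on N E dg.

Definition normprod (vs : seq V) : R := \prod_(v <- vs) `|v|.

(* C^k on [N]: [T p vs] is the Frechet derivative of [g] of order [size vs] at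
   [p], a bounded multilinear map in the directions [vs]; differentiability and
   continuity in [p] are with respect to the norm of multilinear maps. At
   boundary points of [N] the derivatives are those relative to [N]. *)
Definition Ck_on (k : nat) (N E : set V) (g : V -> W) :=
  exists T : V -> seq V -> W,
  [/\ forall p, N p -> T p [::] = g p,
      forall p vs1 vs2 (a : R) u v, N p ->
        (size vs1 + size vs2 < k)%N ->
        (forall w, w \in vs1 ++ u :: v :: vs2 -> E w) ->
        T p (vs1 ++ (a *: u + v) :: vs2) =
          a *: T p (vs1 ++ u :: vs2) + T p (vs1 ++ v :: vs2),
      forall p j, N p -> (j <= k)%N -> exists C : R, forall vs,
        size vs = j -> (forall w, w \in vs -> E w) ->
        `|T p vs| <= C * normprod vs,
      forall p j, N p -> (j < k)%N -> forall e : R, 0 < e ->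
        \forall z \near within N (nbhs p), forall vs,
          size vs = j -> (forall w, w \in vs -> E w) ->
          `|T z vs - T p vs - T p ((z - p) :: vs)|
            <= e * `|z - p| * normprod vs &
      forall p j, N p -> (j <= k)%N -> forall e : R, 0 < e ->
        \forall z \near within N (nbhs p), forall vs,
          size vs = j -> (forall w, w \in vs -> E w) ->
          `|T z vs - T p vs| <= e * normprod vs].

End Differentiability.

Section Scalars.
Context {R : realType}.

(* A complex Banach space is given as its underlying real Banach space together
   with the multiplication by the imaginary unit. *)
Record complex_structure (X : normedModType R) := ComplexStructure {
  mul_i : X -> X ;
  mul_i_linear : forall (a : R) x y, mul_i (a *: x + y) = a *: mul_i x + mul_i y ;
  mul_i_sq : forall x, mul_i (mul_i x) = - x ;
  mul_i_norm : forall (a b : R) x,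
    `|a *: x + b *: mul_i x| = Num.sqrt (a ^+ 2 + b ^+ 2) * `|x| }.

Variant scalar_field (X Y : normedModType R) :=
  | RealScalars
  | ComplexScalars of complex_structure X & complex_structure Y.

Definition cact (V : normedModType R) (J : V -> V) (z : R[i]) (x : V) : V :=
  complex.Re z *: x + complex.Im z *: J x.

Variables (X Y : normedModType R) (K : scalar_field X Y).

(* In both cases scalars, and the values of functionals, are elements of [R[i]],
   restricted to real ones for real spaces. *)
Definition is_scalar (z : R[i]) :=
  if K is RealScalars then complex.Im z = 0 else True.

Definition actX (z : R[i]) (x : X) : X :=
  if K is ComplexScalars JX _ then cact (mul_i JX) z x else complex.Re z *: x.

Definition actY (z : R[i]) (y : Y) : Y :=
  if K is ComplexScalars _ JY then cact (mul_i JY) z y else complex.Re z *: y.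

Definition linear_operator (D : set X) (A : X -> Y) :=
  D 0 /\ forall z x x', is_scalar z -> D x -> D x' ->
    D (actX z x + x') /\ A (actX z x + x') = actY z (A x) + A x'.

Definition closed_densely_defined (D : set X) (A : X -> Y) :=
  [/\ linear_operator D A, dense D &
      closed [set p : X * Y | D p.1 /\ p.2 = A p.1]].

Definition functional (V : normedModType R) (act : R[i] -> V -> V)
    (p : V -> R[i]) :=
  [/\ forall z x x', is_scalar z -> p (act z x + x') = z * p x + p x',
      forall x, is_scalar (p x) &
      exists C : R, forall x, Normc.normc (p x) <= C * `|x|].

(* q belongs to the domain of the adjoint of (A, D), and A^* q = p *)
Definition adjoint_rel (D : set X) (A : X -> Y) (q : Y -> R[i]) (p : X -> R[i]) :=
  [/\ functional actY q, functional actX p & forall x, D x -> p x = q (A x)].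

End Scalars.

Section Pencil.
Context {R : realType} {V W : normedModType R}.
Variables (actV : R[i] -> V -> V) (actW : R[i] -> W -> W).
Variables (D : set V) (A B : V -> W).

Definition regular_pencil := exists2 r : R, 0 < r & forall z : R[i],
  r < Normc.normc z ->
  boundedly_invertible D [set: W] (fun x => actW z (A x) + B x).

(* (A + z B)^-1 has a pole of order nu at z = 0: its Laurent expansion
   \sum_k z ^ (k - nu) C_k, convergent in operator norm, has C_0 <> 0. *)
Definition resolvent_pole (nu : nat) :=
  exists (r : R) (T : R[i] -> W -> V) (C : nat -> W -> V),
  [/\ 0 < r,
      forall k, bounded_linear_on [set: W] (C k) /\
                forall z y, C k (actW z y) = actV z (C k y),
      exists y, C 0%N y != 0 &
      forall z : R[i], 0 < Normc.normc z < r ->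
        is_bounded_inverse D [set: W] (fun x => A x + actW z (B x)) (T z) /\
        forall e : R, 0 < e -> exists N, forall k, (N <= k)%N -> forall y,
          `|actV (z ^+ nu) (T z y) - \sum_(0 <= j < k) actV (z ^+ j) (C j y)|
            <= e * `|y|].

Definition regular_pencil_of_index (nu : nat) :=
  [/\ (0 < nu)%N, regular_pencil & resolvent_pole nu].

End Pencil.

Section Data.
Context {R : realType}.

(* The pencil together with the fixed root vectors. The indices j of
   [phi i j], [q i j], [Bq i j] (= B^* q_i^j) start at 1. *)
Record pencil_data (X Y : normedModType R) := PencilData {
  scalars : scalar_field X Y ;
  domA : set X ;
  domB : set X ;
  opA : X -> Y ;
  opB : X -> Y ;
  nu_of : nat ;
  nker : nat ;
  mult : 'I_nker -> nat ;
  phi : 'I_nker -> nat -> X ;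
  q : 'I_nker -> nat -> Y -> R[i] ;
  Bq : 'I_nker -> nat -> X -> R[i] }.

Variables (X Y : normedModType R) (S : pencil_data X Y).
Local Notation A := (opA S).
Local Notation B := (opB S).
Local Notation nu := (nu_of S).

Definition dom : set X := domA S `&` domB S.

(* For real spaces the pencil is complexified: X * X with i (x, y) = (-y, x). *)
Definition pencil_regular_of_index (k : nat) :=
  match scalars S with
  | RealScalars =>
      regular_pencil_of_index
        (cact (fun p : X * X => (- p.2, p.1)))
        (cact (fun p : Y * Y => (- p.2, p.1)))
        (dom `*` dom)
        (fun p : X * X => (A p.1, A p.2)) (fun p : X * X => (B p.1, B p.2)) k
  | ComplexScalars JX JY =>
      regular_pencil_of_index (cact (mul_i JX)) (cact (mul_i JY)) dom A B k
  end.

Local Notation aX := (actX (scalars S)).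
Local Notation aY := (actY (scalars S)).

Definition kernel_basis :=
  (forall i : 'I_(nker S), dom (phi i 1) /\ A (phi i 1) = 0) /\
  forall x, dom x -> A x = 0 ->
    exists! c : {ffun 'I_(nker S) -> R[i]},
      (forall i, is_scalar (scalars S) (c i)) /\
      x = \sum_(i < nker S) aX (c i) (phi i 1).

Definition root_chains :=
  [/\ forall i : 'I_(nker S), (1 <= mult i)%N,
      \max_(i < nker S) mult i = nu,
      forall (i : 'I_(nker S)) j, (1 <= j <= mult i)%N -> dom (phi i j) &
      forall (i : 'I_(nker S)) j, (1 <= j < mult i)%N ->
        A (phi i j.+1) = - B (phi i j)].

Definition dual_chains :=
  [/\ forall (i : 'I_(nker S)) j, (1 <= j <= mult i)%N ->
        adjoint_rel (scalars S) (domB S) B (q i j) (Bq i j),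
      forall i : 'I_(nker S), adjoint_rel (scalars S) (domA S) A
                  (q i (mult i)) (fun=> 0),
      forall (i : 'I_(nker S)) j, (1 <= j < mult i)%N ->
        adjoint_rel (scalars S) (domA S) A
          (q i j) (fun x => - Bq i j.+1 x) &
      forall (i k : 'I_(nker S)) j l,
        (1 <= j <= mult i)%N -> (1 <= l <= mult k)%N ->
        q k l (B (phi i j)) = ((i == k) && (j == l))%:R].

Definition canonical_root_system :=
  [/\ kernel_basis, root_chains & dual_chains].

(* [P2sj s j], [P2s s], [P2wedge s] are P_{2s}^{(j)}, P_{2s}, P_{2/\,s}; the
   suffix "diag" refers to P_{2s}^{(s+1)} and Q_{2s}^{(s+1)}. *)
Definition P2sj (s j : nat) (x : X) : X :=
  \sum_(i < nker S | mult i == j) aX (Bq i s.+1 x) (phi i s.+1).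
Definition Q2sj (s j : nat) (y : Y) : Y :=
  \sum_(i < nker S | mult i == j) aY (q i s.+1 y) (B (phi i s.+1)).
Definition P2s (s : nat) (x : X) : X := \sum_(s.+1 <= j < nu.+1) P2sj s j x.
Definition Q2s (s : nat) (y : Y) : Y := \sum_(s.+1 <= j < nu.+1) Q2sj s j y.
Definition P2 (x : X) : X := \sum_(0 <= s < nu) P2s s x.
Definition Q2 (y : Y) : Y := \sum_(0 <= s < nu) Q2s s y.
Definition P1 (x : X) : X := x - P2 x.
Definition Q1 (y : Y) : Y := y - Q2 y.
Definition P2Sigma (x : X) : X := \sum_(1 <= s < nu) P2s s x.
Definition P2wedge (s : nat) (x : X) : X := P2s s x - P2sj s s.+1 x.
Definition Q2Sigma (s : nat) (y : Y) : Y := Q2s s y - Q2sj s s.+1 y.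

Definition D1 : set X := P1 @` dom.
Definition D2s (s : nat) : set X := P2s s @` dom.
Definition Ddiag (s : nat) : set X := P2sj s s.+1 @` dom.
Definition Dwedge (s : nat) : set X := P2wedge s @` dom.
Definition D2Sigma : set X := P2Sigma @` dom.
Definition Y1 : set Y := range Q1.
Definition Y2s (s : nat) : set Y := range (Q2s s).
Definition Ydiag (s : nat) : set Y := range (Q2sj s s.+1).
Definition Y2Sigma (s : nat) : set Y := range (Q2Sigma s).

Definition Atilde (x : X) : Y :=
  A x + \sum_(i < nker S) aY (Bq i 1 x) (B (phi i (mult i))).

Definition Atilde_inv : Y -> X := 'pinv_(fun=> 0) dom Atilde.

(* Direct sums of subsets are sets of sums. *)
Definition setsum (M N : set X) : set X := [set x + y | x in M & y in N].
Definition famsum (a b : nat) (M : nat -> set X) : set X :=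
  [set \sum_(a <= j < b) z j |
    z in [set z : nat -> X | forall j, (a <= j < b)%N -> M j (z j)]].

(* [Md j] and [Mw j] stand for M_{2j}^{(j+1)} and M_{2/\,j}; [Msum s] is the sum
   of all the [Md j] and of the [Mw i] with i >= s. *)
Definition Msum (s : nat) (Md Mw : nat -> set X) : set X :=
  setsum (famsum 1 nu Md) (famsum s nu.-1 Mw).
Definition Mtotal (M20 : set X) (Md Mw : nat -> set X) : set X :=
  setsum (setsum D1 M20) (Msum 1 Md Mw).

Definition rel_open (E M : set X) := exists2 O, open O & M = E `&` O.

Variable f : R -> X -> Y.

(* In the functions below [xd j] and [xw i] are the components x_{2j}^{(j+1)}
   and x_{2/\,i}; the unknown component z of each equation is a separate
   argument. *)
Definition F2last (t : R) (z : X) : Y := Q2s nu.-1 (f t z) - B z.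
Definition F2diag (s : nat) (t : R) (z : X) (xd : nat -> X) : Y :=
  Q2sj s s.+1 (f t (z + \sum_(s.+1 <= j < nu) xd j)) - B z.
Definition F2Sigma_last (t : R) (xd : nat -> X) (z d : X) : Y :=
  Q2Sigma nu.-2 (f t (\sum_(1 <= j < nu) xd j + z)) - B z - A d.
Definition F2Sigma (s : nat) (t : R) (xd : nat -> X) (z : X) (xw : nat -> X)
    (d dw : X) : Y :=
  Q2Sigma s
    (f t (\sum_(1 <= j < nu) xd j + (z + \sum_(s.+1 <= i < nu.-1) xw i)))
  - B z - A (d + dw).
Definition F20 (t : R) (x1 x20 xS d dw : X) : Y :=
  Q2s 0 (f t (x1 + x20 + xS)) - B x20 - Q2s 0 (A (d + dw)).

(* The differential equation is required only for t > 0, so that no derivative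
   is required at t = 0; at a left endpoint of J other than 0 the derivative is
   one-sided. *)
Definition is_solution_on (J : set R) (x : R -> X) :=
  [/\ {within J, continuous x},
      forall t, J t -> dom (x t) &
      exists dAx : R -> Y,
      [/\ forall t, J t -> 0 < t ->
            (fun s : R => (s - t)^-1 *: (A (x s) - A (x t)))
              @ within J t^' --> dAx t,
          {within J `&` [set t | 0 < t], continuous dAx} &
          forall t, J t -> 0 < t -> dAx t + B (x t) = f t (x t)]].

End Data.

Definition Rplus (R : realType) : set R := [set t | 0 <= t].
Arguments Rplus : clear implicits.

Section Neighborhoods.
Context {R : realType} {X Y : normedModType R}.

Definition Uball (V : normedModType R) (E : set V) (c : V) (r : R) : set V :=
  [set x | E x /\ `|x - c| < r].

(* local Lipschitz condition on R_+ x M with respect to x_1 + x_20: it is only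
   required of points having the same component x_{2 Sigma} *)
Definition loc_lipschitz_x1_x20 (S : pencil_data X Y) (M : set X)
    (g : R -> X -> Y) :=
  forall t' x', 0 <= t' -> M x' ->
    exists r L : R, [/\ 0 < r, 0 <= L &
      forall t x y, Uball (Rplus R) t' r t ->
        Uball M x' r x -> Uball M x' r y -> P2Sigma S x = P2Sigma S y ->
        `|g t x - g t y| <= L * `|x - y|].

End Neighborhoods.

(* The default value 0 is harmless: the V_i take nonnegative values. *)
Definition Vmax (R : realType) (Y : Type) (m : nat) (V : 'I_m -> Y -> R)
  (w : Y) : R := \big[Order.max/0]_(i < m) V i w.

(* Main.v *)
(* The projectors Q split the equation into algebraic equations and one
   differential equation. Applied to d/dt[Ax], Q_{2s}^{(s+1)} gives 0, while
   Q_{2Sigma,s} and Q_{20} only see the components of level s + 1. Going down in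
   s, first the components x_{2s}^{(s+1)} and then the x_{2/\,s} are therefore
   determined as implicit functions of t; every step costs one derivative, which
   is what the smoothness C^s provides, and implicit curves are obtained from the
   contraction principle. Then x_20 = zeta(t, x_1), locally Lipschitz in x_1
   under either alternative of 2.e, and w = A x_1 solves an ordinary differential
   equation in Y_1 with locally Lipschitz right-hand side.

   That x_1 is a bounded function of w comes from the resolvent: the Laurent
   coefficients of (A + z B)^-1 y of negative order form a chain of root vectors,
   which P_1 annihilates, so the coefficient of order 0 solves A x_1 = Q_1 y; the
   closed graph theorem gives the bounds.

   By condition 3 a local solution w can only stop by becoming unbounded. Near
   such a time |w| would stay above the radius of condition 4, where the increase
   of Phi(V(w)), Phi' = 1/U, is bounded by the integral of psi; this contradicts
   the divergence of the integral of 1/U.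

   Any solution has components satisfying the same equations, hence equals the
   constructed one. *)
Require Import Defs.
From mathcomp Require Import measurable_realfun ring lra zify.

Set Implicit Arguments.
Unset Strict Implicit.
Unset Printing Implicit Defensive.

Local Open Scope classical_set_scope.
Local Open Scope ring_scope.

(** The unbounded operators matter only on [D1]: all other components lie in ranges of finite-rank
    projectors, where [A] and [B] agree with the bounded operators [AP] and [BP], and on [D1] the
    inverse of A and its product with B are bounded. An implicit function theorem with parameters is
    avoided: when a component of some level is sought, the components above it and their derivatives
    are already known curves, so the unknown is a curve in t alone. Its smoothness is bootstrapped,
    since its derivative solves a linear equation with the same invertible operator. Derivatives are
    taken relative to a set, because time starts at 0 and the sets M are open only in subspaces. For
    vector-valued functions on intervals, Cousin's lemma provides both the compactness arguments and
    the mean value inequality, and primitives are limits of approximate primitives. Three defects of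
    regularity meet in the growth estimate: the maximum of the V_i is not differentiable, U may
    vanish, and psi is merely integrable. They are met by a weighted sum of derivatives, by 1 / (U +
    e), and by limits under the integral sign. *)

(** * Decision of linear identities by comparison of coefficients *)

Section LinearCombinations.
Context {R : comPzRingType} {V : lmodType R}.

Inductive lincomb :=
  | LCvar of nat | LCzero | LCadd of lincomb & lincomb | LCopp of lincomb
  | LCscale of R & lincomb.

Fixpoint lc_eval (env : seq V) (e : lincomb) : V :=
  match e with
  | LCvar i => nth 0 env i
  | LCzero => 0
  | LCadd e1 e2 => lc_eval env e1 + lc_eval env e2
  | LCopp e1 => - lc_eval env e1
  | LCscale a e1 => a *: lc_eval env e1
  end.

Fixpoint lc_coef (e : lincomb) (i : nat) : R :=
  match e with
  | LCvar j => if i == j then 1 else 0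
  | LCzero => 0
  | LCadd e1 e2 => lc_coef e1 i + lc_coef e2 i
  | LCopp e1 => - lc_coef e1 i
  | LCscale a e1 => a * lc_coef e1 i
  end.

Fixpoint lc_vars_below (n : nat) (e : lincomb) : bool :=
  match e with
  | LCvar i => (i < n)%N
  | LCzero => true
  | LCadd e1 e2 => lc_vars_below n e1 && lc_vars_below n e2
  | LCopp e1 => lc_vars_below n e1
  | LCscale _ e1 => lc_vars_below n e1
  end.

(** A recursive conjunction instead of a quantifier over indices, so that simplification leaves one
    scalar goal per variable for [ring] or [field]. *)
Fixpoint lc_coef_eq (n : nat) (e1 e2 : lincomb) : Prop :=
  if n is m.+1 then lc_coef e1 m = lc_coef e2 m /\ lc_coef_eq m e1 e2 else True.

Lemma lc_evalE env e : lc_vars_below (size env) e ->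
  lc_eval env e = \sum_(i < size env) lc_coef e i *: env`_i.
Proof.
elim: e => [j|_|e1 IH1 e2 IH2 /andP[h1 h2]|e1 IH1 h|a e1 IH1 h] /=.
- move=> jn; rewrite (bigD1 (Ordinal jn))//= eqxx scale1r big1 ?addr0// => i ij.
  by rewrite ifN ?scale0r//; exact: ij.
- by rewrite big1// => i _; rewrite scale0r.
- by rewrite IH1// IH2// -big_split/=; apply: eq_bigr => i _; rewrite scalerDl.
- by rewrite IH1// -sumrN; apply: eq_bigr => i _; rewrite scaleNr.
- by rewrite IH1// scaler_sumr; apply: eq_bigr => i _; rewrite scalerA.
Qed.

Lemma lc_eq env e1 e2 : lc_vars_below (size env) e1 -> lc_vars_below (size env) e2 ->
  lc_coef_eq (size env) e1 e2 -> lc_eval env e1 = lc_eval env e2.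
Proof.
move=> h1 h2 h; rewrite !lc_evalE//; apply: eq_bigr => i _; congr (_ *: _).
have : (i < size env)%N by []; move: (nat_of_ord i).
elim: (size env) h => //= n IH [hn h] j; rewrite ltnS leq_eqVlt => /orP[/eqP->//|].
exact: IH.
Qed.

End LinearCombinations.

(** The matches on [constr:(Set)] let a tactic that returns a term run [unify]; two atoms are thus
    identified up to unification, not only when they are syntactically equal. *)
Ltac lc_index x env :=
  lazymatch env with
  | ?y :: ?env' =>
    match constr:(Set) with
    | _ => let _ := match constr:(Set) with _ => unify x y end in constr:(O)
    | _ => let n := lc_index x env' in constr:(S n)
    end
  end.

Ltac lc_env V t env :=
  lazymatch t with
  | @GRing.add _ ?a ?b => let env := lc_env V a env in lc_env V b env
  | @GRing.opp _ ?a => lc_env V a env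
  | @GRing.scale _ _ _ ?a => lc_env V a env
  | @GRing.zero _ => env
  | _ => match constr:(Set) with
         | _ => let _ := lc_index t env in env
         | _ => constr:(@cons V t env)
         end
  end.

Ltac lc_reify R t env :=
  lazymatch t with
  | @GRing.add _ ?a ?b =>
    let a := lc_reify R a env in let b := lc_reify R b env in constr:(@LCadd R a b)
  | @GRing.opp _ ?a => let a := lc_reify R a env in constr:(@LCopp R a)
  | @GRing.scale _ _ ?k ?a => let a := lc_reify R a env in constr:(@LCscale R k a)
  | @GRing.zero _ => constr:(@LCzero R)
  | _ => let n := lc_index t env in constr:(@LCvar R n)
  end.

(* proves equalities between linear combinations in a normed module, the
   equalities of coefficients being left to [field] *)
Ltac lincomb_eq :=
  lazymatch goal with
  | |- @eq _ ?a ?b =>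
    let T := type of a in
    match T with
    | context [?V] =>
      let K := lazymatch type of V with
               | @NormedModule.type ?K => K
               | @CompleteNormedModule.type ?K => K
               end in
      let env := lc_env T a (@nil T) in let env := lc_env T b env in
      let ea := lc_reify K a env in let eb := lc_reify K b env in
      change (@lc_eval K V env ea = @lc_eval K V env eb);
      apply: lc_eq => //=; repeat split; try ring; try field
    end
  end.

(** * Cousin's lemma *)

Section Cousin.
Context {R : realType}.
Implicit Types (a b : R) (P : R -> R -> Prop).

(** The supremum of the s with [P a s] lies in that set and cannot lie below b. The gauge [d] may
    depend on the tag t, so a merely pointwise hypothesis such as continuity or differentiability is
    enough; the lemma is the substitute for compactness of intervals throughout. *)
Lemma cousin a b P : a <= b ->
  (forall u v w, a <= u -> u <= v -> v <= w -> w <= b ->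
     P u v -> P v w -> P u w) ->
  (forall t, a <= t <= b -> exists2 d : R, 0 < d &
     forall u v, a <= u -> u <= t -> t <= v -> v <= b -> v - u < d -> P u v) ->
  P a b.
Proof.
move=> ab Ptr Ploc.
pose S := [set s | a <= s <= b /\ P a s].
have Sa : S a.
  split; first by rewrite lexx.
  have [|d d0] := Ploc a; first by rewrite lexx.
  by apply; rewrite // subrr.
have Sb : has_ubound S by exists b => s [/andP[]].
have hS : has_sup S by split; [exists a|].
have ac : a <= sup S by exact: ub_le_sup.
have cb : sup S <= b by apply: sup_le_ub => [|s [/andP[]]//]; exists a.
have [|d d0 Pd] := Ploc (sup S); first by rewrite ac.
have [s [/andP[as_ sb] Ps] ds] := sup_adherent (divr_gt0 d0 (ltr0n R 2)) hS.
have sc : s <= sup S by apply: ub_le_sup => //; split => //; rewrite as_.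
(* The point s is less than d / 2 below the supremum and c' at most d / 3 above it, so [s, c'] is
   shorter than the gauge d. *)
pose c' := Order.min b (sup S + d / 3).
have cc' : sup S <= c' by rewrite le_min cb lerDl divr_ge0// ltW.
have c'b : c' <= b by rewrite ge_min lexx.
have c'd : c' <= sup S + d / 3 by rewrite ge_min lexx orbT.
have Sc' : S c'.
  split; first by rewrite (le_trans ac)//.
  apply: (Ptr a s c') => //; first exact: le_trans sc cc'.
  by apply: Pd => //; lra.
have := ub_le_sup Sb Sc'; rewrite /c' ge_min => /orP[bs|]; last first.
  by rewrite gerDl leNgt divr_gt0.
have -> : b = c' by apply/eqP; rewrite eq_le c'b andbT (le_trans bs).
by case: Sc'.
Qed.

End Cousin.

(** * Calculus in Banach spaces *)

Section Nearness.
Context {R : realType}.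

Lemma near_withinP (V : normedModType R) (J : set V) (t : V) (P : V -> Prop) :
  (\forall s \near within J (nbhs t), P s) <->
  exists2 d : R, 0 < d & forall s, J s -> `|s - t| < d -> P s.
Proof.
split.
  move=> /nbhs_ballP[d /= d0 dP]; exists d => // s Js st; apply: dP => //.
  by rewrite -ball_normE /= distrC.
move=> [d d0 dP]; apply/nbhs_ballP; exists d => // s.
by rewrite -ball_normE /= distrC => st Js; exact: dP.
Qed.

Lemma near_within_self (V : normedModType R) (J : set V) (t : V) :
  \forall s \near within J (nbhs t), J s.
Proof. by apply/near_withinP; exists 1. Qed.

Lemma near_within_ball (V : normedModType R) (J : set V) (t : V) (e : R) :
  0 < e -> \forall s \near within J (nbhs t), `|s - t| < e.
Proof. by move=> e0; apply/near_withinP; exists e. Qed.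

Lemma near_within_subset (V : normedModType R) (J J' : set V) (t : V)
    (P : V -> Prop) : J' `<=` J ->
  (\forall s \near within J (nbhs t), P s) ->
  \forall s \near within J' (nbhs t), P s.
Proof.
by move=> JJ' /near_withinP[d d0 dP]; apply/near_withinP; exists d => // s /JJ'; exact: dP.
Qed.

Lemma cvgr_normP (T : Type) (F : set_system T) (V : normedModType R)
    (FF : Filter F) (g : T -> V) (l : V) :
  g @ F --> l <-> forall e : R, 0 < e -> \forall s \near F, `|g s - l| <= e.
Proof.
split=> [/cvgr_distC_le //|gl]; apply/cvgrPdistC_le; exact: gl.
Qed.

Lemma cvg_within_subset (U V : normedModType R) (J J' : set U) (t : U) (g : U -> V)
    (l : V) : J' `<=` J -> g @ within J (nbhs t) --> l -> g @ within J' (nbhs t) --> l.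
Proof.
move=> JJ' /cvgr_normP gl; apply/cvgr_normP => e e0.
by apply: near_within_subset JJ' _; exact: gl.
Qed.

Lemma cvg_sumr (T : Type) (F : set_system T) (FF : Filter F) (V : normedModType R)
    (I : Type) (r : seq I) (z : I -> T -> V) (l : I -> V) :
  (forall i, z i @ F --> l i) ->
  (fun s => \sum_(i <- r) z i s) @ F --> \sum_(i <- r) l i.
Proof.
move=> zl; elim: r => [|i r IH].
  rewrite big_nil (_ : (fun _ => _) = fun=> 0); last by apply/funext => s; rewrite big_nil.
  exact: cvg_cst.
rewrite big_cons (_ : (fun _ => _) = fun s => z i s + \sum_(i <- r) z i s).
  exact: cvgD.
by apply/funext => s; rewrite big_cons.
Qed.

End Nearness.

Section BoundedLinear.
Context {R : realType} {V W : normedModType R}.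
Variables (L : V -> W) (bL : bounded_linear_on setT L).

Lemma blinP a x y : L (a *: x + y) = a *: L x + L y.
Proof. exact: bL.1. Qed.

Lemma blin0 : L 0 = 0.
Proof. by have := blinP (-1) 0 0; rewrite scaler0 addr0 scaleN1r addNr. Qed.

Lemma blinD x y : L (x + y) = L x + L y.
Proof. by rewrite -{1}[x]scale1r blinP scale1r. Qed.

Lemma blinZ a x : L (a *: x) = a *: L x.
Proof. by rewrite -{1}[a *: x]addr0 blinP blin0 addr0. Qed.

Lemma blinN x : L (- x) = - L x.
Proof. by rewrite -[- x]scaleN1r blinZ scaleN1r. Qed.

Lemma blinB x y : L (x - y) = L x - L y.
Proof. by rewrite blinD blinN. Qed.

Lemma blin_sum (I : Type) (r : seq I) (P : pred I) (F : I -> V) :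
  L (\sum_(i <- r | P i) F i) = \sum_(i <- r | P i) L (F i).
Proof. exact: (big_morph L blinD blin0). Qed.

Lemma blin_bound : exists2 C : R, 0 < C & forall x, `|L x| <= C * `|x|.
Proof.
case: bL => _ [C CL]; exists (`|C| + 1); first by rewrite ltr_wpDl.
move=> x; apply: le_trans (CL x I) _; rewrite ler_wpM2r//.
by rewrite (le_trans (ler_norm C))// lerDl.
Qed.

Lemma blin_cvg (T : Type) (F : set_system T) (FF : Filter F) (g : T -> V) l :
  g @ F --> l -> L \o g @ F --> L l.
Proof.
have [C C0 CL] := blin_bound.
move=> /cvgr_normP gl; apply/cvgr_normP => e e0.
apply: filterS (gl (e / C) (divr_gt0 e0 C0)) => s /= hs.
by rewrite -blinB (le_trans (CL _))// mulrC -ler_pdivlMr.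
Qed.

End BoundedLinear.

Section Derivatives.
Context {R : realType}.

(** The quotient is multiplied out, so s = t needs no exclusion and endpoints need no separate
    one-sided notion. At an isolated point of J every vector is a derivative; away from such points
    uniqueness is [deriv_within_unique]. *)
Definition deriv_within (V : normedModType R) (J : set R) (x : R -> V) (t : R)
    (d : V) :=
  forall e : R, 0 < e -> \forall s \near within J (nbhs t),
    `|x s - x t - (s - t) *: d| <= e * `|s - t|.

Variables (V W : normedModType R).
Implicit Types (J : set R) (x y : R -> V) (t a b : R) (d : V).

Lemma deriv_within_subset J J' x t d : J' `<=` J ->
  deriv_within J x t d -> deriv_within J' x t d.
Proof. by move=> JJ' xd e e0; apply: near_within_subset JJ' _; exact: xd. Qed.

Lemma eq_deriv_within J x y t d : J t -> (forall s, J s -> x s = y s) ->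
  deriv_within J x t d -> deriv_within J y t d.
Proof.
move=> Jt xy xd e e0.
apply: filterS2 (near_within_self J t) (xd e e0) => s Js.
by rewrite !xy.
Qed.

Lemma deriv_within_lip J x t d K : deriv_within J x t d -> `|d| < K ->
  \forall s \near within J (nbhs t), `|x s - x t| <= K * `|s - t|.
Proof.
move=> xd dK; have e0 : 0 < K - `|d| by rewrite subr_gt0.
apply: filterS (xd _ e0) => s hs.
rewrite -(subrK ((s - t) *: d) (x s - x t)) (le_trans (ler_normD _ _))//.
by rewrite normrZ (le_trans (lerD hs (lexx _)))// mulrBl [_ * `|d|]mulrC subrK.
Qed.

Lemma deriv_within_cvg J x t d : deriv_within J x t d ->
  x @ within J (nbhs t) --> x t.
Proof.
move=> xd; apply/cvgr_normP => e e0.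
have K0 : 0 < `|d| + 1 by rewrite ltr_wpDl.
have h : \forall s \near within J (nbhs t), `|x s - x t| <= (`|d| + 1) * `|s - t|.
  by apply: deriv_within_lip xd _; rewrite ltrDl.
apply: filterS2 h (near_within_ball J t (divr_gt0 e0 K0)) => s hs st.
by rewrite (le_trans hs)// mulrC -ler_pdivlMr// ltW.
Qed.

Lemma deriv_within_cst J (c : V) t : deriv_within J (fun=> c) t 0.
Proof.
by move=> e e0; apply: nearW => s; rewrite subrr scaler0 subrr normr0 mulr_ge0// ltW.
Qed.

Lemma deriv_within_id J t : deriv_within J (fun s => s : R^o) t (1 : R^o).
Proof.
move=> e e0; apply: nearW => s.
by rewrite /GRing.scale /= mulr1 subrr normr0 mulr_ge0// ltW.
Qed.

Lemma deriv_withinD J x y t d d' :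
  deriv_within J x t d -> deriv_within J y t d' ->
  deriv_within J (fun s => x s + y s) t (d + d').
Proof.
move=> xd yd e e0; have e2 : 0 < e / 2 by rewrite divr_gt0.
apply: filterS2 (xd _ e2) (yd _ e2) => s h h'.
rewrite [X in `|X|](_ : _ = (x s - x t - (s - t) *: d) + (y s - y t - (s - t) *: d')).
  by rewrite (le_trans (ler_normD _ _))// (le_trans (lerD h h'))// -mulrDl -splitr.
by lincomb_eq.
Qed.

Lemma deriv_within_blin J x t d (L : V -> W) : bounded_linear_on setT L ->
  deriv_within J x t d -> deriv_within J (L \o x) t (L d).
Proof.
move=> bL xd e e0; have [C C0 CL] := blin_bound bL.
apply: filterS (xd (e / C) (divr_gt0 e0 C0)) => s hs /=.
rewrite -(blinZ bL) -!(blinB bL) (le_trans (CL _))//.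
by rewrite -ler_pdivlMl// mulrA [C^-1 * e]mulrC.
Qed.

Lemma deriv_withinN J x t d : deriv_within J x t d ->
  deriv_within J (fun s => - x s) t (- d).
Proof.
move=> xd e e0; apply: filterS (xd e e0) => s.
by rewrite scalerN -!opprD normrN.
Qed.

Lemma deriv_withinB J x y t d d' :
  deriv_within J x t d -> deriv_within J y t d' ->
  deriv_within J (fun s => x s - y s) t (d - d').
Proof. by move=> xd yd; apply: deriv_withinD => //; exact: deriv_withinN. Qed.

Lemma deriv_within_sum J (I : Type) (r : seq I) (z : I -> R -> V) (dz : I -> V) t :
  (forall i, deriv_within J (z i) t (dz i)) ->
  deriv_within J (fun s => \sum_(i <- r) z i s) t (\sum_(i <- r) dz i).
Proof.
move=> zd; elim: r => [|i r IH].
  rewrite big_nil (_ : (fun _ => _) = fun=> 0); last by apply/funext => s; rewrite big_nil.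
  exact: deriv_within_cst.
rewrite big_cons (_ : (fun _ => _) = fun s => z i s + \sum_(i <- r) z i s).
  exact: deriv_withinD.
by apply/funext => s; rewrite big_cons.
Qed.

(** Bounds against the tag t alone suffice: the increment over [u, v] is split at t, and [cousin]
    adds up the pieces. For vector-valued functions there is no intermediate point as in the mean
    value theorem, and this inequality takes its place. *)
Lemma local_lipschitz_increment x a b (K : R) : a <= b ->
  (forall t, a <= t <= b -> \forall s \near within `[a, b] (nbhs t),
     `|x s - x t| <= K * `|s - t|) ->
  `|x b - x a| <= K * (b - a).
Proof.
move=> ab xK; pose P u v := `|x v - x u| <= K * (v - u).
apply: (@cousin _ a b P ab) => [u v w _ uv vw _|t tab].
  rewrite /P => h h'; rewrite -(subrKA (x v)) (le_trans (ler_normD _ _))//.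
  by rewrite (le_trans (lerD h' h))// -mulrDr subrKA.
have /near_withinP[r r0 hr] := xK _ tab; exists r => // u v au ut tv vb uv.
have hu : `|x t - x u| <= K * (t - u).
  have := hr u; rewrite (distrC u t) (distrC (x u)) (ger0_norm (_ : 0 <= t - u)) ?subr_ge0//.
  by apply; [rewrite /= in_itv /= au (le_trans ut)// (le_trans tv)|lra].
have hv : `|x v - x t| <= K * (v - t).
  have := hr v; rewrite (ger0_norm (_ : 0 <= v - t)) ?subr_ge0//.
  by apply; [rewrite /= in_itv /= vb (le_trans au)// (le_trans ut)|lra].
rewrite /P -(subrKA (x t)) (le_trans (ler_normD _ _))//.
by rewrite (le_trans (lerD hv hu))// -mulrDr subrKA.
Qed.

Lemma mean_value_inequality x (dx : R -> V) a b (K : R) : a <= b ->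
  (forall t, a <= t <= b -> deriv_within `[a, b] x t (dx t)) ->
  (forall t, a <= t <= b -> `|dx t| <= K) ->
  `|x b - x a| <= K * (b - a).
Proof.
move=> ab xd dK; apply/ler_addgt0Pl => e e0.
have [->|ab'] := eqVneq a b; first by rewrite !subrr normr0 mulr0 addr0 ltW.
have ab0 : 0 < b - a by rewrite subr_gt0 lt_neqAle ab' ab.
(* The slack e / (b - a) makes the bound on the derivative strict, as [deriv_within_lip]
   requires. *)
rewrite -[e](divfK (lt0r_neq0 ab0)) -mulrDl.
apply: local_lipschitz_increment => // t tab.
apply: deriv_within_lip (xd _ tab) _.
by rewrite (le_lt_trans (dK _ tab))// ltrDr divr_gt0.
Qed.

End Derivatives.

(** * Operators with closed graph *)

Section ClosedGraph.
Context {R : realType}.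

Lemma exprn_small (q e : R) : 0 <= q < 1 -> 0 < e -> exists n, q ^+ n <= e.
Proof.
move=> /andP[q0 q1] e0; have : (fun n => q ^+ n) @ \oo --> (0 : R).
  by apply: cvg_expr; rewrite ger0_norm.
move=> /cvgr_normP /(_ e e0) [N _ /(_ N)] /= => /(_ (leqnn _)).
by rewrite subr0 ger0_norm ?exprn_ge0// => ?; exists N.
Qed.

(** Completeness in the form suited to the iterations below; the explicit rate makes limits uniform
    in a parameter. *)
Lemma geometric_cauchy (V : completeNormedModType R) (u : nat -> V) (C q : R) :
  0 <= q < 1 -> (forall k, `|u k.+1 - u k| <= C * q ^+ k) ->
  exists l, u @ \oo --> l /\ forall k, `|u k - l| <= C * q ^+ k / (1 - q).
Proof.
move=> q01 uC; have /andP[q0 q1] := q01; have q1' : 0 < 1 - q by rewrite subr_gt0.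
have C0 : 0 <= C by have := uC 0%N; rewrite expr0 mulr1; exact: le_trans.
have uj k j : `|u (k + j)%N - u k| <= C * q ^+ k / (1 - q).
  suff : `|u (k + j)%N - u k| <= C * q ^+ k * (1 - q ^+ j) / (1 - q).
    move/le_trans; apply; rewrite ler_pM2r ?invr_gt0// ler_piMr ?mulr_ge0 ?exprn_ge0//.
    by rewrite gerBl exprn_ge0.
  elim: j => [|j IH]; first by rewrite addn0 subrr normr0 expr0 subrr mulr0 mul0r.
  rewrite addnS -(subrKA (u (k + j)%N)) (le_trans (ler_normD _ _))//.
  rewrite (le_trans (lerD (uC _) IH))// exprD le_eqVlt; apply/orP; left; apply/eqP.
  by rewrite exprS; field; rewrite lt0r_neq0.
have uc : cvg (u @ \oo).
  apply: cauchy_cvg; apply: cauchy_exP => e e0.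
  have D0 : 0 < (C / (1 - q)) + 1 by rewrite ltr_wpDl// divr_ge0// ltW.
  have [N qN] := exprn_small q01 (divr_gt0 (divr_gt0 e0 D0) (ltr0n R 2)).
  exists (u N); exists N => // n /= /subnKC <-.
  rewrite -ball_normE /= distrC (le_lt_trans (uj _ _))//.
  rewrite mulrAC; apply: (@le_lt_trans _ _ ((C / (1 - q) + 1) * q ^+ N)).
    by rewrite ler_wpM2r ?exprn_ge0// lerDl.
  rewrite mulrC -ltr_pdivlMr// (le_lt_trans qN)// ltr_pdivrMr// ltr_pMr ?ltr1n//.
  exact: divr_gt0.
exists (lim (u @ \oo)); split=> // k; apply/ler_addgt0Pl => e e0.
have /cvgr_normP/(_ e e0)[N _ hN] := uc.
have := hN (k + N)%N (leq_addl _ _) => /= h.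
rewrite -(subrKA (u (k + N)%N)) (le_trans (ler_normD _ _))// addrC lerD//.
by rewrite distrC.
Qed.

Variables (V : normedModType R) (W : completeNormedModType R) (E : set V) (L : V -> W).
Hypothesis E0 : E 0.
Hypothesis EP : forall a x y, E x -> E y -> E (a *: x + y).
(** Completeness is asked of E for rapidly converging sequences. This covers a complete space as
    well as the graph of a closed operator, on which L will be a second operator. *)
Hypothesis Ecomplete : forall (u : nat -> V) (C : R), (forall k, E (u k)) ->
  (forall k, `|u k.+1 - u k| <= C * 2^-1 ^+ k) -> exists2 l : V, E l & u @ \oo --> l.
Hypothesis LP : forall a x y, E x -> E y -> L (a *: x + y) = a *: L x + L y.
Hypothesis Lcl : closed [set p : V * W | E p.1 /\ p.2 = L p.1].

Let EB x y : E x -> E y -> E (x - y).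
Proof. by move=> Ex Ey; rewrite -scaleN1r addrC; exact: EP. Qed.

Let LB x y : E x -> E y -> L (x - y) = L x - L y.
Proof. by move=> Ex Ey; rewrite -scaleN1r addrC LP// scaleN1r addrC. Qed.

Let L0 : L 0 = 0.
Proof. by rewrite -(subrr 0) LB// subrr. Qed.

Let EZ a x : E x -> E (a *: x).
Proof. by move=> Ex; rewrite -[a *: x]addr0; exact: EP. Qed.

Let LZ a x : E x -> L (a *: x) = a *: L x.
Proof. by move=> Ex; rewrite -[in LHS](addr0 (a *: x)) LP// L0 addr0. Qed.

(* Baire's theorem in E, applied to the closures of {x | `|L x| <= n} *)
Let nonmeager : exists (n : nat) (x0 : V) (r : R), [/\ E x0, 0 < r &
  forall x, E x -> `|x - x0| <= r ->
  forall e : R, 0 < e -> exists y, [/\ E y, `|y - x| <= e & `|L y| <= n%:R]].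
Proof.
apply: contrapT => H.
have step (a : nat * (V * R)) : exists b : V * R, E a.2.1 -> 0 < a.2.2 ->
    [/\ E b.1, 0 < b.2, `|b.1 - a.2.1| + b.2 <= a.2.2, b.2 <= a.2.2 / 2 &
    forall y, E y -> `|y - b.1| <= b.2 -> a.1%:R < `|L y|].
  case: a => n [x0 r] /=.
  have [[Ex0 r0]|] := pselect (E x0 /\ 0 < r); last first.
    by move=> h; exists (x0, r) => Ex0 r0; exfalso; apply: h.
  have [x1 [Ex1 x1r [e e0 h]]] : exists x1, [/\ E x1, `|x1 - x0| <= r / 2 &
     exists2 e : R, 0 < e & forall y, E y -> `|y - x1| <= e -> n%:R < `|L y|].
    apply: contrapT => H'; apply: H; exists n, x0, (r / 2).
    split=> //; first exact: divr_gt0.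
    move=> x Ex xr e e0; apply: contrapT => H; apply: H'; exists x; split=> //.
    exists e => // y Ey ye; rewrite ltNge; apply/negP => Ly.
    by apply: H; exists y.
  exists (x1, Order.min e (r / 2)) => /= _ _.
  split=> //.
  - by rewrite lt_min e0 divr_gt0.
  - by rewrite [leRHS]splitr lerD// ge_min lexx orbT.
  - by rewrite ge_min lexx orbT.
  - by move=> y Ey; rewrite le_min => /andP[ye _]; exact: h.
have [g gP] := choice step.
pose fix s k : V * R := if k is j.+1 then g (j, s j) else (0, 1).
have sP k : E (s k).1 /\ 0 < (s k).2.
  elim: k => [|k [Ek rk]] //=.
  by have [] := gP (k, s k) Ek rk.
have sS k : [/\ `|(s k.+1).1 - (s k).1| + (s k.+1).2 <= (s k).2,
    (s k.+1).2 <= (s k).2 / 2 &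
    forall y, E y -> `|y - (s k.+1).1| <= (s k.+1).2 -> k%:R < `|L y|].
  by have [Ek rk] := sP k; have [] := gP (k, s k) Ek rk.
have rk k : (s k).2 <= 2^-1 ^+ k.
  elim: k => [|k IH]; first by rewrite expr0.
  have [_ h _] := sS k; rewrite (le_trans h)// exprS mulrC ler_wpM2l//.
have [k|k|l El sl] := @Ecomplete (fun k => (s k).1) 1.
- by have [] := sP k.
- have [h _ _] := sS k; rewrite mul1r (le_trans _ (rk k))// (le_trans _ h)// lerDl.
  by have [_ /ltW] := sP k.+1.
have sj k j : `|(s (k + j)%N).1 - (s k).1| + (s (k + j)%N).2 <= (s k).2.
  elim: j => [|j IH]; first by rewrite addn0 subrr normr0 add0r.
  have [h _ _] := sS (k + j)%N; rewrite addnS (le_trans _ IH)//.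
  rewrite -(subrKA (s (k + j)%N).1 (s (k + j).+1).1).
  by rewrite (le_trans (lerD (ler_normD _ _) (lexx _)))// addrAC addrC lerD2l.
have ls k : `|l - (s k).1| <= (s k).2.
  apply/ler_addgt0Pl => e e0; have /cvgr_normP/(_ e e0)[N _ hN] := sl.
  have := hN (k + N)%N (leq_addl _ _) => /= h.
  rewrite -(subrKA (s (k + N)%N).1) (le_trans (ler_normD _ _))// lerD//.
    by rewrite distrC.
  by rewrite (le_trans _ (sj k N))// lerDl; have [_ /ltW] := sP (k + N)%N.
have [k kL] : exists k : nat, `|L l| <= k%:R.
  by exists (Num.bound `|L l|); rewrite ltW// archi_boundP.
by have [_ _ /(_ l El (ls k.+1))] := sS k; rewrite ltNge kL.
Qed.

(** By [nonmeager] and scaling, every x has approximations y of any accuracy with |L y| at most M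
    |x|. Subtracting approximations repeatedly writes x as a series whose images converge
    geometrically; the closed graph identifies the sum of the images with L x. *)
Lemma closed_graph_bounded : exists2 C : R, 0 < C & forall x, E x -> `|L x| <= C * `|x|.
Proof.
have [n [x0 [r [Ex0 r0 hr]]]] := nonmeager.
(* An approximation of x is a rescaled difference of two points with |L| at most n, one near the
   centre x0 and one near its translate by a vector of norm r; rescaling by |x| / r gives this
   constant, with n + 1 for positivity. *)
pose M : R := n.+1%:R * 2 / r.
have M0 : 0 < M by rewrite divr_gt0// mulr_gt0.
have approx (a : V * R) : exists y, E a.1 -> 0 < a.2 ->
    [/\ E y, `|y - a.1| <= a.2 & `|L y| <= M * `|a.1|].
  case: a => x e /=.
  have [[Ex e0]|] := pselect (E x /\ 0 < e); last first.
    by move=> h; exists 0 => Ex e0; exfalso; apply: h.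
  have [->|xn0] := eqVneq x 0.
    by exists 0 => _ _; rewrite L0 subrr !normr0 mulr0 (ltW e0).
  have nx0 : 0 < `|x| by rewrite normr_gt0.
  pose a := r / `|x|; have a0 : 0 < a by rewrite divr_gt0.
  have e2 : 0 < e * a / 2 by rewrite divr_gt0// mulr_gt0.
  have Ex1 : E (a *: x + x0) by exact: EP.
  have [|y1 [Ey1 y1e Ly1]] := hr _ Ex1 _ _ e2.
    by rewrite addrK normrZ gtr0_norm// divfK// normr_eq0.
  have [|y2 [Ey2 y2e Ly2]] := hr _ Ex0 _ _ e2.
    by rewrite subrr normr0 ltW.
  exists (a^-1 *: (y1 - y2)) => _ _; split.
  - by apply: EZ; exact: EB.
  - have -> : a^-1 *: (y1 - y2) - x = a^-1 *: ((y1 - (a *: x + x0)) - (y2 - x0)).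
      rewrite -[in LHS](scalerK (lt0r_neq0 a0) x) -scalerBr; congr (_ *: _).
      by lincomb_eq.
    rewrite normrZ gtr0_norm ?invr_gt0// ler_pdivrMl// mulrC.
    by rewrite (le_trans (ler_normB _ _))// [leRHS]splitr lerD.
  - rewrite LZ ?LB//; last exact: EB.
    rewrite normrZ gtr0_norm ?invr_gt0// ler_pdivrMl//.
    have -> : a * (M * `|x|) = n.+1%:R + n.+1%:R.
      by rewrite /a /M; field; rewrite !lt0r_neq0.
    by rewrite (le_trans (ler_normB _ _))// lerD// (le_trans (y := n%:R))// ler_nat.
have [g gP] := choice approx.
exists (M * 2); first by rewrite mulr_gt0.
move=> x Ex; have [->|xn0] := eqVneq x 0; first by rewrite L0 !normr0 mulr0.
have nx0 : 0 < `|x| by rewrite normr_gt0.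
pose e k : R := `|x| * 2^-1 ^+ k.
have ek0 k : 0 < e k by rewrite mulr_gt0// exprn_gt0// invr_gt0.
(* The remainder after k approximations, of norm at most [e k]. *)
pose fix s k : V := if k is j.+1 then s j - g (s j, e j.+1) else x.
have Es k : E (s k) /\ `|s k| <= e k.
  elim: k => [|k [Ek sk]]; first by rewrite /e expr0 mulr1.
  have [Ey ye _] := gP (s k, e k.+1) Ek (ek0 _).
  by split; [exact: EB|rewrite /= distrC].
have [|k|w [sw /(_ 0%N) w0]] := @geometric_cauchy _ (fun k => L (x - s k)) (M * `|x|) 2^-1.
- by apply/andP; split; lra.
- have [Ek sk] := Es k; have [Ek' _] := Es k.+1.
  have [Ey _ Ly] := gP (s k, e k.+1) Ek (ek0 _).
  rewrite -LB; [|exact: EB|exact: EB].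
  have -> : x - s k.+1 - (x - s k) = g (s k, e k.+1) by rewrite /=; lincomb_eq.
  by rewrite (le_trans Ly)// -mulrA ler_pM2l.
suff -> : L x = w.
  move: w0; rewrite /= subrr L0 sub0r normrN expr0 mulr1 => /le_trans; apply.
  by rewrite le_eqVlt; apply/orP; left; apply/eqP; field.
have sx : (fun k => x - s k) @ \oo --> x.
  apply/cvgr_normP => d d0.
  have [||N qN] := @exprn_small 2^-1 (d / `|x|); first by apply/andP; split; lra.
    exact: divr_gt0.
  exists N => // k /= Nk; rewrite addrAC subrr sub0r normrN.
  have [_ /le_trans] := Es k; apply; rewrite /e mulrC -ler_pdivlMr//.
  by rewrite (le_trans _ qN)// ler_wiXn2l//; lra.
have := @closed_cvg _ _ \oo _ (fun k => (x - s k, L (x - s k))) _ Lcl _ (x, w).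
move=> /(_ _ _) [] //.
- apply: nearW => k /=; split=> //; apply: EB => //; exact: (Es k).1.
- exact: cvg_pair.
Qed.

End ClosedGraph.

Lemma closed_graph_theorem (R : realType) (V W : completeNormedModType R) (L : V -> W) :
  (forall a x y, L (a *: x + y) = a *: L x + L y) ->
  closed [set p : V * W | p.2 = L p.1] -> bounded_linear_on setT L.
Proof.
move=> LP Lcl; split=> [a x y _ _|]; first exact: LP.
have cpl (u : nat -> V) (C : R) : (forall k, setT (u k)) ->
    (forall k, `|u k.+1 - u k| <= C * 2^-1 ^+ k) -> exists2 l : V, setT l & u @ \oo --> l.
  move=> _ uC; have [|//|l [ul _]] := @geometric_cauchy _ _ u C 2^-1; last by exists l.
  by apply/andP; split; lra.
have cl : closed [set p : V * W | setT p.1 /\ p.2 = L p.1].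
  by rewrite (_ : [set _ | _] = [set p : V * W | p.2 = L p.1])//; apply/seteqP; split => p []//=.
have [C _ hC] := closed_graph_bounded (E := setT) I (fun _ _ _ _ _ => I) cpl
  (fun a x y _ _ => LP a x y) cl.
by exists C => x _; exact: hC.
Qed.

(** * Ordinary differential equations *)

Section Gluing.
Context {R : realType}.

Lemma in_itvccP (a b t : R) : `[a, b]%classic t <-> a <= t <= b.
Proof. by rewrite /= in_itv. Qed.

Lemma near_within_glue (u v w t : R) (P : R -> Prop) : u <= v -> v <= w ->
  (t <= v -> \forall s \near within `[u, v] (nbhs t), P s) ->
  (v <= t -> \forall s \near within `[v, w] (nbhs t), P s) ->
  \forall s \near within `[u, w] (nbhs t), P s.
Proof.
move=> uv vw h1 h2.
have {}h1 : \forall s \near within `[u, v] (nbhs t), P s.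
  have [/h1//|vt] := leP t v; apply/near_withinP; exists (t - v); rewrite ?subr_gt0//.
  by move=> s /in_itvccP /andP[_ sv]; rewrite distrC ger0_norm; lra.
have {}h2 : \forall s \near within `[v, w] (nbhs t), P s.
  have [/h2//|vt] := leP v t; apply/near_withinP; exists (v - t); rewrite ?subr_gt0//.
  by move=> s /in_itvccP /andP[vs _]; rewrite ger0_norm; lra.
have /near_withinP[d d0 hd] := h1; have /near_withinP[d' d'0 hd'] := h2.
apply/near_withinP; exists (Order.min d d'); first by rewrite lt_min d0.
move=> s /in_itvccP /andP[us sw]; rewrite lt_min => /andP[sd sd'].
have [sv|/ltW vs] := leP s v.
  by apply: hd => //; apply/in_itvccP; rewrite us.
by apply: hd' => //; apply/in_itvccP; rewrite vs.
Qed.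

Lemma small_power (C e : R) : 0 < e -> exists n, C * 2^-1 ^+ n <= e.
Proof.
move=> e0; have C0 : 0 < `|C| + 1 by rewrite ltr_wpDl.
have [||n hn] := @exprn_small R 2^-1 (e / (`|C| + 1)); first by apply/andP; split; lra.
  exact: divr_gt0.
exists n; rewrite (@le_trans _ _ ((`|C| + 1) * 2^-1 ^+ n))//.
  rewrite ler_wpM2r ?exprn_ge0//.
  by rewrite (le_trans (ler_norm _))// lerDl.
by rewrite mulrC -ler_pdivlMr.
Qed.

Lemma eq0_small_power (V : normedModType R) (x : V) (C : R) :
  (forall n, `|x| <= C * 2^-1 ^+ n) -> x = 0.
Proof.
move=> xC; apply/eqP; rewrite -normr_le0; apply/ler_addgt0Pl => e e0.
by have [n /(le_trans (xC n))] := small_power C e0; rewrite addr0.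
Qed.

Lemma cvg_within_uniform (V : normedModType R) (J : set R) (w : nat -> R -> V)
    (l : R -> V) (C : R) (t : R) : J t ->
  (forall k s, J s -> `|w k s - l s| <= C * 2^-1 ^+ k) ->
  (forall k, w k @ within J (nbhs t) --> w k t) ->
  l @ within J (nbhs t) --> l t.
Proof.
move=> Jt wl wc; apply/cvgr_normP => e e0.
have [k hk] := small_power C (divr_gt0 e0 (ltr0n R 3)).
have /cvgr_normP/(_ _ (divr_gt0 e0 (ltr0n R 3))) := wc k.
apply: filterS2 (near_within_self J t) => s Js h.
have -> : l s - l t = (l s - w k s) + (w k s - w k t) + (w k t - l t) by lincomb_eq.
have h1 := wl k s Js; have h2 := wl k t Jt; rewrite distrC in h1.
by rewrite (le_trans (ler_normD _ _))// (le_trans (lerD (ler_normD _ _) (lexx _)))//; lra.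
Qed.

End Gluing.

(** * Primitives of continuous vector-valued functions *)

Section Primitive.
Context {R : realType} {Y : completeNormedModType R}.

(** The left endpoint is exempt from differentiability because the equation yields no derivative at
    t = 0; continuity there lets the inequality on [s, b] pass to the limit as s tends to a. *)
Lemma mean_value_inequality_open (x dx : R -> Y) (a b K : R) : a <= b -> 0 <= K ->
  x @ within `[a, b] (nbhs a) --> x a ->
  (forall t, a < t <= b -> deriv_within `[a, b] x t (dx t)) ->
  (forall t, a < t <= b -> `|dx t| <= K) ->
  `|x b - x a| <= K * (b - a).
Proof.
move=> ab K0 xa xd dK; have [->|nab] := eqVneq a b; first by rewrite !subrr normr0 mulr0.
have {}ab : a < b by rewrite lt_neqAle nab.
apply/ler_addgt0Pl => e e0.
have /cvgr_normP/(_ e e0)/near_withinP[d d0 hd] := xa.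
pose s := Order.min b (a + d / 2).
have sa : a < s by rewrite lt_min ab ltrDl divr_gt0.
have sb : s <= b by rewrite ge_min lexx.
have sd : s <= a + d / 2 by rewrite ge_min lexx orbT.
have h1 : `|x s - x a| <= e.
  by apply: hd; [apply/in_itvccP; rewrite (ltW sa)|rewrite gtr0_norm ?subr_gt0//; lra].
have h2 : `|x b - x s| <= K * (b - s).
  apply: (@mean_value_inequality _ _ x dx) => // t /andP[st tb]; last first.
    by apply: dK; rewrite tb (lt_le_trans sa).
  apply: deriv_within_subset (xd t _); last by rewrite tb (lt_le_trans sa).
  by move=> r /in_itvccP/andP[sr rb]; apply/in_itvccP; rewrite rb (le_trans (ltW sa)).
rewrite -(subrKA (x s)) (le_trans (ler_normD _ _))// addrC lerD// (le_trans h2)//.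
by rewrite ler_wpM2l//; lra.
Qed.

(** An approximate primitive with slope error e. Around t the function s *: h t qualifies, and
    approximate primitives on adjacent intervals can be glued, so [cousin] yields them globally
    without an integral of vector-valued functions. *)
Let eprim (h H : R -> Y) (e u v : R) := forall t, u <= t <= v ->
  \forall s \near within `[u, v] (nbhs t), `|H s - H t - (s - t) *: h t| <= e * `|s - t|.

Let eprim_exists (h : R -> Y) (a b e : R) : a <= b -> 0 < e ->
  (forall t, a <= t <= b -> h @ within `[a, b] (nbhs t) --> h t) ->
  exists H, eprim h H e a b.
Proof.
move=> ab e0 hc; apply: (@cousin _ a b (fun u v => exists H, eprim h H e u v) ab).
  move=> u v w _ uv vw _ [H1 P1] [H2 P2].
  exists (fun t => if t <= v then H1 t else H2 t - H2 v + H1 v) => t /andP[ut tw].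
  apply: (near_within_glue uv vw) => htv.
    apply: filterS2 (near_within_self _ t) (P1 t _); last by rewrite ut.
    by move=> s /in_itvccP/andP[_ ->]; rewrite htv.
  have E r : v <= r -> (if r <= v then H1 r else H2 r - H2 v + H1 v) = H2 r - H2 v + H1 v.
    move=> vr; have [rv|//] := leP r v.
    by rewrite (_ : r = v) ?subrr ?add0r//; apply/eqP; rewrite eq_le rv.
  apply: filterS2 (near_within_self _ t) (P2 t _); last by rewrite htv.
  move=> s /in_itvccP/andP[vs _]; rewrite !E//; congr (`|_| <= _); lincomb_eq.
move=> t tab; have /cvgr_normP/(_ _ (divr_gt0 e0 (ltr0n R 2)))/near_withinP[d d0 hd] := hc t tab.
exists d => // u v au ut tv vb uvd; exists (fun s => s *: h t) => r /andP[ur rv].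
apply: nearW => s; rewrite -!scalerBl -scalerBr normrZ mulrC ler_wpM2r// distrC.
rewrite (le_trans (hd r _ _))//; last lra.
  by apply/in_itvccP; rewrite (le_trans au)// (le_trans rv).
by case: (leP 0 (r - t)) => ?; [rewrite ger0_norm|rewrite ltr0_norm]; lra.
Qed.

Lemma primitive_exists (h : R -> Y) (a b : R) : a <= b ->
  (forall t, a <= t <= b -> h @ within `[a, b] (nbhs t) --> h t) ->
  exists H, H a = 0 /\ forall t, a <= t <= b -> deriv_within `[a, b] H t (h t).
Proof.
move=> ab hc; pose e n : R := 2^-1 ^+ n.
have e0 n : 0 < e n by rewrite exprn_gt0// invr_gt0.
have [g gP] := choice (fun n => eprim_exists ab (e0 n) hc).
have diff n s t : a <= s -> s <= t -> t <= b ->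
    `|(g n.+1 t - g n.+1 s) - (g n t - g n s)| <= 2 * (t - s) * e n.
  move=> as_ st tb; pose x r := g n.+1 r - g n r.
  have -> : (g n.+1 t - g n.+1 s) - (g n t - g n s) = x t - x s.
    by rewrite /x; lincomb_eq.
  rewrite mulrAC; apply: local_lipschitz_increment => // r /andP[sr rt].
  have rab : a <= r <= b by rewrite (le_trans as_)// (le_trans rt).
  have sub : `[s, t] `<=` `[a, b].
    by move=> q /in_itvccP/andP[? ?]; apply/in_itvccP; rewrite (le_trans as_)// (le_trans _ tb).
  have /(near_within_subset sub) P1 := gP n.+1 r rab.
  have /(near_within_subset sub) P2 := gP n r rab.
  apply: filterS2 P1 P2 => q h1 h2.
  have -> : x q - x r = (g n.+1 q - g n.+1 r - (q - r) *: h r) - (g n q - g n r - (q - r) *: h r).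
    by rewrite /x; lincomb_eq.
  rewrite (le_trans (ler_normB _ _))// (le_trans (lerD h1 h2))// -mulrDl ler_wpM2r//.
  by rewrite mulr_natl mulr2n lerD2r /e exprS ler_piMl// ?exprn_ge0//; lra.
(* Approximate primitives are controlled only up to constants, so increments and not values are
   shown to converge. The error is proportional to t - s, which is what makes the limit
   differentiable. *)
have lim_st s t : a <= s -> s <= t -> t <= b -> exists l : Y,
    (fun n => g n t - g n s) @ \oo --> l /\
    forall n, `|(g n t - g n s) - l| <= 4 * (t - s) * e n.
  move=> as_ st tb.
  have [|n|l [gl lP]] := @geometric_cauchy _ _ (fun n => g n t - g n s) (2 * (t - s)) 2^-1.
  - by apply/andP; split; lra.
  - exact: diff.
  - exists l; split=> // n; rewrite (le_trans (lP n))// /e le_eqVlt; apply/orP; left.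
    by apply/eqP; field.
have ex t : exists l : Y, a <= t <= b -> (fun n => g n t - g n a) @ \oo --> l.
  have [/andP[at_ tb]|nt] := boolP (a <= t <= b); last by exists 0.
  by have [l [gl _]] := lim_st a t (lexx a) at_ tb; exists l.
have [H HP] := choice ex.
have Hst s t : a <= s -> s <= t -> t <= b ->
    forall n, `|(g n t - g n s) - (H t - H s)| <= 4 * (t - s) * e n.
  move=> as_ st tb; have [l [gl lP]] := lim_st s t as_ st tb.
  suff -> : H t - H s = l by [].
  apply: (cvg_unique (@norm_hausdorff _ Y) _ gl).
  have Ht : (fun n => g n t - g n a) @ \oo --> H t by apply: HP; rewrite tb (le_trans as_).
  have Hs : (fun n => g n s - g n a) @ \oo --> H s by apply: HP; rewrite as_ (le_trans st).
  rewrite (_ : (fun n => _) = (fun n => (g n t - g n a) - (g n s - g n a))).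
    exact: cvgB.
  by apply/funext => n; lincomb_eq.
have Hst' s t : a <= s <= b -> a <= t <= b ->
    forall n, `|(g n t - g n s) - (H t - H s)| <= 4 * `|t - s| * e n.
  move=> /andP[as_ sb] /andP[at_ tb] n; have [st|/ltW ts] := leP s t.
    by rewrite ger0_norm ?subr_ge0//; exact: Hst.
  rewrite (ler0_norm (_ : t - s <= 0)) ?subr_le0// (opprB t).
  have -> : g n t - g n s - (H t - H s) = - (g n s - g n t - (H s - H t)) by lincomb_eq.
  by rewrite normrN; exact: Hst.
exists (fun t => H t - H a); split=> [|t tab d d0]; first by rewrite subrr.
(* In units of [e n], the slope error is 1 from [g n] and 4 from its distance to the limit. *)
have [n hn] := small_power 5 d0.
apply: filterS2 (near_within_self _ t) (gP n t tab) => s /in_itvccP sab h1.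
have h2 := Hst' s t sab tab n.
have -> : H s - H a - (H t - H a) - (s - t) *: h t =
    (g n s - g n t - (s - t) *: h t) + ((g n t - g n s) - (H t - H s)) by lincomb_eq.
rewrite (le_trans (ler_normD _ _))// (le_trans (lerD h1 h2))// distrC mulrAC -mulrDl.
by rewrite ler_wpM2r// (le_trans _ hn)// /e; lra.
Qed.

End Primitive.

(** * Local existence and uniqueness for ordinary differential equations *)

Section ODE.
Context {R : realType} {Y : completeNormedModType R}.
Variables (T0 : R) (G : R -> Y -> Y).

Definition ode_continuous := forall t w, T0 <= t -> forall e : R, 0 < e ->
  exists2 d : R, 0 < d & forall s u, T0 <= s -> `|s - t| < d -> `|u - w| < d ->
    `|G s u - G t w| <= e.

Definition ode_lipschitz := forall t w, T0 <= t ->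
  exists r L : R, [/\ 0 < r, 0 < L & forall s u v, T0 <= s -> `|s - t| < r ->
    `|u - w| < r -> `|v - w| < r -> `|G s u - G s v| <= L * `|u - v|].

Definition ode_sol (J : set R) (w : R -> Y) :=
  forall t, J t -> deriv_within J w t (G t (w t)).

Hypotheses (Gc : ode_continuous) (Gl : ode_lipschitz).

Lemma ode_cvg (J : set R) (w : R -> Y) t : J `<=` [set t | T0 <= t] -> J t ->
  w @ within J (nbhs t) --> w t ->
  (fun s => G s (w s)) @ within J (nbhs t) --> G t (w t).
Proof.
move=> JT Jt /cvgr_normP wc; apply/cvgr_normP => e e0.
have [d d0 hd] := Gc (w t) (JT _ Jt) e0.
have d2 : 0 < d / 2 by rewrite divr_gt0.
apply: filterS3 (near_within_self J t) (wc _ d2) (near_within_ball J t d0) => s Js h h'.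
by apply: hd => //; [exact: JT|rewrite (le_lt_trans h)//; lra].
Qed.

Lemma ode_local t1 w1 : T0 <= t1 ->
  exists2 h : R, 0 < h & exists2 w, w t1 = w1 & ode_sol `[t1, (t1 + h)] w.
Proof.
move=> Tt1; have [r [L [r0 L0 hL]]] := Gl w1 Tt1.
have [d d0 hd] := Gc w1 Tt1 ltr01.
pose M := `|G t1 w1| + 1; have M0 : 0 < M by rewrite ltr_wpDl.
pose rho := Order.min r d / 2.
have rd0 : 0 < Order.min r d by rewrite lt_min r0.
have rho0 : 0 < rho by rewrite divr_gt0.
have rhor : rho < r.
  by rewrite /rho ltr_pdivrMr// gt_min ltr_pMr// ltr1n.
have rhod : rho < d.
  by rewrite /rho ltr_pdivrMr// gt_min ltr_pMr// ltr1n// orbT.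
(* M h <= rho keeps the Picard iterates in the ball of radius rho, and L h <= 1/2 makes the Picard
   map halve distances. *)
pose h := Order.min rho (Order.min (rho / M) (2^-1 / L)).
have h0 : 0 < h by rewrite !lt_min rho0 !divr_gt0// invr_gt0.
have hrho : h <= rho by rewrite ge_min lexx.
have hM : M * h <= rho.
  by rewrite mulrC -ler_pdivlMr// /h !ge_min lexx orbT.
have hL2 : L * h <= 2^-1.
  by rewrite mulrC -ler_pdivlMr// /h !ge_min lexx !orbT.
exists h => //; pose I := `[t1, (t1 + h)]%classic.
have IT : I `<=` [set t | T0 <= t] by move=> t /in_itvccP/andP[/(le_trans Tt1)].
have Id t : I t -> `|t - t1| < r /\ `|t - t1| < d /\ 0 <= t - t1 <= h.
  move=> /in_itvccP/andP[t1t th]; rewrite ger0_norm ?subr_ge0//.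
  by split; [|split]; [lra|lra|]; apply/andP; split; lra.
pose good (w : R -> Y) := forall t, I t ->
  w @ within I (nbhs t) --> w t /\ `|w t - w1| <= rho.
have GM w t : good w -> I t -> `|G t (w t)| <= M.
  move=> gw It; have [_ hw] := gw t It; have [_ [td _]] := Id t It.
  rewrite -[G t _](subrK (G t1 w1)) (le_trans (ler_normD _ _))// addrC lerD2l.
  by apply: hd => //; [exact: IT|exact: le_lt_trans hw _].
have t1I : I t1 by apply/in_itvccP; rewrite lexx lerDl ltW.
have subI t : I t -> `[t1, t] `<=` I.
  move=> /in_itvccP/andP[_ th] s /in_itvccP/andP[? st].
  by apply/in_itvccP; apply/andP; split=> //; exact: le_trans st th.
(* The Picard map has to be a total function for the iteration; on a curve that is not [good] its
   value is arbitrary. *)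
have step (w : R -> Y) : exists w' : R -> Y, good w ->
    [/\ good w', w' t1 = w1 & forall t, I t -> deriv_within I w' t (G t (w t))].
  have [gw|] := pselect (good w); last by move=> ?; exists w.
  have [|t tI|H [H1 Hd]] := @primitive_exists R Y (fun t => G t (w t)) t1 (t1 + h).
  - by rewrite lerDl ltW.
  - have It : I t by exact/in_itvccP.
    exact: (ode_cvg IT It (gw t It).1).
  exists (fun t => w1 + H t) => _.
  have Dd t : I t -> deriv_within I (fun t => w1 + H t) t (G t (w t)).
    move=> It; rewrite -[X in deriv_within _ _ _ X]add0r; apply: deriv_withinD.
      exact: deriv_within_cst.
    by apply: Hd; exact/in_itvccP.
  split=> [t It||//]; last by rewrite H1 addr0.
  split; first exact: deriv_within_cvg (Dd t It).
  rewrite addrAC subrr add0r -[H t]subr0 -H1.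
  have [_ [_ /andP[tt1 tth]]] := Id t It.
  rewrite (@le_trans _ _ (M * (t - t1)))//; last first.
    by rewrite (le_trans _ hM)// ler_pM2l.
  have t1t : t1 <= t by rewrite -subr_ge0.
  apply: (@mean_value_inequality _ _ H (fun t => G t (w t))) => // s /andP[ts st].
    apply: deriv_within_subset (subI t It) (Hd s _).
    by apply/in_itvccP; apply: subI It _ _; apply/in_itvccP; rewrite ts.
  by apply: GM => //; apply: subI It _ _; apply/in_itvccP; rewrite ts.
have [p pP] := choice step.
pose w k := iter k p (fun=> w1).
have gw k : good (w k).
  elim: k => [t It|k IH]; last by rewrite /w iterS; have [] := pP _ IH.
  split; first exact: cvg_cst.
  by rewrite /= subrr normr0 ltW.
have lipG u v t : good u -> good v -> I t -> `|G t (u t) - G t (v t)| <= L * `|u t - v t|.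
  move=> gu gv It; have [tr _] := Id t It; apply: hL => //; first exact: IT.
    exact: le_lt_trans (gu t It).2 _.
  exact: le_lt_trans (gv t It).2 _.
have contract u v (c : R) : good u -> good v -> 0 <= c ->
    (forall t, I t -> `|u t - v t| <= c) -> forall t, I t -> `|p u t - p v t| <= c / 2.
  move=> gu gv c0 uv t It.
  have [_ pu1 pud] := pP _ gu; have [_ pv1 pvd] := pP _ gv.
  have [_ [_ /andP[tt1 tth]]] := Id t It.
  pose x s := p u s - p v s.
  have -> : p u t - p v t = x t - x t1 by rewrite /x pu1 pv1 subrr subr0.
  apply: (@le_trans _ _ ((L * c) * (t - t1))); last first.
    rewrite mulrAC mulrC ler_wpM2l// (le_trans _ hL2)// ler_pM2l//.
  have t1t : t1 <= t by rewrite -subr_ge0.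
  apply: (@mean_value_inequality _ _ x (fun s => G s (u s) - G s (v s))) => // s /andP[ts st].
    apply: deriv_within_subset (subI t It) _; apply: deriv_withinB.
      by apply: pud; apply: subI It _ _; apply/in_itvccP; rewrite ts.
    by apply: pvd; apply: subI It _ _; apply/in_itvccP; rewrite ts.
  have Is : I s by apply: subI It _ _; apply/in_itvccP; rewrite ts.
  by rewrite (le_trans (lipG _ _ _ gu gv Is))// ler_pM2l// uv.
have wS k t : I t -> `|w k.+1 t - w k t| <= rho * 2^-1 ^+ k.
  elim: k t => [|k IH] t It; first by rewrite expr0 mulr1; exact: (gw 1%N t It).2.
  rewrite /w 2!iterS -/(w k.+1) -/(w k).
  rewrite exprS mulrCA mulrC.
  have c0 : 0 <= rho * 2^-1 ^+ k by rewrite mulr_ge0 ?exprn_ge0// ltW.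
  exact: contract (gw k.+1) (gw k) c0 IH t It.
have lw t : exists l : Y, I t -> (w ^~ t) @ \oo --> l /\
    forall k, `|w k t - l| <= (2 * rho) * 2^-1 ^+ k.
  have [It|] := pselect (I t); last by move=> ?; exists 0.
  have [|k|l [wl lP]] := @geometric_cauchy _ _ (w ^~ t) rho 2^-1.
  - by apply/andP; split; lra.
  - exact: wS.
  - exists l => _; split=> // k; rewrite (le_trans (lP k))// le_eqVlt; apply/orP; left.
    by apply/eqP; field.
have [l lP] := choice lw.
have gl : good l.
  move=> t It; split.
    apply: (cvg_within_uniform It _ (fun k => (gw k t It).1)) => k s Is.
    exact: (lP s Is).2.
  apply/ler_addgt0Pl => e e0; have [k hk] := small_power (2 * rho) e0.
  have h1 := le_trans ((lP t It).2 k) hk; rewrite distrC in h1.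
  by rewrite -(subrKA (w k t)) (le_trans (ler_normD _ _))// lerD//; exact: (gw k t It).2.
have [gpl pl1 pld] := pP l gl.
have El t : I t -> p l t = l t.
  move=> It; apply/eqP; rewrite -subr_eq0; apply/eqP.
  apply: (@eq0_small_power _ _ _ (2 * rho)) => k.
  rewrite -(subrKA (w k.+1 t)) (le_trans (ler_normD _ _))//.
  have h1 := (lP t It).2 k.+1.
  have h2 : `|p l t - w k.+1 t| <= (2 * rho * 2^-1 ^+ k) / 2.
    have c0 : 0 <= 2 * rho * 2^-1 ^+ k by rewrite !mulr_ge0// ?exprn_ge0// ltW.
    have lw_k s : I s -> `|l s - w k s| <= 2 * rho * 2^-1 ^+ k.
      by move=> Is; rewrite distrC; exact: (lP s Is).2.
    exact: contract gl (gw k) c0 lw_k t It.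
  by move: h1; rewrite exprS => h1; rewrite (le_trans (lerD h2 h1))//; lra.
exists l; first by rewrite -El.
by move=> t It; apply: (eq_deriv_within It El); exact: pld.
Qed.

(** [cousin] is applied to the relation that equality at u implies equality on [u, v]. At a tag
    where the curves differ they differ nearby, so the premise fails; where they agree, the mean
    value inequality halves any bound on their distance on intervals shorter than 1 / (2 L). Only
    continuity is asked at a. *)
Lemma ode_unique (a b : R) (w w' : R -> Y) : T0 <= a -> a <= b ->
  (forall t, a <= t <= b -> w @ within `[a, b] (nbhs t) --> w t) ->
  (forall t, a <= t <= b -> w' @ within `[a, b] (nbhs t) --> w' t) ->
  (forall t, a < t <= b -> deriv_within `[a, b] w t (G t (w t))) ->
  (forall t, a < t <= b -> deriv_within `[a, b] w' t (G t (w' t))) ->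
  w a = w' a -> forall t, a <= t <= b -> w t = w' t.
Proof.
move=> Ta ab wc wc' wd wd' waa.
suff : w a = w' a -> forall t, a <= t <= b -> w t = w' t by apply.
pose P u v := w u = w' u -> forall t, u <= t <= v -> w t = w' t.
apply: (@cousin _ a b P ab) => [u v z _ uv vz _ P1 P2 h t /andP[ut tz]|t tab].
  have [tv|/ltW vt] := leP t v; first by apply: P1 => //; rewrite ut.
  by apply: P2; [apply: P1 => //; rewrite uv lexx|rewrite vt].
have /andP[at_ tb] := tab.
have [Et|/eqP nEt] := eqVneq (w t) (w' t); last first.
  have e0 : 0 < `|w t - w' t| / 3 by rewrite divr_gt0// normr_gt0 subr_eq0; apply/eqP.
  have /cvgr_normP/(_ _ e0) h1 := wc t tab; have /cvgr_normP/(_ _ e0) h2 := wc' t tab.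
  have : \forall s \near within `[a, b] (nbhs t),
      `|w s - w t| <= `|w t - w' t| / 3 /\ `|w' s - w' t| <= `|w t - w' t| / 3.
    exact: filterI h1 h2.
  move=> {h1 h2} /near_withinP[d d0 hd].
  exists d => // u v au ut tv vb uvd Eu; exfalso.
  have [||h1 h2] := hd u.
  - by apply/in_itvccP; rewrite au (le_trans ut).
  - by rewrite distrC ger0_norm ?subr_ge0//; lra.
  rewrite Eu in h1; have := ler_normB (w' u - w' t) (w' u - w t).
  have -> : w' u - w' t - (w' u - w t) = w t - w' t by lincomb_eq.
  by move: e0 => e0; lra.
have [r [L [r0 L0 hL]]] := Gl (w t) (le_trans Ta at_).
have r2 : 0 < r / 2 by rewrite divr_gt0.
have /cvgr_normP/(_ _ r2) h1 := wc t tab; have /cvgr_normP/(_ _ r2) h2 := wc' t tab.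
have : \forall s \near within `[a, b] (nbhs t),
    `|w s - w t| <= r / 2 /\ `|w' s - w' t| <= r / 2 by exact: filterI h1 h2.
move=> {h1 h2} /near_withinP[d d0 hd].
pose d' := Order.min d (Order.min r (2^-1 / L)).
exists d'; first by rewrite !lt_min d0 r0 divr_gt0// invr_gt0.
move=> u v au ut tv vb; rewrite !lt_min => /andP[uvd /andP[uvr uvL]] Eu.
have close s : u <= s <= v -> [/\ a <= s <= b, `|s - t| < r, `|w s - w t| < r & `|w' s - w t| < r].
  move=> /andP[us sv].
  have st : `|s - t| <= v - u by case: (leP t s) => ?; [rewrite ger0_norm|rewrite ltr0_norm]; lra.
  have sab : a <= s <= b by rewrite (le_trans au)// (le_trans sv).
  have [|| /= h h'] := hd s; [exact/in_itvccP|exact: le_lt_trans st uvd|].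
  split=> //; first exact: le_lt_trans st uvr.
    by rewrite (le_lt_trans h)//; lra.
  by rewrite Et (le_lt_trans h')//; lra.
suff bnd k s : u <= s <= v -> `|w s - w' s| <= (2 * r) * 2^-1 ^+ k.
  move=> s usv; apply/eqP; rewrite -subr_eq0; apply/eqP.
  by apply: (@eq0_small_power _ _ _ (2 * r)) => k; exact: bnd.
elim: k s => [|k IH] s usv.
  have [_ _ h h'] := close s usv; rewrite expr0 mulr1 -(subrKA (w t)).
  by rewrite (le_trans (ler_normD _ _))// [X in _ + X]distrC mulr_natl mulr2n lerD// ltW.
have /andP[us sv] := usv.
pose x q := w q - w' q.
have c0 : 0 <= 2 * r * 2^-1 ^+ k by rewrite !mulr_ge0// ?exprn_ge0// ltW.
have -> : w s - w' s = x s - x u by rewrite /x Eu subrr subr0.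
apply: (@le_trans _ _ (L * (2 * r * 2^-1 ^+ k) * (s - u))); last first.
  have -> : 2 * r * 2^-1 ^+ k.+1 = 2^-1 * (2 * r * 2^-1 ^+ k) by rewrite exprS mulrCA.
  rewrite mulrAC ler_wpM2r//.
  by rewrite mulrC -ler_pdivlMr// (le_trans _ (ltW uvL))//; lra.
have sub : `[u, s] `<=` `[a, b].
  move=> q /in_itvccP/andP[uq qs]; apply/in_itvccP.
  by rewrite (le_trans au)// (le_trans qs)// (le_trans sv).
have uab : a <= u <= b by rewrite au (le_trans us)// (le_trans sv).
apply: (@mean_value_inequality_open _ _ x (fun q => G q (w q) - G q (w' q))) => //.
- by rewrite mulr_ge0// ltW.
- by apply: cvg_within_subset sub _; exact: cvgB (wc u uab) (wc' u uab).
- move=> q /andP[uq qs]; have aq : a < q <= b.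
    by rewrite (le_lt_trans au)// (le_trans qs)// (le_trans sv).
  by apply: deriv_within_subset sub _; apply: deriv_withinB; [exact: wd|exact: wd'].
- move=> q /andP[/ltW uq qs]; have uqv : u <= q <= v by rewrite uq (le_trans qs).
  have [/andP[aq _] h3 h4 h5] := close q uqv.
  rewrite (le_trans (hL _ _ _ (le_trans Ta aq) h3 h4 h5))// ler_pM2l//.
  exact: IH.
Qed.

End ODE.

(** * Continuation of solutions *)

Section GlobalODE.
Context {R : realType} {Y : completeNormedModType R}.
Variables (T0 : R) (G : R -> Y -> Y).
Hypotheses (Gc : ode_continuous T0 G) (Gl : ode_lipschitz T0 G).

Lemma ode_sol_glue (a b c : R) (w w' : R -> Y) : a <= b -> b <= c -> w b = w' b ->
  ode_sol G `[a, b] w -> ode_sol G `[b, c] w' ->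
  ode_sol G `[a, c] (fun t => if t <= b then w t else w' t).
Proof.
move=> ab bc wb wd wd' t /in_itvccP/andP[at_ tc] e e0.
have E r : b <= r -> (if r <= b then w r else w' r) = w' r.
  move=> br; have [rb|//] := leP r b.
  by rewrite (_ : r = b)//; apply/eqP; rewrite eq_le rb.
apply: (near_within_glue ab bc) => htb.
  have It : `[a, b]%classic t by apply/in_itvccP; rewrite at_.
  apply: filterS2 (near_within_self _ t) (wd t It e e0).
  by move=> s /in_itvccP/andP[_ ->]; rewrite htb.
have It : `[b, c]%classic t by apply/in_itvccP; rewrite htb.
apply: filterS2 (near_within_self _ t) (wd' t It e e0) => s /in_itvccP/andP[bs _].
by rewrite !E.
Qed.

Lemma ode_sol_subset (J J' : set R) w : J' `<=` J -> ode_sol G J w -> ode_sol G J' w.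
Proof. by move=> JJ' wd t J't; apply: deriv_within_subset JJ' (wd t (JJ' _ J't)). Qed.

Lemma itvcc_sub (a b c d : R) : a <= c -> d <= b -> `[c, d] `<=` `[a, b].
Proof.
move=> ac db t /in_itvccP/andP[ct td]; apply/in_itvccP.
by rewrite (le_trans ac)// (le_trans td).
Qed.

Lemma ode_sol_unique (a b : R) (w w' : R -> Y) : T0 <= a -> a <= b ->
  ode_sol G `[a, b] w -> ode_sol G `[a, b] w' -> w a = w' a ->
  forall t, a <= t <= b -> w t = w' t.
Proof.
move=> Ta ab wd wd'; apply: (ode_unique Gl Ta ab) => t tab.
- by apply: deriv_within_cvg (wd t _); exact/in_itvccP.
- by apply: deriv_within_cvg (wd' t _); exact/in_itvccP.
- by case/andP: tab => /ltW ? ?; apply: wd; apply/in_itvccP/andP.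
- by case/andP: tab => /ltW ? ?; apply: wd'; apply/in_itvccP/andP.
Qed.

(** Bounded slopes make w Lipschitz, so it has a limit l at b; the derivative at b then comes from
    continuity of G along the extended curve. *)
Lemma ode_sol_closure (a b C : R) (w : R -> Y) : T0 <= a -> a < b ->
  ode_sol G `[a, b[ w -> (forall t, a <= t < b -> `|G t (w t)| <= C) ->
  exists l : Y, ode_sol G `[a, b] (fun t => if t < b then w t else l).
Proof.
move=> Ta ab wd wC.
have C0 : 0 <= C by apply: le_trans (wC a _); rewrite ?lexx.
have sub s t : a <= s -> t < b -> `[s, t] `<=` `[a, b[.
  by move=> as_ tb q /in_itvccP/andP[sq qt]; rewrite /= in_itv /= (le_trans as_)// (le_lt_trans qt).
have wlip s t : a <= s -> s <= t -> t < b -> `|w t - w s| <= C * (t - s).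
  move=> as_ st tb; apply: (@mean_value_inequality _ _ w (fun r => G r (w r))) => // r /andP[sr rt].
    apply: deriv_within_subset (sub s t as_ tb) (wd r _).
    by rewrite /= in_itv /= (le_trans as_)// (le_lt_trans rt).
  by apply: wC; rewrite (le_trans as_)// (le_lt_trans rt).
pose tn n := b - (b - a) * 2^-1 ^+ n.
have ba0 : 0 <= b - a by rewrite subr_ge0 ltW.
have pw n : 0 < (2^-1 : R) ^+ n <= 1.
  by rewrite exprn_gt0 ?invr_gt0// exprn_ile1//; lra.
have tn_b n : tn n < b by rewrite gtrBl mulr_gt0 ?subr_gt0//; have /andP[] := pw n.
have tn_a n : a <= tn n.
  have /andP[p0 p1] := pw n; rewrite /tn lerBrDr -lerBrDl.
  by rewrite ler_piMr// subr_ge0 ltW.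
have tnS n : tn n <= tn n.+1.
  rewrite lerD2l lerN2 ler_wpM2l// exprS ler_piMl ?exprn_ge0//; lra.
have [|n|l [wl lP]] := @geometric_cauchy _ _ (fun n => w (tn n)) (C * (b - a)) 2^-1.
- by apply/andP; split; lra.
- rewrite (le_trans (wlip _ _ (tn_a n) (tnS n) (tn_b _)))// -mulrA ler_wpM2l//.
  rewrite /tn exprS.
  have /andP[p0 p1] := pw n.
  have ba : 0 <= (b - a) * 2^-1 ^+ n by rewrite mulr_ge0// exprn_ge0.
  by move: ba; set z := _ * _ => ba; rewrite mulrCA -/z; lra.
have wl_ s : a <= s < b -> `|l - w s| <= C * (b - s).
  move=> /andP[as_ sb]; apply/ler_addgt0Pl => e e0.
  have bs0 : 0 < b - s by rewrite subr_gt0.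
  have [k hk] := small_power (C * (b - a) / (1 - 2^-1)) e0.
  have [j hj] := small_power (b - a) bs0.
  have [n [kn jn]] : exists n, (k <= n)%N /\ (j <= n)%N.
    by exists (maxn k j); rewrite leq_maxl leq_maxr.
  have stn : s <= tn n.
    rewrite /tn lerBrDr -lerBrDl (le_trans _ hj)//.
    by rewrite ler_wpM2l// ler_wiXn2l//; lra.
  have h1 := lP n; rewrite distrC in h1.
  rewrite -(subrKA (w (tn n))) (le_trans (ler_normD _ _))// lerD//.
    rewrite (le_trans h1)// (le_trans _ hk)// mulrAC ler_wpM2l//; last first.
      by rewrite ler_wiXn2l//; lra.
    by rewrite divr_ge0 ?mulr_ge0//; lra.
  rewrite (le_trans (wlip _ _ as_ stn (tn_b _)))// ler_wpM2l//.
  by have := ltW (tn_b n); lra.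
exists l; pose wb t : Y := if t < b then w t else l.
change (ode_sol G `[a, b] wb).
have wbE t : t < b -> wb t = w t by rewrite /wb => ->.
have wbb : wb b = l by rewrite /wb ltxx.
have wb_cvg : wb @ within `[a, b] (nbhs b) --> wb b.
  apply/cvgr_normP => e e0; apply/near_withinP.
  have C1 : 0 < C + 1 by rewrite ltr_wpDl.
  exists (e / (C + 1)); first exact: divr_gt0.
  move=> s /in_itvccP/andP[as_ sb] sbd; rewrite wbb.
  have [sb'|] := ltP s b; last first.
    by move=> bs; rewrite (_ : s = b) ?wbb ?subrr ?normr0 ?ltW//; apply/eqP; rewrite eq_le sb.
  rewrite wbE// distrC (le_trans (wl_ s _)) ?as_//.
  rewrite distrC ger0_norm ?subr_ge0// ltr_pdivlMr// in sbd.
  by rewrite mulrC; apply: le_trans (ltW sbd); rewrite ler_wpM2l ?subr_ge0//; lra.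
move=> t /in_itvccP/andP[at_ tb]; have [tb'|bt] := ltP t b.
  have It : `[a, b[%classic t by rewrite /= in_itv /= at_.
  rewrite wbE// => e e0; have /near_withinP[d d0 hd] := wd t It e e0.
  apply/near_withinP; exists (Order.min d (b - t)); first by rewrite lt_min d0 subr_gt0.
  move=> s /in_itvccP/andP[as_ sb]; rewrite lt_min => /andP[sd st].
  have sb' : s < b by have := ler_norm (s - t); lra.
  by rewrite !wbE//; apply: hd => //; rewrite /= in_itv /= as_.
have -> : t = b by apply/eqP; rewrite eq_le tb.
move=> e e0; have bI : `[a, b]%classic b by apply/in_itvccP; rewrite ltW/=.
have JT : `[a, b] `<=` [set t | T0 <= t] by move=> s /in_itvccP/andP[/(le_trans Ta)].
have /cvgr_normP/(_ e e0)/near_withinP[d d0 hd] := ode_cvg Gc JT bI wb_cvg.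
apply/near_withinP; exists d => // s /in_itvccP/andP[as_ sb] sbd.
have [sb'|bs] := ltP s b; last first.
  have -> : s = b by apply/eqP; rewrite eq_le sb.
  by rewrite !subrr scale0r subrr !normr0 mulr0.
(* The slope of x is G r (w r) - c, at most e near b. The mean value inequality is applied on [s, r]
   with r < b, where w is known to be a solution, and then r tends to b. *)
pose c := G b (wb b); pose x r := wb r - (r - b) *: c.
have -> : wb s - wb b - (s - b) *: c = - (x b - x s) by rewrite /x; lincomb_eq.
have sb0 : `|s - b| = b - s by rewrite distrC ger0_norm ?subr_ge0.
rewrite normrN sb0.
have hx r : s <= r -> r < b -> `|x r - x s| <= e * (b - s).
  move=> sr rb; apply: (@le_trans _ _ (e * (r - s))); last first.
    by rewrite (ler_wpM2l (ltW e0))//; lra.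
  apply: (@mean_value_inequality _ _ x (fun q => G q (w q) - c)) => // q /andP[sq qr].
    have Iq : `[a, b[%classic q by rewrite /= in_itv /= (le_trans as_)// (le_lt_trans qr).
    have qI : `[s, r]%classic q by apply/in_itvccP; rewrite sq.
    apply: (@eq_deriv_within _ _ _ (fun p => w p - ((p - b) *: c)) _ _ _ qI).
      by move=> p /in_itvccP/andP[_ pr]; rewrite /x wbE// (le_lt_trans pr).
    apply: deriv_withinB; first by apply: deriv_within_subset (wd q Iq); exact: sub.
    move=> e' e'0; apply: nearW => p.
    have -> : (p - b) *: c - (q - b) *: c - (p - q) *: c = 0 by lincomb_eq.
    by rewrite normr0 mulr_ge0// ltW.
  have qb : q < b by exact: le_lt_trans qr rb.
  rewrite -(wbE q qb); apply: hd.
    by apply/in_itvccP; rewrite (le_trans as_)//= ltW.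
  by rewrite distrC ger0_norm; lra.
apply/ler_addgt0Pl => e' e'0.
have /cvgr_normP/(_ _ (divr_gt0 e'0 (ltr0n R 2)))/near_withinP[d' d'0 hd'] := wb_cvg.
have c1 : 0 < `|c| + 1 by rewrite ltr_wpDl.
(* So close to b that |wb r - wb b| and (b - r) |c| are both at most e' / 2. *)
pose r := Order.max s (b - Order.min (d' / 2) (e' / 2 / (`|c| + 1))).
have m0 : 0 < Order.min (d' / 2) (e' / 2 / (`|c| + 1)) by rewrite lt_min !divr_gt0.
have m1 : Order.min (d' / 2) (e' / 2 / (`|c| + 1)) <= d' / 2 by rewrite ge_min lexx.
have m2 : Order.min (d' / 2) (e' / 2 / (`|c| + 1)) <= e' / 2 / (`|c| + 1) by rewrite ge_min lexx orbT.
have sr : s <= r by rewrite le_max lexx.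
have rb : r < b by rewrite gt_max sb' gtrBl.
have rm : b - r <= Order.min (d' / 2) (e' / 2 / (`|c| + 1)).
  by rewrite lerBlDr -lerBlDl le_max lexx orbT.
rewrite -(subrKA (x r)) (le_trans (ler_normD _ _))// lerD//; last exact: hx.
have h1 : `|wb r - wb b| <= e' / 2.
  apply: hd'; first by apply/in_itvccP; rewrite (le_trans as_)//= ltW.
  by rewrite distrC ger0_norm; lra.
have -> : x b - x r = - ((wb r - wb b) + (b - r) *: c) by rewrite /x; lincomb_eq.
rewrite normrN (le_trans (ler_normD _ _))// [leRHS]splitr lerD// normrZ ger0_norm; last by lra.
rewrite (@le_trans _ _ ((b - r) * (`|c| + 1)))//.
  by rewrite ler_wpM2l//; lra.
by rewrite -ler_pdivlMr// (le_trans rm).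
Qed.

(** The a priori bound concerns the slopes and not w: in infinite dimensions a continuous G may be
    unbounded on bounded sets, so a bound on w alone would not give a limit at the end of the
    interval. The supremum of the existence times is attained by [ode_sol_closure] and passed by
    [ode_local]. *)
Lemma ode_global (t0 : R) (w0 : Y) : T0 <= t0 ->
  (forall T w, t0 < T -> w t0 = w0 -> ode_sol G `[t0, T[ w ->
     exists C, forall t, t0 <= t < T -> `|G t (w t)| <= C) ->
  exists2 w, w t0 = w0 & ode_sol G `[t0, +oo[ w.
Proof.
move=> Tt0 apriori.
pose S := [set T | t0 <= T /\ exists2 w, w t0 = w0 & ode_sol G `[t0, T] w].
have S0 : S t0.
  split=> //; exists (fun=> w0) => // t /in_itvccP/andP[t0t tt0].
  have -> : t = t0 by apply/eqP; rewrite eq_le tt0.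
  move=> e e0; apply: filterS (near_within_self _ _) => s /in_itvccP/andP[t0s st0].
  have -> : s = t0 by apply/eqP; rewrite eq_le st0.
  by rewrite !subrr scale0r subrr !normr0 mulr0.
have Sdown T T' : S T -> t0 <= T' -> T' <= T -> S T'.
  move=> [_ [w w1 wd]] t0T T'T; split=> //; exists w => //.
  by apply: ode_sol_subset wd; exact: itvcc_sub.
have exg T : exists w : R -> Y, S T -> w t0 = w0 /\ ode_sol G `[t0, T] w.
  have [[_ [w w1 wd]]|] := pselect (S T); first by exists w.
  by exists (fun=> 0).
have [g gP] := choice exg.
have gE T T' t : S T -> S T' -> t0 <= t -> t <= T -> t <= T' -> g T t = g T' t.
  move=> ST ST' t0t tT tT'.
  have [g1 gd] := gP T ST; have [g1' gd'] := gP T' ST'.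
  apply: (@ode_sol_unique t0 t) => //; last by rewrite t0t lexx.
  - by apply: ode_sol_subset gd; exact: itvcc_sub.
  - by apply: ode_sol_subset gd'; exact: itvcc_sub.
  - by rewrite g1.
(* The solutions [g T] chosen for the various T agree by uniqueness; reading at t the one for a time
   [sg t] beyond t gives a single solution on J. *)
have glue (J : set R) (sg : R -> R) : J `<=` [set t | t0 <= t] ->
    (forall t, J t -> S (sg t) /\ t < sg t) -> ode_sol G J (fun t => g (sg t) t).
  move=> Jt0 sgP t Jt e e0; have [St tlt] := sgP t Jt.
  have [_ gd] := gP _ St.
  have It : `[t0, sg t]%classic t by apply/in_itvccP; rewrite (ltW tlt) andbT; exact: Jt0.
  have /near_withinP[d d0 hd] := gd t It e e0.
  apply/near_withinP; exists (Order.min d (sg t - t)); first by rewrite lt_min d0 subr_gt0.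
  move=> s Js; rewrite lt_min => /andP[sd st].
  have st' : s <= sg t by have := ler_norm (s - t); lra.
  have [Ss slt] := sgP s Js.
  rewrite (@gE (sg s) (sg t) s) ?(ltW slt)//; last exact: Jt0.
  by apply: hd => //; apply/in_itvccP; rewrite st' andbT; exact: Jt0.
suff all_S T : t0 <= T -> S T.
  exists (fun t => g (t + 1) t).
    by have [] := gP (t0 + 1) (all_S _ _); rewrite // lerDl.
  apply: glue => [t|t]; rewrite /= in_itv /= andbT// => t0t.
  by split; [apply: all_S; rewrite ler_wpDr|rewrite ltrDl].
move=> t0T; apply: contrapT => nST.
have ubS : ubound S T.
  move=> s [t0s Ss]; rewrite leNgt; apply/negP => Ts; apply: nST.
  by apply: (Sdown s) => //; exact: ltW.
have hS : has_sup S by split; [exists t0|exists T].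
pose b := sup S.
have t0b : t0 <= b by apply: ub_le_sup => //; exists T.
have Sb : S b.
  have [->//|nb] := eqVneq b t0.
  have {}t0b : t0 < b by rewrite lt_neqAle eq_sym nb.
  have exs t : exists s : R, t0 <= t < b -> S s /\ t < s.
    have [/andP[t0t tb]|_] := boolP (t0 <= t < b); last by exists 0.
    have [|s Ss ts] := @sup_adherent _ S (b - t) _ hS; first by rewrite subr_gt0.
    by exists s => _; split=> //; move: ts; rewrite -/b subKr.
  have [sg sgP] := choice exs.
  have wd : ode_sol G `[t0, b[ (fun t => g (sg t) t).
    apply: glue => t; rewrite /= in_itv /= => /andP[t0t tb] //.
    by apply: sgP; rewrite t0t.
  have [|St0 _] := sgP t0; first by rewrite lexx.
  have w1 : g (sg t0) t0 = w0 by have [] := gP _ St0.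
  have [C hC] := apriori _ _ t0b w1 wd.
  have [l ld] := ode_sol_closure Tt0 t0b wd hC.
  by split; [exact: ltW|exists (fun t => if t < b then g (sg t) t else l); rewrite ?t0b].
have [_ [w w1 wd]] := Sb.
have [h h0 [w' w'b w'd]] := ode_local Gc Gl (w b) (le_trans Tt0 t0b).
have : S (b + h).
  split; first by rewrite (le_trans t0b)// lerDl ltW.
  exists (fun t => if t <= b then w t else w' t); first by rewrite t0b.
  by apply: ode_sol_glue => //; rewrite lerDl ltW.
move/(ub_le_sup (ex_intro _ T ubS)); rewrite -/b.
by rewrite gerDl leNgt h0.
Qed.

End GlobalODE.

(** * Growth of Lyapunov functions *)

Section RealPrimitives.
Context {R : realType}.
Implicit Types (a b t : R) (F H h : R -> R^o).

Lemma deriv_within_interior H a b t (d : R) : a < t < b ->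
  deriv_within `[a, b] H t d -> (fun k : R => k^-1 *: (H (k + t) - H t)) @ 0^' --> d.
Proof.
move=> /andP[at_ tb] Hd; apply/cvgr_normP => e e0.
have /near_withinP[r r0 hr] := Hd e e0.
apply/near_withinP; exists (Order.min r (Order.min (t - a) (b - t))).
  by rewrite !lt_min r0 !subr_gt0 at_.
move=> s s0; rewrite subr0 !lt_min => /andP[sr /andP[sa sb]].
have hs := ler_norm s; have hs' := ler_norm (- s); rewrite normrN in hs'.
have := hr (s + t); rewrite addrK => /(_ _ sr) h.
have -> : s^-1 *: (H (s + t) - H t) - d = s^-1 * (H (s + t) - H t - s *: d).
  by rewrite /GRing.scale /= [RHS]mulrBr mulKf.
rewrite normrM normfV ler_pdivrMl ?normr_gt0// mulrC; apply: h.
by apply/in_itvccP; apply/andP; split; lra.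
Qed.

Lemma integral_deriv_within H h a b : a < b ->
  (forall t, a <= t <= b -> h @ within `[a, b] (nbhs t) --> h t) ->
  (forall t, a <= t <= b -> deriv_within `[a, b] H t (h t)) ->
  (\int[lebesgue_measure]_(x in `[a, b]) (h x)%:E = (H b - H a)%:E)%E.
Proof.
move=> ab hc Hd; rewrite EFinB; apply: continuous_FTC2 => //.
- by apply/subspace_continuousP => t /in_itvccP; exact: hc.
- have Hc : {within `[a, b], continuous H}.
    by apply/subspace_continuousP => t /in_itvccP tab; apply: deriv_within_cvg (Hd t tab).
  have [_ Ha Hb] := (continuous_within_itvP H ab).1 Hc.
  split=> // t; rewrite in_itv /= => tab; apply/cvg_ex; exists (h t).
  have := deriv_within_interior tab (Hd t _).
  have /andP[/ltW -> /ltW ->] := tab => /(_ isT).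
  rewrite /derivable /=; apply: cvg_trans; apply: near_eq_cvg; apply: nearW => s.
  by rewrite /GRing.scale /= mulr1.
- move=> t; rewrite in_itv /= => tab; rewrite derive1E.
  apply: cvg_lim => //; have /andP[/ltW at_ /ltW tb] := tab.
  have := deriv_within_interior tab (Hd t _); rewrite at_ tb => /(_ isT).
  apply: cvg_trans; apply: near_eq_cvg; apply: nearW => s.
  by rewrite /GRing.scale /= mulr1.
Qed.

Lemma deriv_within_strict_mono H h a b : a <= b ->
  (forall t, a <= t <= b -> deriv_within `[a, b] H t (h t)) ->
  (forall t, a <= t <= b -> 0 < h t) ->
  forall u v, a <= u -> u < v -> v <= b -> H u < H v.
Proof.
move=> ab Hd h0 u v au uv vb.
(* [cousin] also visits degenerate intervals, whence the alternative u = v. *)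
suff : (u == v) || (H u < H v) by rewrite (lt_eqF uv).
have sub : `[u, v] `<=` `[a, b].
  by move=> s /in_itvccP/andP[? ?]; apply/in_itvccP; rewrite (le_trans au)// (le_trans _ vb).
apply: (@cousin _ u v (fun u v => (u == v) || (H u < H v))) => [|p q r _ pq qr _|t tuv].
- exact: ltW.
- move=> /orP[/eqP->//|Hpq] /orP[/eqP<-|Hqr]; first by rewrite Hpq orbT.
  by rewrite (lt_trans Hpq Hqr) orbT.
have tab : a <= t <= b by apply/in_itvccP/sub/in_itvccP.
have h2 : 0 < h t / 2 by rewrite divr_gt0 ?h0.
have /near_withinP[d d0 hd] := Hd t tab _ h2.
exists d => // p q up pt tq qv qpd; pose h0t : R := h t.
have Hq : t < q -> H t < H q.
  move=> tq'; have qI : `[a, b]%classic q.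
    by apply/sub/in_itvccP; rewrite qv (le_trans up)// (le_trans pt).
  have qt : `|q - t| = q - t by rewrite gtr0_norm ?subr_gt0.
  have := hd q qI; rewrite qt /GRing.scale /= ler_norml => /(_ _)/andP[|k _].
    by lra.
  have : 0 < (q - t) * h0t by rewrite mulr_gt0 ?subr_gt0 ?h0.
  by rewrite /h0t in k *; lra.
have Hp : p < t -> H p < H t.
  move=> pt'; have pI : `[a, b]%classic p.
    by apply/sub/in_itvccP; rewrite up (le_trans pt)// (le_trans tq).
  have pt0 : `|p - t| = t - p by rewrite distrC gtr0_norm ?subr_gt0.
  have := hd p pI; rewrite pt0 /GRing.scale /= ler_norml => /(_ _)/andP[|_ k].
    by lra.
  have : 0 < (t - p) * h0t by rewrite mulr_gt0 ?subr_gt0 ?h0.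
  by rewrite /h0t in k *; lra.
move: pt tq; rewrite !le_eqVlt => /orP[/eqP->|/Hp pt] /orP[/eqP<-|/Hq tq].
- by rewrite eqxx.
- by rewrite tq orbT.
- by rewrite pt orbT.
- by rewrite (lt_trans pt tq) orbT.
Qed.

Lemma deriv_within_comp (J I : set R) (H v : R -> R^o) t (d c : R) :
  (forall s, I s -> J (v s)) ->
  deriv_within J H (v t) d -> deriv_within I v t c ->
  deriv_within I (H \o v) t (d * c).
Proof.
move=> IJ Hd vd e e0.
have K0 : 0 < `|c| + 1 by rewrite ltr_wpDl.
have D0 : 0 < `|d| + 1 by rewrite ltr_wpDl.
have e1 : 0 < e / 2 / (`|c| + 1) by rewrite !divr_gt0.
have e2 : 0 < e / 2 / (`|d| + 1) by rewrite !divr_gt0.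
have /near_withinP[r r0 hr] := Hd _ e1.
have h1 : \forall s \near within I (nbhs t), `|v s - v t| <= (`|c| + 1) * `|s - t|.
  by apply: deriv_within_lip vd _; rewrite ltrDl.
have h2 := vd _ e2.
have h3 := near_within_ball I t (divr_gt0 r0 K0).
apply: filterS2 (filterI h1 h2) (filterI h3 (near_within_self I t)) => s /= [{}h1 {}h2] [{}h3 Is].
have h4 : `|v s - v t| < r.
  by rewrite (le_lt_trans h1)// mulrC -ltr_pdivlMr.
have := hr (v s) (IJ _ Is) h4; rewrite /GRing.scale /= => h5.
have -> : H (v s) - H (v t) - (s - t) * (d * c) =
  (H (v s) - H (v t) - (v s - v t) * d) + d * (v s - v t - (s - t) * c) by ring.
rewrite (le_trans (ler_normD _ _))// (_ : e * `|s - t| = e / 2 * `|s - t| + e / 2 * `|s - t|); last by field.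
apply: lerD.
  rewrite (le_trans h5)// (le_trans (ler_wpM2l (ltW e1) h1))//.
  by rewrite mulrA divfK ?lt0r_neq0.
rewrite normrM (le_trans (ler_wpM2l (normr_ge0 d) h2))//.
rewrite mulrA ler_wpM2r// mulrCA ler_piMr ?divr_ge0// ?ltW//.
by rewrite ltr_pdivrMr// mul1r ltrDl.
Qed.

End RealPrimitives.

(** * Growth of a maximum of differentiable functions *)

Section MaximumGrowth.
Context {R : realType}.
Local Notation mu := (@lebesgue_measure R).
Variables (m : nat) (a b : R) (y dy : 'I_m -> R -> R^o) (ymax : R -> R^o) (psi : R -> R).
Hypothesis ab : a < b.
Hypothesis yd : forall j t, a <= t <= b -> deriv_within `[a, b] (y j) t (dy j t).
Hypothesis dyc : forall j t, a <= t <= b -> dy j @ within `[a, b] (nbhs t) --> dy j t.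
Hypothesis y_le : forall j t, a <= t <= b -> y j t <= ymax t.
Hypothesis y_eq : forall t, a <= t <= b -> exists j, y j t = ymax t.

Lemma max_cvg t : a <= t <= b -> ymax @ within `[a, b] (nbhs t) --> ymax t.
Proof.
move=> tab; apply/cvgr_normP => e e0.
have h : \forall s \near within `[a, b] (nbhs t), forall j, `|y j s - y j t| <= e.
  apply: filter_forall => j.
  by have /cvgr_normP/(_ e e0) := deriv_within_cvg (@yd j _ tab).
apply: filterS2 (near_within_self _ t) h => s /in_itvccP sab h.
have [i yi] := y_eq sab; have [j yj] := y_eq tab.
have := h i; have := h j; rewrite !ler_norml => /andP[hj _] /andP[_ hi].
by apply/andP; split; have := @y_le i _ tab; have := @y_le j _ sab; lra.
Qed.

(* The weights tend to 1 at the indices where y j is maximal and to 0 at the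
   others, so that in the limit only derivatives of maximal y j contribute. *)
Let g (n : nat) (t : R) : R^o :=
  \sum_(j < m) Num.max (dy j t) 0 / (1 + n%:R * (ymax t - y j t)).

Let g_den n j t : a <= t <= b -> 1 <= 1 + n%:R * (ymax t - y j t).
Proof. by move=> tab; rewrite lerDl mulr_ge0// subr_ge0 y_le. Qed.

Let max_cvg0 j t : a <= t <= b ->
  (fun s => Num.max (dy j s) 0 : R^o) @ within `[a, b] (nbhs t) --> (Num.max (dy j t) 0 : R^o).
Proof.
move=> tab; apply/cvgr_normP => e e0; have /cvgr_normP/(_ e e0) := @dyc j _ tab.
apply: filterS => s; rewrite !ler_norml /Num.max => /andP[? ?].
by apply/andP; split; case: ltP => ?; case: ltP => ?; lra.
Qed.

Let gc n t : a <= t <= b -> g n @ within `[a, b] (nbhs t) --> g n t.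
Proof.
move=> tab; apply: cvg_sumr => j; apply: cvgM; first exact: max_cvg0.
apply: cvgV; first by rewrite lt0r_neq0// (lt_le_trans ltr01)// g_den.
apply: cvgD; first exact: cvg_cst.
apply: cvgM; first exact: cvg_cst.
by apply: cvgB; [exact: max_cvg|exact: deriv_within_cvg (@yd j _ tab)].
Qed.

Let g_ge0 n t : a <= t <= b -> 0 <= g n t.
Proof.
move=> tab; apply: sumr_ge0 => j _; rewrite divr_ge0// ?le_max ?lexx ?orbT//.
by rewrite (le_trans ler01)// g_den.
Qed.

Let g_le0 n t : a <= t <= b -> g n t <= g 0%N t.
Proof.
move=> tab; apply: ler_sum => j _; rewrite mul0r addr0 divr1 ler_piMr//.
  by rewrite le_max lexx orbT.
by rewrite invf_le1 ?g_den// (lt_le_trans ltr01)// g_den.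
Qed.

(** With H a primitive of [g n], increments of ymax are compared with those of H by [cousin]. To the
    left of the tag t an index maximal at t is used, to the right an index maximal at the endpoint;
    on a short interval the latter is already maximal at t, because a strict gap at t persists
    nearby. Maximal indices have weight 1 and no term is negative, so [g n t] dominates their
    derivatives. *)
Let growth_le n : ((ymax b - ymax a)%:E <= \int[mu]_(t in `[a, b]) (g n t)%:E)%E.
Proof.
have [|t tab|H [_ Hd]] := @primitive_exists R R^o (g n) a b; first exact: ltW.
  exact: gc.
rewrite (integral_deriv_within ab (@gc n) Hd) lee_fin.
apply/ler_addgt0Pl => e e0; have ab0 : 0 < b - a by rewrite subr_gt0.
rewrite -[e](divfK (lt0r_neq0 ab0)); have {}e0 : 0 < e / (b - a) by rewrite divr_gt0.
move: (e / (b - a)) e0 => {}e e0.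
pose P u v := ymax v - ymax u <= e * (v - u) + (H v - H u).
apply: (@cousin _ a b P (ltW ab)) => [u v w _ uv vw _|t tab].
  by rewrite /P => h h'; rewrite mulrBr in h h' *; lra.
have e2 : 0 < e / 2 by rewrite divr_gt0.
have h1 : \forall s \near within `[a, b] (nbhs t), forall j,
    `|y j s - y j t - (s - t) *: dy j t| <= e / 2 * `|s - t|.
  by apply: filter_forall => j; exact: yd.
have h2 : \forall s \near within `[a, b] (nbhs t), forall j,
    y j t < ymax t -> y j s < ymax s.
  apply: filter_forall => j; have [yt|] := ltP (y j t) (ymax t); last first.
    by move=> ?; apply: nearW.
  have d0 : 0 < (ymax t - y j t) / 3 by rewrite divr_gt0 ?subr_gt0.
  have /cvgr_normP/(_ _ d0) h := max_cvg tab.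
  have /cvgr_normP/(_ _ d0) := deriv_within_cvg (@yd j _ tab).
  apply: filterS2 h => s; rewrite !ler_norml => /andP[? ?] /andP[? ?] _.
  by lra.
have : \forall s \near within `[a, b] (nbhs t),
    ((forall j, `|y j s - y j t - (s - t) *: dy j t| <= e / 2 * `|s - t|) /\
     (forall j, y j t < ymax t -> y j s < ymax s)) /\
    `|H s - H t - (s - t) *: g n t| <= e / 2 * `|s - t|.
  exact: filterI (filterI h1 h2) (Hd t tab _ e2).
move=> /near_withinP[d d0 hd].
exists d => // u v au ut tv vb uvd.
have [i yi] := y_eq tab.
have gdy j : y j t = ymax t -> dy j t <= g n t.
  move=> yj; rewrite /g (bigD1 j)//= yj subrr mulr0 addr0 divr1.
  rewrite (le_trans (_ : _ <= Num.max (dy j t) 0)) ?le_max ?lexx//.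
  rewrite lerDl sumr_ge0// => k _; rewrite divr_ge0// ?le_max ?lexx ?orbT//.
  by rewrite (le_trans ler01)// g_den.
have left : P u t.
  have uab : a <= u <= b by rewrite au (le_trans ut)// (le_trans tv).
  have [||/= [k1 _] k2] := hd u; first exact/in_itvccP.
    by rewrite distrC ger0_norm ?subr_ge0//; lra.
  move: k2 (k1 i); rewrite (distrC u t) (ger0_norm (_ : 0 <= t - u)) ?subr_ge0//.
  rewrite !ler_norml /GRing.scale /= => /andP[k3 k4] /andP[k5 k6].
  have := gdy i yi; have := @y_le i _ uab; rewrite /P => k7 k8.
  have : (t - u) * dy i t <= (t - u) * g n t by rewrite ler_wpM2l ?subr_ge0.
  by rewrite mulrBr; rewrite mulrBr in k3 k4 k5 k6; lra.
have right : P t v.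
  have vab : a <= v <= b by rewrite vb andbT (le_trans au)// (le_trans ut).
  have [||/= [k1 k1'] k2] := hd v; first exact/in_itvccP.
    by rewrite ger0_norm ?subr_ge0//; lra.
  have [j yj] := y_eq vab.
  have yjt : y j t = ymax t.
    apply/eqP; rewrite eq_le y_le//= leNgt; apply/negP => /k1'.
    by rewrite yj ltxx.
  move: k2 (k1 j); rewrite (ger0_norm (_ : 0 <= v - t)) ?subr_ge0//.
  rewrite !ler_norml /GRing.scale /= => /andP[k3 k4] /andP[k5 k6].
  have := gdy j yjt; rewrite /P => k8.
  have : (v - t) * dy j t <= (v - t) * g n t by rewrite ler_wpM2l ?subr_ge0.
  by rewrite mulrBr; rewrite mulrBr in k3 k4 k5 k6; lra.
by move: left right; rewrite /P !mulrBr; lra.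
Qed.

Hypothesis psi0 : forall t, a <= t <= b -> 0 <= psi t.
Hypothesis psi_int : mu.-integrable `[a, b] (EFin \o psi).
Hypothesis dy_psi : forall j t, a <= t <= b -> y j t = ymax t -> dy j t <= psi t.

Let g_psi t : a <= t <= b -> forall e : R, 0 < e ->
  \forall n \near \oo, g n t <= m%:R * psi t + e.
Proof.
move=> tab e e0; have m1 : 0 < m%:R + 1 :> R by rewrite ltr_wpDl.
have : \forall n \near \oo, forall j : 'I_m,
    Num.max (dy j t) 0 / (1 + n%:R * (ymax t - y j t)) <= psi t + e / (m%:R + 1).
  apply: filter_forall => j.
  have [yj|yj|yj] := ltrgtP (y j t) (ymax t); last first.
  - apply: nearW => n; rewrite yj subrr mulr0 addr0 divr1 ler_wpDr//.
      by rewrite divr_ge0 ?ltW.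
    by rewrite ge_max dy_psi//= psi0.
  - by have := @y_le j _ tab; rewrite leNgt yj.
  - have k0 : 0 < (ymax t - y j t) * (e / (m%:R + 1)).
      by rewrite mulr_gt0 ?subr_gt0// divr_gt0.
    exists (Num.bound (Num.max (dy j t) 0 / ((ymax t - y j t) * (e / (m%:R + 1))))) => // n /= nk.
    rewrite ler_pdivrMr; last by rewrite (lt_le_trans ltr01)// g_den.
    apply: (@le_trans _ _ ((e / (m%:R + 1)) * (n%:R * (ymax t - y j t)))).
      have -> : e / (m%:R + 1) * (n%:R * (ymax t - y j t)) =
        n%:R * ((ymax t - y j t) * (e / (m%:R + 1))) by rewrite mulrC -mulrA.
      rewrite -ler_pdivrMr//.
      have : (Num.bound (Num.max (dy j t) 0 / ((ymax t - y j t) * (e / (m%:R + 1)))))%:R <= n%:R :> R.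
        by rewrite ler_nat.
      apply: le_trans; rewrite ltW// archi_boundP// divr_ge0 ?(ltW k0)//.
      by rewrite le_max lexx orbT.
    have e1 : 0 <= e / (m%:R + 1) by rewrite divr_ge0 ?ltW.
    have nz : 0 <= n%:R * (ymax t - y j t) by rewrite mulr_ge0// subr_ge0 ltW.
    by apply: ler_pM => //; [rewrite lerDr psi0|rewrite lerDr].
apply: filterS => n h; rewrite (le_trans (ler_sum _ (fun j _ => h j)))//.
rewrite sumr_const card_ord -[leLHS]mulr_natl mulrDr lerD2l mulrCA ler_piMr ?ltW//.
by rewrite ltr_pdivrMr// mul1r ltrDl.
Qed.

(** The factor m accounts for several indices being maximal at once. It is harmless, as only
    finiteness of the right-hand side matters later. *)
Lemma max_growth : ((ymax b - ymax a)%:E <= m%:R%:E * \int[mu]_(t in `[a, b]) (psi t)%:E)%E.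
Proof.
have mI : measurable (`[a, b]%classic : set (measurableTypeR R)) by exact: measurable_itv.
have g_int n : mu.-integrable `[a, b] (EFin \o g n).
  apply: continuous_compact_integrable; first exact: segment_compact.
  by apply/subspace_continuousP => t /in_itvccP; exact: gc.
have g_meas n := measurable_int _ (g_int n).
have mpsi_int : mu.-integrable `[a, b] (fun t => m%:R%:E * (psi t)%:E)%E.
  exact: integrableZl.
have mpsi_meas := measurable_int _ mpsi_int.
(* For large n, [g n t] is only known to lie below m psi t + e, with no matching lower bound; its
   maximum with m psi t does converge, which allows dominated convergence. *)
pose G n t : \bar R := maxe (g n t)%:E (m%:R%:E * (psi t)%:E)%E.
have G_meas n := measurable_maxe (g_meas n) mpsi_meas.
have dom_int : mu.-integrable `[a, b] (fun t => (g 0%N t)%:E + m%:R%:E * (psi t)%:E)%E.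
  by apply: integrableD => //; exact: g_int.
have G_dom n t : `[a, b]%classic t -> (`|G n t| <= (g 0%N t)%:E + m%:R%:E * (psi t)%:E)%E.
  move=> /in_itvccP tab; rewrite /G -EFinM -EFin_max abse_EFin -EFinD lee_fin.
  have mp : 0 <= m%:R * psi t by rewrite mulr_ge0// psi0.
  have g0 := g_ge0 0 tab; have gn := g_ge0 n tab; have gn0 := g_le0 n tab.
  by rewrite ger0_norm ?le_max ?gn// ge_max; apply/andP; split; lra.
have G_cvg t : `[a, b]%classic t -> G ^~ t @ \oo --> (m%:R%:E * (psi t)%:E)%E.
  move=> /in_itvccP tab; rewrite /G -EFinM; apply: cvg_EFin; first by apply: nearW => n; rewrite -EFin_max.
  apply/(@cvgr_normP R _ _ R^o) => e e0; apply: filterS (g_psi tab e0) => n /= h.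
  rewrite -EFin_max /= ger0_norm ?subr_ge0 ?le_max ?lexx ?orbT//.
  by rewrite lerBlDl ge_max h/= lerDl ltW.
rewrite -(integralZl mI psi_int).
have GI : (fun n => \int[mu]_(t in `[a, b]) G n t)%E @ \oo -->
    (\int[mu]_(t in `[a, b]) (m%:R%:E * (psi t)%:E))%E.
  apply: (dominated_cvg mI _ G_cvg _ dom_int G_dom) => //.
rewrite -(cvg_lim (@ereal_hausdorff R) GI); apply: lime_ge.
  by apply/cvg_ex; exists (\int[mu]_(t in `[a, b]) (m%:R%:E * (psi t)%:E))%E.
apply: nearW => n.
apply: le_trans (growth_le n) _; apply: ge0_le_integral => //.
- by move=> t /in_itvccP tab; rewrite lee_fin g_ge0.
- exact: g_meas.
- exact: G_meas.
- by move=> t _; rewrite /G le_max lexx.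
Qed.

End MaximumGrowth.

(** * Divergence of the integral of 1/U *)

Section Escape.
Context {R : realType}.
Local Notation mu := (@lebesgue_measure R).
Variables (U : R -> R).
Hypothesis Uc : {within Rplus R, continuous U}.
Hypothesis U0 : forall u : R, 0 <= u -> 0 <= U u.
Hypothesis U_div : forall u0 : R, 0 < u0 ->
  (\int[mu]_(u in `[u0, +oo[) ((U u)%:E^-1) = +oo)%E.

(** U may vanish, so 1/U is approximated by continuous functions that increase to it as e decreases
    to 0; the absolute value extends U from the half-line to all reals. *)
Let h (e : R) (u : R) : R^o := (U (`|u| : R) + e)^-1.

Let h_den (e u : R) : 0 < e -> 0 < U (`|u| : R) + e.
Proof. by move=> e0; rewrite ltr_wpDl// U0. Qed.

Lemma inv_shift_gt0 e u : 0 < e -> 0 < h e u.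
Proof. by move=> e0; rewrite invr_gt0 h_den. Qed.

Lemma inv_shift_cvg e (J : set R) (u : R) : 0 < e -> h e @ within J (nbhs u) --> h e u.
Proof.
move=> e0; apply: cvgV; first by rewrite lt0r_neq0// h_den.
apply: cvgD; last exact: cvg_cst.
apply/(@cvgr_normP R _ _ R^o) => d d0.
have /(@subspace_continuousP _ _ _ U)/(_ `|u|) := Uc.
rewrite /Rplus /= => /(_ (normr_ge0 _))/(@cvgr_normP R _ _ R^o)/(_ d d0).
move=> /(@near_withinP R R^o)[r r0 hr]; apply/near_withinP; exists r => // s _ su.
by apply: hr => //=; rewrite (le_lt_trans (ler_dist_dist _ _)).
Qed.

(** Monotone convergence along e = 1/(n+1) and the intervals [u0, u0 + n + 1] transfers the
    divergence of the integral of 1/U. *)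
Lemma inv_integral_large (u0 K : R) : 0 < u0 -> exists e c : R,
  [/\ 0 < e, u0 < c & (K%:E < \int[mu]_(u in `[u0, c]) (h e u)%:E)%E].
Proof.
move=> u00; pose e n : R := n.+1%:R^-1; have e0 n : 0 < e n by rewrite invr_gt0.
pose c n : R := u0 + n.+1%:R.
have mD : measurable (`[u0, +oo[%classic : set (measurableTypeR R)) by exact: measurable_itv.
have mI n : measurable (`[u0, c n]%classic : set (measurableTypeR R)) by exact: measurable_itv.
have hint n : mu.-integrable `[u0, c n] (EFin \o h (e n)).
  apply: continuous_compact_integrable; first exact: segment_compact.
  by apply/subspace_continuousP => t _; exact: inv_shift_cvg.
pose g n : measurableTypeR R -> \bar R := (EFin \o h (e n)) \_ `[u0, c n].
have gm n : measurable_fun (`[u0, +oo[%classic : set (measurableTypeR R)) (g n).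
  apply/measurable_restrict => //.
  rewrite (_ : _ `&` _ = `[u0, c n]%classic); first exact: measurable_int (hint n).
  apply/seteqP; split => x /=; rewrite !in_itv /=; first by case.
  by move=> /andP[-> ->].
have g0 n x : `[u0, +oo[%classic x -> (0 <= g n x)%E.
  by move=> _; rewrite /g patchE; case: ifP => // _; rewrite lee_fin ltW ?inv_shift_gt0.
have ghomo x : `[u0, +oo[%classic x -> {homo g ^~ x : n k / (n <= k)%N >-> (n <= k)%E}.
  move=> /= xD n k nk; rewrite /g !patchE; case: ifPn => [|_]; last first.
    by case: ifP => // _; rewrite lee_fin ltW ?inv_shift_gt0.
  rewrite inE /= in_itv /= => /andP[u0x xn]; rewrite mem_set; last first.
    by rewrite /= in_itv /= u0x (le_trans xn)// lerD2l ler_nat.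
  rewrite /= lee_fin /h lef_pV2 ?posrE ?h_den// lerD2l /e lef_pV2 ?posrE//.
  by rewrite ler_nat.
have gcvg x : `[u0, +oo[%classic x -> limn (g ^~ x) = ((U x)%:E^-1)%E.
  rewrite /= in_itv /= andbT => u0x; apply: cvg_lim => //.
  have x0 : 0 <= x by rewrite (le_trans _ u0x)// ltW.
  have cx : \forall n \near \oo, g n x = (h (e n) x)%:E.
    exists (Num.bound x) => // n /= xn; rewrite /g patchE mem_set//= in_itv /= u0x /=.
    rewrite /c (@le_trans _ _ n%:R)//.
      by rewrite (le_trans (ltW (archi_boundP x0)))// ler_nat.
    by rewrite -natr1 -[leLHS]add0r lerD// ?lerDl// ltW.
  have e_small d : 0 < d -> \forall n \near \oo, e n <= d.
    move=> d0; exists (Num.bound d^-1) => // n /= dn.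
    rewrite /e invf_ple ?posrE// (le_trans (ltW (archi_boundP _)))//.
      by rewrite invr_ge0 ltW.
    by rewrite ler_nat (leq_trans dn).
  (* At a zero of U the inverse in the extended reals is +oo, and [h (e n) x] = n + 1 tends to
     it. *)
  have [Ux|Ux] := eqVneq (U x) 0.
    rewrite Ux inver eqxx; apply/cvgeyPge => A.
    have A0 : 0 < `|A| + 1 by rewrite ltr_wpDl.
    have := e_small _ (_ : 0 < (`|A| + 1)^-1); rewrite invr_gt0 => /(_ A0).
    apply: filterS2 cx => n -> en; rewrite lee_fin /h ger0_norm// Ux add0r.
    rewrite (@le_trans _ _ (`|A| + 1))// ?(le_trans (ler_norm A))// ?lerDl//.
    by rewrite -[leLHS]invrK lef_pV2 ?posrE// invr_gt0.
  rewrite inver (negbTE Ux).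
  have Ux0 : 0 < U x by rewrite lt_neqAle eq_sym Ux U0.
  apply: (@cvg_trans _ ((fun n => (h (e n) x)%:E) @ \oo)).
    by apply: near_eq_cvg; apply: filterS cx => n ->.
  apply: cvg_EFin; first exact: nearW.
  rewrite (_ : fine \o _ = fun n => h (e n) x)//.
  rewrite /h ger0_norm//; apply: cvgV => //.
  rewrite -[X in _ --> X]addr0; apply: cvgD; first exact: cvg_cst.
  apply/(@cvgr_normP R _ _ R^o) => d d0; apply: filterS (e_small d d0) => n.
  by rewrite subr0 ger0_norm// ltW.
have E : (\int[mu]_(u in `[u0, +oo[) limn (g ^~ u) = +oo)%E.
  by rewrite -(U_div u00); apply: eq_integral => x; rewrite inE => /gcvg.
have MC : (fun n => \int[mu]_(u in `[u0, +oo[) g n u)%E @ \oo -->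
  (\int[mu]_(u in `[u0, +oo[) limn (g ^~ u))%E := cvg_monotone_convergence mD gm g0 ghomo.
move: MC; rewrite E => /cvgeyPge/(_ (K + 1))[n _ /(_ n (leqnn _))] /= hn.
exists (e n), (c n); split=> //; first by rewrite ltrDl.
rewrite (lt_le_trans (_ : _ < (K + 1)%:E)%E) ?lte_fin ?ltrDl//.
rewrite (le_trans hn)// /g -integral_mkcondr (_ : _ `&` _ = `[u0, c n]%classic)//.
apply/seteqP; split => x /=; rewrite !in_itv /=; first by case.
by move=> /andP[-> ->].
Qed.

End Escape.

Section Lyapunov.
Context {R : realType}.
Local Notation mu := (@lebesgue_measure R).
Variables (U psi : R -> R).
Hypothesis Uc : {within Rplus R, continuous U}.
Hypothesis U0 : forall u : R, 0 <= u -> 0 <= U u.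
Hypothesis U_div : forall u0 : R, 0 < u0 ->
  (\int[mu]_(u in `[u0, +oo[) ((U u)%:E^-1) = +oo)%E.
Hypothesis psi0 : forall t : R, 0 <= t -> 0 <= psi t.
Hypothesis psi_int : forall a : R, 0 <= a -> mu.-integrable `[0, a] (EFin \o psi).

(** If vm b exceeded c, a primitive H of 1/(U + e) would grow along vm by more than K; but the
    derivative of H along a maximal v j is at most psi, so by [max_growth] it grows by at most m
    times the integral of psi over [0, T], which is K. The constant c is fixed before the interval
    [a, b] and the curves. *)
Lemma lyapunov_bound (m : nat) (T u0 : R) : 0 <= T -> 0 < u0 ->
  exists c : R, forall (a b : R) (v dv : 'I_m -> R -> R^o) (vm : R -> R^o),
    0 <= a -> a < b -> b <= T ->
    (forall j t, a <= t <= b -> deriv_within `[a, b] (v j) t (dv j t)) ->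
    (forall j t, a <= t <= b -> dv j @ within `[a, b] (nbhs t) --> dv j t) ->
    (forall j t, a <= t <= b -> 0 <= v j t <= vm t) ->
    (forall t, a <= t <= b -> exists j, v j t = vm t) ->
    (forall j t, a <= t <= b -> v j t = vm t -> dv j t <= U (vm t) * psi t) ->
    vm a <= u0 -> vm b <= c.
Proof.
move=> T0 u00; have mT : measurable (`[0, T]%classic : set (measurableTypeR R)).
  exact: measurable_itv.
pose K := m%:R * fine (\int[mu]_(t in `[0%R, T]) (psi t)%:E)%E.
have [e [c [e0 u0c Kc]]] := inv_integral_large Uc U0 U_div K u00.
exists c => a b v dv vm a0 ab bT vd dvc vb vmE dvU vma.
rewrite leNgt; apply/negP => cvm.
pose h (u : R) : R^o := (U (`|u| : R) + e)^-1.
have h0 u : 0 < h u by exact: inv_shift_gt0.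
have hc (J : set R) u : h @ within J (nbhs u) --> h u by exact: inv_shift_cvg.
have v_le j t : a <= t <= b -> v j t <= vm t by case/(vb j)/andP.
have vmc t : a <= t <= b -> vm @ within `[a, b] (nbhs t) --> vm t.
  by move=> tab; exact: (max_cvg vd v_le vmE tab).
(* H is constructed on a compact interval, so an upper bound for vm is fixed first. *)
have [B vB] : exists B : R, forall t, a <= t <= b -> vm t <= B.
  have [|t0 _ ht0] := @EVT_max R vm a b (ltW ab).
    by apply/subspace_continuousP => t /in_itvccP; exact: vmc.
  by exists (vm t0) => t tab; apply: ht0; rewrite in_itv.
have cB : c < B by rewrite (lt_le_trans cvm)// vB// lexx ltW.
have B0 : 0 < B by rewrite (lt_trans _ cB)// (lt_trans u00).
have [|t _|H [_ Hd]] := @primitive_exists R R^o h 0 B; [exact: ltW|exact: hc|].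
have Hmono : forall u w, 0 <= u -> u < w -> w <= B -> H u < H w.
  by apply: (deriv_within_strict_mono (ltW B0) Hd) => t _; exact: h0.
have vI j t : a <= t <= b -> 0 <= v j t <= B.
  by move=> tab; have /andP[-> /le_trans->//] := vb j t tab; exact: vB.
have vmI t : a <= t <= b -> 0 <= vm t <= B.
  by move=> tab; have [j <-] := vmE t tab; exact: vI.
have Hle u w : 0 <= u -> u <= w -> w <= B -> H u <= H w.
  by move=> hu; rewrite le_eqVlt => /orP[/eqP->//|uw wB]; exact/ltW/Hmono.
have bI : a <= b <= b by rewrite lexx ltW.
have aI : a <= a <= b by rewrite lexx ltW.
have /andP[vma0 _] := vmI a aI; have /andP[_ vmbB] := vmI b bI.
have Hinc : K < H (vm b) - H (vm a).
  have : K < H c - H u0.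
    have Hd' t : u0 <= t <= c -> deriv_within `[u0, c] H t (h t).
      move=> /andP[u0t tc]; apply: (@deriv_within_subset _ _ `[0, B]).
        move=> s /in_itvccP/andP[? ?]; apply/in_itvccP; apply/andP; split; first by lra.
        by rewrite (le_trans _ (ltW cB)).
      by apply: Hd; apply/andP; split; lra.
    have E := integral_deriv_within u0c (fun t _ => hc _ t) Hd'.
    rewrite -lte_fin -E.
    exact: Kc.
  move/lt_le_trans; apply; apply: lerB; first by apply: Hle; [lra|exact: ltW|exact: vmbB].
  by apply: Hle; [exact: vma0|exact: vma|lra].
have sub : `[a, b] `<=` `[0, T].
  move=> t /in_itvccP/andP[at_ tb]; apply/in_itvccP.
  by rewrite (le_trans a0)// (le_trans tb).
have psiab : mu.-integrable `[a, b] (EFin \o psi).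
  by apply: integrableS (psi_int T0) => //; exact: measurable_itv.
have yd j t : a <= t <= b ->
    deriv_within `[a, b] (H \o v j : R -> R^o) t (h (v j t) * dv j t).
  move=> tab; apply: (@deriv_within_comp _ `[0, B]); last exact: vd.
    by move=> s /in_itvccP sab; apply/in_itvccP; exact: vI.
  exact: Hd (vI j t tab).
have mg1 j t : a <= t <= b ->
    (fun s => h (v j s) * dv j s : R^o) @ within `[a, b] (nbhs t) --> (h (v j t) * dv j t : R^o).
  move=> tab; apply: cvgM; last exact: dvc.
  have vc := deriv_within_cvg (vd j t tab).
  have : h @ within setT (nbhs (v j t)) --> h (v j t) by exact: hc.
  by rewrite withinET => hv; exact: (cvg_comp _ _ vc hv).
have mg2 j t : a <= t <= b -> (H \o v j) t <= (H \o vm) t.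
  move=> tab; apply: Hle; [by case/(vb j)/andP: tab|exact: v_le|].
  by have /andP[] := vmI t tab.
have mg3 t : a <= t <= b -> exists j, (H \o v j) t = (H \o vm) t.
  by move=> tab; have [j vj] := vmE t tab; exists j; rewrite /= vj.
have mg4 t : a <= t <= b -> 0 <= psi t.
  by move=> /andP[at_ _]; rewrite psi0// (le_trans a0).
have mg5 j t : a <= t <= b -> (H \o v j) t = (H \o vm) t -> h (v j t) * dv j t <= psi t.
  move=> tab /= Hv; have vvm : v j t = vm t.
    apply/eqP; rewrite eq_le v_le//= leNgt; apply/negP => lt.
    have /andP[v0 _] := vb j t tab; have /andP[_ vmB] := vmI t tab.
    by have := Hmono _ _ v0 lt vmB; rewrite Hv ltxx.
  have /andP[vm0 _] := vmI t tab; have Uvm := U0 vm0.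
  rewrite vvm /h ger0_norm// mulrC ler_pdivrMr; last by rewrite ltr_wpDl.
  rewrite (le_trans (dvU j t tab vvm))// mulrC ler_wpM2l ?mg4// lerDl.
  exact: ltW.
have := max_growth ab yd mg1 mg2 mg3 mg4 psiab mg5.
apply/negP; rewrite -ltNge.
apply: (@le_lt_trans _ _ K%:E); last by rewrite lte_fin.
rewrite /K EFinM lee_wpmul2l// fineK; last exact: integrable_fin_num (psi_int T0).
apply: ge0_subset_integral => //.
  exact: measurable_int (psi_int T0).
by move=> t /in_itvccP/andP[t0 _]; rewrite lee_fin psi0.
Qed.

End Lyapunov.

(** * Curves of class C^k and implicit functions *)

Section Curves.
Context {R : realType}.
Local Notation J := (Rplus R).

(** The values and all derivatives up to order k lie in E, usually a subspace, so that a derivative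
    can be fed into an equation posed on E. At t = 0 the derivatives are one-sided. *)
Fixpoint Ccurve (V : normedModType R) (E : set V) (k : nat) (x : R -> V) : Prop :=
  (forall t : R, 0 <= t -> E (x t)) /\
  if k is k'.+1 then
    exists2 dx : R -> V, (forall t : R, 0 <= t -> deriv_within J x t (dx t)) & Ccurve E k' dx
  else forall t : R, 0 <= t -> x @ within J (nbhs t) --> x t.

Variables (V W : normedModType R).
Implicit Types (E : set V) (F : set W) (t : R) (x : R -> V).

Lemma Ccurve_in E k x t : Ccurve E k x -> 0 <= t -> E (x t).
Proof. by case: k => [|k] [h _]; exact: h. Qed.

Lemma Ccurve_cvg E k x t : Ccurve E k x -> 0 <= t -> x @ within J (nbhs t) --> x t.
Proof.
by case: k => [|k] [_]; [exact|move=> [dx dxP _] /dxP; exact: deriv_within_cvg].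
Qed.

Lemma CcurveW E j k x : (j <= k)%N -> Ccurve E k x -> Ccurve E j x.
Proof.
elim: j k x => [|j IH] [|k] x // jk.
  by move=> xC; split=> [t /(Ccurve_in xC)//|t]; exact: Ccurve_cvg xC.
by move=> [xE [dx dxP dxC]]; split=> //; exists dx => //; exact: IH dxC.
Qed.

Lemma Ccurve_subset E E' k x : E `<=` E' -> Ccurve E k x -> Ccurve E' k x.
Proof.
move=> EE'; elim: k x => [|k IH] x [xE xP]; (split; first by move=> t /xE/EE') => //.
by case: xP => dx ? /IH; exists dx.
Qed.

Lemma eq_Ccurve E k x (y : R -> V) : (forall t : R, 0 <= t -> x t = y t) -> Ccurve E k x -> Ccurve E k y.
Proof.
case: k => [|k] xy [xE xP]; (split; first by move=> t t0; rewrite -xy//; exact: xE).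
- move=> t t0; rewrite -xy//; apply: cvg_trans (xP t t0); apply: near_eq_cvg.
  by apply: filterS (near_within_self J t) => s Js; rewrite xy.
- case: xP => dx dxP dxC; exists dx => // t t0.
  by apply: (eq_deriv_within (x := x)) (dxP t t0).
Qed.

Lemma Ccurve_cst E k c : E c -> E 0 -> Ccurve E k (fun=> c).
Proof.
move=> Ec E0; elim: k c Ec => [|k IH] c Ec; split=> //.
  by move=> t _; exact: cvg_cst.
by exists (fun=> 0) => [t _|]; [exact: deriv_within_cst|exact: IH].
Qed.

Lemma Ccurve_add E k x (y : R -> V) : (forall u v, E u -> E v -> E (u + v)) ->
  Ccurve E k x -> Ccurve E k y -> Ccurve E k (fun t => x t + y t).
Proof.
move=> ED; elim: k x y => [|k IH] x y [xE xP] [yE yP];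
  (split; first by move=> t t0; apply: ED; [exact: xE|exact: yE]).
  by move=> t t0; apply: cvgD; [exact: xP|exact: yP].
case: xP => dx dxP dxC; case: yP => dy dyP dyC.
by exists (fun t => dx t + dy t) => [t t0|]; [apply: deriv_withinD; [exact: dxP|exact: dyP]|exact: IH].
Qed.

Lemma CcurveD k x (y : R -> V) : Ccurve (setT : set V) k x -> Ccurve setT k y ->
  Ccurve setT k (fun t => x t + y t).
Proof. exact: Ccurve_add. Qed.

Lemma Ccurve_blin E F k x (L : V -> W) : bounded_linear_on setT L ->
  (forall z, E z -> F (L z)) -> Ccurve E k x -> Ccurve F k (L \o x).
Proof.
move=> bL EF; elim: k x => [|k IH] x [xE xP]; (split; first by move=> t /xE/EF).
  by move=> t t0; apply: (blin_cvg bL); exact: xP.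
case: xP => dx dxP dxC; exists (L \o dx) => [t t0|]; last exact: IH.
by apply: deriv_within_blin => //; exact: dxP.
Qed.

Lemma deriv_within_pair (I : set R) (x : R -> V) (y : R -> W) t d d' :
  deriv_within I x t d -> deriv_within I y t d' ->
  deriv_within I (fun s => (x s, y s)) t (d, d').
Proof.
move=> xd yd e e0; apply: filterS2 (xd e e0) (yd e e0) => s h h'.
by rewrite prod_normE /= ge_max h.
Qed.

Lemma Ccurve_pair E F k x (y : R -> W) : Ccurve E k x -> Ccurve F k y ->
  Ccurve (E `*` F) k (fun t => (x t, y t)).
Proof.
elim: k x y => [|k IH] x y [xE xP] [yF yP];
  (split; first by move=> t t0; split; [exact: xE|exact: yF]).
- by move=> t t0; apply: cvg_pair; [exact: xP|exact: yP].
- case: xP => dx dxP dxC; case: yP => dy dyP dyC.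
  exists (fun t => (dx t, dy t)) => [t t0|]; last exact: IH.
  by apply: deriv_within_pair; [exact: dxP|exact: dyP].
Qed.

End Curves.

Lemma Ccurve_id (R : realType) k : Ccurve (setT : set R^o) k (fun t : R => t : R^o).
Proof.
case: k => [|k]; split=> //.
  by move=> t _; exact: cvg_within.
exists (fun=> 1) => [t _|]; first exact: deriv_within_id.
exact: Ccurve_cst.
Qed.

(** * Multilinear forms along curves *)

Section Multilinear.
Context {R : realType} {V W : normedModType R}.
Local Notation J := (Rplus R).
Variable E : set V.
Implicit Types t : R.
Hypothesis E0 : E 0.
Hypothesis EP : forall (a : R) x y, E x -> E y -> E (a *: x + y).

Definition all_in (vs : seq V) := forall w, w \in vs -> E w.

Lemma all_in_cons v vs : all_in (v :: vs) <-> E v /\ all_in vs.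
Proof.
split=> [h|[Ev h] w]; first by split=> [|w ws]; apply: h; rewrite inE ?eqxx// ws orbT.
by rewrite inE => /orP[/eqP->//|]; exact: h.
Qed.

Lemma all_in_cat vs ws : all_in (vs ++ ws) <-> all_in vs /\ all_in ws.
Proof.
split=> [h|[h h'] w]; first by split=> w ws_; apply: h; rewrite mem_cat ws_ ?orbT.
by rewrite mem_cat => /orP[/h|/h'].
Qed.

Definition multilinear_at (j : nat) (L : seq V -> W) :=
  (forall vs1 vs2 (a : R) u v, (size vs1 + size vs2).+1 = j ->
     all_in (vs1 ++ u :: v :: vs2) ->
     L (vs1 ++ (a *: u + v) :: vs2) = a *: L (vs1 ++ u :: vs2) + L (vs1 ++ v :: vs2)) /\
  exists C : R, forall vs, size vs = j -> all_in vs -> `|L vs| <= C * normprod vs.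

Lemma normprod_ge0 (vs : seq V) : 0 <= normprod vs.
Proof. by rewrite /normprod; apply: prodr_ge0. Qed.

Lemma normprod_cat (vs ws : seq V) : normprod (vs ++ ws) = normprod vs * normprod ws.
Proof. by rewrite /normprod big_cat. Qed.

Lemma normprod_cons v (vs : seq V) : normprod (v :: vs) = `|v| * normprod vs.
Proof. by rewrite /normprod big_cons. Qed.

Let eval (vs : seq (R -> V)) (t : R) : seq V := map (fun v => v t) vs.

Fixpoint curves (m : nat) (vs : seq (R -> V)) : Prop :=
  if vs is v :: vs' then Ccurve E m v /\ curves m vs' else True.

Lemma curves_in m vs t : curves m vs -> 0 <= t -> all_in (eval vs t).
Proof.
move=> + t0; elim: vs => [|v vs IH] //= [vC /IH h].
by apply/all_in_cons; split=> //; exact: Ccurve_in vC t0.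
Qed.

Lemma curvesW j m vs : (j <= m)%N -> curves m vs -> curves j vs.
Proof.
by move=> jm; elim: vs => //= v vs IH [/(CcurveW jm) ? /IH].
Qed.

Lemma curves_cat m vs ws : curves m vs -> curves m ws -> curves m (vs ++ ws).
Proof. by elim: vs => //= v vs IH [vC /IH h] /h. Qed.

Lemma normprod_near m vs t : curves m vs -> 0 <= t -> exists2 B : R, 0 < B &
  \forall s \near within J (nbhs t), normprod (eval vs s) <= B.
Proof.
move=> + t0; elim: vs => [_|v vs IH /= [vC /IH[B B0 hB]]].
  by exists 1 => //; apply: nearW => s; rewrite /normprod big_nil.
have v1 : 0 < `|v t| + 1 by rewrite ltr_wpDl.
exists ((`|v t| + 1) * B); first by rewrite mulr_gt0.
have /cvgr_normP/(_ _ ltr01) hv := Ccurve_cvg vC t0.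
apply: filterS2 hB hv => s h h'; rewrite normprod_cons ler_pM ?normprod_ge0//.
by rewrite -(subrK (v t) (v s)) (le_trans (ler_normD _ _))// addrC lerD2l.
Qed.

Section FixedForm.
Variables (j : nat) (L : seq V -> W).
Hypothesis mL : multilinear_at j L.

Lemma multilinear_bound : exists2 C : R, 0 < C &
  forall vs, size vs = j -> all_in vs -> `|L vs| <= C * normprod vs.
Proof.
case: mL => _ [C hC]; exists (`|C| + 1); first by rewrite ltr_wpDl.
move=> vs sv av; rewrite (le_trans (hC vs sv av))// ler_wpM2r ?normprod_ge0//.
by rewrite (le_trans (ler_norm _))// lerDl.
Qed.

Lemma multilinear0 vs1 vs2 : (size vs1 + size vs2).+1 = j -> all_in (vs1 ++ vs2) ->
  L (vs1 ++ 0 :: vs2) = 0.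
Proof.
move=> sz /all_in_cat[h1 h2]; have := mL.1 vs1 vs2 (-1) 0 0 sz.
rewrite scaler0 addr0 scaleN1r addNr; apply.
by apply/all_in_cat; split=> //; apply/all_in_cons; split=> //; apply/all_in_cons.
Qed.

Lemma multilinearD vs1 vs2 u v : (size vs1 + size vs2).+1 = j ->
  all_in (vs1 ++ u :: v :: vs2) ->
  L (vs1 ++ (u + v) :: vs2) = L (vs1 ++ u :: vs2) + L (vs1 ++ v :: vs2).
Proof. by move=> sz h; have := mL.1 vs1 vs2 1 u v sz h; rewrite !scale1r. Qed.

Lemma multilinearZ vs1 vs2 a u : (size vs1 + size vs2).+1 = j ->
  all_in (vs1 ++ u :: vs2) -> L (vs1 ++ (a *: u) :: vs2) = a *: L (vs1 ++ u :: vs2).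
Proof.
move=> sz /all_in_cat[h1 /all_in_cons[Eu h2]].
rewrite -[a *: u]addr0 mL.1// ?multilinear0// ?addr0//.
  exact/all_in_cat.
by apply/all_in_cat; split=> //; apply/all_in_cons; split=> //; apply/all_in_cons.
Qed.

Lemma multilinear_cvg m ws vs t : 0 <= t -> (size ws + size vs)%N = j ->
  all_in ws -> curves m vs ->
  (fun s => L (ws ++ eval vs s)) @ within J (nbhs t) --> L (ws ++ eval vs t).
Proof.
move=> t0; elim: vs ws => [|v vs IH] ws sz aw vC; first by rewrite /=; exact: cvg_cst.
case: (vC) => vC1 vC2.
have Et := Ccurve_in vC1 t0.
have aw' : all_in (rcons ws (v t)).
  by rewrite -cats1; apply/all_in_cat; split=> //; apply/all_in_cons; split.
have sz' : (size (rcons ws (v t)) + size vs)%N = j by rewrite size_rcons addSnnS.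
have h1 := IH _ sz' aw' vC2.
have [C C0 hC] := multilinear_bound.
have [B B0 hB] := normprod_near vC2 t0.
apply/cvgr_normP => e e0; have e2 : 0 < e / 2 by rewrite divr_gt0.
have K0 : 0 < C * (normprod ws + 1) * B.
  by rewrite !mulr_gt0// ltr_wpDl// normprod_ge0.
have /cvgr_normP/(_ _ (divr_gt0 e2 K0)) hv := Ccurve_cvg vC1 t0.
move/cvgr_normP/(_ _ e2) : h1; rewrite -cats1 -catA /= => h1.
apply: filterS2 (filterI h1 hB) (filterI hv (near_within_self J t)) => s [{}h1 {}hB] [{}hv Js].
have av := curves_in vC2 Js; have Es := Ccurve_in vC1 Js.
have Ed : E (v s - v t) by rewrite -scaleN1r addrC; exact: EP.
have szs : (size ws + size (eval vs s)).+1 = j by rewrite size_map -addnS.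
have -> : L (ws ++ eval (v :: vs) s) =
    L (ws ++ (v s - v t) :: eval vs s) + L (ws ++ v t :: eval vs s).
  rewrite -multilinearD ?subrK//; apply/all_in_cat; split=> //.
  by apply/all_in_cons; split=> //; apply/all_in_cons.
rewrite -addrA (le_trans (ler_normD _ _))// [leRHS]splitr lerD//; last first.
  by rewrite -catA in h1.
rewrite (le_trans (hC _ _ _))//.
- by rewrite size_cat /= addnS.
- by apply/all_in_cat; split=> //; apply/all_in_cons.
- rewrite normprod_cat normprod_cons.
  have : `|v s - v t| * (C * (normprod ws + 1) * B) <= e / 2 by rewrite -ler_pdivlMr.
  apply: le_trans; rewrite [leRHS]mulrC -!mulrA ler_pM2l//.
  rewrite [leRHS]mulrA [leRHS]mulrAC -mulrA.
  apply: ler_pM => //; rewrite ?normprod_ge0 ?mulr_ge0 ?normprod_ge0//.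
    by rewrite lerDl.
  by rewrite mulrC [leRHS]mulrC; apply: ler_wpM2r.
Qed.

(** The Leibniz sum: in each term one entry of vs is replaced by the corresponding entry of dvs; ws
    holds the entries already passed. *)
Fixpoint mder (ws vs dvs : seq V) : W :=
  match vs, dvs with
  | v :: vs', dv :: dvs' => L (ws ++ dv :: vs') + mder (rcons ws v) vs' dvs'
  | _, _ => 0
  end.

Lemma mder_zero ws1 ws2 vs dvs : (size ws1 + size ws2 + size vs).+1 = j ->
  size dvs = size vs -> all_in (ws1 ++ ws2) -> all_in vs -> all_in dvs ->
  mder (ws1 ++ 0 :: ws2) vs dvs = 0.
Proof.
elim: vs dvs ws2 => [|v vs IH] [|dv dvs] ws2 //= sz [sd] aw /all_in_cons[Ev av] /all_in_cons[Edv adv].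
rewrite -catA /= multilinear0//; last first.
- by case/all_in_cat: aw => h1 h2; apply/all_in_cat; split=> //; apply/all_in_cat; split=> //; apply/all_in_cons.
- by rewrite size_cat /= addnA.
rewrite add0r rcons_cat rcons_cons IH//; first by rewrite size_rcons -sz !addnS !addSn.
case/all_in_cat: aw => h1 h2; apply/all_in_cat; split=> //; rewrite -cats1.
by apply/all_in_cat; split=> //; apply/all_in_cons.
Qed.

Lemma multilinear_deriv ws (vs : seq (R -> V)) (dvs : seq V) t : 0 <= t ->
  (size ws + size vs)%N = j -> size dvs = size vs -> all_in ws -> curves 0 vs -> all_in dvs ->
  (forall i, (i < size vs)%N -> deriv_within J (nth (fun=> 0) vs i) t (nth 0 dvs i)) ->
  deriv_within J (fun s => L (ws ++ eval vs s)) t (mder ws (eval vs t) dvs).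
Proof.
move=> t0; elim: vs dvs ws => [|v vs IH] [|dv dvs] ws //= sz sd aw vC ad dP.
  exact: deriv_within_cst.
case: sd => sd; case/all_in_cons: ad => Edv ad; case: vC => vC0 vC2.
have vC1 : Ccurve E 0 v by exact: vC0.
have dv1 : deriv_within J v t dv := dP 0%N isT.
have Et := Ccurve_in vC1 t0.
have aw' : all_in (rcons ws (v t)).
  by rewrite -cats1; apply/all_in_cat; split=> //; apply/all_in_cons; split.
have sz' : (size (rcons ws (v t)) + size vs)%N = j by rewrite size_rcons addSnnS.
have h1 := IH dvs _ sz' sd aw' vC2 ad (fun i => dP i.+1).
have aw2 : all_in (rcons ws dv).
  by rewrite -cats1; apply/all_in_cat; split=> //; apply/all_in_cons; split.
have sz2 : (size (rcons ws dv) + size vs)%N = j by rewrite size_rcons addSnnS.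
have h2 := multilinear_cvg t0 sz2 aw2 vC2.
rewrite addrC.
have szs s : (size ws + size (eval vs s)).+1 = j by rewrite size_map -addnS.
have [C C0 hC] := multilinear_bound.
have [B B0 hB] := normprod_near vC2 t0.
have K0 : 0 < C * (normprod ws + 1) * B.
  by rewrite !mulr_gt0// ltr_wpDl// normprod_ge0.
(* The first moving entry is frozen at v t; the induction hypothesis differentiates the rest, and r
   collects the variation of that entry. *)
pose r s := L (ws ++ v s :: eval vs s) - L (rcons ws (v t) ++ eval vs s).
suff rd : deriv_within J r t (L (ws ++ dv :: eval vs t)).
  have := deriv_withinD h1 rd; rewrite /r.
  by under [X in deriv_within _ X]eq_fun => s do rewrite addrC subrK.
move=> e e0; have e2 : 0 < e / 2 by rewrite divr_gt0.
move/cvgr_normP/(_ _ e2) : h2; rewrite -cats1 -catA /= => h2.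
have h3 := dv1 _ (divr_gt0 e2 K0).
apply: filterS2 (filterI h2 hB) (filterI h3 (near_within_self J t)) => s [{}h2 {}hB] [{}h3 Js].
rewrite -catA /= in h2.
have av := curves_in vC2 Js; have Es := Ccurve_in vC1 Js.
have -> : r t = 0 by rewrite /r -cats1 -catA subrr.
have EN u : E u -> E (- u) by move=> Eu; rewrite -scaleN1r -[_ *: _]addr0; exact: EP.
have ED u w : E u -> E w -> E (u + w) by move=> Eu Ew; rewrite -[u]scale1r; exact: EP.
have EZ a u : E u -> E (a *: u) by move=> Eu; rewrite -[_ *: _]addr0; exact: EP.
pose q := v s - v t - (s - t) *: dv.
have Eq : E q by apply: (ED); [apply: (ED) => //; exact: EN|apply: EN; exact: EZ].
have al u : E u -> all_in (ws ++ u :: eval vs s).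
  by move=> Eu; apply/all_in_cat; split=> //; apply/all_in_cons.
have al2 u w : E u -> E w -> all_in (ws ++ u :: w :: eval vs s).
  by move=> Eu Ew; apply/all_in_cat; split=> //; apply/all_in_cons; split=> //; apply/all_in_cons.
have -> : r s = L (ws ++ q :: eval vs s) + (s - t) *: L (ws ++ dv :: eval vs s).
  rewrite -multilinearZ; [|exact: szs|exact: al].
  rewrite -multilinearD; [|exact: szs|by apply: al2 => //; exact: EZ].
  rewrite /r -cats1 -catA /= subrK.
  rewrite -[in L (ws ++ v s :: _)](subrK (v t) (v s)) multilinearD; [|exact: szs|].
    by rewrite addrK.
  by apply: al2 => //; apply: ED => //; exact: EN.
rewrite subr0 -addrA -scalerBr (le_trans (ler_normD _ _))//.
rewrite (_ : e * `|s - t| = e / 2 * `|s - t| + e / 2 * `|s - t|); last by field.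
apply: lerD; last by rewrite normrZ mulrC ler_wpM2r.
rewrite (le_trans (hC _ _ (al _ Eq)))//; first by rewrite size_cat /= addnS szs.
rewrite normprod_cat normprod_cons.
have : `|q| * (C * (normprod ws + 1) * B) <= e / 2 * `|s - t|.
  by rewrite -ler_pdivlMr// mulrAC.
apply: le_trans; rewrite [leRHS]mulrC -!mulrA ler_pM2l//.
rewrite [leRHS]mulrA [leRHS]mulrAC -mulrA.
apply: ler_pM => //; rewrite ?normprod_ge0 ?mulr_ge0 ?normprod_ge0//.
  by rewrite lerDl.
by rewrite mulrC [leRHS]mulrC; apply: ler_wpM2r.
Qed.

End FixedForm.
End Multilinear.

Section Chain.
Context {R : realType} {V W : normedModType R}.
Local Notation J := (Rplus R).
Variables (N E : set V) (k : nat) (T : V -> seq V -> W).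
Implicit Types t : R.
Hypothesis E0 : E 0.
Hypothesis EP : forall (a : R) x y, E x -> E y -> E (a *: x + y).
Hypothesis Tlin : forall p vs1 vs2 (a : R) u v, N p ->
  (size vs1 + size vs2 < k)%N ->
  (forall w, w \in vs1 ++ u :: v :: vs2 -> E w) ->
  T p (vs1 ++ (a *: u + v) :: vs2) = a *: T p (vs1 ++ u :: vs2) + T p (vs1 ++ v :: vs2).
Hypothesis Tbound : forall p j, N p -> (j <= k)%N -> exists C : R, forall vs,
  size vs = j -> (forall w, w \in vs -> E w) -> `|T p vs| <= C * normprod vs.
Hypothesis Tdiff : forall p j, N p -> (j < k)%N -> forall e : R, 0 < e ->
  \forall z \near within N (nbhs p), forall vs,
    size vs = j -> (forall w, w \in vs -> E w) ->
    `|T z vs - T p vs - T p ((z - p) :: vs)| <= e * `|z - p| * normprod vs.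
Hypothesis Tcont : forall p j, N p -> (j <= k)%N -> forall e : R, 0 < e ->
  \forall z \near within N (nbhs p), forall vs,
    size vs = j -> (forall w, w \in vs -> E w) ->
    `|T z vs - T p vs| <= e * normprod vs.

Let eval (vs : seq (R -> V)) (t : R) : seq V := map (fun v => v t) vs.

Lemma Ck_multilinear p j : N p -> (j <= k)%N -> multilinear_at E j (T p).
Proof.
move=> Np jk; split=> [vs1 vs2 a u v sz aE|]; last exact: Tbound.
by apply: Tlin => //; rewrite sz.
Qed.

Lemma curves_deriv m vs : curves E m.+1 vs -> exists dvs,
  [/\ size dvs = size vs, curves E m dvs &
   forall i t, (i < size vs)%N -> 0 <= t ->
     deriv_within J (nth (fun=> 0) vs i) t (nth 0 (eval dvs t) i)].
Proof.
elim: vs => [_|v vs IH [[vE [dv dvP dvC]] /IH[dvs [sd dC dP]]]]; first by exists [::].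
exists (dv :: dvs); split=> //=; first by rewrite sd.
by case=> [|i] t it t0; [exact: dvP|exact: dP].
Qed.

Lemma near_curve (c : R -> V) t (P : V -> Prop) : 0 <= t ->
  (forall t, 0 <= t -> N (c t)) -> c @ within J (nbhs t) --> c t ->
  (\forall z \near within N (nbhs (c t)), P z) ->
  \forall s \near within J (nbhs t), P (c s).
Proof.
move=> t0 cN /cvgr_normP cc /near_withinP[d d0 hd].
have d2 : 0 < d / 2 by rewrite divr_gt0.
apply: filterS2 (cc _ d2) (near_within_self J t) => s h Js.
by apply: hd; [exact: cN|rewrite (le_lt_trans h)//; lra].
Qed.

Lemma Ck_chain_cvg c vs t : 0 <= t -> (size vs <= k)%N -> Ccurve E 0 c ->
  (forall t, 0 <= t -> N (c t)) -> curves E 0 vs ->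
  (fun s => T (c s) (eval vs s)) @ within J (nbhs t) --> T (c t) (eval vs t).
Proof.
move=> t0 sk cC cN vC; apply/cvgr_normP => e e0.
have [B B0 hB] := normprod_near vC t0.
have e2 : 0 < e / 2 by rewrite divr_gt0.
have h1 := near_curve t0 cN (Ccurve_cvg cC t0) (Tcont (cN t t0) sk (divr_gt0 e2 B0)).
have mT := Ck_multilinear (cN t t0) sk.
have nil_in : all_in E [::] by [].
have /cvgr_normP/(_ _ e2) h2 := multilinear_cvg EP mT t0 (ws := [::]) erefl nil_in vC.
apply: filterS2 (filterI h1 h2) (filterI hB (near_within_self J t)) => s [{}h1 {}h2] [{}hB Js].
rewrite -(subrKA (T (c t) (eval vs s))) (le_trans (ler_normD _ _))// [leRHS]splitr lerD//.
rewrite (le_trans (h1 _ _ _)) ?size_map//; first exact: curves_in vC Js.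
by rewrite mulrAC ler_pdivrMr// ler_wpM2l// ltW.
Qed.

(** T (c s) (vs s) is T (c t) (vs s), plus T (c t) (c s - c t, vs s), plus a remainder with
    derivative 0 by the differentiability of T. In the second summand one entry vanishes at s = t,
    so only the Leibniz term that differentiates this entry survives. *)
Lemma Ck_chain_deriv c vs (dc : V) (dvs : seq V) t : 0 <= t -> (size vs < k)%N ->
  Ccurve E 0 c -> (forall t, 0 <= t -> N (c t)) -> curves E 0 vs ->
  E dc -> all_in E dvs -> size dvs = size vs -> deriv_within J c t dc ->
  (forall i, (i < size vs)%N -> deriv_within J (nth (fun=> 0) vs i) t (nth 0 dvs i)) ->
  deriv_within J (fun s => T (c s) (eval vs s)) t
    (T (c t) (dc :: eval vs t) + mder (T (c t)) [::] (eval vs t) dvs).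
Proof.
move=> t0 sk cC cN vC Edc Edvs sd cd vd.
have Ect := Ccurve_in cC t0.
have EB u w : E u -> E w -> E (u - w).
  by move=> Eu Ew; rewrite -scaleN1r addrC; exact: EP.
pose d s := c s - c t.
have dC : Ccurve E 0 d.
  split=> [s s0|s s0]; first by apply: EB => //; exact: Ccurve_in cC s0.
  by apply: cvgB; [exact: Ccurve_cvg cC s0|exact: cvg_cst].
have dd : deriv_within J d t dc.
  rewrite -[dc]subr0; apply: deriv_withinB => //; exact: deriv_within_cst.
have mT1 := Ck_multilinear (cN t t0) (sk : (size vs).+1 <= k)%N.
have mT0 := Ck_multilinear (cN t t0) (ltnW sk).
have nil_in : all_in E [::] by [].
have h1 : deriv_within J (fun s => T (c t) (d s :: eval vs s)) t (T (c t) (dc :: eval vs t)).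
  have := @multilinear_deriv _ _ _ _ E0 EP _ _ mT1 [::] (d :: vs) (dc :: dvs) t t0 erefl _ nil_in.
  rewrite /= sd => /(_ erefl (conj dC vC)).
  have -> : mder (T (c t)) [:: d t] (eval vs t) dvs = 0.
    rewrite /d subrr; apply: (mder_zero E0 mT1 (ws1 := [::]) (ws2 := [::])) => //.
    - by rewrite size_map.
    - by rewrite size_map.
    - exact: curves_in vC t0.
  rewrite addr0; apply; first exact/all_in_cons.
  by case=> [|i] //; exact: vd.
have h2 : deriv_within J (fun s => T (c t) (eval vs s)) t (mder (T (c t)) [::] (eval vs t) dvs).
  exact: (@multilinear_deriv _ _ _ _ E0 EP _ _ mT0 [::] vs dvs t t0 erefl sd nil_in vC Edvs vd).
have h3 : deriv_within J (fun s => T (c s) (eval vs s) - T (c t) (eval vs s) -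
    T (c t) (d s :: eval vs s)) t 0.
  move=> e e0; have [B B0 hB] := normprod_near vC t0.
  have K0 : 0 < `|dc| + 1 by rewrite ltr_wpDl.
  have e1 : 0 < e / ((`|dc| + 1) * B) by rewrite divr_gt0// mulr_gt0.
  have k1 := near_curve t0 cN (Ccurve_cvg cC t0) (Tdiff (cN t t0) sk e1).
  have k2 : \forall s \near within J (nbhs t), `|c s - c t| <= (`|dc| + 1) * `|s - t|.
    by apply: deriv_within_lip cd _; rewrite ltrDl.
  apply: filterS2 (filterI k1 k2) (filterI hB (near_within_self J t)) => s [{}k1 {}k2] [{}hB Js].
  have z0 : T (c t) (d t :: eval vs t) = 0.
    rewrite /d subrr; apply: (multilinear0 E0 mT1 (vs1 := [::])); first by rewrite size_map.
    exact: curves_in vC t0.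
  rewrite z0 !subrr scaler0 !subr0 (le_trans (k1 _ _ _)) ?size_map//.
    exact: curves_in vC Js.
  have -> : e * `|s - t| = e / ((`|dc| + 1) * B) * ((`|dc| + 1) * `|s - t|) * B.
    by field; rewrite !lt0r_neq0.
  apply: ler_pM; [|exact: normprod_ge0| |exact: hB].
    by rewrite mulr_ge0// ltW.
  by rewrite ler_wpM2l// ltW.
have := deriv_withinD (deriv_withinD h3 h1) h2; rewrite add0r.
by under [X in deriv_within _ X]eq_fun => s do rewrite subrK subrK.
Qed.

Lemma mder_curve m c ws vs dvs : 
  (forall us, size us = (size ws + size vs)%N -> curves E m us ->
     Ccurve setT m (fun t => T (c t) (eval us t))) ->
  size dvs = size vs -> curves E m ws -> curves E m vs -> curves E m dvs ->
  Ccurve setT m (fun t => mder (T (c t)) (eval ws t) (eval vs t) (eval dvs t)).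
Proof.
elim: vs ws dvs => [|v vs IH] ws [|dv dvs] //= TC sd wsC vC dC; try exact: Ccurve_cst.
case: sd => sd; case: vC => vC1 vC2; case: dC => dC1 dC2.
have dvC : curves E m (dv :: vs) by split.
have v1C : curves E m [:: v] by split.
apply: CcurveD.
  have := TC (ws ++ dv :: vs); rewrite size_cat /= => /(_ erefl (curves_cat wsC dvC)).
  by apply: eq_Ccurve => t _; rewrite /eval map_cat.
have := IH (rcons ws v) dvs; rewrite size_rcons addSnnS => /(_ TC sd _ vC2 dC2).
rewrite -cats1 => /(_ (curves_cat wsC v1C)).
by apply: eq_Ccurve => t _; rewrite /eval map_cat cats1.
Qed.

(** Differentiating lowers m by one and adds at most one argument to T, so the bound k on their sum
    is preserved. *)
Lemma Ck_chain m vs c : (size vs + m <= k)%N -> Ccurve E m c ->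
  (forall t, 0 <= t -> N (c t)) -> curves E m vs ->
  Ccurve setT m (fun t => T (c t) (eval vs t)).
Proof.
elim: m vs c => [|m IH] vs c sk cC cN vC.
  by split=> // t t0; apply: Ck_chain_cvg => //; rewrite addn0 in sk.
have [dvs [sd dC dP]] := curves_deriv vC.
have cC0 := CcurveW (leq0n m.+1) cC; have cCm := CcurveW (leqnSn m) cC.
have vC0 := curvesW (leq0n m.+1) vC; have vCm := curvesW (leqnSn m) vC.
case: (cC) => cE [dc dcP dcC]; split=> //.
exists (fun t => T (c t) (dc t :: eval vs t) +
                 mder (T (c t)) [::] (eval vs t) (eval dvs t)) => [t t0|].
  apply: Ck_chain_deriv => //.
  - by rewrite (leq_trans _ sk)// addnS ltnS leq_addr.
  - exact: Ccurve_in dcC t0.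
  - exact: curves_in dC t0.
  - by rewrite size_map.
  - exact: dcP.
  - by move=> i ivs; exact: dP.
apply: CcurveD; first by apply: (IH (dc :: vs)) => //=; rewrite addSnnS.
apply: (mder_curve (ws := [::])) => // us sus usC.
by apply: IH => //; rewrite sus add0n (leq_trans _ sk)// leq_add2l.
Qed.

End Chain.

(** * Zeros of maps close to an invertible operator *)

Section Implicit.
Context {R : realType} {V : completeNormedModType R} {W : normedModType R}.
Variables (E0 : set V) (F0 : set W) (Z : V -> W) (Zi : W -> V) (c k : R).
Hypothesis E0cl : closed E0.
Hypothesis E0_0 : E0 0.
Hypothesis E0P : forall (a : R) x y, E0 x -> E0 y -> E0 (a *: x + y).
Hypothesis F0_0 : F0 0.
Hypothesis F0P : forall (a : R) x y, F0 x -> F0 y -> F0 (a *: x + y).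
Hypothesis ZiP : is_bounded_inverse E0 F0 Z Zi.
Hypothesis c0 : 0 < c.
Hypothesis Zic : forall y, F0 y -> `|Zi y| <= c * `|y|.
Hypothesis k0 : 0 <= k.
Hypothesis ck : c * k < 1.

Let E0B x y : E0 x -> E0 y -> E0 (x - y).
Proof. by move=> Ex Ey; rewrite -scaleN1r addrC; exact: E0P. Qed.

Let F0B x y : F0 x -> F0 y -> F0 (x - y).
Proof. by move=> Fx Fy; rewrite -scaleN1r addrC; exact: F0P. Qed.

Let ZiB x y : F0 x -> F0 y -> Zi (x - y) = Zi x - Zi y.
Proof.
case: ZiP => _ _ [h _] Fx Fy.
by rewrite -scaleN1r addrC h// scaleN1r addrC.
Qed.

Let Zi0 : Zi 0 = 0.
Proof. by rewrite -(subrr 0) ZiB// subrr. Qed.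

Section OneEquation.
Variables (Phi : V -> W) (z0 : V) (rho : R).
Hypothesis Ez0 : E0 z0.
Hypothesis PhiF : forall z, E0 z -> `|z - z0| <= rho -> F0 (Phi z).
Hypothesis Phik : forall z' z'', E0 z' -> E0 z'' -> `|z' - z0| <= rho ->
  `|z'' - z0| <= rho -> `|Phi z' - Phi z'' - Z (z' - z'')| <= k * `|z' - z''|.

(** The iteration z - Zi (Phi z) uses one fixed inverse: since Phi differs from Z by a k-Lipschitz
    map, the iteration map is (c k)-Lipschitz. No derivative of Phi enters, so that both
    alternatives of condition 2.e are covered. *)
Lemma contraction_step z' z'' : E0 z' -> E0 z'' -> `|z' - z0| <= rho ->
  `|z'' - z0| <= rho ->
  `|(z' - z'') - Zi (Phi z' - Phi z'')| <= c * k * `|z' - z''|.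
Proof.
move=> E' E'' r' r''; have [ZF _ _] := ZiP.
have Ed := E0B E' E''; have [Fd Zid] := ZF _ Ed.
have FP := F0B (PhiF E' r') (PhiF E'' r'').
rewrite -{1}Zid -ZiB// (le_trans (Zic (F0B Fd FP)))// -mulrA ler_pM2l//.
by rewrite distrC; exact: Phik.
Qed.

Lemma contraction_dist z' z'' : E0 z' -> E0 z'' -> `|z' - z0| <= rho ->
  `|z'' - z0| <= rho ->
  `|z' - z''| <= c / (1 - c * k) * `|Phi z' - Phi z''|.
Proof.
move=> E' E'' r' r''; have h := contraction_step E' E'' r' r''.
have FP := F0B (PhiF E' r') (PhiF E'' r'').
have ck1 : 0 < 1 - c * k by rewrite subr_gt0.
rewrite mulrAC ler_pdivlMr// mulrBr mulr1 lerBlDr.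
rewrite -{1}(subrK (Zi (Phi z' - Phi z'')) (z' - z'')).
rewrite (le_trans (ler_normD _ _))// addrC lerD ?Zic//.
by rewrite mulrC.
Qed.

Lemma contraction_zero : 0 <= rho -> c * `|Phi z0| <= (1 - c * k) * rho ->
  exists z, [/\ E0 z, `|z - z0| <= rho & Phi z = 0].
Proof.
move=> rho0 Phi0; have [ZF FZ _] := ZiP.
have ck0 : 0 <= c * k by rewrite mulr_ge0// ltW.
have ck1 : 0 < 1 - c * k by rewrite subr_gt0.
pose z n := iter n (fun z => z - Zi (Phi z)) z0.
have zS n : z n.+1 = z n - Zi (Phi (z n)) by [].
(* C (c k)^n bounds the n-th step, so all iterates stay within C / (1 - c k) <= rho of z0. *)
pose C := c * `|Phi z0|; have C0 : 0 <= C by rewrite mulr_ge0// ltW.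
have zP n : [/\ E0 (z n), (1 - c * k) * `|z n - z0| <= C * (1 - (c * k) ^+ n) &
    `|z n.+1 - z n| <= C * (c * k) ^+ n] /\ `|z n - z0| <= rho.
  have bnd m : (1 - c * k) * `|z m - z0| <= C * (1 - (c * k) ^+ m) -> `|z m - z0| <= rho.
    move=> h; rewrite -(ler_pM2l ck1) (le_trans h)// (le_trans _ Phi0)//.
    by rewrite ler_piMr// gerBl exprn_ge0.
  elim: n => [|n [[En dn sn] rn]].
    split; last by rewrite /z /= subrr normr0.
    split; rewrite ?expr0 ?subrr ?normr0 ?mulr0 ?mulr1//.
    rewrite zS addrAC subrr sub0r normrN; apply: Zic; apply: PhiF => //.
    by rewrite /z /= subrr normr0.
  have En1 : E0 (z n.+1) by rewrite zS; apply: E0B => //; exact: (FZ _ (PhiF En rn)).1.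
  have dn1 : (1 - c * k) * `|z n.+1 - z0| <= C * (1 - (c * k) ^+ n.+1).
    rewrite (le_trans (ler_wpM2l (ltW ck1) (ler_distD (z n) _ _)))// mulrDr.
    rewrite (le_trans (lerD (ler_wpM2l (ltW ck1) sn) dn))//.
    by rewrite le_eqVlt; apply/orP; left; apply/eqP; rewrite exprS; ring.
  have rn1 := bnd _ dn1; split=> //; split=> //.
  have -> : z n.+2 - z n.+1 = (z n.+1 - z n) - Zi (Phi (z n.+1) - Phi (z n)).
    rewrite ZiB; [|exact: PhiF|exact: PhiF].
    by rewrite (zS n.+1) {3}(zS n); lincomb_eq.
  rewrite (le_trans (contraction_step _ _ _ _))// exprS mulrCA.
  by rewrite ler_wpM2l.
have [|n|l [zl lP]] := @geometric_cauchy _ _ z C (c * k).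
- by rewrite ck0.
- by have [[]] := zP n.
have El : E0 l.
  by apply: (closed_cvg _ E0cl) zl; apply: nearW => n; have [[]] := zP n.
have rl : `|l - z0| <= rho.
  apply/ler_addgt0Pl => e e0; have /cvgr_normP/(_ e e0)[n _ hn] := zl.
  have h := hn n (leqnn _).
  by rewrite (le_trans (ler_distD (z n) _ _))// lerD//; [rewrite distrC|have [] := zP n].
exists l; split=> //; have FPl := PhiF El rl.
suff Z0 : Zi (Phi l) = 0 by have [_ <-] := FZ _ FPl; rewrite Z0 -Zi0 (FZ _ F0_0).2.
have q01 : 0 <= c * k < 1 by rewrite ck0.
apply/eqP; rewrite -normr_le0; apply/ler_addgt0Pl => e e0.
have e2 : 0 < e / 2 by rewrite divr_gt0.
have /cvgr_normP/(_ _ e2) [n _ hn] := zl.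
have hn0 := hn n (leqnn _); have hn1 := hn n.+1 (leqnSn n).
have [[En _ _] rn] := zP n.
have := contraction_step El En rl rn; rewrite ZiB//; last exact: PhiF.
have -> : l - z n - (Zi (Phi l) - Zi (Phi (z n))) = (l - z n.+1) - Zi (Phi l).
  by rewrite zS; lincomb_eq.
move=> h; rewrite addr0 -[Zi _](subKr (l - z n.+1)) (le_trans (ler_normB _ _))//.
rewrite [leRHS]splitr lerD//; first by rewrite distrC.
rewrite (le_trans h)//= (le_trans (ler_piMl _ (ltW ck)))// distrC.
exact: hn0.
Qed.

End OneEquation.

(* [M] is the set in which the solution [zeta p] is unique; near the base point
   the fixed point found by contraction must coincide with it. *)
Lemma implicit_near (T : Type) (F : set_system T) (FF : Filter F)
    (Phi : T -> V -> W) (z0 : V) (rho : R) (M : set V) (zeta : T -> V) :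
  E0 z0 -> 0 < rho ->
  (forall z, E0 z -> `|z - z0| <= rho -> M z) ->
  (\forall p \near F, (forall z, E0 z -> `|z - z0| <= rho -> F0 (Phi p z)) /\
     forall z' z'', E0 z' -> E0 z'' -> `|z' - z0| <= rho -> `|z'' - z0| <= rho ->
       `|Phi p z' - Phi p z'' - Z (z' - z'')| <= k * `|z' - z''|) ->
  (fun p => Phi p z0) @ F --> 0 ->
  (\forall p \near F, forall z, M z -> Phi p z = 0 -> z = zeta p) ->
  \forall p \near F, [/\ E0 (zeta p), `|zeta p - z0| <= rho &
    `|zeta p - z0| <= c / (1 - c * k) * `|Phi p z0|].
Proof.
move=> Ez0 rho0 Mz PhiP Phi0 Puniq.
have ck1 : 0 < 1 - c * k by rewrite subr_gt0.
have e0 : 0 < (1 - c * k) * rho / c by rewrite divr_gt0// mulr_gt0.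
have /cvgr_normP/(_ _ e0) hs := Phi0.
apply: filterS3 PhiP hs Puniq => p [PF Pk] hp hu.
rewrite subr0 ler_pdivlMr// mulrC in hp.
have [z [Ez zr Pz]] := contraction_zero Ez0 PF Pk (ltW rho0) hp.
rewrite -(hu z (Mz z Ez zr) Pz); split=> //.
have rr : `|z0 - z0| <= rho by rewrite subrr normr0 ltW.
by have := contraction_dist PF Pk Ez Ez0 zr rr; rewrite Pz sub0r normrN.
Qed.

End Implicit.

Section DerivativeUniqueness.
Context {R : realType} {V W : normedModType R}.

(** Conditions 2 speak of some Frechet derivative L, whereas the C^k hypothesis provides the forms
    T. The two are identified on E0, whose directions are those in which N contains a ball around p;
    in other directions a derivative relative to N need not be unique. *)
Lemma frechet_within_unique (N E E0 : set V) (g : V -> W) (p : V) (L L' : V -> W) :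
  E0 `<=` E -> E 0 -> (forall a : R, forall h, E0 h -> E0 (a *: h)) ->
  (exists2 r : R, 0 < r & forall h, E0 h -> `|h| < r -> N (p + h)) ->
  bounded_linear_on E L ->
  (forall a h, E0 h -> L' (a *: h) = a *: L' h) ->
  (forall e : R, 0 < e -> \forall z \near within N (nbhs p),
     `|g z - g p - L (z - p)| <= e * `|z - p|) ->
  (forall e : R, 0 < e -> \forall z \near within N (nbhs p), E0 (z - p) ->
     `|g z - g p - L' (z - p)| <= e * `|z - p|) ->
  forall h, E0 h -> L h = L' h.
Proof.
move=> EE E_0 E0Z [r r0 hN] [Llin _] L'Z gL gL' h Eh.
have L0 : L 0 = 0.
  by have := Llin (-1) 0 0 E_0 E_0; rewrite scaler0 addr0 scaleN1r addNr.
have LZ a : L (a *: h) = a *: L h.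
  by rewrite -[X in L X = _]addr0 Llin ?L0 ?addr0//; exact: EE.
have [->|hn0] := eqVneq h 0.
  by rewrite L0; have := L'Z 0 h Eh; rewrite !scale0r.
have nh0 : 0 < `|h| by rewrite normr_gt0.
apply/eqP; rewrite -subr_eq0 -normr_le0; apply/ler_addgt0Pl => e e0.
have e1 : 0 < e / 2 / `|h| by rewrite !divr_gt0.
have : \forall z \near within N (nbhs p), `|g z - g p - L (z - p)| <= e / 2 / `|h| * `|z - p| /\
   (E0 (z - p) -> `|g z - g p - L' (z - p)| <= e / 2 / `|h| * `|z - p|).
  exact: filterI (gL _ e1) (gL' _ e1).
move=> /near_withinP[d d0 hd].
pose s := Order.min r d / 2 / `|h|.
have m0 : 0 < Order.min r d by rewrite lt_min r0.
have s0 : 0 < s by rewrite !divr_gt0.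
have nsh : `|s *: h| = Order.min r d / 2 by rewrite normrZ gtr0_norm// divfK ?lt0r_neq0.
have m2 : Order.min r d / 2 < Order.min r d by lra.
have shr : `|s *: h| < r by rewrite nsh (lt_le_trans m2)// ge_min lexx.
have shd : `|s *: h| < d by rewrite nsh (lt_le_trans m2)// ge_min lexx orbT.
have shp : p + s *: h - p = s *: h by rewrite addrAC subrr add0r.
have [||] := hd (p + s *: h); [by apply: hN => //; exact: E0Z|by rewrite shp|].
rewrite shp LZ L'Z// => h1 h2.
have {}h2 := h2 (E0Z _ _ Eh).
rewrite addr0 -(ler_pM2l s0) -[X in X * `|_|](gtr0_norm s0) -normrZ.
have -> : s *: (L h - L' h) = (g (p + s *: h) - g p - s *: L' h) - (g (p + s *: h) - g p - s *: L h).
  by lincomb_eq.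
rewrite (le_trans (ler_normB _ _))// (le_trans (lerD h2 h1))// normrZ gtr0_norm//.
by rewrite le_eqVlt; apply/orP; left; apply/eqP; field; rewrite lt0r_neq0.
Qed.

(** The mean value inequality is applied to s -> g (a + s (b - a)) - s w. When w is the value of the
    derivative at a base point, the result expresses strict differentiability. *)
Lemma segment_increment (N : set V) (g : V -> W) (dg : V -> V -> W) (a b : V)
    (w : W) (K : R) :
  (forall s : R, 0 <= s <= 1 -> N (a + s *: (b - a))) ->
  (forall p q : R, 0 <= p <= 1 -> dg (a + p *: (b - a)) (q *: (b - a)) = q *: dg (a + p *: (b - a)) (b - a)) ->
  (forall s : R, 0 <= s <= 1 -> forall e : R, 0 < e ->
     \forall z \near within N (nbhs (a + s *: (b - a))),
     `|g z - g (a + s *: (b - a)) - dg (a + s *: (b - a)) (z - (a + s *: (b - a)))|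
        <= e * `|z - (a + s *: (b - a))|) ->
  (forall s : R, 0 <= s <= 1 -> `|dg (a + s *: (b - a)) (b - a) - w| <= K) ->
  `|g b - g a - w| <= K.
Proof.
move=> Nseg dgZ gd dK.
pose x (s : R) := a + s *: (b - a).
pose phi (s : R) := g (x s) - s *: w.
have -> : g b - g a - w = phi 1 - phi 0.
  rewrite /phi /x !scale1r !scale0r addr0 subr0 subrKC.
  by lincomb_eq.
have := @mean_value_inequality R W phi (fun s => dg (x s) (b - a) - w) 0 1 K ler01.
rewrite subr0 mulr1; apply=> // t t01.
have nba : 0 < `|b - a| + 1 by rewrite ltr_wpDl.
apply: deriv_withinB; last first.
  move=> e e0; apply: nearW => s.
  have -> : s *: w - t *: w - (s - t) *: w = 0 by lincomb_eq.
  by rewrite normr0 mulr_ge0// ltW.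
move=> e e0; have /near_withinP[d d0 hd] := gd t t01 _ (divr_gt0 e0 nba).
apply/near_withinP; exists (d / (`|b - a| + 1)); first by rewrite divr_gt0.
move=> s /in_itvccP s01 st.
have xst : x s - x t = (s - t) *: (b - a) by rewrite /x; lincomb_eq.
have := hd (x s) (Nseg s s01); rewrite -/(x t) xst (dgZ t _ t01) normrZ => h.
rewrite (le_trans (h _))//.
  rewrite (le_lt_trans (_ : _ <= `|s - t| * (`|b - a| + 1)))//.
    by rewrite ler_wpM2l// lerDl.
  by rewrite -ltr_pdivlMr.
rewrite mulrAC ler_pdivrMr// mulrA ler_wpM2l//; first by rewrite mulr_ge0// ltW.
by rewrite lerDl.
Qed.

End DerivativeUniqueness.

(** * Smoothness of implicitly defined curves *)

Section ImplicitCurve.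
Context {R : realType} {X Y : completeNormedModType R}.
Local Notation J := (Rplus R).
Variables (N E E0 : set X) (F0 : set Y) (k : nat) (g : R * X -> Y)
  (T : R * X -> seq (R * X) -> Y) (Q : Y -> Y) (K : X -> Y).
Implicit Types t : R.
Let NN : set (R * X) := J `*` N.
Let EE : set (R * X) := [set: R] `*` E.
Hypothesis k_gt0 : (0 < k)%N.
Hypothesis NE : N `<=` E.
Hypothesis E_0 : E 0.
Hypothesis EP : forall (a : R) x y, E x -> E y -> E (a *: x + y).
Hypothesis E0E : E0 `<=` E.
Hypothesis E0cl : closed E0.
Hypothesis E0_0 : E0 0.
Hypothesis E0P : forall (a : R) x y, E0 x -> E0 y -> E0 (a *: x + y).
Hypothesis bQ : bounded_linear_on setT Q.
Hypothesis QF : forall y, F0 (Q y).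
Hypothesis Qid : forall y, F0 y -> Q y = y.
Hypothesis bK : bounded_linear_on setT K.
Hypothesis Tg : forall p, NN p -> T p [::] = g p.
Hypothesis Tlin : forall p vs1 vs2 (a : R) u v, NN p ->
  (size vs1 + size vs2 < k)%N ->
  (forall w, w \in vs1 ++ u :: v :: vs2 -> EE w) ->
  T p (vs1 ++ (a *: u + v) :: vs2) = a *: T p (vs1 ++ u :: vs2) + T p (vs1 ++ v :: vs2).
Hypothesis Tbound : forall p j, NN p -> (j <= k)%N -> exists C : R, forall vs,
  size vs = j -> (forall w, w \in vs -> EE w) -> `|T p vs| <= C * normprod vs.
Hypothesis Tdiff : forall p j, NN p -> (j < k)%N -> forall e : R, 0 < e ->
  \forall z \near within NN (nbhs p), forall vs,
    size vs = j -> (forall w, w \in vs -> EE w) ->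
    `|T z vs - T p vs - T p ((z - p) :: vs)| <= e * `|z - p| * normprod vs.
Hypothesis Tcont : forall p j, NN p -> (j <= k)%N -> forall e : R, 0 < e ->
  \forall z \near within NN (nbhs p), forall vs,
    size vs = j -> (forall w, w \in vs -> EE w) ->
    `|T z vs - T p vs| <= e * normprod vs.

Let EE0 : EE 0.
Proof. by split. Qed.

Let EEP (a : R) x y : EE x -> EE y -> EE (a *: x + y).
Proof. by move=> [_ hx] [_ hy]; split=> //; exact: EP. Qed.

Let EB u w : E u -> E w -> E (u - w).
Proof. by move=> Eu Ew; rewrite -scaleN1r addrC; exact: EP. Qed.

Let E0B u w : E0 u -> E0 w -> E0 (u - w).
Proof. by move=> Eu Ew; rewrite -scaleN1r addrC; exact: E0P. Qed.

Let F0P (a : R) x y : F0 x -> F0 y -> F0 (a *: x + y).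
Proof. by move=> /Qid <- /Qid <-; rewrite -(blinP bQ); exact: QF. Qed.

Let F0_0 : F0 0.
Proof. by rewrite -(blin0 bQ); exact: QF. Qed.

Lemma normprod1 (V : normedModType R) (v : V) : normprod [:: v] = `|v|.
Proof. by rewrite /normprod big_seq1. Qed.

Lemma norm_pair0 (x : X) : `|((0 : R), x)| = `|x|.
Proof. by rewrite prod_normE /= normr0 max_r. Qed.

Let EE1 h : E h -> forall w, w \in [:: ((0 : R), h)] -> EE w.
Proof. by move=> Eh w; rewrite inE => /eqP ->. Qed.

Let T1lin p (a : R) u v : NN p -> E u -> E v ->
  T p [:: ((0 : R), a *: u + v)] = a *: T p [:: ((0 : R), u)] + T p [:: ((0 : R), v)].
Proof.
move=> Np Eu Ev; have := @Tlin p [::] [::] a ((0 : R), u) ((0 : R), v) Np k_gt0.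
have -> : a *: ((0 : R), u) + ((0 : R), v) = ((0 : R), a *: u + v).
  by congr (_, _); rewrite /= ?mulr0 ?scaler0 ?addr0.
by apply=> w; rewrite /= !inE => /orP[]/eqP ->.
Qed.

Let T1_0 p : NN p -> T p [:: ((0 : R), 0)] = 0.
Proof.
by move=> Np; have := T1lin (-1) Np E_0 E_0; rewrite scaler0 addr0 scaleN1r addNr.
Qed.

Let T1Z p (a : R) u : NN p -> E u -> T p [:: ((0 : R), a *: u)] = a *: T p [:: ((0 : R), u)].
Proof. by move=> Np Eu; rewrite -[a *: u]addr0 T1lin// T1_0// addr0. Qed.

Let T1B p u v : NN p -> E u -> E v ->
  T p [:: ((0 : R), u - v)] = T p [:: ((0 : R), u)] - T p [:: ((0 : R), v)].
Proof.
by move=> Np Eu Ev; rewrite -scaleN1r addrC T1lin// scaleN1r addrC.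
Qed.

Let slice t (y : X) (P : R * X -> Prop) : 0 <= t ->
  (\forall z \near within NN (nbhs (t, y)), P z) ->
  \forall z \near within N (nbhs y), P (t, z).
Proof.
move=> t0 /near_withinP[d d0 hd]; apply/near_withinP; exists d => // z Nz zy.
by apply: hd => //; rewrite prod_normE /= subrr normr0 max_r.
Qed.

Lemma Ck_slice_deriv t (y : X) : 0 <= t -> N y -> forall e : R, 0 < e ->
  \forall z \near within N (nbhs y),
    `|g (t, z) - g (t, y) - T (t, y) [:: ((0 : R), z - y)]| <= e * `|z - y|.
Proof.
move=> t0 Ny e e0; have Np : NN (t, y) by [].
apply: filterS2 (near_within_self N y) (slice t0 (Tdiff Np k_gt0 e0)) => z Nz.
move=> /(_ [::] erefl (fun w => ltac:(by []))).
have -> : (t, z) - (t, y) = ((0 : R), z - y) by congr (_, _); rewrite /= subrr.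
by rewrite !Tg// norm_pair0 /normprod big_nil mulr1.
Qed.

(** Joint continuity of the first derivative in (t, x) makes the estimate uniform for t near t0
    while the derivative stays frozen at the base point. *)
Lemma Ck_strict_diff (t0 : R) (y0 : X) (e : R) : 0 <= t0 -> N y0 -> 0 < e ->
  exists2 d : R, 0 < d & forall t a b, 0 <= t -> `|t - t0| < d ->
    (forall s : R, 0 <= s <= 1 -> N (a + s *: (b - a)) /\ `|a + s *: (b - a) - y0| < d) ->
    `|g (t, b) - g (t, a) - T (t0, y0) [:: ((0 : R), b - a)]| <= e * `|b - a|.
Proof.
move=> t00 Ny0 e0; have Np : NN (t0, y0) by [].
have /near_withinP[d d0 hd] := Tcont Np k_gt0 e0.
exists d => // t a b tJ td seg.
have Nseg s : 0 <= s <= 1 -> N (a + s *: (b - a)) by move=> /seg[].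
have Ea : E a by apply: NE; have := Nseg 0; rewrite scale0r addr0 lexx ler01; apply.
have Eb : E b by apply: NE; have := Nseg 1; rewrite scale1r subrKC lexx ler01; apply.
have Eba := EB Eb Ea.
have NNs s : 0 <= s <= 1 -> NN (t, a + s *: (b - a)) by move=> /Nseg.
apply: (@segment_increment R X Y N (fun x => g (t, x)) (fun y h => T (t, y) [:: ((0 : R), h)])) => //.
- by move=> p q p01; apply: T1Z => //; exact: NNs.
- by move=> s s01 e' e'0; apply: Ck_slice_deriv => //; exact: Nseg.
- move=> s s01.
  have := hd (t, a + s *: (b - a)) (NNs s s01); rewrite prod_normE /= gt_max td.
  case: (seg s s01) => _ -> /(_ isT)/(_ [:: ((0 : R), b - a)] erefl (EE1 Eba)).
  by rewrite normprod1 norm_pair0.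
Qed.

Section AlongCurve.
Variable c : R -> R * X.
Hypothesis cN : forall t, 0 <= t -> NN (c t).

Let Jop t h := T (c t) [:: ((0 : R), h)] - K h.

Hypothesis inv : forall t, 0 <= t -> boundedly_invertible E0 F0 (Jop t).

Let JopB t u v : 0 <= t -> E u -> E v -> Jop t (u - v) = Jop t u - Jop t v.
Proof.
move=> t0 Eu Ev; rewrite /Jop T1B//; last exact: cN.
by rewrite (blinB bK); lincomb_eq.
Qed.

(** Composition with the projector Q extends the inverse, which is controlled on F0 only, to a
    bounded operator on all of Y. *)
Lemma right_inverse t : 0 <= t -> exists S : Y -> X,
  [/\ bounded_linear_on setT S, forall y, E0 (S y), forall h, E0 h -> S (Jop t h) = h,
      forall y, Jop t (S y) = Q y & forall y, S (Q y) = S y].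
Proof.
move=> t0; have [Ji [JF FJ [Jlin [C JC]]]] := inv t0.
have [CQ CQ0 hQ] := blin_bound bQ.
exists (Ji \o Q); split=> //=.
- split=> [a x y _ _|]; first by rewrite /= (blinP bQ) Jlin.
  exists (`|C| * CQ) => x _; rewrite (le_trans (JC _ (QF x)))// -mulrA.
  by rewrite (le_trans (ler_wpM2r _ (ler_norm C)))// ler_wpM2l.
- by move=> y; have [] := FJ _ (QF y).
- by move=> h Eh; have [Fh Jh] := JF _ Eh; rewrite Qid.
- by move=> y; have [] := FJ _ (QF y).
- by move=> y; rewrite [Q (Q y)]Qid.
Qed.

Lemma linear_curve_cvg (u : R -> X) (b : R -> Y) t : 0 <= t ->
  c @ within J (nbhs t) --> c t ->
  (forall t, 0 <= t -> E0 (u t) /\ Jop t (u t) = Q (b t)) ->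
  b @ within J (nbhs t) --> b t -> u @ within J (nbhs t) --> u t.
Proof.
move=> t0 cc uP bc; have [S [bS SE SJ _ _]] := right_inverse t0.
have [C C0 hC] := blin_bound bS.
apply/cvgr_normP => d d0.
have n0 : 0 < `|u t| + d by rewrite ltr_wpDl.
(* The error is proportional to |u s|, which is at most |u t| + |u s - u t|; with this constant the
   part containing |u s - u t| is absorbed on the left. *)
have e0 : 0 < d / 4 / (`|u t| + d) / C by rewrite !divr_gt0.
have h1 := near_curve t0 cN cc (Tcont (cN t0) k_gt0 e0).
have d4 : 0 < d / 4 / C by rewrite !divr_gt0.
have h0 : (Q \o b) @ within J (nbhs t) --> Q (b t) by apply: blin_cvg.
have /cvgr_normP/(_ _ d4) h2 := h0.
apply: filterS3 h1 h2 (near_within_self J t) => s h1 h2 Js.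
have [Eus Jus] := uP s Js; have [Eut Jut] := uP t t0.
have := h1 [:: ((0 : R), u s)] erefl (EE1 (E0E Eus)); rewrite normprod1 norm_pair0 => {}h1.
have Jd : Jop t (u s - u t) = (Q (b s) - Q (b t)) -
    (T (c s) [:: ((0 : R), u s)] - T (c t) [:: ((0 : R), u s)]).
  by rewrite JopB ?Jut; [rewrite -Jus /Jop; lincomb_eq|exact: t0|exact: E0E|exact: E0E].
have us : `|u s| <= `|u t| + `|u s - u t|.
  by rewrite -{1}(subrK (u t) (u s)) addrC ler_normD.
have := hC (Jop t (u s - u t)); rewrite SJ; last exact: E0B.
rewrite Jd => /le_trans/(_ (ler_wpM2l (ltW C0) (ler_normB _ _))).
move=> /le_trans/(_ (ler_wpM2l (ltW C0) (lerD h2 h1))).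
have -> : C * (d / 4 / C + d / 4 / (`|u t| + d) / C * `|u s|) =
    d / 4 + d / 4 / (`|u t| + d) * `|u s| by field; rewrite !lt0r_neq0.
have : d / 4 / (`|u t| + d) * `|u s| <= d / 4 + `|u s - u t| / 4.
  rewrite mulrAC ler_pdivrMr// (le_trans (ler_wpM2l _ us))//; first by lra.
  have := normr_ge0 (u t); have := normr_ge0 (u s - u t).
  set p := `|u t|; set q := `|u s - u t| => q0 p0; nra.
by lra.
Qed.

(** Formal differentiation of Jop t (u t) = Q (b t) gives the value. The error [err] is a difference
    of operators of size O(s - t) applied to u s - u t, which tends to 0 by continuity of u; so it
    is o(s - t). *)
Lemma linear_curve_deriv (u : R -> X) (b : R -> Y) (c1 : R * X) (b1 : Y) t : 0 <= t ->
  (1 < k)%N -> Ccurve EE 0 c -> EE c1 -> deriv_within J c t c1 -> deriv_within J b t b1 ->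
  u @ within J (nbhs t) --> u t ->
  (forall t, 0 <= t -> E0 (u t) /\ Jop t (u t) = Q (b t)) ->
  forall S : Y -> X, bounded_linear_on setT S -> (forall h, E0 h -> S (Jop t h) = h) ->
  (forall y, S (Q y) = S y) ->
  deriv_within J u t (S (b1 - T (c t) [:: c1; ((0 : R), u t)])).
Proof.
move=> t0 k1 cC Ec1 cd bd uc uP S bS SJ SQ.
have [Eut Jut] := uP t t0.
pose u0 := ((0 : R), u t).
have EEu0 : EE u0 by split=> //; exact: E0E.
have Tu0 : deriv_within J (fun s => T (c s) [:: u0]) t (T (c t) [:: c1; u0]).
  have u0C : curves EE 0 [:: fun=> u0] by split=> //; exact: (Ccurve_cst 0 EEu0 EE0).
  have z_in : all_in EE [:: 0] by move=> w; rewrite inE => /eqP ->.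
  have zd i : (i < 1)%N -> deriv_within J (nth (fun=> 0) [:: fun=> u0] i) t (nth 0 [:: 0] i).
    by case: i => // _; exact: deriv_within_cst.
  have := Ck_chain_deriv EE0 EEP Tlin Tbound Tdiff (vs := [:: fun=> u0]) t0 k1 cC cN u0C Ec1 z_in erefl cd zd.
  rewrite /= addr0; have -> : T (c t) [:: 0] = 0 by apply: T1_0; exact: cN.
  by rewrite addr0.
pose w s := Q (b s) - T (c s) [:: u0].
have wd : deriv_within J w t (Q b1 - T (c t) [:: c1; u0]).
  by apply: deriv_withinB => //; exact: (deriv_within_blin bQ bd).
pose err s := T (c s) [:: ((0 : R), u s - u t)] - T (c t) [:: ((0 : R), u s - u t)].
have errt : err t = 0 by rewrite /err [LHS]subrr.
have [M M0 hM] : exists2 M : R, 0 < M & \forall s \near within J (nbhs t),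
    `|err s| <= M * `|s - t| * `|u s - u t|.
  have mT := Ck_multilinear Tlin Tbound (cN t0) k1.
  have [C C0 hC] := multilinear_bound mT.
  have K0 : 0 < `|c1| + 1 by rewrite ltr_wpDl.
  exists ((C + 1) * (`|c1| + 1)); first by rewrite mulr_gt0// addr_gt0.
  have h1 := near_curve t0 cN (Ccurve_cvg cC t0) (Tdiff (cN t0) k1 ltr01).
  have h2 : \forall s \near within J (nbhs t), `|c s - c t| <= (`|c1| + 1) * `|s - t|.
    by apply: deriv_within_lip cd _; rewrite ltrDl.
  apply: filterS3 h1 h2 (near_within_self J t) => s h1 h2 Js.
  have [Eus _] := uP s Js; have Ed := EE1 (E0E (E0B Eus Eut)).
  have := h1 [:: ((0 : R), u s - u t)] erefl Ed; rewrite normprod1 norm_pair0 mul1r => {}h1.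
  have Edc : EE (c s - c t) by split=> //; apply: EB; apply: NE; [case: (cN Js)|case: (cN t0)].
  have h3 : `|T (c t) [:: c s - c t; ((0 : R), u s - u t)]| <= C * (`|c s - c t| * `|u s - u t|).
    have := hC [:: c s - c t; ((0 : R), u s - u t)] erefl.
    rewrite normprod_cons normprod1 norm_pair0; apply=> z; rewrite inE => /orP[/eqP->//|].
    exact: Ed.
  rewrite /err -[X in `|X|](subrK (T (c t) [:: c s - c t; ((0 : R), u s - u t)])).
  rewrite (le_trans (ler_normD _ _))// (le_trans (lerD h1 h3))//.
  rewrite -{1}[_ * `|u s - u t|]mul1r -mulrDl addrC -!mulrA ler_pM2l ?addr_gt0// mulrA.
  by rewrite ler_wpM2r.
have errd : deriv_within J err t 0.
  move=> e e0; have /cvgr_normP/(_ _ (divr_gt0 e0 M0)) hu := uc.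
  apply: filterS2 hu hM => s hu hM'; rewrite errt scaler0 !subr0 (le_trans hM')//.
  by rewrite mulrAC ler_wpM2r// mulrC -ler_pdivlMr.
have uE s : J s -> S (w s) - S (w t) - S (err s) + u t = u s.
  move=> Js; have [Eus Jus] := uP s Js.
  rewrite -!(blinB bS).
  have : S (Jop t (u s - u t)) = u s - u t by apply: SJ; exact: E0B.
  rewrite JopB ?Jut; [move=> SJd|exact: t0|exact: E0E|exact: E0E].
  have -> : w s - w t - err s = Jop t (u s) - Q (b t).
    rewrite /w /err -Jus (T1B (cN Js) (E0E Eus) (E0E Eut)).
    rewrite (T1B (cN t0) (E0E Eus) (E0E Eut)).
    by rewrite /Jop /u0; lincomb_eq.
  by rewrite SJd subrK.
rewrite [S _](_ : _ = S (Q b1 - T (c t) [:: c1; u0]) - 0 - S 0 + 0); last first.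
  by rewrite (blin0 bS) !subr0 addr0 !(blinB bS) SQ.
apply: (eq_deriv_within _ uE) => //.
apply: deriv_withinD; last exact: deriv_within_cst.
apply: deriv_withinB; last exact: (deriv_within_blin bS errd).
apply: deriv_withinB; last exact: deriv_within_cst.
exact: (deriv_within_blin bS wd).
Qed.

(** The derivative of u solves a linear equation with the same operator and a new right-hand side,
    so induction applies. One order of T is spent on the operator itself, hence 1 + m <= k. *)
Lemma linear_curve m (u : R -> X) (b : R -> Y) : (1 + m <= k)%N -> Ccurve EE m c ->
  (forall t, 0 <= t -> E0 (u t) /\ Jop t (u t) = Q (b t)) ->
  Ccurve setT m b -> Ccurve E0 m u.
Proof.
elim: m u b => [|m IH] u b mk cC uP bC.
  split=> t t0; first by have [] := uP t t0.
  by apply: (linear_curve_cvg t0 _ uP); [exact: Ccurve_cvg cC t0|exact: Ccurve_cvg bC t0].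
have cC0 := CcurveW (leq0n m.+1) cC; have cCm := CcurveW (leqnSn m) cC.
have bCm := CcurveW (leqnSn m) bC.
have uCm : Ccurve E0 m u by apply: IH bCm => //; exact: ltnW.
case: (cC) => _ [c1 c1P c1C]; case: (bC) => _ [b1 b1P b1C].
pose rhs t := b1 t - T (c t) [:: c1 t; ((0 : R), u t)].
have exS t : exists S : Y -> X, 0 <= t -> [/\ bounded_linear_on setT S, forall y, E0 (S y), forall h, E0 h -> S (Jop t h) = h,
      forall y, Jop t (S y) = Q y & forall y, S (Q y) = S y].
  have [/right_inverse[S ?]|_] := boolP (0 <= t); first by exists S.
  by exists (fun=> 0).
have [S SP] := choice exS.
split; first by move=> t t0; have [] := uP t t0.
exists (fun t => S t (rhs t)) => [t t0|].
  have [bS SE SJ JS SQ] := SP t t0.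
  apply: (linear_curve_deriv t0 _ cC0 _ (c1P t t0) (b1P t t0) _ uP bS SJ SQ) => //.
  - by rewrite (leq_trans _ mk).
  - exact: Ccurve_in c1C t0.
  - exact: Ccurve_cvg uCm t0.
apply: (IH _ rhs) => //; first exact: ltnW.
  by move=> t t0; have [bS SE SJ JS SQ] := SP t t0.
apply: CcurveD => //.
have u0C : Ccurve EE m (fun t => ((0 : R), u t)).
  apply: Ccurve_pair; first exact: Ccurve_cst.
  exact: Ccurve_subset uCm.
have := @Ck_chain R _ _ NN EE k T EE0 EEP Tlin Tbound Tdiff Tcont m [:: c1; fun t => ((0 : R), u t)] c.
move=> /(_ _ cCm cN) h.
apply: (@Ccurve_blin _ _ _ setT setT m (fun t => T (c t) [:: c1 t; ((0 : R), u t)]) -%R) => //.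
  split=> [a x y _ _|]; first by rewrite opprD scalerN.
  by exists 1 => x _; rewrite normrN mul1r.
by apply: h => //; rewrite (leq_trans _ mk)//.
Qed.

End AlongCurve.

Section Solution.
Variables (M0 : set X) (kap eta : R -> X) (lam : R -> Y).
Hypothesis M0E0 : M0 `<=` E0.
Hypothesis M0open : forall z, M0 z -> exists2 r : R, 0 < r &
  forall z', E0 z' -> `|z' - z| < r -> M0 z'.
Hypothesis kapC : Ccurve E k kap.
Hypothesis lamC : Ccurve setT k lam.
Hypothesis kapN : forall t z, 0 <= t -> M0 z -> N (kap t + z).
Hypothesis valF : forall t z, 0 <= t -> M0 z -> F0 (g (t, kap t + z) - K z - lam t).
Hypothesis etaP : forall t, 0 <= t -> M0 (eta t) /\ g (t, kap t + eta t) = K (eta t) + lam t.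
Hypothesis etaU : forall t z, 0 <= t -> M0 z -> g (t, kap t + z) = K z + lam t -> z = eta t.
Hypothesis derinv : forall t, 0 <= t -> exists L : X -> Y,
  frechet_within N E (fun x => g (t, x)) (kap t + eta t) L /\
  boundedly_invertible E0 F0 (fun h => L h - K h).

Let c t : R * X := (t, kap t + eta t).

Let cN t : 0 <= t -> NN (c t).
Proof. by move=> t0; split=> //; apply: kapN => //; case: (etaP t0). Qed.

Let E0Z (a : R) h : E0 h -> E0 (a *: h).
Proof. by move=> Eh; rewrite -[a *: h]addr0; exact: E0P. Qed.

Let inv t : 0 <= t -> boundedly_invertible E0 F0 (fun h => T (c t) [:: ((0 : R), h)] - K h).
Proof.
move=> t0; have [L [[bL gL] [Li [h1 h2 h3]]]] := derinv t0; have [Met _] := etaP t0.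
have LT h : E0 h -> L h = T (c t) [:: ((0 : R), h)].
  apply: (@frechet_within_unique R X Y N E E0 (fun x => g (t, x)) (kap t + eta t) L
    (fun h => T (c t) [:: ((0 : R), h)])) => //.
  - have [r r0 hr] := M0open Met; exists r => // h' Eh' hr'.
    rewrite -addrA; apply: kapN => //; apply: hr; last by rewrite addrAC subrr add0r.
    by rewrite -[eta t]scale1r; apply: E0P => //; exact: M0E0.
  - by move=> a h' Eh'; apply: T1Z; [exact: cN|exact: E0E].
  - move=> e e0; have := Ck_slice_deriv t0 (kapN t0 Met) e0.
    by apply: filterS => z hz _.
exists Li; split=> //.
- by move=> h Eh; rewrite -LT//; exact: h1.
- by move=> y Fy; have [Ey Ly] := h2 y Fy; split=> //; rewrite -LT.
Qed.

(** For t near t0 the contraction around eta t0 produces a zero close to eta t0, and uniqueness in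
    M0 identifies it with eta t. *)
Let eta_cvg t0 : 0 <= t0 -> eta @ within J (nbhs t0) --> eta t0.
Proof.
move=> t00; have [Met geta] := etaP t00; have Eet := M0E0 Met.
have [Zi ZiP] := inv t00; have [_ _ [_ [C0 hC0]]] := ZiP.
pose C := `|C0| + 1; have Cp : 0 < C by rewrite ltr_wpDl.
have hC y : F0 y -> `|Zi y| <= C * `|y|.
  move=> Fy; rewrite (le_trans (hC0 _ Fy))// ler_wpM2r//.
  by rewrite (le_trans (ler_norm _))// lerDl.
pose q := 2^-1 / C; have q0 : 0 < q by rewrite divr_gt0// invr_gt0.
have Cq : C * q < 1 by rewrite /q mulrC divfK ?lt0r_neq0//; lra.
have [d d0 hd] := Ck_strict_diff t00 (kapN t00 Met) q0.
have [r r0 hr] := M0open Met.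
(* kap moves by at most d / 4 and z by at most rho <= d / 4, so the segments stay in the ball of
   radius d where the derivative varies little; rho < r keeps them in M0. *)
pose rho := Order.min r d / 4.
have m0 : 0 < Order.min r d by rewrite lt_min r0.
have rho0 : 0 < rho by rewrite divr_gt0.
have rhor : rho < r by rewrite (lt_le_trans (_ : _ < Order.min r d)) ?ge_min ?lexx// /rho; lra.
have rhod : rho <= d / 4 by rewrite /rho ler_pM2r ?invr_gt0// ge_min lexx orbT.
have Mz z : E0 z -> `|z - eta t0| <= rho -> M0 z.
  by move=> Ez zr; apply: hr => //; exact: le_lt_trans zr rhor.
pose Phi t z := g (t, kap t + z) - K z - lam t.
have kc := Ccurve_cvg kapC t00.
have d4 : 0 < d / 4 by rewrite divr_gt0.
have /cvgr_normP/(_ _ d4) hk := kc.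
have Phi_near : \forall t \near within J (nbhs t0),
    (forall z, E0 z -> `|z - eta t0| <= rho -> F0 (Phi t z)) /\
    forall z' z'', E0 z' -> E0 z'' -> `|z' - eta t0| <= rho -> `|z'' - eta t0| <= rho ->
    `|Phi t z' - Phi t z'' - (T (c t0) [:: ((0 : R), z' - z'')] - K (z' - z''))|
      <= q * `|z' - z''|.
  apply: filterS3 hk (near_within_ball J t0 d0) (near_within_self J t0) => t hkt td Jt.
  split=> [z Ez zr|z' z'' E' E'' r' r'']; first by apply: valF => //; exact: Mz.
  have ba : kap t + z' - (kap t + z'') = z' - z'' by lincomb_eq.
  have := hd t (kap t + z'') (kap t + z') Jt td; rewrite ba => h.
  have -> : Phi t z' - Phi t z'' - (T (c t0) [:: ((0 : R), z' - z'')] - K (z' - z'')) =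
    g (t, kap t + z') - g (t, kap t + z'') - T (c t0) [:: ((0 : R), z' - z'')].
    by rewrite /Phi (blinB bK); lincomb_eq.
  apply: h => s /andP[s0 s1].
  have Es : E0 (z'' + s *: (z' - z'')) by rewrite addrC; apply: E0P => //; exact: E0B.
  have sr : `|z'' + s *: (z' - z'') - eta t0| <= rho.
    have -> : z'' + s *: (z' - z'') - eta t0 = (1 - s) *: (z'' - eta t0) + s *: (z' - eta t0).
      by lincomb_eq.
    rewrite (le_trans (ler_normD _ _))// !normrZ (ger0_norm s0) ger0_norm ?subr_ge0//.
    rewrite (le_trans (lerD (ler_wpM2l _ r'') (ler_wpM2l s0 r')))// ?subr_ge0//.
    by rewrite -mulrDl subrK mul1r.
  rewrite -addrA; split; first by apply: kapN => //; exact: Mz.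
  have -> : kap t + (z'' + s *: (z' - z'')) - (kap t0 + eta t0) =
    (kap t - kap t0) + (z'' + s *: (z' - z'') - eta t0) by lincomb_eq.
  by rewrite (le_lt_trans (ler_normD _ _))// (le_lt_trans (lerD hkt sr))//; lra.
have Phi0 : Phi t0 (eta t0) = 0 by rewrite /Phi geta; lincomb_eq.
have Phi_cvg : (fun t => Phi t (eta t0)) @ within J (nbhs t0) --> 0.
  rewrite -Phi0; apply: cvgB; last exact: Ccurve_cvg lamC t00.
  apply: cvgB; last exact: cvg_cst.
  pose b t : R * X := (t, kap t + eta t0).
  have bN t : 0 <= t -> NN (b t) by move=> tJ; split=> //; exact: kapN.
  have bc : b @ within J (nbhs t0) --> b t0.
    have h1 : (fun t : R => t) @ within J (nbhs t0) --> t0 by exact: cvg_within.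
    have h2 : (fun t => kap t + eta t0) @ within J (nbhs t0) --> kap t0 + eta t0.
      by apply: cvgD => //; exact: cvg_cst.
    exact: cvg_pair h1 h2.
  apply/cvgr_normP => e e0.
  have := near_curve t00 bN bc (Tcont (bN _ t00) (leq0n k) e0).
  apply: filterS2 (near_within_self J t0) => t Jt /(_ [::] erefl (fun w => ltac:(by []))).
  by rewrite /normprod big_nil mulr1 !Tg//; [exact: bN|exact: bN].
have etaN : \forall t \near within J (nbhs t0), forall z, M0 z -> Phi t z = 0 -> z = eta t.
  apply: filterS (near_within_self J t0) => t Jt z Mz' Pz; apply: etaU => //.
  by apply/eqP; rewrite -subr_eq0 opprD addrA -/(Phi t z) Pz.
have FF : Filter (within J (nbhs t0)) by exact: within_filter.
have := implicit_near E0cl E0P F0_0 F0P ZiP Cp hC (ltW q0) Cq FF Eet rho0 Mz Phi_near Phi_cvg etaN.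
move=> near_eta; apply/cvgr_normP => e e0.
have A0 : 0 < C / (1 - C * q) by rewrite divr_gt0// subr_gt0.
have /cvgr_normP/(_ _ (divr_gt0 e0 A0)) := Phi_cvg.
apply: filterS2 near_eta => t [_ _ ht]; rewrite subr0 => h.
by rewrite (le_trans ht)// mulrC -ler_pdivlMr.
Qed.

Let c_cvg t : 0 <= t -> c @ within J (nbhs t) --> c t.
Proof.
move=> t0; have h1 : (fun s : R => s) @ within J (nbhs t) --> t by exact: cvg_within.
have h2 : (fun t => kap t + eta t) @ within J (nbhs t) --> kap t + eta t.
  by apply: cvgD; [exact: Ccurve_cvg kapC t0|exact: eta_cvg].
exact: cvg_pair h1 h2.
Qed.

Let eta_deriv t (dk : X) (dl : Y) (S : Y -> X) : 0 <= t ->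
  E dk -> deriv_within J kap t dk -> deriv_within J lam t dl ->
  bounded_linear_on setT S ->
  (forall h, E0 h -> S (T (c t) [:: ((0 : R), h)] - K h) = h) ->
  deriv_within J eta t (S (dl - T (c t) [:: ((1 : R), dk)])).
Proof.
move=> t0 Edk kd ld bS SJ; have Nt := cN t0.
have [C C0 hC] := blin_bound bS.
have mT := Ck_multilinear Tlin Tbound Nt k_gt0.
pose u s : R * X := (s - t, kap s - kap t).
have ud : deriv_within J u t ((1 : R), dk).
  apply: deriv_within_pair.
    rewrite -[1 : R]subr0; apply: deriv_withinB; last exact: deriv_within_cst.
    exact: deriv_within_id.
  by rewrite -[dk]subr0; apply: deriv_withinB => //; exact: deriv_within_cst.
have kE s : J s -> E (kap s) by exact: Ccurve_in kapC.
have uC : curves EE 0 [:: u].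
  split=> //; split=> s s0; first by split=> //; apply: EB; exact: kE.
  have h1 : (fun r : R => r - t) @ within J (nbhs s) --> s - t.
    by apply: cvgB; [exact: cvg_within|exact: cvg_cst].
  have h2 : (fun r => kap r - kap t) @ within J (nbhs s) --> kap s - kap t.
    by apply: cvgB; [exact: Ccurve_cvg kapC s0|exact: cvg_cst].
  exact: cvg_pair h1 h2.
have Tu : deriv_within J (fun s => T (c t) [:: u s]) t (T (c t) [:: ((1 : R), dk)]).
  have nil_in : all_in EE [::] by [].
  have d_in : all_in EE [:: ((1 : R), dk)] by move=> w; rewrite inE => /eqP ->.
  have dP i : (i < 1)%N -> deriv_within J (nth (fun=> 0) [:: u] i) t (nth 0 [:: ((1 : R), dk)] i).
    by case: i.
  have := multilinear_deriv EE0 EEP mT t0 (ws := [::]) (vs := [:: u]) (dvs := [:: ((1 : R), dk)]) erefl erefl nil_in uC d_in dP.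
  by rewrite /= addr0.
pose w s := lam s - T (c t) [:: u s].
have wd : deriv_within J w t (dl - T (c t) [:: ((1 : R), dk)]) by exact: deriv_withinB.
pose err s := g (c s) - g (c t) - T (c t) [:: c s - c t].
have [Met geta] := etaP t0; have Eet := M0E0 Met.
have ET s : J s -> S (w s) - S (w t) - S (err s) + eta t = eta s.
  move=> Js; have [Mes getas] := etaP Js; have Ees := M0E0 Mes.
  have Ed := E0B Ees Eet; rewrite -!(blinB bS).
  have ccs : c s - c t = u s + ((0 : R), eta s - eta t).
    by rewrite /c /u; congr (_, _); rewrite /= ?addr0//; lincomb_eq.
  have Eu : EE (u s) by split=> //; apply: EB; exact: kE.
  have Tc : T (c t) [:: c s - c t] = T (c t) [:: u s] + T (c t) [:: ((0 : R), eta s - eta t)].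
    rewrite ccs; have := @Tlin (c t) [::] [::] 1 (u s) ((0 : R), eta s - eta t) Nt k_gt0.
    rewrite !scale1r; apply=> z; rewrite /= !inE => /orP[]/eqP -> //.
    by split=> //; exact: E0E.
  have Tt : T (c t) [:: u t] = 0.
    by rewrite /u !subrr; exact: T1_0.
  have -> : w s - w t - err s = T (c t) [:: ((0 : R), eta s - eta t)] - K (eta s - eta t).
    by rewrite /w Tt /err Tc /c getas geta (blinB bK); lincomb_eq.
  by rewrite SJ// subrK.
have ceta s : J s -> `|c s - c t| <= `|s - t| + `|kap s - kap t| + `|eta s - eta t|.
  move=> Js; rewrite prod_normE /= ge_max -addrA; apply/andP; split.
    by rewrite lerDl addr_ge0.
  have -> : kap s + eta s - (kap t + eta t) = (kap s - kap t) + (eta s - eta t) by lincomb_eq.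
  by rewrite (le_trans (ler_normD _ _))// lerDr.
have errN e : 0 < e -> \forall s \near within J (nbhs t), `|err s| <= e * `|c s - c t|.
  move=> e0; have := near_curve t0 cN (c_cvg t0) (Tdiff Nt k_gt0 e0).
  apply: filterS2 (near_within_self J t) => s Js /(_ [::] erefl (fun w => ltac:(by []))).
  by rewrite /normprod big_nil mulr1 !Tg//; exact: cN.
have [K1 K10 hK1] : exists2 K1 : R, 0 < K1 &
    \forall s \near within J (nbhs t), `|kap s - kap t| <= K1 * `|s - t|.
  exists (`|dk| + 1); first by rewrite ltr_wpDl.
  by apply: deriv_within_lip kd _; rewrite ltrDl.
pose dw := dl - T (c t) [:: ((1 : R), dk)].
have hK2 : \forall s \near within J (nbhs t), `|w s - w t| <= (`|dw| + 1) * `|s - t|.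
  by apply: deriv_within_lip wd _; rewrite ltrDl.
(* With the error constant 1 / (2 C) the contribution of [err] is at most half of |c s - c t| and is
   absorbed; this gives a Lipschitz bound for c at t before differentiability is known. *)
have [K4 K40 hK4] : exists2 K4 : R, 0 < K4 &
    \forall s \near within J (nbhs t), `|c s - c t| <= K4 * `|s - t|.
  have e0 : 0 < 2^-1 / C by rewrite divr_gt0// invr_gt0.
  pose K2 := `|dw| + 1; have K20 : 0 < K2 by rewrite ltr_wpDl.
  exists (1 + K1 + (2 * C * K2 + 1 + K1)).
    by rewrite !addr_gt0// !mulr_gt0.
  apply: filterS3 (filterI hK1 hK2) (errN _ e0) (near_within_self J t) => s [{}hK1 {}hK2] hE Js.
  have de : `|eta s - eta t| <= C * (K2 * `|s - t|) + C * (2^-1 / C * `|c s - c t|).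
    have -> : eta s - eta t = S (w s - w t) - S (err s).
      by apply/eqP; rewrite subr_eq; apply/eqP; rewrite -[LHS](ET s Js) (blinB bS (w s)).
    rewrite (le_trans (ler_normB _ _))// lerD// (le_trans (hC _))// ler_pM2l//.
  have := ceta s Js; move: de.
  have -> : C * (2^-1 / C * `|c s - c t|) = `|c s - c t| / 2 by field; rewrite lt0r_neq0.
  rewrite -/K2; move: hK1; set x1 := `|kap s - _|; set x2 := `|eta s - _|; set x3 := `|c s - _|.
  set x0 := `|s - t| => h1 h2 h3.
  have -> : (1 + K1 + (2 * C * K2 + 1 + K1)) * x0 = 2 * (C * (K2 * x0)) + 2 * x0 + 2 * (K1 * x0) by ring.
  by lra.
have errd : deriv_within J err t 0.
  move=> e e0.
  have errt : err t = 0.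
    rewrite /err !subrr sub0r (_ : T (c t) [:: 0] = 0) ?oppr0//; exact: T1_0.
  apply: filterS2 (errN _ (divr_gt0 e0 K40)) hK4 => s h h'.
  rewrite errt scaler0 !subr0 (le_trans h)// mulrAC ler_pdivrMr// -mulrA.
  by rewrite ler_pM2l// mulrC.
rewrite -/dw [S dw](_ : _ = S dw - 0 - S 0 + 0); last by rewrite (blin0 bS) !subr0 addr0.
apply: (eq_deriv_within _ ET) => //.
apply: deriv_withinD; last exact: deriv_within_cst.
apply: deriv_withinB; last exact: (deriv_within_blin bS errd).
apply: deriv_withinB; last exact: deriv_within_cst.
exact: (deriv_within_blin bS wd).
Qed.

(** The derivative of eta solves the linearised equation. If eta is C^m, then so is the right-hand
    side of that equation; [linear_curve] makes the derivative C^m, and eta is C^(m+1). *)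
Lemma implicit_curve : Ccurve E0 k eta.
Proof.
have exS t : exists S : Y -> X, 0 <= t -> [/\ bounded_linear_on setT S,
    forall y, E0 (S y), forall h, E0 h -> S (T (c t) [:: ((0 : R), h)] - K h) = h,
    forall y, T (c t) [:: ((0 : R), S y)] - K (S y) = Q y & forall y, S (Q y) = S y].
  have [t0|_] := boolP (0 <= t); last by exists (fun=> 0).
  by have [S ?] := right_inverse inv t0; exists S.
have [S SP] := choice exS.
suff H m : (m <= k)%N -> Ccurve E0 m eta by exact: H.
elim: m => [_|m IH mk].
  by split=> t t0; [have [/M0E0] := etaP t0|exact: eta_cvg].
have eC := IH (ltnW mk).
have kC := CcurveW mk kapC; have lC := CcurveW mk lamC.
case: (kC) => _ [dk dkP dkC]; case: (lC) => _ [dl dlP dlC].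
pose rhs t := dl t - T (c t) [:: ((1 : R), dk t)].
split; first by move=> t t0; have [/M0E0] := etaP t0.
exists (fun t => S t (rhs t)) => [t t0|].
  have [bS SE SJ JS SQ] := SP t t0.
  by apply: eta_deriv => //; [exact: Ccurve_in dkC t0|exact: dkP|exact: dlP].
have sumC : Ccurve E m (fun t => kap t + eta t).
  have : Ccurve setT m (fun t => kap t + eta t).
    by apply: CcurveD; [apply: Ccurve_subset (CcurveW (leqnSn m) kC)|apply: Ccurve_subset eC].
  move=> _; have ED z x y : Ccurve E z x -> Ccurve E z y -> Ccurve E z (fun t => x t + y t).
    elim: z x y => [|z IHz] x y [xE xP] [yE yP];
      (split; first by move=> t t0; rewrite -[x t]scale1r; apply: EP; [exact: xE|exact: yE]).
      by move=> t t0; apply: cvgD; [exact: xP|exact: yP].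
    case: xP => dx dxP dxC; case: yP => dy dyP dyC.
    exists (fun t => dx t + dy t) => [t t0|]; last exact: IHz.
    by apply: deriv_withinD; [exact: dxP|exact: dyP].
  by apply: ED; [exact: CcurveW (leqnSn m) kC|exact: Ccurve_subset eC].
have cC : Ccurve EE m c by apply: Ccurve_pair => //; exact: Ccurve_id.
apply: (linear_curve cN inv _ cC (b := rhs)) => //.
  by move=> t t0; have [bS SE SJ JS SQ] := SP t t0.
apply: CcurveD => //.
have oneC : curves EE m [:: fun t => ((1 : R), dk t)].
  by split=> //; apply: Ccurve_pair => //; exact: Ccurve_cst.
have h := Ck_chain EE0 EEP Tlin Tbound Tdiff Tcont (vs := [:: fun t => ((1 : R), dk t)]) mk cC cN oneC.
apply: (@Ccurve_blin _ _ _ setT setT m (fun t => T (c t) [:: ((1 : R), dk t)]) -%R) => //.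
split=> [a x y _ _|]; first by rewrite opprD scalerN.
by exists 1 => x _; rewrite normrN mul1r.
Qed.

End Solution.
End ImplicitCurve.

(** * Projectors onto the root subspaces *)

Section Scalars.
Context {R : realType} {X Y : normedModType R}.
Variable K : scalar_field X Y.

(** A common form for both kinds of scalars: the second map is multiplication by i on complex spaces
    and 0 on real ones. *)
Lemma actXE : exists Jx : X -> X, forall z x,
  actX K z x = complex.Re z *: x + complex.Im z *: Jx x.
Proof.
case: K => [|JX JY] /=; last by exists (mul_i JX).
by exists (fun=> 0) => z x; rewrite scaler0 addr0.
Qed.

Lemma actYE : exists Jy : Y -> Y, forall z y,
  actY K z y = complex.Re z *: y + complex.Im z *: Jy y.
Proof.
case: K => [|JX JY] /=; last by exists (mul_i JY).
by exists (fun=> 0) => z x; rewrite scaler0 addr0.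
Qed.

Lemma is_scalar_real (a : R) : is_scalar K (a%:C)%C.
Proof. by case: K. Qed.

Lemma actX_real (a : R) x : actX K (a%:C)%C x = a *: x.
Proof. by have [J ->] := actXE; rewrite /= scale0r addr0. Qed.

Lemma actX0 x : actX K 0 x = 0.
Proof. by rewrite -[X in actX K X]/((0 : R)%:C)%C actX_real scale0r. Qed.

Lemma actX1 x : actX K 1 x = x.
Proof. by rewrite -[X in actX K X]/((1 : R)%:C)%C actX_real scale1r. Qed.

Lemma actY_real (a : R) y : actY K (a%:C)%C y = a *: y.
Proof. by have [J ->] := actYE; rewrite /= scale0r addr0. Qed.

Lemma actY0 y : actY K 0 y = 0.
Proof. by rewrite -[X in actY K X]/((0 : R)%:C)%C actY_real scale0r. Qed.

Lemma actY1 y : actY K 1 y = y.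
Proof. by rewrite -[X in actY K X]/((1 : R)%:C)%C actY_real scale1r. Qed.

End Scalars.

Section FiniteRank.
Context {R : realType} {V W : normedModType R}.
Variables (K : scalar_field V W).

Lemma normc_bound (z : R[i]) :
  `|complex.Re z| <= Normc.normc z /\ `|complex.Im z| <= Normc.normc z.
Proof.
case: z => a b /=; rewrite -!sqrtr_sqr; split; rewrite ler_sqrt ?addr_ge0 ?sqr_ge0//.
  by rewrite lerDl sqr_ge0.
by rewrite lerDr sqr_ge0.
Qed.

Lemma Re_linear (a : R) z z' : complex.Re ((a%:C)%C * z + z') = a * complex.Re z + complex.Re z'.
Proof. by case: z => x y; case: z' => x' y' /=; rewrite mul0r subr0. Qed.

Lemma Im_linear (a : R) z z' : complex.Im ((a%:C)%C * z + z') = a * complex.Im z + complex.Im z'.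
Proof. by case: z => x y; case: z' => x' y' /=; rewrite mul0r addr0. Qed.

(** The map [Jz] is evaluated at finitely many fixed vectors w i, so the sum is real linear and
    bounded as soon as the functionals p i are. *)
Lemma finite_rank_bounded (U Z : normedModType R) (actU : R[i] -> U -> U)
    (actZ : R[i] -> Z -> Z) (Jz : Z -> Z) (I : finType) (P : pred I)
    (p : I -> U -> R[i]) (w : I -> Z) :
  (forall (a : R) x, actU (a%:C)%C x = a *: x) ->
  (forall z y, actZ z y = complex.Re z *: y + complex.Im z *: Jz y) ->
  (forall i, P i -> (forall (a : R) x x', p i (actU (a%:C)%C x + x') = (a%:C)%C * p i x + p i x') /\
     exists C : R, forall x, Normc.normc (p i x) <= C * `|x|) ->
  bounded_linear_on setT (fun x => \sum_(i | P i) actZ (p i x) (w i)).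
Proof.
move=> aU aZ pP; split=> [a x y _ _|].
  rewrite scaler_sumr -big_split /=; apply: eq_bigr => i Pi.
  have [plin _] := pP i Pi.
  by rewrite -[a *: x]aU plin !aZ Re_linear Im_linear; lincomb_eq.
have exC i : exists C : R, P i -> forall x, Normc.normc (p i x) <= C * `|x|.
  have [Pi|] := boolP (P i); last by exists 0.
  by have [_ [C hC]] := pP i Pi; exists C.
have [C hC] := choice exC.
exists (\sum_(i | P i) C i * (`|w i| + `|Jz (w i)|)) => x _.
rewrite mulr_suml (le_trans (ler_norm_sum _ _ _))//; apply: ler_sum => i Pi.
have [hr hi] := normc_bound (p i x).
rewrite aZ (le_trans (ler_normD _ _))// !normrZ mulrAC mulrDr.
rewrite lerD// ler_wpM2r// ?(le_trans hr (hC i Pi x))// ?(le_trans hi (hC i Pi x))//.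
Qed.

End FiniteRank.

Section IndexSums.
Variables (V : zmodType) (n nu : nat) (mult : 'I_n -> nat).
Hypothesis mult_nu : forall i, (mult i <= nu)%N.
Local Notation idx := ('I_n * 'I_nu)%type.

Definition valid (p : idx) := (p.2 < mult p.1)%N.

(** A sum over a set of admissible pairs (chain, level). All projectors in question have this form,
    so that their sums and compositions become boolean operations on predicates. *)
Definition gsum (F : 'I_n -> nat -> V) (s : pred idx) : V :=
  \sum_(p : idx | valid p && s p) F p.1 p.2.+1.

Lemma eq_gsum F (s s' : pred idx) : (forall p, valid p -> s p = s' p) -> gsum F s = gsum F s'.
Proof. by move=> ss'; apply: eq_bigl => p; case: (boolP (valid p)) => //= /ss'. Qed.

Lemma gsum_level F s j : (s < j)%N ->
  \sum_(i < n | mult i == j) F i s.+1 = gsum F (fun p => (p.2 == s :> nat) && (mult p.1 == j)).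
Proof.
move=> sj; rewrite /gsum big_mkcond /=.
under [RHS]eq_bigl do rewrite andbA andbC.
have -> : \sum_(p : idx | (mult p.1 == j) && (valid p && (p.2 == s :> nat))) F p.1 p.2.+1 =
    \sum_(i < n | mult i == j) \sum_(l < nu | (l < mult i)%N && (l == s :> nat)) F i l.+1.
  by rewrite pair_big_dep.
rewrite [RHS]big_mkcond /=; apply: eq_bigr => i _; case: eqP => // mi.
have snu : (s < nu)%N by rewrite (leq_trans sj)// -mi.
rewrite (big_pred1 (Ordinal snu))// => l /=.
by rewrite -val_eqE /=; case: eqP => [->|]; rewrite ?andbF// mi sj.
Qed.

Lemma gsum_fiber F (s : pred idx) (h : idx -> nat) a b :
  \sum_(a <= j < b) gsum F (fun p => s p && (h p == j)) =
  gsum F (fun p => s p && (a <= h p < b)%N).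
Proof.
rewrite /gsum (exchange_big_dep (fun p => valid p && s p)) /=; last first.
  by move=> j p _ /and3P[-> ->].
rewrite [RHS](eq_bigl (fun p => (valid p && s p) && (a <= h p < b)%N)); last by move=> p; rewrite andbA.
rewrite [RHS]big_mkcondr /=; apply: eq_bigr => p /andP[vp sp].
under eq_bigl do rewrite vp sp /=.
case: ifPn => hp.
  rewrite big_mkcond /= (bigD1_seq (h p)) ?mem_index_iota ?iota_uniq//= eqxx.
  by rewrite big1 ?addr0// => j; rewrite eq_sym => /negbTE ->.
rewrite big_nat_cond big1// => j /andP[abj /eqP hj].
by move: hp; rewrite hj abj.
Qed.

Lemma gsumD F (s s' : pred idx) : (forall p, s p -> ~~ s' p) ->
  gsum F s + gsum F s' = gsum F (fun p => s p || s' p).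
Proof.
move=> dis; rewrite /gsum [RHS](bigID s) /=; congr (_ + _); apply: eq_bigl => p.
  by rewrite -andbA; case: (s p); rewrite ?andbF ?andbT//= orbT.
by have := dis p; case: (s p); case: (s' p); rewrite ?andbF ?andbT ?orbT ?orbF// => /(_ isT).
Qed.

End IndexSums.

Section Projectors.
Context {R : realType} {X Y : completeNormedModType R}.
Variable S : pencil_data X Y.
Local Notation A := (opA S).
Local Notation B := (opB S).
Local Notation nu := (nu_of S).
Local Notation K := (scalars S).
Local Notation aX := (actX K).
Local Notation aY := (actY K).
Local Notation D := (dom S).
Hypothesis hA : linear_operator K (domA S) A.
Hypothesis hB : linear_operator K (domB S) B.
Hypothesis hroot : canonical_root_system S.

Let ipred := 'I_(nker S) -> nat -> bool.
Implicit Types (s r : ipred) (i : 'I_(nker S)).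

Definition proj_sum (V : zmodType) (F : 'I_(nker S) -> nat -> V) (s : ipred) : V :=
  gsum (nu := nu) (@mult R X Y S) F (fun p => s p.1 p.2).

(* A predicate s on pairs (i, l) selects the terms <., B^* q_i^(l+1)> phi_i^(l+1):
   the level l starts at 0, whereas the indices of phi, q and Bq start at 1. *)
Definition PP s (x : X) := proj_sum (fun i j => aX (Bq i j x) (phi i j)) s.
Definition QQ s (y : Y) := proj_sum (fun i j => aY (q i j y) (B (phi i j))) s.
(** By [B_PP] and [A_PP] these are B and A applied to [PP s x]; the explicit finite sums show that
    they are bounded on all of X although A and B are unbounded. *)
Definition BP s (x : X) := proj_sum (fun i j => aY (Bq i j x) (B (phi i j))) s.
Definition AP s (x : X) := proj_sum (fun i j => aY (Bq i j x) (A (phi i j))) s.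

Lemma mult_le i : (mult i <= nu)%N.
Proof.
have [_ [_ <- _ _] _] := hroot; exact: (@leq_bigmax_cond _ xpredT (@mult R X Y S)).
Qed.

Lemma mult_gt0 i : (0 < mult i)%N.
Proof. by have [_ [h _ _ _] _] := hroot; exact: h. Qed.

Lemma phi_dom i j : (1 <= j <= mult i)%N -> D (phi i j).
Proof. by have [_ [_ _ h _] _] := hroot; exact: h. Qed.

Lemma Bq_functional i j : (1 <= j <= mult i)%N -> functional K aX (Bq i j).
Proof. by have [_ _ [h _ _ _]] := hroot; move=> /h[]. Qed.

Lemma q_functional i j : (1 <= j <= mult i)%N -> functional K aY (q i j).
Proof. by have [_ _ [h _ _ _]] := hroot; move=> /h[]. Qed.

Lemma Bq_q i j x : (1 <= j <= mult i)%N -> D x -> Bq i j x = q i j (B x).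
Proof. by have [_ _ [h _ _ _]] := hroot; move=> /h[_ _ e] [_ Bx]; exact: e. Qed.

Lemma A_phi1 i : A (phi i 1) = 0.
Proof. by have [[h _] _ _] := hroot; case: (h i). Qed.

Lemma A_phiS i j : (1 <= j < mult i)%N -> A (phi i j.+1) = - B (phi i j).
Proof. by have [_ [_ _ _ h] _] := hroot; exact: h. Qed.

Lemma q_biorth i (k : 'I_(nker S)) j l : (1 <= j <= mult i)%N -> (1 <= l <= @mult R X Y S k)%N ->
  q k l (B (phi i j)) = ((i == k) && (j == l))%:R.
Proof. by have [_ _ [_ _ _ h]] := hroot; exact: h. Qed.

Lemma q_A i j x : (1 <= j <= mult i)%N -> D x ->
  q i j (A x) = if (j < mult i)%N then - Bq i j.+1 x else 0.
Proof.
have [_ _ [_ h1 h2 _]] := hroot => /andP[j1 jm] [Ax _].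
case: ltnP => [jm'|mj].
  by have [|_ _ <-] := h2 i j; rewrite ?j1.
have -> : j = mult i by apply/eqP; rewrite eqn_leq jm.
by have [_ _ <-] := h1 i.
Qed.

Lemma dom_lin z x x' : is_scalar K z -> D x -> D x' -> D (aX z x + x').
Proof.
move=> hz [Ax Bx] [Ax' Bx']; split.
  by have [_ /(_ z x x' hz Ax Ax')[]] := hA.
by have [_ /(_ z x x' hz Bx Bx')[]] := hB.
Qed.

Lemma dom0 : D 0.
Proof. by split; [case: hA|case: hB]. Qed.

Lemma A_lin z x x' : is_scalar K z -> D x -> D x' -> A (aX z x + x') = aY z (A x) + A x'.
Proof. by move=> hz [Ax _] [Ax' _]; have [_ /(_ z x x' hz Ax Ax')[]] := hA. Qed.

Lemma B_lin z x x' : is_scalar K z -> D x -> D x' -> B (aX z x + x') = aY z (B x) + B x'.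
Proof. by move=> hz [_ Bx] [_ Bx']; have [_ /(_ z x x' hz Bx Bx')[]] := hB. Qed.

Lemma domP (a : R) x y : D x -> D y -> D (a *: x + y).
Proof. by rewrite -(actX_real K); apply: dom_lin; exact: is_scalar_real. Qed.

Lemma dom_sub x y : D x -> D y -> D (x - y).
Proof. by move=> Dx Dy; rewrite -scaleN1r addrC; exact: domP. Qed.

Lemma domD x y : D x -> D y -> D (x + y).
Proof. by move=> Dx Dy; rewrite -[x]scale1r; exact: domP. Qed.

Lemma A_real (a : R) x y : D x -> D y -> A (a *: x + y) = a *: A x + A y.
Proof.
move=> Dx Dy; rewrite -(actX_real K) A_lin//; last exact: is_scalar_real.
by rewrite actY_real.
Qed.

Lemma B_real (a : R) x y : D x -> D y -> B (a *: x + y) = a *: B x + B y.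
Proof.
move=> Dx Dy; rewrite -(actX_real K) B_lin//; last exact: is_scalar_real.
by rewrite actY_real.
Qed.

Lemma opA0 : A 0 = 0.
Proof. by have := A_real (-1) dom0 dom0; rewrite scaler0 addr0 scaleN1r addNr. Qed.

Lemma opB0 : B 0 = 0.
Proof. by have := B_real (-1) dom0 dom0; rewrite scaler0 addr0 scaleN1r addNr. Qed.

Lemma A_D x y : D x -> D y -> A (x + y) = A x + A y.
Proof. by move=> Dx Dy; rewrite -{1}[x]scale1r A_real// scale1r. Qed.

Lemma B_D x y : D x -> D y -> B (x + y) = B x + B y.
Proof. by move=> Dx Dy; rewrite -{1}[x]scale1r B_real// scale1r. Qed.

Lemma A_B x y : D x -> D y -> A (x - y) = A x - A y.
Proof. by move=> Dx Dy; rewrite -scaleN1r addrC A_real// scaleN1r addrC. Qed.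

Lemma B_B x y : D x -> D y -> B (x - y) = B x - B y.
Proof. by move=> Dx Dy; rewrite -scaleN1r addrC B_real// scaleN1r addrC. Qed.

Let validP (p : 'I_(nker S) * 'I_nu) (b : bool) : valid (@mult R X Y S) p && b ->
  (1 <= p.2.+1 <= @mult R X Y S p.1)%N.
Proof. by move=> /andP[]. Qed.

Let functional_real (V : normedModType R) (act : R[i] -> V -> V) p :
  (forall (a : R) x, act (a%:C)%C x = a *: x) -> functional K act p ->
  (forall (a : R) x x', p (act (a%:C)%C x + x') = (a%:C)%C * p x + p x') /\
     exists C : R, forall x, Normc.normc (p x) <= C * `|x|.
Proof. by move=> _ [h1 _ h3]; split=> // a x x'; apply: h1; exact: is_scalar_real. Qed.

Lemma PP_bounded s : bounded_linear_on setT (PP s).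
Proof.
have [J hJ] := actXE K.
apply: (finite_rank_bounded (actU := aX) (Jz := J)) => //; first exact: actX_real.
by move=> p vp; apply: functional_real; [exact: actX_real|exact: Bq_functional (validP vp)].
Qed.

Lemma BP_bounded s : bounded_linear_on setT (BP s).
Proof.
have [J hJ] := actYE K.
apply: (finite_rank_bounded (actU := aX) (Jz := J)) => //; first exact: actX_real.
by move=> p vp; apply: functional_real; [exact: actX_real|exact: Bq_functional (validP vp)].
Qed.

Lemma AP_bounded s : bounded_linear_on setT (AP s).
Proof.
have [J hJ] := actYE K.
apply: (finite_rank_bounded (actU := aX) (Jz := J)) => //; first exact: actX_real.
by move=> p vp; apply: functional_real; [exact: actX_real|exact: Bq_functional (validP vp)].
Qed.

Lemma QQ_bounded s : bounded_linear_on setT (QQ s).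
Proof.
have [J hJ] := actYE K.
apply: (finite_rank_bounded (actU := aY) (Jz := J)) => //; first exact: actY_real.
by move=> p vp; apply: functional_real; [exact: actY_real|exact: q_functional (validP vp)].
Qed.

Let sum_dom (I : Type) (rs : seq I) (P : pred I) (cf : I -> R[i]) (w : I -> X) :
  (forall k, P k -> is_scalar K (cf k) /\ D (w k)) ->
  [/\ D (\sum_(i <- rs | P i) aX (cf i) (w i)),
      A (\sum_(i <- rs | P i) aX (cf i) (w i)) = \sum_(i <- rs | P i) aY (cf i) (A (w i)) &
      B (\sum_(i <- rs | P i) aX (cf i) (w i)) = \sum_(i <- rs | P i) aY (cf i) (B (w i))].
Proof.
move=> h; elim: rs => [|i rs [h1 h2 h3]]; first by rewrite !big_nil opA0 opB0; split=> //; exact: dom0.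
rewrite !big_cons; case: ifP => // Pi; have [si Di] := h i Pi.
by rewrite A_lin// B_lin// h2 h3; split=> //; exact: dom_lin.
Qed.

Let Bq_scalar i j x : (1 <= j <= mult i)%N -> is_scalar K (Bq i j x).
Proof. by move=> /Bq_functional[]. Qed.

Let PP_all s x : [/\ D (PP s x), A (PP s x) = AP s x & B (PP s x) = BP s x].
Proof.
apply: sum_dom => p vp; split; first exact: Bq_scalar (validP vp).
exact: phi_dom (validP vp).
Qed.

Lemma PP_dom s x : D (PP s x). Proof. by have [] := PP_all s x. Qed.
Lemma A_PP s x : A (PP s x) = AP s x. Proof. by have [] := PP_all s x. Qed.
Lemma B_PP s x : B (PP s x) = BP s x. Proof. by have [] := PP_all s x. Qed.

Lemma functional_sum (V : normedModType R) (act : R[i] -> V -> V) (p : V -> R[i])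
    (I : Type) (rs : seq I) (P : pred I) (cf : I -> R[i]) (w : I -> V) :
  (forall x, act 1 x = x) ->
  functional K act p -> (forall k, P k -> is_scalar K (cf k)) ->
  p (\sum_(i <- rs | P i) act (cf i) (w i)) = \sum_(i <- rs | P i) cf i * p (w i).
Proof.
move=> act1 [h _ _] sc.
have s1 : is_scalar K 1 by exact: (is_scalar_real K 1).
have p0 : p 0 = 0.
  have := h 1 0 0 s1; rewrite act1 mul1r addr0 => /eqP.
  by rewrite -subr_eq subrr eq_sym => /eqP.
elim: rs => [|i rs IH]; first by rewrite !big_nil.
by rewrite !big_cons; case: ifP => // Pi; rewrite h ?IH//; exact: sc.
Qed.

Let delta_sum (cf : 'I_(nker S) * 'I_nu -> R[i]) s p :
  valid (@mult R X Y S) p ->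
  \sum_(p' : 'I_(nker S) * 'I_nu | valid (@mult R X Y S) p' && s p'.1 p'.2)
     cf p' * ((p'.1 == p.1) && (p'.2.+1 == p.2.+1))%:R = if s p.1 p.2 then cf p else 0.
Proof.
move=> vp; rewrite big_mkcond (bigD1 p)//= vp !eqxx/= mulr1 big1 ?addr0// => p' pp'.
case: ifP => // _; suff -> : ((p'.1 == p.1) && (p'.2.+1 == p.2.+1)) = false by rewrite mulr0.
by apply/negP => /andP[/eqP e1 /eqP[e2]]; move/eqP: pp'; apply;
  rewrite [p']surjective_pairing [p]surjective_pairing e1 (val_inj e2).
Qed.

Lemma Bq_PP s (p : 'I_(nker S) * 'I_nu) x : valid (@mult R X Y S) p ->
  Bq p.1 p.2.+1 (PP s x) = if s p.1 p.2 then Bq p.1 p.2.+1 x else 0.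
Proof.
move=> vp; rewrite (functional_sum (act := aX))//; last first.
- by move=> p' vp'; exact: Bq_scalar (validP vp').
- exact: (Bq_functional (j := p.2.+1)).
- exact: actX1.
rewrite -(@delta_sum (fun p' => Bq p'.1 p'.2.+1 x))//; apply: eq_bigr => p' vp'.
rewrite (@Bq_q p.1 p.2.+1 _ vp (phi_dom (validP vp'))).
by rewrite q_biorth//; exact: validP vp'.
Qed.

Lemma q_QQ s (p : 'I_(nker S) * 'I_nu) y : valid (@mult R X Y S) p ->
  q p.1 p.2.+1 (QQ s y) = if s p.1 p.2 then q p.1 p.2.+1 y else 0.
Proof.
move=> vp; rewrite (functional_sum (act := aY))//; last first.
- by move=> p' vp'; have [] := q_functional (validP vp').
- exact: (q_functional (j := p.2.+1)).
- exact: actY1.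
rewrite -(@delta_sum (fun p' => q p'.1 p'.2.+1 y))//; apply: eq_bigr => p' vp'.
by rewrite q_biorth//; exact: validP vp'.
Qed.

Lemma eq_PP s r x : (forall i l, (l < mult i)%N -> s i l = r i l) -> PP s x = PP r x.
Proof. by move=> sr; apply: eq_gsum => p vp; exact: sr. Qed.

Lemma eq_QQ s r y : (forall i l, (l < mult i)%N -> s i l = r i l) -> QQ s y = QQ r y.
Proof. by move=> sr; apply: eq_gsum => p vp; exact: sr. Qed.

Lemma eq_AP s r x : (forall i l, (l < mult i)%N -> s i l = r i l) -> AP s x = AP r x.
Proof. by move=> sr; apply: eq_gsum => p vp; exact: sr. Qed.

Let PP_comp (V : normedModType R) (act : R[i] -> V -> V) (w : 'I_(nker S) -> nat -> V) s r x :
  (forall v, act 0 v = 0) ->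
  proj_sum (fun i j => act (Bq i j (PP r x)) (w i j)) s =
  proj_sum (fun i j => act (Bq i j x) (w i j)) (fun i l => s i l && r i l).
Proof.
move=> act0; rewrite /proj_sum /gsum big_mkcond [RHS]big_mkcond; apply: eq_bigr => p _ /=.
case: (boolP (valid _ p)) => //= vp; rewrite Bq_PP//.
by case: (s p.1 p.2); case: (r p.1 p.2) => //=; rewrite act0.
Qed.

Lemma PP_PP s r x : PP s (PP r x) = PP (fun i l => s i l && r i l) x.
Proof. by apply: PP_comp; exact: actX0. Qed.

Lemma AP_PP s r x : AP s (PP r x) = AP (fun i l => s i l && r i l) x.
Proof. by apply: PP_comp; exact: actY0. Qed.

Lemma QQ_QQ s r y : QQ s (QQ r y) = QQ (fun i l => s i l && r i l) y.
Proof.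
rewrite /QQ /proj_sum /gsum big_mkcond [RHS]big_mkcond; apply: eq_bigr => p _ /=.
case: (boolP (valid _ p)) => //= vp; rewrite q_QQ//.
by case: (s p.1 p.2); case: (r p.1 p.2) => //=; rewrite actY0.
Qed.

Lemma QQ_Bop s x : D x -> QQ s (B x) = BP s x.
Proof.
move=> Dx; apply: eq_bigr => p vp; congr (aY _ _); rewrite Bq_q//; exact: validP vp.
Qed.

Definition shift s : ipred := fun i l => (0 < l)%N && s i l.-1.

(** The relations A^* q_i^j = - B^* q_i^(j+1) and A phi_i^(j+1) = - B phi_i^j turn the term (i, j)
    of Q applied to A x into the term (i, j+1) of [AP], the two signs cancelling; the last q of a
    chain annihilates A x. *)
Lemma QQ_Aop s x : D x -> QQ s (A x) = AP (shift s) x.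
Proof.
move=> Dx; pose F i l := aY (Bq i l.+1 x) (A (phi i l.+1)).
pose f i l := if (l < mult i)%N && shift s i l then F i l else 0.
have -> : AP (shift s) x = \sum_(i < nker S) \sum_(0 <= l < nu) f i l.
  rewrite /AP /proj_sum /gsum; under [RHS]eq_bigr do rewrite big_mkord -big_mkcond /=.
  by rewrite pair_big_dep.
have -> : QQ s (A x) = \sum_(i < nker S) \sum_(0 <= l < nu) f i l.+1.
  rewrite /QQ /proj_sum /gsum; under [RHS]eq_bigr do rewrite big_mkord.
  rewrite pair_big /= big_mkcond; apply: eq_bigr => p _ /=.
  rewrite /f /shift /=; case: (boolP (valid _ p)) => [vp|] /=; last first.
    by rewrite /valid -leqNgt => /leqW mp; rewrite ltnNge mp.
  case: (s p.1 p.2); rewrite ?andbF ?andbT// q_A//; case: ifP => [lm|_]; last by rewrite actY0.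
  rewrite /F A_phiS//.
  have EN z y : aY z (- y) = aY (- z) y.
    case: K z y => [|JX JY] z y /=; first by case: z => a b /=; rewrite scalerN scaleNr.
    have jN : mul_i JY (- y) = - mul_i JY y.
      have j0 : mul_i JY 0 = 0.
        by have := mul_i_linear JY (-1) 0 0; rewrite scaler0 addr0 scaleN1r addNr.
      by have := mul_i_linear JY (-1) y 0; rewrite !scaleN1r j0 !addr0.
    by rewrite /cact jN; case: z => a b /=; rewrite !scalerN !scaleNr.
  by rewrite EN.
apply: eq_bigr => i _.
have f0 : f i 0%N = 0 by rewrite /f /shift andbF.
have fnu : f i nu = 0 by rewrite /f ltnNge mult_le.
(* The index shift costs nothing at the ends: level 0 is excluded by [shift], and no chain reaches
   level nu. *)
transitivity (\sum_(0 <= l < nu.+1) f i l).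
  by rewrite [RHS]big_ltn// f0 add0r big_add1.
by rewrite big_nat_recr//= fnu addr0.
Qed.

Lemma PP_image s : PP s @` D = [set x | PP s x = x].
Proof.
apply/seteqP; split=> [_ [x _ <-]|x /= <-] /=.
  by rewrite PP_PP; apply: eq_PP => i l _; rewrite andbb.
by exists (PP s x); [exact: PP_dom|rewrite PP_PP; apply: eq_PP => i l _; rewrite andbb].
Qed.

Lemma QQ_range s : range (QQ s) = [set y | QQ s y = y].
Proof.
apply/seteqP; split=> [_ [x _ <-]|x /= <-] /=.
  by rewrite QQ_QQ; apply: eq_QQ => i l _; rewrite andbb.
by exists x.
Qed.

(** With levels counted from 0, [sdiag k] selects the last vectors of the chains of length k + 1,
    and [swedge k] the vectors at level k whose chains continue. *)
Definition sdiag (k : nat) : ipred := fun i l => (l == k) && (mult i == k.+1).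
Definition swedge (k : nat) : ipred := fun i l => (l == k) && (k.+1 < mult i)%N.
Definition slev (k : nat) : ipred := fun _ l => l == k.
Definition spos : ipred := fun _ l => (0 < l)%N.
Definition sall : ipred := fun _ _ => true.

(** The P and the Q families are the same sums over index pairs with different terms; the
    translation into predicates is made once for arbitrary terms F. *)
Section Generic.
Variables (V : zmodType) (F : 'I_(nker S) -> nat -> V).
Let G2sj (k j : nat) := \sum_(i < nker S | mult i == j) F i k.+1.
Let G2s (k : nat) := \sum_(k.+1 <= j < nu.+1) G2sj k j.

Let G2sj_proj (k j : nat) : (k < j)%N ->
  G2sj k j = proj_sum F (fun i l => (l == k) && (mult i == j)).
Proof. by move=> sj; rewrite /G2sj (gsum_level mult_le). Qed.

Let G2s_proj (k : nat) : G2s k = proj_sum F (slev k).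
Proof.
rewrite /G2s big_nat_cond; under eq_bigr => j /andP[/andP[sj _] _] do rewrite G2sj_proj//.
rewrite -big_nat_cond /proj_sum
  (gsum_fiber _ F (fun p => p.2 == k :> nat) (fun p => @mult R X Y S p.1)).
apply: eq_gsum => p; rewrite /valid /slev => vp.
by case: eqP => //= <-; rewrite vp ltnS mult_le.
Qed.

Let G2wedge_proj (k : nat) : G2s k - G2sj k k.+1 = proj_sum F (swedge k).
Proof.
rewrite G2s_proj G2sj_proj//; apply/eqP; rewrite subr_eq; apply/eqP.
rewrite /proj_sum gsumD; last first.
  by move=> p; rewrite /swedge => /andP[/eqP-> h]; rewrite eqxx/= gtn_eqF.
apply: eq_gsum => p; rewrite /valid /slev /swedge => vp.
by case: eqP => //= e; rewrite -e; case: ltngtP vp => //; rewrite e; lia.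
Qed.

Let G2sum_proj a : \sum_(a <= k < nu) G2s k = proj_sum F (fun _ l => (a <= l)%N).
Proof.
under eq_bigr do rewrite G2s_proj.
rewrite /proj_sum; have := gsum_fiber (@mult R X Y S) F xpredT (fun p => p.2 : nat) a nu.
move=> /= ->; apply: eq_gsum => p _; by rewrite ltn_ord andbT.
Qed.

Definition generic_proj := (G2sj_proj, G2s_proj, G2wedge_proj, G2sum_proj).
End Generic.

Lemma P2sj_PP (k : nat) x : P2sj S k k.+1 x = PP (sdiag k) x.
Proof. by have [[[h _] _] _] := generic_proj (fun i j => aX (Bq i j x) (phi i j)); exact: h. Qed.
Lemma P2s_PP (k : nat) x : P2s S k x = PP (slev k) x.
Proof. by have [[[_ h] _] _] := generic_proj (fun i j => aX (Bq i j x) (phi i j)); exact: h. Qed.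
Lemma P2wedge_PP (k : nat) x : P2wedge S k x = PP (swedge k) x.
Proof. by have [[_ h] _] := generic_proj (fun i j => aX (Bq i j x) (phi i j)); exact: h. Qed.
Lemma P2_PP x : P2 S x = PP sall x.
Proof. by have [_ h] := generic_proj (fun i j => aX (Bq i j x) (phi i j)); exact: (h 0%N). Qed.
Lemma P2Sigma_PP x : P2Sigma S x = PP spos x.
Proof. by have [_ h] := generic_proj (fun i j => aX (Bq i j x) (phi i j)); exact: (h 1%N). Qed.
Lemma Q2sj_QQ (k : nat) y : Q2sj S k k.+1 y = QQ (sdiag k) y.
Proof. by have [[[h _] _] _] := generic_proj (fun i j => aY (q i j y) (B (phi i j))); exact: h. Qed.
Lemma Q2s_QQ (k : nat) y : Q2s S k y = QQ (slev k) y.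
Proof. by have [[[_ h] _] _] := generic_proj (fun i j => aY (q i j y) (B (phi i j))); exact: h. Qed.
Lemma Q2Sigma_QQ (k : nat) y : Q2Sigma S k y = QQ (swedge k) y.
Proof. by have [[_ h] _] := generic_proj (fun i j => aY (q i j y) (B (phi i j))); exact: h. Qed.
Lemma Q2_QQ y : Q2 S y = QQ sall y.
Proof. by have [_ h] := generic_proj (fun i j => aY (q i j y) (B (phi i j))); exact: (h 0%N). Qed.

End Projectors.

(** * The inverse of A on D_1 *)

(** Cauchy estimates: convergence at the single point q bounds the terms q^k a_k, so for z <= q / 2
    the tail is dominated by a geometric series of ratio at most 1/2. *)
Lemma power_series_remainder (R : realType) (V : normedModType R) (a : nat -> V)
    (u : R -> V) (r : R) : 0 < r ->
  (forall z e : R, 0 < z < r -> 0 < e -> exists N, forall k, (N <= k)%N ->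
     `|u z - \sum_(0 <= j < k) z ^+ j *: a j| <= e) ->
  exists c q : R, [/\ 0 <= c, 0 < q, q < r & forall k (z : R), 0 < z <= q / 2 ->
     `|u z - \sum_(0 <= j < k) z ^+ j *: a j| <= c * (z / q) ^+ k].
Proof.
move=> r0 hu; pose q := r / 2; have q0 : 0 < q by rewrite divr_gt0.
have qr : 0 < q < r by rewrite q0 /q; lra.
have [N hN] := hu q 1 qr ltr01.
(* Terms before N are simply added up; each later one is a difference of two remainders of norm at
   most 1. *)
pose M := \sum_(0 <= k < N) `|q ^+ k *: a k| + 2.
have M0 : 0 <= M by rewrite addr_ge0// sumr_ge0.
have aM k : `|q ^+ k *: a k| <= M.
  case: (ltnP k N) => kN.
    rewrite /M (bigD1_seq k) ?mem_index_iota ?iota_uniq//= -addrA lerDl addr_ge0//.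
    by rewrite sumr_ge0.
  have -> : q ^+ k *: a k = (u q - \sum_(0 <= j < k) q ^+ j *: a j) -
      (u q - \sum_(0 <= j < k.+1) q ^+ j *: a j).
    by rewrite big_nat_recr//=; lincomb_eq.
  rewrite (le_trans (ler_normB _ _))// (le_trans (lerD (hN k kN) (hN k.+1 (leqW kN))))//.
  by rewrite -[leLHS]add0r lerD// sumr_ge0.
exists (2 * M), q; split=> //; [exact: mulr_ge0|by case/andP: qr|] => k z /andP[z0 zq].
have x0 : 0 <= z / q by rewrite divr_ge0// ltW.
have x2 : z / q <= 2^-1 by rewrite ler_pdivrMr// mulrC.
have tail n : forall k, `|\sum_(k <= j < k + n) z ^+ j *: a j| <= 2 * M * (z / q) ^+ k.
  elim: n => [|n IH] k'; first by rewrite addn0 big_geq// normr0 !mulr_ge0// exprn_ge0.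
  rewrite addnS big_ltn ?ltnS ?leq_addr// -addSn (le_trans (ler_normD _ _))//.
  have h1 : `|z ^+ k' *: a k'| <= M * (z / q) ^+ k'.
    have -> : z ^+ k' *: a k' = (z / q) ^+ k' *: (q ^+ k' *: a k').
      by rewrite scalerA -exprMn divfK// gt_eqF.
    by rewrite normrZ ger0_norm ?exprn_ge0// mulrC ler_wpM2r// exprn_ge0.
  have h2 : 2 * M * (z / q) ^+ k'.+1 <= M * (z / q) ^+ k'.
    have Mx : 0 <= M * (z / q) ^+ k' by rewrite mulr_ge0// exprn_ge0.
    by rewrite exprS; nra.
  by have := IH k'.+1; lra.
apply/ler_addgt0Pl => e e0.
have zr : 0 < z < r by case/andP: qr => _ qr; rewrite z0/=; nra.
have [N' hN'] := hu z e zr e0; pose m := maxn N' k.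
have -> : u z - \sum_(0 <= j < k) z ^+ j *: a j =
    (u z - \sum_(0 <= j < m) z ^+ j *: a j) + \sum_(k <= j < m) z ^+ j *: a j.
  by rewrite [in RHS](@big_cat_nat _ _ _ k)//= ?leq_maxr//; lincomb_eq.
rewrite (le_trans (ler_normD _ _))// lerD ?hN' ?leq_maxl//.
by have := tail (m - k)%N k; rewrite subnKC// leq_maxr.
Qed.

Section Atilde.
Context {R : realType} {X Y : completeNormedModType R}.
Variable S : pencil_data X Y.
Local Notation A := (opA S).
Local Notation B := (opB S).
Local Notation nu := (nu_of S).
Local Notation K := (scalars S).
Local Notation aX := (actX K).
Local Notation aY := (actY K).
Local Notation D := (dom S).
Hypothesis hA : closed_densely_defined K (domA S) A.
Hypothesis hB : closed_densely_defined K (domB S) B.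
Hypothesis hdom : domA S `<=` domB S.
Hypothesis hpencil : pencil_regular_of_index S nu.
Hypothesis hroot : canonical_root_system S.

Let lA : linear_operator K (domA S) A. Proof. by case: hA. Qed.
Let lB : linear_operator K (domB S) B. Proof. by case: hB. Qed.

Lemma dom_domA : D = domA S.
Proof. by apply/setIidPl. Qed.

Let clA : closed [set p : X * Y | D p.1 /\ p.2 = A p.1].
Proof. by rewrite dom_domA; case: hA. Qed.

(** Positive real z suffice to identify the Laurent coefficients. For a real space the first
    component of the complexified resolvent at (y, 0) is the real resolvent, because a real z acts
    componentwise. *)
Lemma real_resolvent : exists (r : R) (T : R -> Y -> X) (C : nat -> Y -> X),
  0 < r /\ forall z : R, 0 < z < r -> forall y,
   [/\ D (T z y), A (T z y) + z *: B (T z y) = y &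
      forall e : R, 0 < e -> exists N, forall k, (N <= k)%N ->
        `|z ^+ nu *: T z y - \sum_(0 <= j < k) z ^+ j *: C j y| <= e].
Proof.
have cactR (V : normedModType R) (J : V -> V) (z : R) x : cact J (z%:C)%C x = z *: x.
  by rewrite /cact /= scale0r addr0.
have powC (z : R) n : ((z%:C)%C ^+ n = ((z ^+ n)%:C)%C :> R[i])%R by rewrite rmorphXn.
have nC (z r : R) : 0 < z < r -> 0 < Normc.normc (z%:C)%C < r.
  move=> /andP[z0 zr]; rewrite /Normc.normc /= expr0n /= addr0 sqrtr_sqr gtr0_norm//.
  by rewrite z0.
have eps (y e : R) : 0 <= y -> 0 < e -> e / (y + 1) * y <= e.
  by move=> y0 e0; rewrite mulrAC ler_pdivrMr ?ltr_wpDl// ler_wpM2l ?ltW// ltrDl.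
have eps0 (y e : R) : 0 <= y -> 0 < e -> 0 < e / (y + 1).
  by move=> y0 e0; rewrite divr_gt0// ltr_wpDl.
move: hpencil; rewrite /pencil_regular_of_index; case: K => [|JX JY].
  move=> [_ _ [r [T [C [r0 _ _ h]]]]].
  exists r, (fun z y => (T (z%:C)%C (y, 0)).1), (fun j y => (C j (y, 0)).1).
  split=> // z zr y; have [[_ h1 _] h2] := h _ (nC _ _ zr).
  have [[Dx _] e1] := h1 (y, 0) I; split=> //.
    by have /(congr1 fst) := e1; rewrite cactR /=.
  move=> e e0; have [N hN] := h2 _ (eps0 `|y| e (normr_ge0 _) e0).
  exists N => k Nk; have := hN k Nk (y, 0).
  rewrite powC cactR; under eq_bigr do rewrite powC cactR.
  have n1 : `|(y, 0 : Y)| = `|y| by rewrite prod_normE /= normr0 max_l.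
  rewrite n1 => hn; have := le_trans hn (eps _ _ (normr_ge0 y) e0).
  rewrite prod_normE ge_max => /andP[+ _].
  by rewrite /= (raddf_sum (@fst X X)).
move=> [_ _ [r [T [C [r0 _ _ h]]]]].
exists r, (fun z => T (z%:C)%C), C; split=> // z zr y; have [[_ h1 _] h2] := h _ (nC _ _ zr).
have [Dx e1] := h1 y I; split=> //; first by rewrite cactR in e1.
move=> e e0; have [N hN] := h2 _ (eps0 `|y| e (normr_ge0 _) e0).
exists N => k Nk; have := hN k Nk y.
rewrite powC cactR; under eq_bigr do rewrite powC cactR.
by move=> hn; exact: le_trans hn (eps _ _ (normr_ge0 y) e0).
Qed.

(** Since D_A is contained in D_B, B is everywhere defined on the graph of A, which is complete
    because A is closed; as an operator there B is closed, hence bounded. *)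
Lemma relatively_bounded : exists2 c : R, 0 < c & forall x, D x -> `|B x| <= c * (`|x| + `|A x|).
Proof.
pose E := [set p : X * Y | D p.1 /\ p.2 = A p.1].
have [|a p p' [Dx ex] [Dx' ex']|u C uE uC|a p p' [Dx _] [Dx' _]||c c0 hc] :=
    @closed_graph_bounded R (X * Y)%type Y E (fun p => B p.1).
- by split=> /=; [exact: dom0|rewrite (opA0 lA lB)].
- by split=> /=; [exact: domP|rewrite (A_real lA)// ex ex'].
- have h : (0 <= (2^-1 : R) < 1) by lra.
  have [k|x [ux _]] := @geometric_cauchy R X (fst \o u) C _ h.
    by apply: le_trans (uC k); rewrite prod_normE /= le_max lexx.
  have [k|y [uy _]] := @geometric_cauchy R Y (snd \o u) C _ h.
    by apply: le_trans (uC k); rewrite [leRHS]prod_normE /= le_max lexx orbT.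
  have uxy : u @ \oo --> (x, y).
    rewrite (_ : u = fun k => ((fst \o u) k, (snd \o u) k)); first exact: cvg_pair ux uy.
    by apply/funext => k /=; rewrite -surjective_pairing.
  by exists (x, y) => //; apply: (closed_cvg _ clA) uxy; exact: nearW.
- exact: B_real.
- rewrite (_ : [set _ | _] = (fst @^-1` E) `&`
     ((fun p : (X * Y) * Y => (p.1.1, p.2)) @^-1` [set p | domB S p.1 /\ p.2 = B p.1])).
    apply: closedI; apply: closed_comp; rewrite ?clA//; last by case: hB.
      by move=> p _; exact: cvg_fst.
    move=> p _; apply: cvg_pair; last exact: cvg_snd.
    by apply: (@continuous_comp _ _ _ fst fst p); exact: cvg_fst.
  by apply/seteqP; split=> p /=; [move=> [[[? ?] ?] ?]|move=> [? []]].
exists c => // x Dx; have := hc (x, A x) (conj Dx erefl).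
move=> /le_trans; apply; rewrite ler_pM2l// prod_normE ge_max /=.
by rewrite lerDl lerDr !normr_ge0.
Qed.

(** The term z B (x z) tends to 0: by relative boundedness it is at most z c (|x z| + |A (x z)|),
    and for z c <= 1/2 the part with A is absorbed. Closedness of A does the rest. *)
Lemma pencil_limit (x : R -> X) (x0 : X) (w : Y) (d : R) : 0 < d ->
  (forall z, 0 < z < d -> D (x z)) -> x @ 0^'+ --> x0 ->
  (fun z => A (x z) + z *: B (x z)) @ 0^'+ --> w -> D x0 /\ A x0 = w.
Proof.
move=> d0 Dx xx0 sw; have [c c0 hc] := relatively_bounded.
have near0 (e : R) : 0 < e -> \forall z \near 0^'+, 0 < z < e.
  move=> e0; near=> z; apply/andP; split; near: z; [exact: nbhs_right_gt|exact: nbhs_right_lt].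
have Bz0 : (fun z => z *: B (x z)) @ 0^'+ --> (0 : Y).
  apply/cvgr_normP => e e0.
  (* A bound for |B (x z)|, from |x z| <= |x0| + 1 and the absorbed estimate |A (x z)| <= |x0| + 1 +
     2 (|w| + 1). *)
  pose M := c * (`|x0| + 1 + ((`|x0| + 1) + 2 * (`|w| + 1))); have M0 : 0 < M by rewrite mulr_gt0// !addr_gt0 ?ltr_wpDl// mulr_gt0// ltr_wpDl.
  have z1 : 0 < Order.min d (Order.min (2 * c)^-1 (e / M)).
    by rewrite !lt_min d0 invr_gt0 mulr_gt0//= divr_gt0.
  have /cvgr_normP /(_ 1 ltr01) h1 := xx0.
  have /cvgr_normP /(_ 1 ltr01) h2 := sw.
  near=> z; rewrite subr0.
  have /andP[z0] : 0 < z < Order.min d (Order.min (2 * c)^-1 (e / M)).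
    by near: z; exact: near0.
  rewrite !lt_min => /and3P[zd zc ze].
  have n1 : `|x z - x0| <= 1 by near: z.
  have n2 : `|A (x z) + z *: B (x z) - w| <= 1 by near: z.
  have Dz := Dx z (introT andP (conj z0 zd)).
  have hB1 := hc _ Dz.
  have bx : `|x z| <= `|x0| + 1.
    by rewrite -[x z](subrKC x0) (le_trans (ler_normD _ _))// lerD2l.
  have bs : `|A (x z)| <= `|w| + 1 + z * `|B (x z)|.
    have -> : A (x z) = w + (A (x z) + z *: B (x z) - w) - z *: B (x z) by lincomb_eq.
    rewrite (le_trans (ler_normB _ _))// normrZ gtr0_norm// lerD2r.
    by rewrite (le_trans (ler_normD _ _))// lerD2l.
  have zc2 : z * c <= 2^-1 by rewrite -ler_pdivlMr// -invfM ltW.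
  have zB : z * `|B (x z)| <= 2^-1 * (`|x z| + `|A (x z)|).
    rewrite (le_trans (ler_wpM2l (ltW z0) hB1))// mulrA ler_wpM2r// addr_ge0//.
  have bA : `|A (x z)| <= (`|x0| + 1) + 2 * (`|w| + 1) by lra.
  have hzM : z * `|B (x z)| <= z * M.
    by rewrite ler_pM2l// (le_trans hB1)// /M ler_pM2l// lerD.
  by rewrite normrZ gtr0_norm// (le_trans hzM)// -ler_pdivlMr// ltW.
have Aw : (fun z => A (x z)) @ 0^'+ --> w.
  rewrite -[w]subr0 (_ : (fun z => A (x z)) = (fun z => A (x z) + z *: B (x z)) - (fun z => z *: B (x z))).
    exact: cvgB.
  by apply/funext => z; rewrite fctE /= addrK.
suff [Dx0 ew] : [set p : X * Y | D p.1 /\ p.2 = A p.1] (x0, w) by [].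
apply: (closed_cvg (F := 0^'+) (u_ := fun z => (x z, A (x z))) _ clA); last exact: cvg_pair.
by apply: filterS (near0 d d0) => z /Dx.
Unshelve. all: by end_near. Qed.

(** Coefficients are compared after multiplying the Laurent series by the pencil; a k belongs to the
    order k - nu, so the coefficient of order 0 is a nu. The a k are limits and a priori only
    elements of X; [pencil_limit] yields membership in D together with the equation. *)
Lemma resolvent_chain y : exists a : nat -> X, forall k, (k <= nu)%N ->
  D (a k) /\ A (a k) = (k == nu)%:R *: y - (if k is k'.+1 then B (a k') else 0).
Proof.
have [r [T [C [r0 hT]]]] := real_resolvent.
pose a j := C j y; exists a.
have [|c [q [c0 q0 qr hc]]] := @power_series_remainder R X a (fun z => z ^+ nu *: T z y) r r0.
  by move=> z e zr e0; have [_ _ /(_ e e0)] := hT z zr y.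
pose b k := if k is k'.+1 then B (a k') else 0.
have tele k : (forall j, (j < k)%N -> D (a j) /\ A (a j) = - b j) -> forall z : R,
   [/\ D (\sum_(0 <= j < k) z ^+ j *: a j) &
    A (\sum_(0 <= j < k) z ^+ j *: a j) + z *: B (\sum_(0 <= j < k) z ^+ j *: a j) = z ^+ k *: b k].
  elim: k => [|k IH] hk z.
    by rewrite big_geq// (opA0 lA lB) (opB0 lA lB) /= !scaler0 addr0; split=> //; exact: dom0.
  have [//|D1 e1] := IH _ z; first by move=> j jk; apply: hk; exact: leqW.
  have [D2 e2] := hk k (ltnSn k).
  rewrite big_nat_recr//= addrC (A_real lA)// (B_real lB)//; split; first exact: domP.
  by rewrite e2 scalerDr addrACA e1 exprS -scalerA; lincomb_eq.
elim/ltn_ind => k IH knu.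
have hk j : (j < k)%N -> D (a j) /\ A (a j) = - b j.
  by move=> jk; have [Dj ->] := IH j jk (leq_trans (ltnW jk) knu); rewrite ltn_eqF ?(leq_trans jk)// scale0r add0r.
(* The remainder of order k divided by z^k. It tends to a k, while by the telescoping identity
   [tele] the pencil sends it to z^(nu - k) y - b k. *)
pose x z := z ^- k *: (z ^+ nu *: T z y - \sum_(0 <= j < k) z ^+ j *: a j).
have small (m : R) : 0 < m -> \forall z \near 0^'+, 0 < z < m.
  by move=> m0; near=> z; apply/andP; split; near: z; [exact: nbhs_right_gt|exact: nbhs_right_lt].
have zk (z : R) : 0 < z -> z ^- k * z ^+ k = 1 by move=> z0; rewrite mulVf// expf_neq0// gt_eqF.
have nuk (z : R) : 0 < z -> z ^- k * z ^+ nu = z ^+ (nu - k).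
  by move=> z0; rewrite -{1}(subnKC knu) exprD mulrA zk// mul1r.
have hx z : 0 < z < r -> D (x z) /\ A (x z) + z *: B (x z) = z ^+ (nu - k) *: y - b k.
  move=> zr; have [Ds es] := tele k hk z; have [DT eT _] := hT z zr y; have /andP[z0 _] := zr.
  pose s := \sum_(0 <= j < k) z ^+ j *: a j.
  have -> : x z = z ^+ (nu - k) *: T z y + ((- z ^- k) *: s + 0).
    by rewrite /x scalerBr scalerA nuk// scaleNr addr0.
  have Ds' : D ((- z ^- k) *: s + 0) by apply: domP => //; exact: dom0.
  split; first exact: domP.
  have d0 := dom0 lA lB; rewrite !(A_real lA)// !(B_real lB)// (opA0 lA lB) (opB0 lA lB).
  transitivity (z ^+ (nu - k) *: (A (T z y) + z *: B (T z y)) - z ^- k *: (A s + z *: B s)).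
    by lincomb_eq.
  by rewrite eT es scalerA zk// scale1r.
apply: (@pencil_limit x (a k) _ r) => //; first by move=> z /hx[].
  apply/cvgr_normP => e e0.
  pose m := Order.min (q / 2) (e / (c + 1) * q ^+ k.+1).
  have m0 : 0 < m by rewrite lt_min divr_gt0//= mulr_gt0 ?exprn_gt0 ?divr_gt0// ltr_wpDl.
  apply: filterS (small m m0) => z /andP[z0]; rewrite lt_min => /andP[zq ze].
  have -> : x z - a k = z ^- k *: (z ^+ nu *: T z y - \sum_(0 <= j < k.+1) z ^+ j *: a j).
    by rewrite /x big_nat_recr//= opprD addrA [RHS]scalerBr scalerA zk// scale1r.
  have zk0 : 0 < z ^- k by rewrite invr_gt0 exprn_gt0.
  have zq' : 0 < z <= q / 2 by rewrite z0 ltW.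
  rewrite normrZ gtr0_norm// (le_trans (ler_wpM2l (ltW zk0) (hc k.+1 z zq')))//.
  have -> : z ^- k * (c * (z / q) ^+ k.+1) = c * (z / q ^+ k.+1).
    by rewrite expr_div_n [z ^+ k.+1]exprS; field; rewrite !gt_eqF ?exprn_gt0.
  move: ze; rewrite -ltr_pdivrMr ?exprn_gt0// ltr_pdivlMr ?ltr_wpDl// => /ltW.
  apply: le_trans; rewrite mulrC ler_wpM2l// ?lerDl//.
  by rewrite divr_ge0 ?ltW// ?exprn_gt0.
apply/cvgr_normP => e e0.
pose m := Order.min r (Order.min 1 (e / (`|y| + 1))).
have m0 : 0 < m by rewrite !lt_min r0 ltr01 divr_gt0// ltr_wpDl.
apply: filterS (small m m0) => z /andP[z0]; rewrite !lt_min => /and3P[zr z1 ze].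
have [_ ->] := hx z (introT andP (conj z0 zr)).
have -> : z ^+ (nu - k) *: y - b k - ((k == nu)%:R *: y - b k) = (z ^+ (nu - k) - (k == nu)%:R) *: y.
  by lincomb_eq.
have hz : `|z ^+ (nu - k) - (k == nu)%:R| <= z.
  have [->|kn] := eqVneq k nu; first by rewrite subnn expr0 subrr normr0 ltW.
  rewrite subr0 ger0_norm ?exprn_ge0 ?(ltW z0)//.
  have : (0 < nu - k)%N by rewrite subn_gt0 ltn_neqAle kn.
  case: (nu - k)%N => // n _; rewrite exprS ler_piMr ?(ltW z0)//.
  by rewrite exprn_ile1 ?(ltW z0) ?(ltW z1).
rewrite normrZ (le_trans (ler_wpM2r (normr_ge0 _) hz))//.
move: ze; rewrite ltr_pdivlMr ?ltr_wpDl// => /ltW; apply: le_trans.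
by rewrite ler_pM2l// lerDl.
Unshelve. all: by end_near. Qed.

Lemma actYr0 z : aY z 0 = 0.
Proof.
case: K => [|JX JY] /=; first by rewrite scaler0.
have j0 : mul_i JY 0 = 0.
  by have := mul_i_linear JY (-1) 0 0; rewrite scaler0 addr0 scaleN1r addNr.
by rewrite /cact j0 !scaler0 addr0.
Qed.

Let s1 : is_scalar K 1. Proof. exact: (is_scalar_real K 1). Qed.

Lemma Q1E y : Q1 S y = y - QQ (sall (S := S)) y.
Proof. by rewrite /Q1 Q2_QQ. Qed.

Lemma P1E x : P1 S x = x - PP (sall (S := S)) x.
Proof. by rewrite /P1 P2_PP. Qed.

(** The shift of the full predicate misses only level 0, where A phi_i^1 = 0; so A intertwines P_2
    with Q_2. *)
Lemma A_P1 x : D x -> A (P1 S x) = Q1 S (A x).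
Proof.
move=> Dx; have DP := PP_dom lA lB hroot (sall (S := S)) x.
rewrite P1E Q1E (A_B lA)// QQ_Aop// A_PP//; congr (_ - _).
rewrite /AP /proj_sum /gsum big_mkcond [RHS]big_mkcond; apply: eq_bigr => -[i l] _ /=.
case: (boolP (valid _ _)) => //= _; rewrite /sall /shift andbT.
by case: ifP => //; case: (nat_of_ord l) => // _; rewrite A_phi1// actYr0.
Qed.

Lemma B_P1 x : D x -> B (P1 S x) = Q1 S (B x).
Proof.
move=> Dx; have DP := PP_dom lA lB hroot (sall (S := S)) x.
by rewrite P1E Q1E (B_B lB)// QQ_Bop// B_PP.
Qed.

Lemma dom_P1 x : D x -> D (P1 S x).
Proof. by move=> Dx; rewrite P1E; apply: (dom_sub lA lB) => //; exact: PP_dom. Qed.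

Lemma Bq1_0 (i : 'I_(nker S)) : Bq i 1 (0 : X) = 0.
Proof.
have h : (1 <= 1 <= @mult R X Y S i)%N by rewrite mult_gt0.
have [/(_ 1 0 0 s1) e _ _] := Bq_functional hroot h.
by apply: (addIr (Bq i 1 0)); rewrite add0r -[X in X + _]mul1r -e actX1 addr0.
Qed.

(** In the expansion of a kernel vector in the phi_i^1, biorthogonality identifies the coefficients
    with the values of [Bq i 1]. *)
Lemma kernel_zero x : D x -> A x = 0 -> (forall i : 'I_(nker S), Bq i 1 x = 0) -> x = 0.
Proof.
move=> Dx Ax Bx; have [[_ /(_ x Dx Ax)[c [[sc xE] _]]] _ _] := hroot.
rewrite xE big1// => k _; suff -> : c k = 0 by rewrite actX0.
have h (i : 'I_(nker S)) : (1 <= 1 <= @mult R X Y S i)%N by rewrite mult_gt0.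
rewrite -(Bx k) xE (functional_sum (S := S) (act := aX))//; [|exact: actX1|exact: Bq_functional (h k)].
rewrite (bigD1 k)//= big1 ?addr0.
  by rewrite Bq_q// ?q_biorth// ?eqxx ?mulr1//; exact: phi_dom.
move=> i ik; rewrite Bq_q// ?q_biorth//; last exact: phi_dom.
by rewrite (negbTE ik) mulr0.
Qed.

Lemma PP_P1 x : PP (sall (S := S)) (P1 S x) = 0.
Proof. by rewrite P1E (blinB (PP_bounded hroot _)) PP_PP// subrr. Qed.

Lemma Bq1_eq0 x (i : 'I_(nker S)) : PP (sall (S := S)) x = 0 -> Bq i 1 x = 0.
Proof.
move=> Px; have nu0 : (0 < nu)%N by exact: leq_trans (mult_gt0 hroot i) (mult_le hroot i).
have := Bq_PP (p := (i, Ordinal nu0)) hroot (sall (S := S)) x (mult_gt0 hroot i).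
by rewrite Px /= Bq1_0 => <-.
Qed.

(** For k < nu, A (P_1 a_k) = Q_1 (A a_k) vanishes because P_1 a_(k-1) = 0, and P_1 a_k has no root
    components; so [kernel_zero] gives P_1 a_k = 0 by induction. *)
Lemma range_Q1 y : exists x, [/\ D x, PP (sall (S := S)) x = 0 & A x = Q1 S y].
Proof.
have [a ha] := resolvent_chain y.
have bQ1 : bounded_linear_on setT (QQ (sall (S := S))) by exact: QQ_bounded.
have hz k : (k < nu)%N -> P1 S (a k) = 0.
  elim: k => [|k IH] knu.
    have [Da ea] := ha 0%N (ltnW knu).
    apply: kernel_zero; [exact: dom_P1| |by move=> i; exact: Bq1_eq0 (PP_P1 _)].
    by rewrite A_P1// ea ltn_eqF// scale0r subr0 Q1E (blin0 bQ1) subr0.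
  have [Da ea] := ha _ (ltnW knu); have [Db _] := ha k (ltnW (ltnW knu)).
  apply: kernel_zero; [exact: dom_P1| |by move=> i; exact: Bq1_eq0 (PP_P1 _)].
  rewrite A_P1// ea ltn_eqF// scale0r sub0r Q1E (blinN bQ1) -opprD -Q1E -B_P1//.
  by rewrite IH 1?ltnW// (opB0 lA lB) oppr0.
have [Da ea] := ha nu (leqnn _); exists (P1 S (a nu)); split; [exact: dom_P1|exact: PP_P1|].
rewrite A_P1// ea eqxx scale1r; case: nu ha hz {Da ea} => [|n] ha hz; first by rewrite subr0.
have [Db _] := ha n (leqnSn n).
suff : Q1 S (B (a n)) = 0 by rewrite !Q1E (blinB bQ1) => e; rewrite -[RHS]subr0 -e; lincomb_eq.
by rewrite -B_P1// hz// (opB0 lA lB).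
Qed.

(** Pairing with q_i^(m_i) annihilates A x and recovers [Bq i 1 x] from the finite-rank part; these
    values being equal, x - x' lies in the kernel of A and [kernel_zero] applies. *)
Lemma Atilde_inj : {in D &, injective (Atilde S)}.
Proof.
have q1 (i : 'I_(nker S)) x : D x -> q i (mult i) (Atilde S x) = Bq i 1 x.
  move=> Dx; have h (j : 'I_(nker S)) : (1 <= @mult R X Y S j <= @mult R X Y S j)%N by rewrite mult_gt0//=.
  have h1 (j : 'I_(nker S)) : (1 <= 1 <= @mult R X Y S j)%N by rewrite mult_gt0.
  have [qlin _ _] := q_functional hroot (h i).
  rewrite /Atilde -[A x](actY1 K) qlin// mul1r q_A// ltnn add0r.
  rewrite (functional_sum (S := S) (act := aY))//; first last.
  - by move=> k _; have [] := Bq_functional hroot (h1 k).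
  - exact: q_functional (h i).
  - exact: actY1.
  rewrite (bigD1 i)//= big1 ?addr0; first by rewrite q_biorth ?eqxx ?mulr1.
  by move=> k ki; rewrite q_biorth// (negbTE ki) mulr0.
move=> x x' /set_mem Dx /set_mem Dx' e.
have eB (i : 'I_(nker S)) : Bq i 1 x = Bq i 1 x' by rewrite -q1// e q1.
have eA : A x = A x'.
  move: e; rewrite /Atilde; under eq_bigr do rewrite eB.
  exact: addIr.
apply/eqP; rewrite -subr_eq0; apply/eqP; apply: kernel_zero.
- exact: (dom_sub lA lB).
- by rewrite (A_B lA)// eA subrr.
move=> i; have h1 : (1 <= 1 <= @mult R X Y S i)%N by rewrite mult_gt0.
have [/(_ _ _ _ (is_scalar_real K (-1))) h _ _] := Bq_functional hroot h1.
rewrite addrC -scaleN1r -(actX_real K) h eB; apply/eqP.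
by rewrite rmorphN rmorph1 mulN1r addrC subr_eq0.
Qed.

(** Precomposition with Q_1 gives an operator on the whole of Y, to which the closed graph theorem
    applies. *)
Definition Ainv (y : Y) := Atilde_inv S (Q1 S y).

Lemma Ainv_unique x y : D x -> PP (sall (S := S)) x = 0 -> A x = Q1 S y -> Ainv y = x.
Proof.
move=> Dx Px Ax; rewrite /Ainv; have <- : Atilde S x = Q1 S y.
  by rewrite /Atilde big1 ?addr0// => i _; rewrite Bq1_eq0// actY0.
by apply: (pinvKV _ Atilde_inj); exact: mem_set.
Qed.

Lemma AinvP y : [/\ D (Ainv y), PP (sall (S := S)) (Ainv y) = 0 & A (Ainv y) = Q1 S y].
Proof. by have [x [Dx Px Ax]] := range_Q1 y; rewrite (Ainv_unique Dx Px Ax). Qed.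

Lemma Q1_bounded : bounded_linear_on setT (Q1 S).
Proof.
have bQ := QQ_bounded hroot (sall (S := S)); split=> [a x y _ _|].
  by rewrite !Q1E (blinP bQ); lincomb_eq.
have [C C0 hC] := blin_bound bQ; exists (1 + C) => x _.
by rewrite Q1E mulrDl mul1r (le_trans (ler_normB _ _))// lerD2l.
Qed.

Lemma P1_bounded : bounded_linear_on setT (P1 S).
Proof.
have bQ := PP_bounded hroot (sall (S := S)); split=> [a x y _ _|].
  by rewrite !P1E (blinP bQ); lincomb_eq.
have [C C0 hC] := blin_bound bQ; exists (1 + C) => x _.
by rewrite P1E mulrDl mul1r (le_trans (ler_normB _ _))// lerD2l.
Qed.

Lemma blin_continuous (V W : normedModType R) (L : V -> W) :
  bounded_linear_on setT L -> continuous L.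
Proof. by move=> bL x; apply: (blin_cvg bL); exact: cvg_id. Qed.

Lemma Ainv_bounded : bounded_linear_on setT Ainv.
Proof.
have bP := PP_bounded hroot (sall (S := S)).
apply: closed_graph_theorem => [a x y|].
  have [Dx Px Ax] := AinvP x; have [Dy Py Ay] := AinvP y.
  apply: Ainv_unique; first exact: domP.
    by rewrite (blinP bP) Px Py scaler0 addr0.
  by rewrite (A_real lA)// Ax Ay (blinP Q1_bounded).
rewrite (_ : [set _ | _] = ((fun p : Y * X => (p.2, Q1 S p.1)) @^-1` [set p | D p.1 /\ p.2 = A p.1])
   `&` ((fun p : Y * X => PP (sall (S := S)) p.2) @^-1` [set 0])).
  apply: closedI; apply: closed_comp => //; last first.
  - exact: accessible_closed_set1 (hausdorff_accessible (@norm_hausdorff _ _)) _.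
  - move=> p _; apply: (@continuous_comp _ _ _ snd (PP _) p); first exact: cvg_snd.
    exact: blin_continuous.
  - move=> p _; apply: cvg_pair; first exact: cvg_snd.
    apply: (@continuous_comp _ _ _ fst (Q1 S) p); first exact: cvg_fst.
    exact: (blin_continuous Q1_bounded).
apply/seteqP; split=> -[y x] /=.
  by move=> ->; have [? ? ?] := AinvP y.
by move=> [[Dx Ax] Px]; rewrite (Ainv_unique Dx Px).
Qed.

Lemma B_Ainv_bounded : bounded_linear_on setT (B \o Ainv).
Proof.
have bL := Ainv_bounded.
apply: closed_graph_theorem => [a x y|] /=.
  have [Dx _ _] := AinvP x; have [Dy _ _] := AinvP y.
  by rewrite (blinP bL) (B_real lB).
rewrite (_ : [set _ | _] = (fun p : Y * Y => (Ainv p.1, p.2)) @^-1` [set p | domB S p.1 /\ p.2 = B p.1]).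
  apply: closed_comp; last by case: hB.
  move=> p _; apply: cvg_pair; last exact: cvg_snd.
  apply: (@continuous_comp _ _ _ fst Ainv p); first exact: cvg_fst.
  exact: (blin_continuous bL).
apply/seteqP; split=> -[y w] /=; last by case.
by have [[_ ?] _ _] := AinvP y.
Qed.

End Atilde.

(** * Algebraic components *)

Section ProjectorRange.
Context {R : realType} {V : normedModType R}.
Variables (P : V -> V) (bP : bounded_linear_on setT P).

Lemma closed_fixed : closed [set x | P x = x].
Proof.
have bP' : bounded_linear_on setT (fun x => P x - x).
  split=> [a x y _ _|]; first by rewrite (blinP bP); lincomb_eq.
  have [C C0 hC] := blin_bound bP; exists (C + 1) => x _.
  by rewrite mulrDl mul1r (le_trans (ler_normB _ _))// lerD2r.
rewrite (_ : [set _ | _] = (fun x => P x - x) @^-1` [set 0]).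
  apply: closed_comp; last exact: accessible_closed_set1 (hausdorff_accessible (@norm_hausdorff _ _)) _.
  by move=> x _; exact: (blin_continuous bP').
by apply/seteqP; split=> x /=; [move=> ->; rewrite subrr|move/eqP; rewrite subr_eq0 => /eqP].
Qed.

Lemma fixed_lin (a : R) x y : P x = x -> P y = y -> P (a *: x + y) = a *: x + y.
Proof. by move=> Px Py; rewrite (blinP bP) Px Py. Qed.

Lemma rel_openP (E M : set V) z : rel_open E M -> M z ->
  exists2 r : R, 0 < r & forall z', E z' -> `|z' - z| < r -> M z'.
Proof.
move=> [G Go ->] [_ Gz].
have : nbhs z G by exact: open_nbhs_nbhs.
move=> /nbhs_ballP[r r0 hr]; exists r => // z' Ez' zz'; split=> //.
by apply: hr; rewrite -ball_normE /= distrC.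
Qed.

Lemma rel_open_sub (E M : set V) : rel_open E M -> M `<=` E.
Proof. by move=> [G _ ->] z []. Qed.

End ProjectorRange.

Lemma eq_boundedly_invertible (R : realType) (V W : normedModType R) (E : set V) (F : set W)
    (L L' : V -> W) : (forall h, E h -> L h = L' h) ->
  boundedly_invertible E F L -> boundedly_invertible E F L'.
Proof.
move=> LL' [I [h1 h2 h3]]; exists I; split=> // [x Ex|y Fy].
  by rewrite -LL'//; exact: h1.
by have [Ey e] := h2 y Fy; split=> //; rewrite -LL'.
Qed.

Section Sumsets.
Context {R : realType} {X Y : normedModType R}.
Implicit Types (M E : nat -> set X) (a b : nat).

Lemma famsum_sub a b M E : (forall j, (a <= j < b)%N -> M j `<=` E j) ->
  famsum a b M `<=` famsum a b E.
Proof. by move=> ME _ [z zM <-]; exists z => // j ab; apply: ME => //; exact: zM. Qed.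

Lemma famsum_lin a b E : (forall j, (a <= j < b)%N -> forall (c : R) x y, E j x -> E j y -> E j (c *: x + y)) ->
  forall (c : R) x y, famsum a b E x -> famsum a b E y -> famsum a b E (c *: x + y).
Proof.
move=> EP c _ _ [z zE <-] [z' zE' <-]; exists (fun j => c *: z j + z' j).
  by move=> j ab; apply: EP => //; [exact: zE|exact: zE'].
by rewrite big_split scaler_sumr.
Qed.

Lemma famsum_0 a b E : (forall j, (a <= j < b)%N -> E j 0) -> famsum a b E 0.
Proof. by move=> E0; exists (fun=> 0) => //; rewrite big1. Qed.

Lemma famsum_first a b E x : (a < b)%N -> (forall j, (a <= j < b)%N -> E j 0) -> E a x -> famsum a b E x.
Proof.
move=> ab E0 Ex; exists (fun j => if j == a then x else 0).
  by move=> j ajb; case: eqP => [->//|_]; exact: E0.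
rewrite big_ltn// eqxx big_nat_cond big1 ?addr0// => j /andP[/andP[aj _] _].
by rewrite gtn_eqF.
Qed.

Lemma famsumI a b M (z : nat -> X) : (forall j, (a <= j < b)%N -> M j (z j)) ->
  famsum a b M (\sum_(a <= j < b) z j).
Proof. by exists z. Qed.

Lemma setsum_lin (E F : set X) : (forall (c : R) x y, E x -> E y -> E (c *: x + y)) ->
  (forall (c : R) x y, F x -> F y -> F (c *: x + y)) ->
  forall (c : R) x y, setsum E F x -> setsum E F y -> setsum E F (c *: x + y).
Proof.
move=> EP FP c _ _ [x Ex [y Fy <-]] [x' Ex' [y' Fy' <-]].
exists (c *: x + x'); first exact: EP.
by exists (c *: y + y'); [exact: FP|lincomb_eq].
Qed.

Lemma setsum_sub (M N E F : set X) : M `<=` E -> N `<=` F -> setsum M N `<=` setsum E F.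
Proof. by move=> ME NF _ [x /ME Ex [y /NF Fy <-]]; exists x => //; exists y. Qed.

Lemma famsum1 b M : famsum b b.+1 M = M b.
Proof.
apply/seteqP; split=> [_ [z zM <-]|x Mx].
  by rewrite big_nat1; apply: zM; rewrite leqnn /=.
exists (fun=> x); last by rewrite big_nat1.
by move=> j; rewrite ltnS -eqn_leq => /eqP <-.
Qed.

End Sumsets.

Lemma sum_update (V : zmodType) (s a b : nat) (z : nat -> V) (x : V) : (s < a)%N ->
  \sum_(a <= j < b) (if j == s then x else z j) = \sum_(a <= j < b) z j.
Proof.
move=> sa; rewrite big_nat_cond [RHS]big_nat_cond; apply: eq_bigr => j.
by move=> /andP[/andP[aj _] _]; rewrite gtn_eqF// (leq_trans sa).
Qed.

Lemma Ccurve_sum (R : realType) (V : normedModType R) (E : set V) k a b (x : nat -> R -> V) :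
  E 0 -> (forall u v, E u -> E v -> E (u + v)) ->
  (forall j, (a <= j < b)%N -> Ccurve E k (x j)) ->
  Ccurve E k (fun t => \sum_(a <= j < b) x j t).
Proof.
move=> E0 ED xC; case: (leqP a b) => [ab|ba]; last first.
  apply: (@eq_Ccurve _ _ _ k (fun=> 0)); last exact: Ccurve_cst.
  by move=> t _; rewrite big_geq// ltnW.
rewrite -(subnKC ab) in xC *; elim: (b - a)%N xC => [|n IH] xC.
  apply: (@eq_Ccurve _ _ _ k (fun=> 0)); last exact: Ccurve_cst.
  by move=> t _; rewrite addn0 big_geq.
apply: (@eq_Ccurve _ _ _ k (fun t => \sum_(a <= j < a + n) x j t + x (a + n)%N t)).
  by move=> t _; rewrite addnS big_nat_recr ?leq_addr.
apply: Ccurve_add => //; last by apply: xC; rewrite leq_addr/= addnS.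
by apply: IH => j /andP[aj jn]; apply: xC; rewrite aj addnS ltnW// ltnS ltnW.
Qed.

Section Curves.
Context {R : realType} {X Y : completeNormedModType R}.
Local Notation J := (Rplus R).

(** Interface to [implicit_curve] in which the spaces of unknowns and of values are fixed spaces of
    projectors, and unique solvability takes the form of conditions 1. *)
Lemma implicit_step (N E M0 : set X) (k : nat) (g : R * X -> Y) (P : X -> X) (Q : Y -> Y)
    (K : X -> Y) (kap : R -> X) (lam : R -> Y) :
  let E0 := [set x | P x = x] in let F0 := [set y | Q y = y] in
  (0 < k)%N -> Ck_on k (J `*` N) ([set: R] `*` E) g -> N `<=` E -> E 0 ->
  (forall (a : R) x y, E x -> E y -> E (a *: x + y)) -> E0 `<=` E ->
  bounded_linear_on setT P -> bounded_linear_on setT Q -> (forall y, Q (Q y) = Q y) ->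
  bounded_linear_on setT K -> (forall p, Q (g p) = g p) -> (forall z, Q (K z) = K z) ->
  (forall t, 0 <= t -> Q (lam t) = lam t) ->
  rel_open E0 M0 -> Ccurve E k kap -> Ccurve setT k lam ->
  (forall t z, 0 <= t -> M0 z -> N (kap t + z)) ->
  (forall t, 0 <= t -> exists! z, M0 z /\ g (t, kap t + z) = K z + lam t) ->
  (forall t z, 0 <= t -> M0 z -> g (t, kap t + z) = K z + lam t ->
     exists L : X -> Y, frechet_within N E (fun x => g (t, x)) (kap t + z) L /\
       boundedly_invertible E0 F0 (fun h => L h - K h)) ->
  exists eta, Ccurve E0 k eta /\ forall t, 0 <= t ->
    [/\ M0 (eta t), g (t, kap t + eta t) = K (eta t) + lam t &
       forall z, M0 z -> g (t, kap t + z) = K z + lam t -> z = eta t].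
Proof.
move=> E0 F0 k0 [T [Tg Tlin Tbound Tdiff Tcont]] NE E_0 EP E0E bP bQ QQ bK Qg QK Ql M0o kapC lamC kapN U inv.
have exeta t : exists z, 0 <= t -> unique (fun z => M0 z /\ g (t, kap t + z) = K z + lam t) z.
  have [t0|_] := boolP (0 <= t); last by exists 0.
  by have [z zU] := U t t0; exists z.
have [eta etaP] := choice exeta; exists eta.
have hU t : 0 <= t -> [/\ M0 (eta t), g (t, kap t + eta t) = K (eta t) + lam t &
       forall z, M0 z -> g (t, kap t + z) = K z + lam t -> z = eta t].
  by move=> t0; have [[h1 h2] h3] := etaP t t0; split=> // z Mz ez; rewrite (h3 z).
split=> //.
apply: (@implicit_curve _ _ _ N E E0 F0 k g T Q K k0 NE E_0 EP E0E _ _ _ bQ _ _ bK Tg Tlin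
    Tbound Tdiff Tcont M0 kap eta lam _ _ kapC lamC kapN) => //.
- exact: closed_fixed.
- by rewrite /E0 /= (blin0 bP).
- exact: fixed_lin.
- exact: rel_open_sub M0o.
- by move=> z; exact: rel_openP.
- by move=> t z t0 Mz; rewrite /F0 /= !(blinB bQ) Qg QK Ql.
- by move=> t t0; have [] := hU t t0.
- by move=> t z t0; have [_ _] := hU t t0; apply.
- by move=> t t0; have [h1 h2 _] := hU t t0; exact: inv.
Qed.

End Curves.

Section AlgebraicEquations.
Context {R : realType} {X Y : completeNormedModType R}.
Variables (S : pencil_data X Y) (f : R -> X -> Y) (Md Mw : nat -> set X).
Local Notation A := (opA S).
Local Notation B := (opB S).
Local Notation nu := (nu_of S).
Local Notation K := (scalars S).
Local Notation D := (dom S).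
Local Notation PP := (@PP R X Y S).
Local Notation QQ := (@QQ R X Y S).
Local Notation AP := (@AP R X Y S).
Local Notation BP := (@BP R X Y S).
Local Notation sdiag := (@sdiag R X Y S).
Local Notation swedge := (@swedge R X Y S).
Local Notation slev := (@slev R X Y S).
Local Notation shift := (@shift R X Y S).
Hypothesis lA : linear_operator K (domA S) A.
Hypothesis lB : linear_operator K (domB S) B.
Hypothesis hroot : canonical_root_system S.
Hypothesis hMd : forall j, (1 <= j < nu)%N -> rel_open (Ddiag S j) (Md j).
Hypothesis hMw : forall j, (1 <= j < nu.-1)%N -> rel_open (Dwedge S j) (Mw j).

Let bP s := PP_bounded hroot s.
Let bQ s := QQ_bounded hroot s.

Lemma DdiagE s : Ddiag S s = [set x | PP (sdiag s) x = x].
Proof.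
rewrite -(PP_image lA lB hroot) /Ddiag; congr (_ @` _).
by apply/funext => x; rewrite P2sj_PP.
Qed.

Lemma DwedgeE s : Dwedge S s = [set x | PP (swedge s) x = x].
Proof.
rewrite -(PP_image lA lB hroot) /Dwedge; congr (_ @` _).
by apply/funext => x; rewrite P2wedge_PP.
Qed.

Lemma D2sE s : D2s S s = [set x | PP (slev s) x = x].
Proof.
rewrite -(PP_image lA lB hroot) /D2s; congr (_ @` _).
by apply/funext => x; rewrite P2s_PP.
Qed.

Lemma YdiagE s : Ydiag S s = [set y | QQ (sdiag s) y = y].
Proof.
rewrite -(QQ_range hroot) /Ydiag; congr (_ @` _).
by apply/funext => x; rewrite Q2sj_QQ.
Qed.

Lemma Y2SigmaE s : Y2Sigma S s = [set y | QQ (swedge s) y = y].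
Proof.
rewrite -(QQ_range hroot) /Y2Sigma; congr (_ @` _).
by apply/funext => x; rewrite Q2Sigma_QQ.
Qed.

Lemma Y2sE s : Y2s S s = [set y | QQ (slev s) y = y].
Proof.
rewrite -(QQ_range hroot) /Y2s; congr (_ @` _).
by apply/funext => x; rewrite Q2s_QQ.
Qed.

Lemma fixed_dom s x : PP s x = x -> D x.
Proof. by move=> <-; exact: PP_dom. Qed.

Lemma A_fixed s x : PP s x = x -> A x = AP s x.
Proof. by move=> {1}<-; exact: A_PP. Qed.

Lemma B_fixed s x : PP s x = x -> B x = BP s x.
Proof. by move=> {1}<-; exact: B_PP. Qed.

Lemma QA_fixed (s r : 'I_(nker S) -> nat -> bool) x : (forall i l, s i l -> shift r i l) -> PP s x = x -> QQ r (A x) = A x.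
Proof.
move=> sr Px; rewrite QQ_Aop//; last exact: fixed_dom Px.
rewrite -{1}Px AP_PP// (A_fixed Px); apply: eq_AP => i l _.
by case: (boolP (s i l)) => [/sr ->|]; rewrite ?andbF.
Qed.

Lemma QB_fixed s x : PP s x = x -> QQ s (B x) = B x.
Proof. by move=> Px; rewrite (QQ_Bop hroot) ?(B_fixed Px)//; exact: fixed_dom Px. Qed.

Lemma QBP s x : QQ s (BP s x) = BP s x.
Proof.
rewrite -B_PP// QB_fixed//.
by rewrite PP_PP//; apply: eq_PP => i l _; rewrite andbb.
Qed.

(** No chain is longer than nu, so none continues beyond the last level. This makes F_{2Sigma,nu-2},
    which contains no wedge derivative, an instance of the general F_{2Sigma,s}. *)
Lemma swedge_last x : PP (swedge nu.-1) x = 0.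
Proof.
rewrite /PP /proj_sum /gsum big1// => p /andP[vp /andP[/eqP e h]].
by have := leq_trans h (mult_le hroot p.1); lia.
Qed.

Lemma slev_last_P x : PP (slev nu.-1) x = PP (sdiag nu.-1) x.
Proof.
by apply: eq_PP => i l; have := mult_le hroot i; rewrite /slev /sdiag; case: eqP => //= ->; lia.
Qed.

Lemma slev_last_Q y : QQ (slev nu.-1) y = QQ (sdiag nu.-1) y.
Proof.
by apply: eq_QQ => i l; have := mult_le hroot i; rewrite /slev /sdiag; case: eqP => //= ->; lia.
Qed.

Lemma Ddiag_lin j (c : R) x y : Ddiag S j x -> Ddiag S j y -> Ddiag S j (c *: x + y).
Proof. by rewrite DdiagE; exact: fixed_lin. Qed.

Lemma Dwedge_lin j (c : R) x y : Dwedge S j x -> Dwedge S j y -> Dwedge S j (c *: x + y).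
Proof. by rewrite DwedgeE; exact: fixed_lin. Qed.

Lemma Ddiag0 j : Ddiag S j 0.
Proof. by rewrite DdiagE /= (blin0 (bP _)). Qed.

Lemma Dwedge0 j : Dwedge S j 0.
Proof. by rewrite DwedgeE /= (blin0 (bP _)). Qed.

Let lin_add (E : set X) : (forall (c : R) x y, E x -> E y -> E (c *: x + y)) ->
  forall x y, E x -> E y -> E (x + y).
Proof. by move=> h x y Ex Ey; rewrite -[x]scale1r; exact: h. Qed.

Let QQid r y : QQ r (QQ r y) = QQ r y.
Proof. by rewrite QQ_QQ//; apply: eq_QQ => i l _; rewrite andbb. Qed.

Section Diagonal.
(** The derivative of x_{2(nu-1)} enters the equation of level nu - 2, whose solution is to be
    C^(nu-2), whence the extra order at the last level. The derivatives of the lower diagonal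
    components enter equations of level at most nu - 3, for which C^(nu-3) is enough. *)
Let kd s := if s == nu.-1 then nu.-1 else nu.-2.
Hypothesis Cdiag : forall s, (1 <= s < nu)%N ->
  Ck_on (kd s) (Rplus R `*` famsum s nu Md) ([set: R] `*` famsum s nu (Ddiag S))
    (fun p : R * X => QQ (sdiag s) (f p.1 p.2)).
Hypothesis Udiag : forall s, (1 <= s < nu)%N -> forall (t : R) (xd : nat -> X), 0 <= t ->
  (forall j, (s.+1 <= j < nu)%N -> Md j (xd j)) ->
  exists! z, Md s z /\ QQ (sdiag s) (f t (z + \sum_(s.+1 <= j < nu) xd j)) = B z.
Hypothesis Idiag : forall s, (1 <= s < nu)%N -> forall (t : R) (xd : nat -> X), 0 <= t ->
  (forall i, (s <= i < nu)%N -> Md i (xd i)) ->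
  QQ (sdiag s) (f t (\sum_(s <= j < nu) xd j)) = B (xd s) ->
  exists L : X -> Y,
    frechet_within (famsum s nu Md) (famsum s nu (Ddiag S))
      (fun x => QQ (sdiag s) (f t x)) (\sum_(s <= i < nu) xd i) L /\
    boundedly_invertible (Ddiag S s) (Ydiag S s)
      (fun h => L (P2sj S s s.+1 h) - Q2sj S s s.+1 (B (P2sj S s s.+1 h))).

Definition diag_solution s (kap eta : R -> X) := Ccurve (Ddiag S s) (kd s) eta /\
  forall t : R, 0 <= t -> [/\ Md s (eta t), QQ (sdiag s) (f t (eta t + kap t)) = B (eta t) &
     forall z, Md s z -> QQ (sdiag s) (f t (z + kap t)) = B z -> z = eta t].

Lemma diag_step s (xd : nat -> R -> X) : (1 <= s < nu)%N ->
  (forall j, (s < j < nu)%N -> Ccurve (Ddiag S j) (kd j) (xd j) /\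
     forall t : R, 0 <= t -> Md j (xd j t)) ->
  exists eta, diag_solution s (fun t => \sum_(s.+1 <= j < nu) xd j t) eta.
Proof.
move=> snu hxd; have /andP[s0 sn] := snu.
have Mdt j (t : R) : 0 <= t -> (s < j < nu)%N -> Md j (xd j t).
  by move=> t0 /hxd[_]; exact.
pose kap t := \sum_(s.+1 <= j < nu) xd j t.
have Blin z : Md s z -> B z = BP (sdiag s) z + 0.
  by move=> /(rel_open_sub (hMd snu)); rewrite DdiagE addr0 => /B_fixed.
have Elin := @famsum_lin R X s nu (Ddiag S) (fun j _ => @Ddiag_lin j).
have sumE z t : \sum_(s <= j < nu) (if j == s then z else xd j t) = z + kap t.
  by rewrite big_ltn// eqxx sum_update.
have upd z (t : R) : 0 <= t -> Md s z -> forall j, (s <= j < nu)%N -> Md j (if j == s then z else xd j t).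
  move=> t0 Mz j /andP[sj jn]; case: eqP => [->//|/eqP js].
  by apply: Mdt; rewrite // ltn_neqAle eq_sym js sj.
have k0 : (0 < kd s)%N by rewrite /kd; case: eqP; lia.
have kapC : Ccurve (famsum s nu (Ddiag S)) (kd s) kap.
  apply: Ccurve_sum => [|u v|j jn].
  - by apply: famsum_0 => j _; exact: Ddiag0.
  - exact: lin_add.
  - have [jC _] := hxd j jn; apply: Ccurve_subset (CcurveW _ jC) => [x Ex|]; last first.
      by rewrite /kd; case: eqP; case: eqP; lia.
    exists (fun i => if i == j then x else 0) => [i _|]; first by case: eqP => [->|_] //; exact: Ddiag0.
    rewrite (bigD1_seq j) ?mem_index_iota ?iota_uniq//=; last by lia.
    by rewrite eqxx big1 ?addr0// => i /negbTE ->.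
suff [eta [etaC etaP]] : exists eta, Ccurve [set x | PP (sdiag s) x = x] (kd s) eta /\
    forall t : R, 0 <= t -> [/\ Md s (eta t),
     QQ (sdiag s) (f t (kap t + eta t)) = BP (sdiag s) (eta t) + 0 &
     forall z, Md s z -> QQ (sdiag s) (f t (kap t + z)) = BP (sdiag s) z + 0 -> z = eta t].
  exists eta; split=> [|t t0]; first by rewrite DdiagE.
  have [h1 h2 h3] := etaP t t0; split=> //; first by rewrite Blin// addrC.
  by move=> z Mz ez; apply: h3 => //; rewrite addrC ez Blin.
apply: (@implicit_step R X Y (famsum s nu Md) (famsum s nu (Ddiag S)) (Md s)
    (kd s) (fun p => QQ (sdiag s) (f p.1 p.2)) (PP (sdiag s)) (QQ (sdiag s)) (BP (sdiag s)) kap (fun=> 0)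
    k0 (Cdiag snu)).
- by apply: famsum_sub => j jn; apply: rel_open_sub; apply: hMd; lia.
- by apply: famsum_0 => j _; exact: Ddiag0.
- exact: Elin.
- by rewrite -DdiagE => x Ex; apply: famsum_first => // j _; exact: Ddiag0.
- exact: bP.
- exact: bQ.
- exact: QQid.
- exact: BP_bounded.
- by move=> p; exact: QQid.
- exact: QBP.
- by move=> t _; exact: blin0.
- by rewrite -DdiagE; exact: hMd.
- exact: kapC.
- exact: Ccurve_cst.
- by move=> t z t0 Mz; rewrite addrC -sumE; apply: famsumI; exact: upd.
- move=> t t0; have [|z [[Mz ez] zU]] := Udiag snu (xd := xd ^~ t) t0.
    by move=> j jn; exact: Mdt.
  exists z; split; first by split=> //; rewrite addrC -Blin.
  by move=> z' [Mz' ez']; apply: zU; split=> //; rewrite Blin// addrC.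
- move=> t z t0 Mz ez; have [|L] := Idiag snu t0 (upd z t t0 Mz).
    by rewrite sumE eqxx addrC Blin.
  rewrite sumE addrC DdiagE YdiagE => -[Lf Li]; exists L; split=> //.
  apply: eq_boundedly_invertible Li => h /= Ph.
  by rewrite P2sj_PP// Q2sj_QQ// Ph QB_fixed// (B_fixed Ph).
Qed.

Lemma diag_curves : exists xd : nat -> R -> X, forall s, (1 <= s < nu)%N ->
  diag_solution s (fun t => \sum_(s.+1 <= j < nu) xd j t) (xd s).
Proof.
(* Downward induction on the level, with n the number of top levels already solved. *)
suff h n : exists xd : nat -> R -> X, forall s, (1 <= s < nu)%N -> (nu - n <= s)%N ->
    diag_solution s (fun t => \sum_(s.+1 <= j < nu) xd j t) (xd s).
  by have [xd xdP] := h nu; exists xd => s hs; apply: xdP; rewrite // subnn.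
elim: n => [|n [xd IH]]; first by exists (fun _ _ => 0) => s; lia.
have [sn|sn] := boolP (1 <= nu - n.+1 < nu)%N; last by exists xd => s hs ns; apply: IH; lia.
have [j jn|eta etaP] := @diag_step (nu - n.+1) xd sn.
  have [||h1 h2] := IH j; [lia|lia|split=> // t t0].
  by have [] := h2 t t0.
pose xd' j := if j == (nu - n.+1)%N then eta else xd j.
exists xd' => s hs ns.
have -> : (fun t => \sum_(s.+1 <= j < nu) xd' j t) = (fun t => \sum_(s.+1 <= j < nu) xd j t).
  apply/funext => t; rewrite big_nat_cond [RHS]big_nat_cond; apply: eq_bigr => j jn.
  by rewrite /xd' gtn_eqF//; lia.
rewrite /xd'; case: eqP => [->//|sn']; apply: IH => //; lia.
Qed.
End Diagonal.

Section Wedge.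
Hypothesis Cwedge : forall s, (1 <= s < nu.-1)%N ->
  Ck_on s (Rplus R `*` Msum S s Md Mw) ([set: R] `*` Msum S s (Ddiag S) (Dwedge S))
    (fun p : R * X => QQ (swedge s) (f p.1 p.2)).
Hypothesis Uwedge : forall s, (1 <= s < nu.-1)%N ->
  forall (t : R) (xd xw : nat -> X) d dw, 0 <= t ->
  (forall j, (1 <= j < nu)%N -> Md j (xd j)) ->
  (forall i, (s.+1 <= i < nu.-1)%N -> Mw i (xw i)) ->
  Ddiag S s.+1 d -> Dwedge S s.+1 dw ->
  exists! z, Mw s z /\
    QQ (swedge s) (f t (\sum_(1 <= j < nu) xd j + (z + \sum_(s.+1 <= i < nu.-1) xw i))) =
      B z + A (d + dw).
Hypothesis Iwedge : forall s, (1 <= s < nu.-1)%N ->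
  forall (t : R) (xd xw : nat -> X) d dw, 0 <= t ->
  (forall j, (1 <= j < nu)%N -> Md j (xd j)) ->
  (forall i, (s <= i < nu.-1)%N -> Mw i (xw i)) ->
  Ddiag S s.+1 d -> Dwedge S s.+1 dw ->
  QQ (swedge s) (f t (\sum_(1 <= j < nu) xd j + \sum_(s <= i < nu.-1) xw i)) =
    B (xw s) + A (d + dw) ->
  exists L : X -> Y,
    frechet_within (Msum S s Md Mw) (Msum S s (Ddiag S) (Dwedge S))
      (fun x => QQ (swedge s) (f t x))
      (\sum_(1 <= j < nu) xd j + \sum_(s <= i < nu.-1) xw i) L /\
    boundedly_invertible (Dwedge S s) (Y2Sigma S s)
      (fun h => L (P2wedge S s h) - Q2Sigma S s (B (P2wedge S s h))).

Definition wedge_solution s (kap : R -> X) (lam : R -> Y) (eta : R -> X) :=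
  Ccurve (Dwedge S s) s eta /\
  forall t : R, 0 <= t -> [/\ Mw s (eta t), QQ (swedge s) (f t (kap t + eta t)) = B (eta t) + lam t &
     forall z, Mw s z -> QQ (swedge s) (f t (kap t + z)) = B z + lam t -> z = eta t].

(** By the chain relations A maps the components of level s + 1 into the range of Q_{2Sigma,s}, and
    it acts there as a bounded operator; both properties make A (d + dw) an admissible known
    term. *)
Lemma A_ddw s d dw : Ddiag S s.+1 d -> Dwedge S s.+1 dw ->
  A (d + dw) = AP (sdiag s.+1) d + AP (swedge s.+1) dw /\
  QQ (swedge s) (A (d + dw)) = A (d + dw).
Proof.
rewrite DdiagE DwedgeE /= => Pd Pw; have Dd := fixed_dom Pd; have Dw := fixed_dom Pw.
rewrite (A_D lA)// (blinD (bQ _)) (@QA_fixed (sdiag s.+1))//; last first.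
  by rewrite /sdiag /shift /swedge => i l /andP[/eqP-> /eqP->]; rewrite /= eqxx ltnSn.
rewrite (@QA_fixed (swedge s.+1))//; last first.
  by rewrite /shift /swedge => i l /andP[/eqP-> h] /=; rewrite eqxx; lia.
by rewrite (A_fixed Pd) (A_fixed Pw).
Qed.

Lemma wedge_step s (xd xw : nat -> R -> X) (d dw : R -> X) : (1 <= s < nu.-1)%N ->
  (forall j, (1 <= j < nu)%N -> Ccurve (Ddiag S j) s (xd j) /\
     forall t : R, 0 <= t -> Md j (xd j t)) ->
  (forall j, (s < j < nu.-1)%N -> Ccurve (Dwedge S j) s (xw j) /\
     forall t : R, 0 <= t -> Mw j (xw j t)) ->
  Ccurve (Ddiag S s.+1) s d -> Ccurve (Dwedge S s.+1) s dw ->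
  exists eta, wedge_solution s
    (fun t => \sum_(1 <= j < nu) xd j t + \sum_(s.+1 <= j < nu.-1) xw j t)
    (fun t => A (d t + dw t)) eta.
Proof.
move=> snu hxd hxw dC dwC; have /andP[s0 sn] := snu.
have Mwt j (t : R) : 0 <= t -> (s < j < nu.-1)%N -> Mw j (xw j t).
  by move=> t0 /hxw[_]; exact.
have Mdt j (t : R) : 0 <= t -> (1 <= j < nu)%N -> Md j (xd j t).
  by move=> t0 /hxd[_]; exact.
pose kap t := \sum_(1 <= j < nu) xd j t + \sum_(s.+1 <= j < nu.-1) xw j t.
pose lam t := AP (sdiag s.+1) (d t) + AP (swedge s.+1) (dw t).
have lamE (t : R) : 0 <= t -> A (d t + dw t) = lam t.
  by move=> t0; have [] := A_ddw (Ccurve_in dC t0) (Ccurve_in dwC t0).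
have Blin z : Mw s z -> B z = BP (swedge s) z.
  by move=> /(rel_open_sub (hMw snu)); rewrite DwedgeE => /B_fixed.
have Elin := setsum_lin (@famsum_lin R X 1 nu (Ddiag S) (fun j _ => @Ddiag_lin j))
  (@famsum_lin R X s nu.-1 (Dwedge S) (fun j _ => @Dwedge_lin j)).
have F1 : famsum 1 nu (Ddiag S) 0 by apply: famsum_0 => j _; exact: Ddiag0.
have F2 : famsum s nu.-1 (Dwedge S) 0 by apply: famsum_0 => j _; exact: Dwedge0.
have E0 : Msum S s (Ddiag S) (Dwedge S) 0 by exists 0 => //; exists 0; rewrite ?addr0.
have single (G : nat -> set X) a b j : (forall j, G j 0) -> (a <= j < b)%N -> G j `<=` famsum a b G.
  move=> G0 jn x Gx; exists (fun i => if i == j then x else 0) => [i _|]; first by case: eqP => [->|_].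
  rewrite (bigD1_seq j) ?mem_index_iota ?iota_uniq//=.
  by rewrite eqxx big1 ?addr0// => i /negbTE ->.
have sumE z t : \sum_(s <= j < nu.-1) (if j == s then z else xw j t) = z + \sum_(s.+1 <= j < nu.-1) xw j t.
  by rewrite big_ltn// eqxx sum_update.
have upd z (t : R) : 0 <= t -> Mw s z -> forall j, (s <= j < nu.-1)%N -> Mw j (if j == s then z else xw j t).
  move=> t0 Mz j /andP[sj jn]; case: eqP => [->//|/eqP js].
  by apply: Mwt; rewrite // ltn_neqAle eq_sym js sj.
have kapC : Ccurve (Msum S s (Ddiag S) (Dwedge S)) s kap.
  apply: Ccurve_add; first exact: lin_add.
    apply: Ccurve_sum => [//||j jn]; first exact: lin_add.
    apply: Ccurve_subset (hxd j jn).1 => x Ex; exists x; first by apply: single Ex; [exact: Ddiag0|].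
    by exists 0; rewrite ?addr0.
  apply: Ccurve_sum => [//||j jn]; first exact: lin_add.
  apply: Ccurve_subset (hxw j jn).1 => x Ex; exists 0 => //; exists x; last by rewrite add0r.
  by apply: single Ex; [exact: Dwedge0|lia].
suff [eta [etaC etaP]] : exists eta, Ccurve [set x | PP (swedge s) x = x] s eta /\
    forall t : R, 0 <= t -> [/\ Mw s (eta t),
     QQ (swedge s) (f t (kap t + eta t)) = BP (swedge s) (eta t) + lam t &
     forall z, Mw s z -> QQ (swedge s) (f t (kap t + z)) = BP (swedge s) z + lam t -> z = eta t].
  exists eta; split=> [|t t0]; first by rewrite DwedgeE.
  have [h1 h2 h3] := etaP t t0; rewrite lamE//; split=> //; first by rewrite Blin.
  by move=> z Mz ez; apply: h3 => //; rewrite ez Blin.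
apply: (@implicit_step R X Y (Msum S s Md Mw) (Msum S s (Ddiag S) (Dwedge S)) (Mw s)
    s (fun p => QQ (swedge s) (f p.1 p.2)) (PP (swedge s)) (QQ (swedge s)) (BP (swedge s)) kap lam
    s0 (Cwedge snu)).
- apply: setsum_sub; apply: famsum_sub => j jn; apply: rel_open_sub; first exact: hMd.
  by apply: hMw; lia.
- exact: E0.
- exact: Elin.
- rewrite -DwedgeE => x Ex; exists 0 => //; exists x; last by rewrite add0r.
  by apply: single Ex; [exact: Dwedge0|rewrite leqnn].
- exact: bP.
- exact: bQ.
- exact: QQid.
- exact: BP_bounded.
- by move=> p; exact: QQid.
- exact: QBP.
- by move=> t t0; rewrite -lamE//; have [] := A_ddw (Ccurve_in dC t0) (Ccurve_in dwC t0).
- by rewrite -DwedgeE; exact: hMw.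
- exact: kapC.
- by apply: CcurveD; [apply: (Ccurve_blin (AP_bounded hroot _)) dC|apply: (Ccurve_blin (AP_bounded hroot _)) dwC].
- move=> t z t0 Mz; exists (\sum_(1 <= j < nu) xd j t); first by apply: famsumI => j jn; exact: Mdt.
  exists (\sum_(s <= j < nu.-1) (if j == s then z else xw j t)); first by apply: famsumI; exact: upd.
  by rewrite sumE /kap; lincomb_eq.
- move=> t t0; have [||||z [[Mz ez] zU]] := Uwedge snu (xd := xd ^~ t) (xw := xw ^~ t) (d := d t) (dw := dw t) t0.
  + by move=> j jn; exact: Mdt.
  + by move=> j jn; exact: Mwt.
  + exact: Ccurve_in dC t0.
  + exact: Ccurve_in dwC t0.
  have kE z' : kap t + z' = \sum_(1 <= j < nu) xd j t + (z' + \sum_(s.+1 <= j < nu.-1) xw j t).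
    by rewrite /kap; lincomb_eq.
  exists z; split; first by split=> //; rewrite -Blin// -lamE// kE.
  by move=> z' [Mz' ez']; apply: zU; split=> //; rewrite Blin// lamE// -kE.
- move=> t z t0 Mz ez.
  have kE : kap t + z = \sum_(1 <= j < nu) xd j t + \sum_(s <= j < nu.-1) (if j == s then z else xw j t).
    by rewrite sumE /kap; lincomb_eq.
  have [||||L] := Iwedge snu (xd := xd ^~ t) (d := d t) (dw := dw t) t0 _ (upd z t t0 Mz).
  + by move=> j jn; exact: Mdt.
  + exact: Ccurve_in dC t0.
  + exact: Ccurve_in dwC t0.
  + by rewrite -kE eqxx Blin// lamE.
  rewrite -kE DwedgeE Y2SigmaE => -[Lf Li]; exists L; split=> //.
  apply: eq_boundedly_invertible Li => h /= Ph.
  by rewrite P2wedge_PP// Q2Sigma_QQ// Ph QB_fixed// (B_fixed Ph).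
Qed.

(** The bookkeeping of classes: [xw s] is C^s, and its equation contains [dxw s.+1], the derivative
    of a C^(s+1) curve. From level nu - 1 on [dxw] is the zero curve, in accordance with
    [swedge_last]. *)
Lemma wedge_curves (xd dxd : nat -> R -> X) :
  (forall j, (1 <= j < nu)%N -> Ccurve (Ddiag S j) nu.-2 (xd j) /\
     forall t : R, 0 <= t -> Md j (xd j t)) ->
  (forall s, (1 <= s < nu.-1)%N -> Ccurve (Ddiag S s.+1) s (dxd s.+1)) ->
  exists xw dxw : nat -> R -> X,
    [/\ forall s, (nu.-1 <= s)%N -> dxw s = fun=> 0,
     forall s, (1 <= s)%N -> Ccurve (Dwedge S s) s.-1 (dxw s),
     forall s, (1 <= s < nu.-1)%N -> forall t : R, 0 <= t -> deriv_within (Rplus R) (xw s) t (dxw s t) &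
     forall s, (1 <= s < nu.-1)%N -> wedge_solution s
      (fun t => \sum_(1 <= j < nu) xd j t + \sum_(s.+1 <= j < nu.-1) xw j t)
      (fun t => A (dxd s.+1 t + dxw s.+1 t)) (xw s)].
Proof.
move=> hxd hdxd.
suff h n : exists xw dxw : nat -> R -> X,
    [/\ forall s, (nu.-1 <= s)%N -> dxw s = fun=> 0,
     forall s, (1 <= s)%N -> (nu - n <= s)%N -> Ccurve (Dwedge S s) s.-1 (dxw s),
     forall s, (1 <= s < nu.-1)%N -> (nu - n <= s)%N ->
       forall t : R, 0 <= t -> deriv_within (Rplus R) (xw s) t (dxw s t) &
     forall s, (1 <= s < nu.-1)%N -> (nu - n <= s)%N -> wedge_solution s
      (fun t => \sum_(1 <= j < nu) xd j t + \sum_(s.+1 <= j < nu.-1) xw j t)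
      (fun t => A (dxd s.+1 t + dxw s.+1 t)) (xw s)].
  have [xw [dxw [h1 h2 h3 h4]]] := h nu; exists xw, dxw; split=> // s hs.
  - by apply: h2 => //; rewrite subnn.
  - by apply: h3 => //; rewrite subnn.
  - by apply: h4 => //; rewrite subnn.
elim: n => [|n [xw [dxw [h1 h2 h3 h4]]]].
  exists (fun _ _ => 0), (fun _ _ => 0); split=> // s; [|lia|lia].
  by move=> _ _; apply: Ccurve_cst; exact: Dwedge0.
set s := (nu - n.+1)%N; have [sn|sn] := boolP (1 <= s < nu.-1)%N; last first.
  exists xw, dxw; split=> // s' hs' ns'; [|apply: h3; lia|apply: h4; lia].
  have [ns|sns] := leqP (nu - n)%N s'; first exact: h2.
  by rewrite h1; [apply: Ccurve_cst; exact: Dwedge0|lia].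
have [j jn|j jn|||eta etaP] := @wedge_step s xd xw (dxd s.+1) (dxw s.+1) sn.
- have [xC xM] := hxd j jn; split=> //; apply: CcurveW xC; lia.
- have [||xC xM] := h4 j; [lia|lia|split=> [|t t0]]; last by have [] := xM t t0.
  by apply: CcurveW xC; lia.
- exact: hdxd.
- by have := h2 s.+1 isT; apply; lia.
have [etaC _] := etaP; have [s' ss'] : exists s', s = s'.+1 by exists s.-1; lia.
have [deta detaP detaC] : exists2 dx : R -> X, (forall t : R, 0 <= t -> deriv_within (Rplus R) eta t (dx t)) &
    Ccurve (Dwedge S s) s.-1 dx.
  by move: etaC; rewrite {2}ss' => -[_ [dx dxP dxC]]; exists dx => //; rewrite ss' in dxC *.
pose xw' j := if j == s then eta else xw j.
pose dxw' j := if j == s then deta else dxw j.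
have kE j : (s <= j)%N -> (fun t => \sum_(1 <= j < nu) xd j t + \sum_(j.+1 <= j < nu.-1) xw' j t) =
    (fun t => \sum_(1 <= j < nu) xd j t + \sum_(j.+1 <= j < nu.-1) xw j t).
  move=> sj; apply/funext => t; congr (_ + _).
  rewrite big_nat_cond [RHS]big_nat_cond; apply: eq_bigr => i jn.
  by rewrite /xw' gtn_eqF//; lia.
have dE j : (s <= j)%N -> dxw' j.+1 = dxw j.+1 by move=> sj; rewrite /dxw' gtn_eqF.
exists xw', dxw'; split=> [j hj|j hj jn|j hj jn|j hj jn].
- by rewrite /dxw' gtn_eqF ?h1//; lia.
- by rewrite /dxw'; case: eqP => [->//|sj]; apply: h2; lia.
- by rewrite /dxw' /xw'; case: eqP => [_//|sj]; apply: h3; lia.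
- rewrite kE// dE// /xw'; case: eqP => [->//|sj]; apply: h4; lia.
Qed.
End Wedge.
End AlgebraicEquations.

(** * The component x_20 *)

Section ImplicitComponent.
Context {R : realType} {X Y : completeNormedModType R}.
Variables (E1 E0 M0 : set X) (F0 : set Y) (h0 h1 : R -> X -> X -> Y) (K : X -> Y)
  (lam : R -> Y) (zeta : R -> X -> X).
Implicit Types (t s e : R) (x y z : X).

Definition jointly_continuous (h : R -> X -> X -> Y) := forall t x z,
  0 <= t -> E1 x -> M0 z -> forall e, 0 < e -> exists2 d : R, 0 < d & forall s y u,
    0 <= s -> E1 y -> M0 u -> `|s - t| < d -> `|y - x| < d -> `|u - z| < d ->
    `|h s y u - h t x z| <= e.

Definition jointly_lipschitz (h : R -> X -> X -> Y) := forall t x z,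
  0 <= t -> E1 x -> M0 z -> exists r L : R, [/\ 0 < r, 0 < L & forall s y y' u u',
    0 <= s -> `|s - t| < r -> E1 y -> E1 y' -> `|y - x| < r -> `|y' - x| < r ->
    M0 u -> M0 u' -> `|u - z| < r -> `|u' - z| < r ->
    `|h s y u - h s y' u'| <= L * (`|y - y'| + `|u - u'|)].

(** The common content of the two alternatives of condition 2.e at the point zeta t x: h0 - K is
    close to an invertible operator, uniformly for (s, y) near (t, x). The known term lam cancels in
    the differences. *)
Definition contractive := forall t x, 0 <= t -> E1 x ->
  exists (Z : X -> Y) (Zi : Y -> X) (c k r : R),
   [/\ is_bounded_inverse E0 F0 Z Zi, [/\ 0 < c, 0 <= k & c * k < 1], 0 < r,
     forall (y : Y), F0 y -> `|Zi y| <= c * `|y| &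
     forall s y z' z'', 0 <= s -> `|s - t| < r -> E1 y -> `|y - x| < r ->
       M0 z' -> M0 z'' -> `|z' - zeta t x| <= r -> `|z'' - zeta t x| <= r ->
       `|(h0 s y z' - K z') - (h0 s y z'' - K z'') - Z (z' - z'')| <= k * `|z' - z''|].

Hypothesis E0cl : closed E0.
Hypothesis E0_0 : E0 0.
Hypothesis E0P : forall (a : R) x y, E0 x -> E0 y -> E0 (a *: x + y).
Hypothesis F0_0 : F0 0.
Hypothesis F0P : forall (a : R) (x y : Y), F0 x -> F0 y -> F0 (a *: x + y).
Hypothesis M0o : rel_open E0 M0.
Hypothesis KF : forall z, E0 z -> F0 (K z).
Hypothesis h0F : forall t x z, F0 (h0 t x z).
Hypothesis lamF : forall t, 0 <= t -> F0 (lam t).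
Hypothesis lamc : forall t, 0 <= t -> lam @ within (Rplus R) (nbhs t) --> lam t.
Hypotheses (h0c : jointly_continuous h0) (h1c : jointly_continuous h1).
Hypotheses (h0l : jointly_lipschitz h0) (h1l : jointly_lipschitz h1).
Hypothesis zetaP : forall t x, 0 <= t -> E1 x ->
  [/\ M0 (zeta t x), h0 t x (zeta t x) = K (zeta t x) + lam t &
    forall z, M0 z -> h0 t x z = K z + lam t -> z = zeta t x].
Hypothesis contr : contractive.

Let F0B (x y : Y) : F0 x -> F0 y -> F0 (x - y).
Proof. by move=> Fx Fy; rewrite -scaleN1r addrC; exact: F0P. Qed.

(** Continuity comes from [implicit_near] on the filter of points (s, y). For the Lipschitz bound,
    zeta s y and zeta s y' are compared through the single map [Phi (s, y)]: it vanishes at the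
    first, and at the second equals a difference of values of h0 that is Lipschitz in y. *)
Lemma zeta_regular t x e : 0 <= t -> E1 x -> 0 < e ->
  exists d L : R, [/\ 0 < d, 0 < L & forall s y y',
    0 <= s -> `|s - t| < d -> E1 y -> E1 y' -> `|y - x| < d -> `|y' - x| < d ->
    `|zeta s y - zeta t x| <= e /\ `|zeta s y - zeta s y'| <= L * `|y - y'|].
Proof.
move=> t0 Ex e0; have [Z [Zi [c [k [r [ZiP [c0 k0 ck] r0 Zic hk]]]]]] := contr t0 Ex.
have [Mz ez _] := zetaP t0 Ex; set z0 := zeta t x in Mz ez hk *.
have [r1 r10 hM] := rel_openP M0o Mz.
have [r2 [L [r20 L0 hL]]] := h0l t0 Ex Mz.
pose rho := Order.min (Order.min r e) (Order.min r1 r2) / 2.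
have m0 : 0 < Order.min (Order.min r e) (Order.min r1 r2) by rewrite !lt_min r0 e0 r10.
have rho0 : 0 < rho by rewrite divr_gt0.
have : rho < Order.min (Order.min r e) (Order.min r1 r2) by rewrite /rho; lra.
rewrite !lt_min => /andP[/andP[rhor rhoe] /andP[rho1 rho2]].
have Ez0 : E0 z0 by exact: rel_open_sub M0o _ Mz.
have MB z : E0 z -> `|z - z0| <= rho -> M0 z.
  by move=> Ez zz; apply: hM => //; exact: le_lt_trans rho1.
pose Phi (p : R * X) z := h0 p.1 p.2 z - K z - lam p.1.
have PhiF s y z : 0 <= s -> E0 z -> F0 (Phi (s, y) z).
  by move=> s0 Ez; apply: (F0B _ (lamF s0)); apply: F0B => //; exact: KF.
have Phik s y : 0 <= s -> `|s - t| < r -> E1 y -> `|y - x| < r ->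
  forall z' z'', E0 z' -> E0 z'' -> `|z' - z0| <= rho -> `|z'' - z0| <= rho ->
       `|Phi (s, y) z' - Phi (s, y) z'' - Z (z' - z'')| <= k * `|z' - z''|.
  move=> s0 st Ey yx z' z'' E' E'' r' r''.
  have := hk s y z' z'' s0 st Ey yx (MB _ E' r') (MB _ E'' r'') (le_trans r' (ltW rhor)) (le_trans r'' (ltW rhor)).
  apply: le_trans; rewrite le_eqVlt; apply/orP; left; apply/eqP; congr `|_|.
  by rewrite /Phi /=; lincomb_eq.
pose F := within (Rplus R `*` E1) (nbhs (t, x)).
have pairN (p : R * X) (d : R) : `|p - (t, x)| < d -> `|p.1 - t| < d /\ `|p.2 - x| < d.
  by rewrite prod_normE /= gt_max => /andP[].
have : \forall p \near F, [/\ E0 (zeta p.1 p.2), `|zeta p.1 p.2 - z0| <= rho &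
    `|zeta p.1 p.2 - z0| <= c / (1 - c * k) * `|Phi p z0|].
  apply: (implicit_near E0cl E0P F0_0 F0P ZiP c0 Zic k0 ck _ Ez0 rho0 MB).
  - apply/near_withinP; exists r => // -[s y] [/= s0 Ey] /pairN[/= st yx].
    by split=> [z Ez _|]; [exact: PhiF|exact: Phik].
  - have -> : 0 = Phi (t, x) z0 by rewrite /Phi /= ez; lincomb_eq.
    apply/cvgr_normP => e' e'0; have e2 : 0 < e' / 2 by rewrite divr_gt0.
    have [d1 d10 hd1] := h0c t0 Ex Mz e2.
    have /cvgr_normP/(_ _ e2)/near_withinP[d2 d20 hd2] := lamc t0.
    apply/near_withinP; exists (Order.min d1 d2); first by rewrite lt_min d10.
    move=> [s y] [/= s0 Ey] /pairN[/=]; rewrite !lt_min => /andP[s1 s2] /andP[y1 y2].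
    have -> : Phi (s, y) z0 - Phi (t, x) z0 = (h0 s y z0 - h0 t x z0) - (lam s - lam t).
      by rewrite /Phi /=; lincomb_eq.
    rewrite (le_trans (ler_normB _ _))// [leRHS]splitr lerD//; last exact: hd2.
    by apply: hd1; rewrite // subrr normr0.
  - apply/near_withinP; exists 1 => // -[s y] [/= s0 Ey] _ z Mz' /eqP.
    have [_ _ hu] := zetaP s0 Ey; rewrite /Phi /= => ez'; apply: hu => //.
    by move: ez'; rewrite !subr_eq add0r => /eqP ->; rewrite addrC.
move=> /near_withinP[d d0 hd].
have ck1 : 0 < 1 - c * k by rewrite subr_gt0.
exists (Order.min (Order.min d r) r2), (c / (1 - c * k) * L); split.
- by rewrite !lt_min d0 r0.
- by rewrite mulr_gt0// divr_gt0.
move=> s y y' s0; rewrite !lt_min => /andP[/andP[sd sr] sr2] Ey Ey' /andP[/andP[yd yr] yr2] /andP[/andP[y'd y'r] y'r2].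
have near_z v : E1 v -> `|v - x| < d -> E0 (zeta s v) /\ `|zeta s v - z0| <= rho.
  move=> Ev vd; have [||h1' h2 _] := hd (s, v); [by []| |by []].
  by rewrite prod_normE /= gt_max sd.
have [Ez zr] := near_z y Ey yd; have [Ez' z'r] := near_z y' Ey' y'd.
split; first exact: le_trans zr (ltW rhoe).
have hcd := contraction_dist E0P F0P ZiP c0 Zic ck (fun z Ez _ => PhiF s y z s0 Ez)
  (Phik s y s0 sr Ey yr) Ez Ez' zr z'r.
have cc0 : 0 <= c / (1 - c * k) by rewrite divr_ge0// ltW.
rewrite (le_trans hcd)// -[leRHS]mulrA ler_wpM2l//.
have [Mzy ezy _] := zetaP s0 Ey; have [Mzy' ezy' _] := zetaP s0 Ey'.
have -> : Phi (s, y) (zeta s y) - Phi (s, y) (zeta s y') = h0 s y' (zeta s y') - h0 s y (zeta s y').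
  by rewrite /Phi /= ezy ezy'; lincomb_eq.
have := hL s y' y (zeta s y') (zeta s y') s0 sr2 Ey' Ey y'r2 yr2 Mzy' Mzy'
  (le_lt_trans z'r rho2) (le_lt_trans z'r rho2).
by rewrite subrr normr0 addr0 [`|y' - y|]distrC.
Qed.

Section Field.
Variables (Ai : Y -> X) (BAi : Y -> Y).
Hypotheses (bAi : bounded_linear_on setT Ai) (bBAi : bounded_linear_on setT BAi).
Hypothesis AiE : forall w, E1 (Ai w).

Definition ode_field t (w : Y) := h1 t (Ai w) (zeta t (Ai w)) - BAi w.

Lemma ode_field_continuous : ode_continuous 0 ode_field.
Proof.
move=> t w t0 e e0; have e2 : 0 < e / 2 by rewrite divr_gt0.
have [Mz _ _] := zetaP t0 (AiE w).
have [d d0 hd] := h1c t0 (AiE w) Mz e2.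
have d2 : 0 < d / 2 by rewrite divr_gt0.
have [d' [L [d'0 L0 hz]]] := zeta_regular t0 (AiE w) d2.
have [C C0 hC] := blin_bound bAi; have [C' C'0 hC'] := blin_bound bBAi.
pose del := Order.min (Order.min d d') (Order.min (Order.min d d' / C) (e / 2 / C')).
have dd0 : 0 < Order.min d d' by rewrite lt_min d0.
exists del; first by rewrite lt_min dd0 lt_min !divr_gt0.
move=> s u s0; rewrite !lt_min => /andP[/andP[sd sd'] _] /andP[_ /andP[uC uC']].
have : `|Ai u - Ai w| < Order.min d d'.
  by rewrite -(blinB bAi) (le_lt_trans (hC _))// mulrC -ltr_pdivlMr.
rewrite lt_min => /andP[ud ud'].
have [hz1 _] := hz s (Ai u) (Ai u) s0 sd' (AiE u) (AiE u) ud' ud'.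
have [Mu _ _] := zetaP s0 (AiE u).
have hd1 := hd s (Ai u) _ s0 (AiE u) Mu sd ud (le_lt_trans hz1 (_ : d / 2 < d)).
have -> : ode_field s u - ode_field t w =
   (h1 s (Ai u) (zeta s (Ai u)) - h1 t (Ai w) (zeta t (Ai w))) - (BAi u - BAi w).
  by rewrite /ode_field; lincomb_eq.
rewrite (le_trans (ler_normB _ _))// [leRHS]splitr lerD//; first by apply: hd1; lra.
by rewrite -(blinB bBAi) (le_trans (hC' _))// mulrC -ler_pdivlMr// ltW.
Qed.

Lemma ode_field_lipschitz : ode_lipschitz 0 ode_field.
Proof.
move=> t w t0; have [Mz _ _] := zetaP t0 (AiE w).
have [r [L [r0 L0 hL]]] := h1l t0 (AiE w) Mz.
have r2 : 0 < r / 2 by rewrite divr_gt0.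
have [d [L' [d0 L'0 hz]]] := zeta_regular t0 (AiE w) r2.
have [C C0 hC] := blin_bound bAi; have [C' C'0 hC'] := blin_bound bBAi.
have m0 : 0 < Order.min r d by rewrite lt_min r0.
exists (Order.min (Order.min r d) (Order.min r d / C)), (L * (1 + L') * C + C'); split.
- by rewrite lt_min m0 divr_gt0.
- by rewrite addr_gt0// !mulr_gt0// addr_gt0.
move=> s u v s0; rewrite !lt_min => /andP[/andP[sr sd] _] /andP[_ uC] /andP[_ vC].
have Aid u' : `|u' - w| < Order.min r d / C -> `|Ai u' - Ai w| < r /\ `|Ai u' - Ai w| < d.
  move=> h; apply/andP; rewrite -lt_min -(blinB bAi) (le_lt_trans (hC _))//.
  by rewrite mulrC -ltr_pdivlMr.
have [ur ud] := Aid u uC; have [vr vd] := Aid v vC.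
have [hu huv] := hz s _ _ s0 sd (AiE u) (AiE v) ud vd.
have [hv _] := hz s _ _ s0 sd (AiE v) (AiE v) vd vd.
have [Mu _ _] := zetaP s0 (AiE u); have [Mv _ _] := zetaP s0 (AiE v).
have rr : r / 2 < r by lra.
have hh := hL s _ _ _ _ s0 sr (AiE u) (AiE v) ur vr Mu Mv (le_lt_trans hu rr) (le_lt_trans hv rr).
have -> : ode_field s u - ode_field s v =
   (h1 s (Ai u) (zeta s (Ai u)) - h1 s (Ai v) (zeta s (Ai v))) - (BAi u - BAi v).
  by rewrite /ode_field; lincomb_eq.
have hA : `|Ai u - Ai v| <= C * `|u - v| by rewrite -(blinB bAi).
have hB : `|BAi u - BAi v| <= C' * `|u - v| by rewrite -(blinB bBAi).
rewrite (le_trans (ler_normB _ _))// mulrDl lerD//.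
rewrite (le_trans hh)// -!mulrA ler_pM2l// (le_trans (lerD (lexx _) huv))//.
by rewrite -[X in X + _]mul1r -mulrDl ler_pM2l// addr_gt0.
Qed.
End Field.
End ImplicitComponent.

Lemma opnorm_bound (R : realType) (V W : normedModType R) (E : set V) (L : V -> W) (x : V) :
  (forall (a : R) y, E y -> E (a *: y)) -> bounded_linear_on E L -> E 0 -> E x ->
  `|L x| <= opnorm E L * `|x|.
Proof.
move=> EZ [Llin [C hC]] E0 Ex.
have L0 : L 0 = 0 by have := Llin (-1) 0 0 E0 E0; rewrite scaler0 addr0 scaleN1r addNr.
have LZ (a : R) : L (a *: x) = a *: L x by rewrite -[X in L X]addr0 Llin// L0 addr0.
have [->|x0] := eqVneq x 0; first by rewrite L0 !normr0 mulr0.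
have nx : 0 < `|x| by rewrite normr_gt0.
have ne : `| (`|x|^-1 *: x) | = 1 by rewrite normrZ normfV normr_id mulVf ?gt_eqF.
rewrite -ler_pdivrMr// mulrC.
have -> : `|x|^-1 * `|L x| = `|L (`|x|^-1 *: x)|.
  by rewrite LZ normrZ normfV normr_id.
apply: ub_le_sup; last first.
  by exists (`|x|^-1 *: x) => //; split; [exact: EZ|rewrite ne].
exists `|C| => _ [y [Ey y1] <-].
rewrite (le_trans (hC y Ey))// (le_trans (ler_wpM2r (normr_ge0 y) (ler_norm C)))//.
by rewrite ler_piMr.
Qed.

Section Regularity.
Context {R : realType} {X Y : completeNormedModType R}.
Variables (S : pencil_data X Y) (f : R -> X -> Y) (M20 : set X) (Md Mw : nat -> set X).
Local Notation A := (opA S).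
Local Notation B := (opB S).
Local Notation nu := (nu_of S).
Local Notation K := (scalars S).
Local Notation D := (dom S).
Local Notation PP := (@PP R X Y S).
Local Notation QQ := (@QQ R X Y S).
Local Notation BP := (@BP R X Y S).
Local Notation sdiag := (@sdiag R X Y S).
Local Notation swedge := (@swedge R X Y S).
Local Notation slev := (@slev R X Y S).
Local Notation spos := (@spos R X Y S).
Local Notation sall := (@sall R X Y S).
Local Notation M := (Mtotal S M20 Md Mw).
Hypothesis hA : closed_densely_defined K (domA S) A.
Hypothesis hB : closed_densely_defined K (domB S) B.
Hypothesis hroot : canonical_root_system S.
Hypothesis hf : {within Rplus R `*` D, continuous (fun p : R * X => f p.1 p.2)}.
Hypothesis hM20 : rel_open (D2s S 0) M20.
Hypothesis hMd : forall j, (1 <= j < nu)%N -> rel_open (Ddiag S j) (Md j).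
Hypothesis hMw : forall j, (1 <= j < nu.-1)%N -> rel_open (Dwedge S j) (Mw j).
Variables (xS d dw : R -> X) (zeta : R -> X -> X).
Hypothesis xSM : forall t : R, 0 <= t -> Msum S 1 Md Mw (xS t).
Hypothesis xSc : forall t : R, 0 <= t -> xS @ within (Rplus R) (nbhs t) --> xS t.
Hypothesis dE : forall t : R, 0 <= t -> Ddiag S 1 (d t) /\ Dwedge S 1 (dw t).

Let lA : linear_operator K (domA S) A. Proof. by case: hA. Qed.
Let lB : linear_operator K (domB S) B. Proof. by case: hB. Qed.
Let bP s := PP_bounded hroot s.
Let bQ s := QQ_bounded hroot s.

Definition slice_Q20 (t : R) (x1 z : X) := QQ (slev 0) (f t (x1 + z + xS t)).
Definition slice_Q1 (t : R) (x1 z : X) := Q1 S (f t (x1 + z + xS t)).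

Lemma D1P x : D1 S x <-> D x /\ PP sall x = 0.
Proof.
split=> [[y Dy <-]|[Dx Px]].
  by split; [exact: dom_P1|exact: PP_P1].
by exists x => //; rewrite P1E// Px subr0.
Qed.

Lemma D1_lin (a : R) x y : D1 S x -> D1 S y -> D1 S (a *: x + y).
Proof.
move=> /D1P[Dx Px] /D1P[Dy Py]; apply/D1P; split; first exact: domP.
by rewrite (blinP (bP _)) Px Py scaler0 addr0.
Qed.

Lemma PP_D1 s x : D1 S x -> PP s x = 0.
Proof.
move=> /D1P[_ Px]; rewrite -(blin0 (bP s)) -Px PP_PP//; apply: eq_PP => i l _.
by rewrite andbT.
Qed.

Lemma Pfixed (s r : 'I_(nker S) -> nat -> bool) x : PP s x = x -> (forall i l, s i l -> r i l) -> PP r x = x.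
Proof.
move=> <- sr; rewrite PP_PP//; apply: eq_PP => i l _.
by case: (boolP (s i l)) => [/sr->|]; rewrite ?andbF.
Qed.

Lemma Pdisjoint (s r : 'I_(nker S) -> nat -> bool) x : PP s x = x -> (forall i l, s i l -> ~~ r i l) -> PP r x = 0.
Proof.
move=> <- sr; rewrite PP_PP// /PP /proj_sum /gsum big1// => p /andP[_].
by case: (boolP (s p.1 p.2)) => [/sr/negbTE->|]; rewrite ?andbF.
Qed.

Lemma Msum_sub s : (1 <= s)%N -> Msum S s Md Mw `<=` Msum S s (Ddiag S) (Dwedge S).
Proof.
move=> s1; apply: setsum_sub; apply: famsum_sub => j jn; apply: rel_open_sub; first exact: hMd.
by apply: hMw; lia.
Qed.

Lemma Msum_spos s x : (1 <= s)%N -> Msum S s (Ddiag S) (Dwedge S) x -> PP spos x = x.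
Proof.
move=> s1 [_ [z zE <-] [_ [z' zE' <-] <-]].
rewrite (blinD (bP _)) !(blin_sum (bP _)); congr (_ + _);
  rewrite big_nat_cond [RHS]big_nat_cond; apply: eq_bigr => j /andP[jn _].
  have := zE j jn; rewrite DdiagE// => /Pfixed; apply=> i l /andP[/eqP-> _].
  by rewrite /spos; lia.
have := zE' j jn; rewrite DwedgeE// => /Pfixed; apply=> i l /andP[/eqP-> _].
by rewrite /spos; lia.
Qed.

Let xSspos (t : R) : 0 <= t -> PP spos (xS t) = xS t.
Proof. by move=> t0; apply: (@Msum_spos 1) => //; apply: Msum_sub => //; exact: xSM. Qed.

Let M20D z : M20 z -> PP (slev 0) z = z.
Proof. by move=> /(rel_open_sub hM20); rewrite D2sE. Qed.

Lemma total_in (t : R) x z : 0 <= t -> D1 S x -> M20 z -> M (x + z + xS t).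
Proof.
move=> t0 Ex Mz; exists (x + z); first by exists x => //; exists z.
by exists (xS t) => //; exact: xSM.
Qed.

Lemma total_dom x : M x -> D x.
Proof.
move=> [_ [x1 E1 [z Mz <-]] [w Mw' <-]].
have /D1P[D1x _] := E1; have Dz := fixed_dom lA lB hroot (M20D Mz).
have Dw : D w by apply: (fixed_dom lA lB hroot (s := spos)); apply: (@Msum_spos 1) => //; exact: Msum_sub.
by do 2 ?apply: (domD lA lB).
Qed.

Lemma total_spos (t : R) x z : 0 <= t -> D1 S x -> M20 z -> P2Sigma S (x + z + xS t) = xS t.
Proof.
move=> t0 Ex Mz; rewrite P2Sigma_PP// !(blinD (bP _)) PP_D1// add0r xSspos//.
rewrite (Pdisjoint (M20D Mz)) ?add0r// => i l /eqP ->; by [].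
Qed.

Lemma slice_near (t : R) x z (r : R) : 0 <= t -> 0 < r -> exists2 e : R, 0 < e &
  forall s y u, 0 <= s -> `|s - t| < e -> `|y - x| < e -> `|u - z| < e ->
    `|s - t| < r /\ `|y + u + xS s - (x + z + xS t)| < r.
Proof.
move=> t0 r0; have r4 : 0 < r / 4 by rewrite divr_gt0.
have /cvgr_normP/(_ _ r4)/near_withinP[e e0 he] := xSc t0.
exists (Order.min e (r / 4)); first by rewrite lt_min e0.
move=> s y u s0; rewrite !lt_min => /andP[se sr] /andP[_ yr] /andP[_ ur].
have hx := he s s0 se; split; first by lra.
have -> : y + u + xS s - (x + z + xS t) = ((y - x) + (u - z)) + (xS s - xS t) by lincomb_eq.
have := ler_normD ((y - x) + (u - z)) (xS s - xS t); have := ler_normD (y - x) (u - z).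
by lra.
Qed.

Lemma h_continuous (Q : Y -> Y) : bounded_linear_on setT Q ->
  jointly_continuous (D1 S) M20 (fun t x z => Q (f t (x + z + xS t))).
Proof.
move=> bL t x z t0 Ex Mz e e0; have [C C0 hC] := blin_bound bL.
have Np : (Rplus R `*` D) (t, x + z + xS t) by split=> //; apply: total_dom; exact: total_in.
have /subspace_continuousP/(_ _ Np)/cvgr_normP/(_ _ (divr_gt0 e0 C0))/near_withinP[r r0 hr] := hf.
have [d' d'0 hd] := slice_near x z t0 r0; exists d' => // s y u s0 Ey Mu sd yd ud.
rewrite -(blinB bL) (le_trans (hC _))// mulrC -ler_pdivlMr//.
have [h1' h2'] := hd s y u s0 sd yd ud.
apply: (hr (s, y + u + xS s)); first by split=> //; apply: total_dom; exact: total_in.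
by rewrite prod_normE /= gt_max h1'.
Qed.

Lemma h_lipschitz (Q : Y -> Y) :
  loc_lipschitz_x1_x20 S M (fun t x => Q (f t x)) ->
  jointly_lipschitz (D1 S) M20 (fun t x z => Q (f t (x + z + xS t))).
Proof.
move=> hL t x z t0 Ex Mz.
have [r [L [r0 L0 hr]]] := hL t _ t0 (total_in t0 Ex Mz).
have [e e0 he] := slice_near x z t0 r0; exists e, (L + 1); split=> //; first by rewrite ltr_wpDl.
move=> s y y' u u' s0 se Ey Ey' ye y'e Mu Mu' ue u'e.
have [h1' h2'] := he s y u s0 se ye ue; have [_ h3'] := he s y' u' s0 se y'e u'e.
rewrite (le_trans (hr s _ _ _ _ _ _))//.
- by split=> //; exact: total_in.
- by split=> //; exact: total_in.
(* Both points carry the same component xS s, as the restricted Lipschitz condition demands. *)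
- by rewrite !total_spos.
have -> : y + u + xS s - (y' + u' + xS s) = (y - y') + (u - u') by lincomb_eq.
rewrite (le_trans (ler_wpM2l L0 (ler_normD _ _)))// mulrDl lerDl mul1r addr_ge0//.
Qed.

Section Differentiable.
Variables (Q : Y -> Y) (dQ : R * X -> X -> Y).
Hypothesis dQP : forall (t : R) x, 0 <= t -> M x ->
  frechet_within M D (fun y => Q (f t y)) x (dQ (t, x)).
Hypothesis dQc : op_continuous_on (Rplus R `*` M) D dQ.

Lemma convex_ball (V : normedModType R) (a b c : V) (s r : R) : 0 <= s <= 1 ->
  `|a - c| < r -> `|b - c| < r -> `|a + s *: (b - a) - c| < r.
Proof.
move=> /andP[s0 s1] ac bc.
have -> : a + s *: (b - a) - c = (1 - s) *: (a - c) + s *: (b - c) by lincomb_eq.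
have s1' : 0 <= 1 - s by lra.
pose m := Order.max `|a - c| `|b - c|; have mr : m < r by rewrite gt_max ac.
rewrite (le_lt_trans (ler_normD _ _))// !normrZ !ger0_norm// (le_lt_trans _ mr)//.
have slice_Q1 : (1 - s) * `|a - c| <= (1 - s) * m by rewrite ler_wpM2l// le_max lexx.
have h2 : s * `|b - c| <= s * m by rewrite ler_wpM2l// le_max lexx orbT.
by rewrite (le_trans (lerD slice_Q1 h2))// -mulrDl subrK mul1r.
Qed.

(** The segment between two nearby points with the same component xS s stays in M, since D_1 is a
    subspace and M_20 is relatively open. With w = 0 the result is a Lipschitz bound; with w the
    derivative at the base point it is strict differentiability. *)
Lemma increment_bound (t : R) x z (C e : R) (w : X -> Y) :
  0 <= t -> D1 S x -> M20 z -> 0 < e ->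
  (forall h, D h -> `|dQ (t, x + z + xS t) h - w h| <= C * `|h|) ->
  exists2 r : R, 0 < r & forall s y y' u u', 0 <= s -> `|s - t| < r ->
    D1 S y -> D1 S y' -> `|y - x| < r -> `|y' - x| < r ->
    M20 u -> M20 u' -> `|u - z| < r -> `|u' - z| < r ->
    `|Q (f s (y + u + xS s)) - Q (f s (y' + u' + xS s)) - w ((y - y') + (u - u'))|
      <= (C + e) * `|(y - y') + (u - u')|.
Proof.
move=> t0 Ex Mz e0 hw.
have /near_withinP[r1 r10 hr1] := dQc (conj t0 (total_in t0 Ex Mz) : (Rplus R `*` M) (t, _)) e0.
have [r2 r20 hr2] := slice_near x z t0 r10.
have [r3 r30 hM] := rel_openP hM20 Mz.
exists (Order.min r2 r3); first by rewrite lt_min r20.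
move=> s y y' u u' s0; rewrite !lt_min => /andP[sr _] Ey Ey' /andP[yr _] /andP[y'r _] Mu Mu' /andP[ur ur3] /andP[u'r u'r3].
have D20l := @fixed_lin _ _ _ (bP (slev 0)).
set h := (y - y') + (u - u').
have hE : y + u + xS s - (y' + u' + xS s) = h by rewrite /h; lincomb_eq.
have Dh : D h.
  rewrite -hE; apply: (dom_sub lA lB); apply: total_dom; exact: total_in.
have seg (p : R) : 0 <= p <= 1 -> M (y' + u' + xS s + p *: h) /\
    `|(s, y' + u' + xS s + p *: h) - (t, x + z + xS t)| < r1.
  move=> p01; have -> : y' + u' + xS s + p *: h = (y' + p *: (y - y')) + (u' + p *: (u - u')) + xS s.
    by rewrite /h; lincomb_eq.
  have Eyy : D1 S (y' + p *: (y - y')).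
    have -> : y' + p *: (y - y') = p *: y + ((1 - p) *: y' + 0) by lincomb_eq.
    by do 2 ?apply: D1_lin => //; apply/D1P; split; [exact: dom0|exact: blin0].
  have Muu : M20 (u' + p *: (u - u')).
    apply: hM; last exact: convex_ball.
    rewrite D2sE//= (blinD (bP _)) (blinZ (bP _)) (blinB (bP _)) (M20D Mu) (M20D Mu') //.
  split; first exact: total_in.
  have [h1' h2'] := hr2 s _ _ s0 sr (convex_ball p01 y'r yr) (convex_ball p01 u'r ur).
  by rewrite prod_normE /= gt_max h1'.
have dlin (p : R) : 0 <= p <= 1 -> bounded_linear_on D (dQ (s, y' + u' + xS s + p *: h)).
  by move=> /seg[Mp _]; have [] := dQP s0 Mp.
apply: (@segment_increment R X Y M (fun y => Q (f s y)) (fun y => dQ (s, y)) (y' + u' + xS s) (y + u + xS s));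
  rewrite hE.
- by move=> p /seg[].
- move=> p q /dlin[dl _]; have D0 := dom0 lA lB.
  have l0 := dl (-1) 0 0 D0 D0; rewrite scaler0 addr0 scaleN1r addNr in l0.
  by rewrite -[X in dQ _ X]addr0 dl// l0 addr0.
- by move=> p /seg[Mp _]; have [] := dQP s0 Mp.
move=> p /seg[Mp np]; have hp := hr1 (s, _) (conj s0 Mp) np h Dh.
set T1 := dQ _ h in hp *; set T2 := dQ _ h in hp.
have -> : T1 - w h = (T1 - T2) + (T2 - w h) by lincomb_eq.
by rewrite (le_trans (ler_normD _ _))// mulrDl addrC lerD//; exact: hw.
Qed.

Lemma h_lipschitz_diff : jointly_lipschitz (D1 S) M20 (fun t x z => Q (f t (x + z + xS t))).
Proof.
move=> t x z t0 Ex Mz.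
have [[dlin [C hC]] _] := dQP t0 (total_in t0 Ex Mz).
have [|r r0 hr] := @increment_bound t x z `|C| 1 (fun=> 0) t0 Ex Mz ltr01.
  move=> h Dh; rewrite subr0 (le_trans (hC h Dh))// ler_wpM2r//; exact: ler_norm.
exists r, (`|C| + 1); split=> //.
move=> s y y' u u' s0 sr Ey Ey' yr y'r Mu Mu' ur u'r.
have := hr s y y' u u' s0 sr Ey Ey' yr y'r Mu Mu' ur u'r; rewrite subr0 => /le_trans; apply.
by rewrite ler_wpM2l ?ler_normD// addr_ge0.
Qed.
End Differentiable.

Hypothesis zetaM : forall (t : R) x, 0 <= t -> D1 S x -> M20 (zeta t x) /\
  F20 S f t x (zeta t x) (xS t) (d t) (dw t) = 0.

Lemma contractive_diff (dQ : R * X -> X -> Y) :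
  (forall (t : R) x, 0 <= t -> M x ->
     frechet_within M D (fun y => Q2s S 0 (f t y)) x (dQ (t, x))) ->
  op_continuous_on (Rplus R `*` M) D dQ ->
  (forall (th : R) x1h x20h xSh dh dwh, 0 <= th -> D1 S x1h -> M20 x20h ->
     Msum S 1 Md Mw xSh -> Ddiag S 1 dh -> Dwedge S 1 dwh ->
     F20 S f th x1h x20h xSh dh dwh = 0 ->
     boundedly_invertible (D2s S 0) (Y2s S 0)
       (fun h => dQ (th, x1h + x20h + xSh) (P2s S 0 h) - Q2s S 0 (B (P2s S 0 h)))) ->
  contractive (D1 S) (D2s S 0) M20 (Y2s S 0) slice_Q20 (BP (slev 0)) zeta.
Proof.
move=> dQP dQc inv t x t0 Ex; have [Mz ez] := zetaM t0 Ex; have [d1 d2] := dE t0.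
have [Zi ZiP] := inv t x _ _ _ _ t0 Ex Mz (xSM t0) d1 d2 ez.
have [_ _ [_ [C hC]]] := ZiP.
have c0 : 0 < `|C| + 1 by rewrite ltr_wpDl.
(* Half the reciprocal of the bound for the inverse, so that c k = 1/2. *)
have k0 : 0 < (`|C| + 1)^-1 / 2 by rewrite divr_gt0 ?invr_gt0.
have [|r r0 hr] := @increment_bound (Q2s S 0) dQ dQP dQc t x (zeta t x) 0 ((`|C| + 1)^-1 / 2)
    (dQ (t, x + zeta t x + xS t)) t0 Ex Mz k0.
  by move=> h _; rewrite subrr normr0 mul0r.
eexists; exists Zi, (`|C| + 1), ((`|C| + 1)^-1 / 2), (r / 2); split; first exact: ZiP.
- by split=> //; rewrite mulrA divff ?gt_eqF//; lra.
- by rewrite divr_gt0.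
- move=> y Fy; rewrite (le_trans (hC y Fy))// ler_wpM2r//.
  by rewrite (le_trans (ler_norm C))// lerDl.
move=> s y z' z'' s0 st Ey yx M' M'' r' r''.
have rr : r / 2 < r by lra.
have := hr s y y z' z'' s0 (lt_trans st rr) Ey Ey (lt_trans yx rr) (lt_trans yx rr) M' M''
  (le_lt_trans r' rr) (le_lt_trans r'' rr).
rewrite subrr add0r add0r; apply: le_trans; rewrite le_eqVlt; apply/orP; left; apply/eqP; congr `|_|.
have Pzz : PP (slev 0) (z' - z'') = z' - z'' by rewrite (blinB (bP _)) (M20D M') (M20D M'').
rewrite !P2s_PP// Pzz /slice_Q20 !Q2s_QQ// QB_fixed// (B_fixed lA lB hroot Pzz) (blinB (BP_bounded hroot _)).
by lincomb_eq.
Qed.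

Lemma contractive_lip :
  (forall (th : R) x1h x20h xSh dh dwh, 0 <= th -> D1 S x1h -> M20 x20h ->
    Msum S 1 Md Mw xSh -> Ddiag S 1 dh -> Dwedge S 1 dwh ->
    F20 S f th x1h x20h xSh dh dwh = 0 ->
    exists (Z : X -> Y) (Zinv : Y -> X) (k : 'rV[R]_5 -> R -> R) (l r : R),
    [/\ bounded_linear_on (D2s S 0) Z /\ is_bounded_inverse (D2s S 0) (Y2s S 0) Z Zinv,
        0 < r,
        forall (delta : 'rV[R]_5) (eps : R), (forall i, 0 < delta 0 i <= r) -> 0 < eps <= r ->
          forall (t : R) x1 xS d dw x' x'',
          Uball (Rplus R) th (delta 0 0) t -> Uball (D1 S) x1h (delta 0 1) x1 ->
          Uball (D2Sigma S) xSh (delta 0 2) xS -> Uball (Ddiag S 1) dh (delta 0 3) d ->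
          Uball (Dwedge S 1) dwh (delta 0 4) dw ->
          Uball (D2s S 0) x20h eps x' -> Uball (D2s S 0) x20h eps x'' ->
          `|F20 S f t x1 x' xS d dw - F20 S f t x1 x'' xS d dw - Z (x' - x'')|
            <= k delta eps * `|x' - x''|,
        (fun p : 'rV[R]_5 * R => k p.1 p.2)
          @ within [set p : 'rV[R]_5 * R | (forall i, 0 < p.1 0 i) /\ 0 < p.2]
              (nbhs ((0, 0) : 'rV[R]_5 * R)) --> l &
        l < (opnorm (Y2s S 0) Zinv)^-1]) ->
  contractive (D1 S) (D2s S 0) M20 (Y2s S 0) slice_Q20 (BP (slev 0)) zeta.
Proof.
move=> hc t x t0 Ex; have [Mz ez] := zetaM t0 Ex; have [d1 d2] := dE t0.
have [Z [Zi [k [l [r [[_ ZiP] r0 hk kl lN]]]]]] := hc t x _ _ _ _ t0 Ex Mz (xSM t0) d1 d2 ez.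
set N := opnorm _ Zi in lN.
have Y0 : Y2s S 0 0 by rewrite Y2sE//=; exact: (blin0 (bQ _)).
have Nb y : Y2s S 0 y -> `|Zi y| <= N * `|y|.
  move=> Fy; have [_ _ bZ] := ZiP; apply: opnorm_bound => // a y'.
  by rewrite !Y2sE//= (blinZ (bQ _)) => ->.
(* Strictly between the limit of k and 1 / N: it bounds k for small equal radii eta and still leaves
   c k0 < 1. *)
pose mid := (l + N^-1) / 2; have lm : l < mid by rewrite /mid; lra.
have [eta [eta0 etar keta]] : exists eta : R, [/\ 0 < eta, eta <= r &
    k (const_mx eta) eta <= mid].
  have lm0 : 0 < mid - l by rewrite subr_gt0.
  have /cvgr_normP/(_ _ lm0) : (fun p : 'rV[R]_5 * R => k p.1 p.2)
          @ within [set p : 'rV[R]_5 * R | (forall i, 0 < p.1 0 i) /\ 0 < p.2]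
              (nbhs ((0, 0) : 'rV[R]_5 * R)) --> l by [].
  move=> /nbhs_ballP[e /= e0 he].
  pose eta := Order.min r (e / 2); have eta0 : 0 < eta by rewrite lt_min r0 divr_gt0.
  have etae : eta < e by rewrite gt_min; apply/orP; right; lra.
  exists eta; split=> //; first by rewrite ge_min lexx.
  have h : `|k (const_mx eta) eta - l| <= mid - l.
    apply: (he (const_mx eta, eta)); last by split=> //= i; rewrite mxE.
    have be : ball (0 : R) e eta by rewrite -ball_normE /= sub0r normrN gtr0_norm.
    by split=> //; split=> // i j; rewrite !mxE.
  by have := le_trans (ler_norm _) h; lra.
(* If Y_20 is trivial then N = 0, whose inverse is 0 by convention; c = 1 and the cut of k0 at 0
   preserve 0 < c and 0 <= k0. *)
pose c := if 0 < N then N else 1; pose k0 := Order.max 0 mid.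
have c0 : 0 < c by rewrite /c; case: ifP.
have k00 : 0 <= k0 by rewrite le_max lexx.
have ck : c * k0 < 1.
  rewrite /k0 /c; have [mid0|mid0] := leP mid 0; first by rewrite mulr0.
  case: ifPn => [N0|]; last first.
    rewrite -leNgt => N0; have : N^-1 <= 0 by rewrite invr_le0.
    by rewrite mul1r; move: lN mid0; rewrite /mid; lra.
  by rewrite mulrC -ltr_pdivlMr// mul1r /mid; lra.
have e2 : 0 < eta / 2 by rewrite divr_gt0.
have /cvgr_normP/(_ _ e2)/near_withinP[r' r'0 hr'] := xSc t0.
exists Z, Zi, c, k0, (Order.min (eta / 2) r'); split=> //.
- by rewrite lt_min e2.
- move=> y Fy; rewrite (le_trans (Nb y Fy))// ler_wpM2r// /c.
  by case: ltP => // N0; exact: le_trans N0 ler01.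
move=> s y z' z'' s0; rewrite lt_min => /andP[st sr'] Ey; rewrite lt_min => /andP[yx _] M' M''.
rewrite !le_min => /andP[zr' _] /andP[zr'' _].
have ee : eta / 2 < eta by lra.
have del (i : 'I_5) : (const_mx eta : 'rV[R]_5) 0 i = eta by rewrite mxE.
have xSs : D2Sigma S (xS s).
  have Px := xSspos s0; exists (xS s); last by rewrite P2Sigma_PP.
  exact: fixed_dom Px.
have := hk (const_mx eta) eta _ _ s y (xS s) (d t) (dw t) z' z''.
rewrite !del => h; have {h} := h (fun i => ltac:(by rewrite mxE eta0)) (introT andP (conj eta0 etar)).
move=> /(_ (conj s0 (lt_trans st ee)) (conj Ey (lt_trans yx ee))
  (conj xSs (le_lt_trans (hr' s s0 sr') ee))).
have sub0 (V : normedModType R) (v : V) : `|v - v| < eta by rewrite subrr normr0.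
move=> /(_ (conj d1 (sub0 _ _)) (conj d2 (sub0 _ _))).
move=> /(_ (conj (rel_open_sub hM20 M') (le_lt_trans zr' ee)) (conj (rel_open_sub hM20 M'') (le_lt_trans zr'' ee))).
move=> h; apply: le_trans (le_trans h _); last first.
  by rewrite ler_wpM2r// (le_trans keta)// le_max lexx orbT.
rewrite le_eqVlt; apply/orP; left; apply/eqP; congr `|_|.
rewrite /F20 /slice_Q20 !Q2s_QQ// (B_fixed lA lB hroot (M20D M')) (B_fixed lA lB hroot (M20D M'')).
by lincomb_eq.
Qed.
End Regularity.

(** * A priori bounds *)

Lemma bounded_on_segment (R : realType) (V : normedModType R) (g : R -> V) (a b : R) : a <= b ->
  (forall t, a <= t <= b -> g @ within `[a, b] (nbhs t) --> g t) ->
  exists C : R, forall t, a <= t <= b -> `|g t| <= C.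
Proof.
move=> ab gc; apply: (@cousin _ a b (fun u v => exists C : R, forall t, u <= t <= v -> `|g t| <= C) ab).
  move=> u v w _ uv vw _ [C hC] [C' hC']; exists (Order.max C C') => t /andP[ut tw].
  rewrite le_max; have [tv|vt] := leP t v; first by rewrite hC ?ut.
  by rewrite hC' ?orbT// (ltW vt).
move=> t tab; have /cvgr_normP/(_ 1 ltr01)/near_withinP[d d0 hd] := gc t tab.
exists d => // u v au ut tv vb vu; exists (`|g t| + 1) => s /andP[us sv].
have st : `|s - t| < d by rewrite ltr_norml; apply/andP; split; lra.
have := hd s _ st; rewrite in_itvccP (le_trans au us) (le_trans sv vb) => /(_ isT) h.
by rewrite -[g s](subrKC (g t)) (le_trans (ler_normD _ _))// lerD2l.
Qed.

Lemma deriv_within_unique (R : realType) (V : normedModType R) (J : set R) (g : R -> V) (t : R) (d d' : V) :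
  (forall e : R, 0 < e -> exists2 s, J s & 0 < `|s - t| < e) ->
  deriv_within J g t d -> deriv_within J g t d' -> d = d'.
Proof.
move=> acc gd gd'; apply/eqP; rewrite -subr_eq0 -normr_le0; apply/ler_addgt0Pl => e e0.
have e2 : 0 < e / 2 by rewrite divr_gt0.
have : \forall s \near within J (nbhs t), `|g s - g t - (s - t) *: d| <= e / 2 * `|s - t| /\
   `|g s - g t - (s - t) *: d'| <= e / 2 * `|s - t| by exact: filterI (gd _ e2) (gd' _ e2).
move=> /near_withinP[r r0 hr].
have [s Js /andP[st0 st]] := acc _ r0; have [h h'] := hr s Js st.
rewrite addr0 -(ler_pM2l st0) -normrZ.
have -> : (s - t) *: (d - d') = (g s - g t - (s - t) *: d') - (g s - g t - (s - t) *: d) by lincomb_eq.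
rewrite (le_trans (ler_normB _ _))// (le_trans (lerD h' h))// -mulrDl -splitr.
by rewrite mulrC.
Qed.

(** On a short interval the linear term is absorbed: the supremum of |u| over [x, h] is at most K
    plus half of itself, so 2 K bounds u independently of x. Then u is Lipschitz on (0, h] and has a
    limit at 0. *)
Lemma linear_ode_limit (R : realType) (Y : completeNormedModType R) (u g : R -> Y) (L : Y -> Y) (b C : R) :
  bounded_linear_on setT L -> 0 < b ->
  (forall t, 0 < t <= b -> deriv_within `[0, b] u t (g t - L (u t))) ->
  (forall t, 0 <= t <= b -> `|g t| <= C) ->
  exists (l : Y) (h K : R), 0 < h /\ forall t, 0 < t <= h -> `|u t - l| <= K * t.
Proof.
move=> bL b0 ud gC; have [C' C'0 hC'] := blin_bound bL.
have C0 : 0 <= C by apply: le_trans (gC 0 _); rewrite ?lexx// ltW.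
pose h := Order.min b ((2 * C')^-1); have h0 : 0 < h by rewrite lt_min b0 invr_gt0 mulr_gt0.
have hb : h <= b by rewrite ge_min lexx.
have hC : h * C' <= 2^-1.
  by rewrite -ler_pdivlMr// -invfM ge_min lexx orbT.
have ud' s t x : 0 < s -> t <= h -> s <= x <= t -> deriv_within `[s, t] u x (g x - L (u x)).
  move=> s0 th /andP[sx xt]; apply: deriv_within_subset (ud x _).
    by move=> y /in_itvccP/andP[sy yt]; apply/in_itvccP; apply/andP; split; lra.
  by apply/andP; split; lra.
pose K := `|u h| + h * C; have K0 : 0 <= K by rewrite addr_ge0// mulr_ge0// ltW.
have ub x : 0 < x <= h -> `|u x| <= 2 * K.
  move=> /andP[x0 xh].
  have [c hc] := bounded_on_segment xh (fun y yx => deriv_within_cvg (ud' x h y x0 (lexx h) yx)).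
  pose A := [set `|u y| | y in [set y | x <= y <= h]].
  have Ax : A (`|u x|) by exists x => //=; rewrite lexx.
  have hA : has_sup A by split; [exists (`|u x|)|exists c => _ [y yx <-]; exact: hc].
  have inA y : x <= y <= h -> `|u y| <= sup A.
    by move=> yx; apply: ub_le_sup => //; [case: hA|exists y].
  have s0 : 0 <= sup A by apply: le_trans (inA x _); rewrite ?lexx.
  have step : sup A <= K + sup A / 2.
    apply: sup_le_ub; first by case: hA.
    move=> _ [y /andP[xy yh] <-].
    have : `|u h - u y| <= (C + C' * sup A) * (h - y).
      apply: (@mean_value_inequality R Y u (fun x => g x - L (u x))) => // z /andP[yz zh].
        by apply: ud'; rewrite ?lexx// ?yz//; lra.
      rewrite (le_trans (ler_normB _ _))// lerD//; first by apply: gC; apply/andP; split; lra.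
      by rewrite (le_trans (hC' _))// ler_pM2l// inA// (le_trans xy yz).
    move=> huy; have : `|u y| <= `|u h| + `|u h - u y|.
      have {1}-> : u y = u h - (u h - u y) by lincomb_eq.
      exact: ler_normB.
    move=> h1; rewrite (le_trans h1)// /K -addrA lerD2l (le_trans huy)//.
    have CS : 0 <= C + C' * sup A by rewrite addr_ge0// mulr_ge0// ltW.
    apply: (@le_trans _ _ ((C + C' * sup A) * h)); first by rewrite ler_wpM2l//; lra.
    rewrite mulrDl lerD//; first by rewrite mulrC.
    have -> : C' * sup A * h = h * C' * sup A by ring.
    by rewrite [leRHS]mulrC ler_wpM2r.
  by have := inA x; rewrite lexx xh => /(_ isT); lra.
pose K2 := C + C' * (2 * K); have K20 : 0 <= K2 by rewrite addr_ge0// !mulr_ge0// ltW.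
have lip s t : 0 < s -> s <= t -> t <= h -> `|u t - u s| <= K2 * (t - s).
  move=> s0 st th; apply: (@mean_value_inequality R Y u (fun x => g x - L (u x))) => // z /andP[sz zt].
    by apply: ud'; rewrite ?sz.
  rewrite (le_trans (ler_normB _ _))// lerD//; first by apply: gC; apply/andP; split; lra.
  by rewrite (le_trans (hC' _))// ler_pM2l// ub//; apply/andP; split; lra.
pose v k := u (h * 2^-1 ^+ k).
have p0 k : 0 < h * 2^-1 ^+ k by rewrite mulr_gt0// exprn_gt0// invr_gt0.
have p1 k : h * 2^-1 ^+ k <= h by rewrite ler_piMr ?(ltW h0)// exprn_ile1//; lra.
have [||l [_ hl]] := @geometric_cauchy R Y v (K2 * h) 2^-1; first by lra.
  move=> k; rewrite distrC (le_trans (lip _ _ (p0 k.+1) _ (p1 k)))//.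
    by rewrite exprS; have := p0 k; lra.
  by rewrite -mulrA ler_wpM2l// lerBlDr lerDl ltW.
exists l, h, K2; split=> // t /andP[t0 th]; apply/ler_addgt0Pl => e e0.
(* One K2 h from moving to the dyadic point h 2^-k, two from its distance to the limit. *)
have [k hk] := small_power (3 * K2 * h) e0.
have -> : u t - l = (u t - v k) + (v k - l) by lincomb_eq.
rewrite (le_trans (ler_normD _ _))//.
have hv : `|u t - v k| <= K2 * (t + h * 2^-1 ^+ k).
  have pk := p0 k; case: (leP t (h * 2^-1 ^+ k)) => tk.
    by rewrite distrC (le_trans (lip _ _ t0 tk (p1 k)))// ler_wpM2l//; lra.
  by rewrite (le_trans (lip _ _ pk (ltW tk) th))// ler_wpM2l//; lra.
have hl' : `|v k - l| <= 2 * K2 * h * 2^-1 ^+ k.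
  by rewrite (le_trans (hl k))// le_eqVlt; apply/orP; left; apply/eqP; field.
rewrite (le_trans (lerD hv hl'))//.
have -> : K2 * (t + h * 2^-1 ^+ k) + 2 * K2 * h * 2^-1 ^+ k = 3 * K2 * h * 2^-1 ^+ k + K2 * t by ring.
by rewrite lerD2r.
Qed.

Lemma deriv_within_frechet (R : realType) (V W : normedModType R) (N E : set V) (g : V -> W)
    (L : V -> W) (J : set R) (w : R -> V) (t : R) (d : V) :
  (forall (a : R) x y, E x -> E y -> E (a *: x + y)) -> N `<=` E ->
  (forall s, J s -> N (w s)) -> J t -> E d ->
  frechet_within N E g (w t) L -> deriv_within J w t d -> deriv_within J (g \o w) t (L d).
Proof.
move=> EP NE wN Jt Ed [[Llin [C hC]] hg] wd.
have EB x y : E x -> E y -> E (x - y) by move=> Ex Ey; rewrite -scaleN1r addrC; exact: EP.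
have E0 : E 0 by rewrite -(subrr d); exact: EB.
have L0 : L 0 = 0 by have := Llin (-1) 0 0 E0 E0; rewrite scaler0 addr0 scaleN1r addNr.
have LB x y : E x -> E y -> L (x - y) = L x - L y.
  by move=> Ex Ey; rewrite -scaleN1r addrC Llin// scaleN1r addrC.
have EZ (a : R) x : E x -> E (a *: x) by move=> Ex; rewrite -[a *: x]addr0; exact: EP.
have LZ (a : R) x : E x -> L (a *: x) = a *: L x by move=> Ex; rewrite -[a *: x]addr0 Llin// L0 addr0.
move=> e e0; have K0 : 0 < `|d| + 1 by rewrite ltr_wpDl.
have C0 : 0 < `|C| + 1 by rewrite ltr_wpDl.
have e1 : 0 < e / 2 / (`|d| + 1) by rewrite !divr_gt0.
have e2 : 0 < e / 2 / (`|C| + 1) by rewrite !divr_gt0.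
have /near_withinP[r1 r10 hr1] := hg _ e1.
have dK : `|d| < `|d| + 1 by rewrite ltrDl.
have h2 := deriv_within_lip wd dK.
have /cvgr_normP h3 := deriv_within_cvg wd.
have r12 : 0 < r1 / 2 by rewrite divr_gt0.
apply: filterS3 (filterI (near_within_self J t) (h3 _ r12)) h2 (wd _ e2) => s [Js wr] wl wds /=.
have Es := NE _ (wN s Js); have Et := NE _ (wN t Jt).
have r1r : r1 / 2 < r1 by lra.
have h := hr1 (w s) (wN s Js) (le_lt_trans wr r1r).
have -> : g (w s) - g (w t) - (s - t) *: L d =
   (g (w s) - g (w t) - L (w s - w t)) + L (w s - w t - (s - t) *: d).
  by rewrite (LB (w s - w t))// ?LZ//; [lincomb_eq|exact: EB|exact: EZ].
rewrite (le_trans (ler_normD _ _))// [e]splitr mulrDl lerD//.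
  rewrite (le_trans h)// (le_trans (ler_wpM2l (ltW e1) wl))// mulrA divfK ?gt_eqF//.
rewrite (le_trans (hC _ _))//; first by apply: (EB); [exact: EB|exact: EZ].
have hC1 : C <= `|C| + 1 by rewrite (le_trans (ler_norm C))// lerDl.
rewrite (le_trans (ler_wpM2r (normr_ge0 _) hC1))//.
rewrite (le_trans (ler_wpM2l (ltW C0) wds))// mulrA mulrC [leRHS]mulrC ler_wpM2l//.
by rewrite mulrC divfK// gt_eqF.
Qed.

Lemma Vmax_ge (R : realType) (Y : Type) m (V : 'I_m -> Y -> R) w j : V j w <= Vmax V w.
Proof. by rewrite /Vmax (bigD1 j)//= le_max lexx. Qed.

Lemma Vmax_eq (R : realType) (Y : Type) m (V : 'I_m -> Y -> R) w : (0 < m)%N ->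
  (forall j, 0 <= V j w) -> exists j, V j w = Vmax V w.
Proof.
move=> m0 V0; have : Vmax V w = 0 \/ exists j, V j w = Vmax V w.
  apply: (big_ind (fun x => x = 0 \/ exists j, V j w = x)); first by left.
    by move=> x y; case: (leP x y).
  by move=> j _; right; exists j.
case=> // e; exists (Ordinal m0); apply/eqP; rewrite eq_le Vmax_ge/=.
by rewrite e.
Qed.

Section Apriori.
Context {R : realType} {Y : completeNormedModType R}.
Local Notation mu := lebesgue_measure.
Variables (E : set Y) (G : R -> Y -> Y) (r : R) (m : nat) (V : 'I_m -> Y -> R)
  (dV : 'I_m -> Y -> Y -> R) (U psi : R -> R).
Hypothesis EP : forall (a : R) (x y : Y), E x -> E y -> E (a *: x + y).
Hypothesis GE : forall t u, E (G t u).
Hypothesis Gc : ode_continuous 0 G.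
Hypothesis Gb : forall a b : R, 0 < a -> 0 < b -> exists C : R, forall t u,
  0 <= t <= a -> E u -> `|u| <= b -> `|G t u| <= C.
Hypotheses (r0 : 0 < r) (m0 : (0 < m)%N).
Hypothesis VC1 : forall i, C1_on (E `&` [set w | r <= `|w|]) E (V i) (dV i).
Hypothesis V0 : forall i w, E w -> 0 <= V i w.
Hypothesis Uc : {within Rplus R, continuous U}.
Hypothesis U0 : forall u : R, 0 <= u -> 0 <= U u.
Hypothesis psi0 : forall t : R, 0 <= t -> 0 <= psi t.
Hypothesis psi_int : forall a : R, 0 <= a -> mu.-integrable `[0, a] (EFin \o psi).
Hypothesis U_div : forall u0 : R, 0 < u0 ->
  (\int[mu]_(u in `[u0, +oo[) ((U u)%:E^-1) = +oo)%E.
Hypothesis V_coercive : forall C : R, exists b : R, forall w, E w -> b <= `|w| -> C <= Vmax V w.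
Hypothesis V_growth : forall (t : R) w j, 0 <= t -> E w -> r <= `|w| -> Vmax V w = V j w ->
  dV j w (G t w) <= U (Vmax V w) * psi t.

Variables (t0 T : R) (w : R -> Y).
Hypotheses (t00 : 0 <= t0) (t0T : t0 < T).
Hypothesis wE : forall t, t0 <= t < T -> E (w t).
Hypothesis wd : ode_sol G `[t0, T[ w.

Let sub a b : t0 <= a -> b < T -> `[a, b] `<=` `[t0, T[.
Proof.
move=> a0 bT t /in_itvccP/andP[at_ tb].
by rewrite /= in_itv/= (le_trans a0 at_) (le_lt_trans tb bT).
Qed.

Let wd' a b t : t0 <= a -> b < T -> a <= t <= b -> deriv_within `[a, b] w t (G t (w t)).
Proof.
move=> a0 bT tab; apply: deriv_within_subset (sub a0 bT) _; apply: wd.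
by apply: (sub a0 bT); apply/in_itvccP.
Qed.

Let wc a b t : t0 <= a -> b < T -> a <= t <= b -> w @ within `[a, b] (nbhs t) --> w t.
Proof. by move=> a0 bT tab; apply: deriv_within_cvg (wd' a0 bT tab). Qed.

Let T_gt0 : 0 < T. Proof. exact: le_lt_trans t00 t0T. Qed.

(** A continuity argument: while |w| <= r + 1 the slope is at most C, and C times the remaining time
    is less than 1, so w cannot cross the gap between the radii r and r + 1. *)
Lemma apriori_small (C t2 t : R) : 0 <= C -> t0 <= t2 -> t2 <= t -> t < T -> C * (T - t2) < 1 ->
  `|w t2| <= r -> (forall s u, 0 <= s <= T -> E u -> `|u| <= r + 1 -> `|G s u| <= C) ->
  `|w t| <= r + 1.
Proof.
move=> C0 t02 t2t tT CT wr hC.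
have main : `|w t - w t2| <= C * (t - t2).
  have := @cousin _ t2 t (fun a b => `|w a - w t2| <= C * (a - t2) -> `|w b - w t2| <= C * (b - t2)) t2t.
  rewrite !subrr normr0 mulr0; apply=> // [a b c _ _ _ _ h h' /h/h' //|s /andP[t2s st]].
  (* The margin left below r + 1. Continuity at the tag s spends at most half of it on each of two
     comparisons with w s. *)
  pose eta := 1 - C * (T - t2); have eta0 : 0 < eta / 2 by rewrite divr_gt0// subr_gt0.
  have /cvgr_normP/(_ _ eta0)/near_withinP[d d0 hd] := wc t02 tT (introT andP (conj t2s st)).
  exists d => // a b t2a as_ sb bt abd ha.
  have ws x : a <= x <= b -> `|w x - w s| <= eta / 2.
    move=> /andP[ax xb]; apply: hd; first by apply/in_itvccP; rewrite (le_trans t2a ax) (le_trans xb bt).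
    by rewrite ltr_norml; apply/andP; split; lra.
  have wr1 x : a <= x <= b -> `|w x| <= r + 1.
    move=> axb; have h1 := ws x axb.
    have h2 : `|w a - w s| <= eta / 2 by apply: ws; rewrite lexx (le_trans as_ sb).
    have -> : w x = w t2 + (w a - w t2) + ((w x - w s) - (w a - w s)) by lincomb_eq.
    have h3 : C * (a - t2) <= C * (T - t2) by rewrite ler_wpM2l// lerD2r; lra.
    have := ler_normD (w t2 + (w a - w t2)) ((w x - w s) - (w a - w s)).
    have := ler_normD (w t2) (w a - w t2); have := ler_normB (w x - w s) (w a - w s).
    by rewrite /eta in h1 h2; lra.
  have bT := le_lt_trans bt tT; have a0 := le_trans t02 t2a.
  have := @mean_value_inequality R Y w (fun x => G x (w x)) a b C (le_trans as_ sb) (fun x => wd' a0 bT).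
  move=> h; have {}h : `|w b - w a| <= C * (b - a).
    apply: h => x /andP[ax xb]; apply: hC; [|apply: wE|by apply: wr1; rewrite ax]; apply/andP; split; move: t00 a0 bT; lra.
  have -> : w b - w t2 = (w b - w a) + (w a - w t2) by lincomb_eq.
  rewrite (le_trans (ler_normD _ _))// (le_trans (lerD h ha))// -mulrDr.
  by rewrite le_eqVlt; apply/orP; left; apply/eqP; congr (_ * _); ring.
have tT' : C * (t - t2) <= C * (T - t2) by rewrite ler_wpM2l// lerD2r ltW.
have -> : w t = w t2 + (w t - w t2) by lincomb_eq.
by rewrite (le_trans (ler_normD _ _))// lerD// (le_trans main)//; lra.
Qed.

(** Above the radius r the functionals are differentiable along w, so [lyapunov_bound] limits V;
    coercivity turns this into a bound on |w|. *)
Lemma apriori_large (t1 : R) : t0 <= t1 -> t1 < T -> (forall t, t1 <= t < T -> r < `|w t|) ->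
  exists C : R, forall t, t1 <= t < T -> `|w t| <= C.
Proof.
move=> t01 t1T wr; pose u0 := `|Vmax V (w t1)| + 1; have u00 : 0 < u0 by rewrite ltr_wpDl.
have [c hc] := lyapunov_bound Uc U0 U_div psi0 psi_int m (ltW T_gt0) u00.
(* The level exceeds by 1 every value of V along w, so |w t| >= b is contradictory. *)
have [b hb] := V_coercive (Order.max c (Vmax V (w t1)) + 1).
exists b => t /andP[t1t tT]; rewrite leNgt; apply/negP => /ltW bw.
have wEr s : t1 <= s < T -> (E `&` [set w | r <= `|w|]) (w s).
  by move=> /[dup] /wr/ltW rw /andP[h1 h2]; split=> //; apply: wE; rewrite h2 (le_trans t01).
have := hb _ (wEr t (introT andP (conj t1t tT))).1 bw; apply/negP; rewrite -ltNge.
have [->|/eqP tt1] := eqVneq t t1.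
  by rewrite (le_lt_trans (_ : _ <= Order.max c (Vmax V (w t1))))// ?ltrDl// le_max lexx orbT.
have {}t1t : t1 < t by rewrite lt_neqAle t1t andbT eq_sym; apply/eqP.
apply: (@le_lt_trans _ _ (Order.max c (Vmax V (w t1)))); last by rewrite ltrDl.
rewrite le_max; apply/orP; left.
have inT s : t1 <= s <= t -> t1 <= s < T.
  by move=> /andP[-> st]; exact: le_lt_trans st tT.
have t10 := le_trans t00 t01.
have sE s x : t1 <= s <= t -> E (w s) /\ E (G s x).
  by move=> /inT/wEr[].
apply: (hc t1 t (fun j s => V j (w s)) (fun j s => dV j (w s) (G s (w s))) (fun s => Vmax V (w s))) => //.
- exact: ltW.
- move=> j s st; have [hV _] := VC1 j.
  apply: (deriv_within_frechet EP (N := E `&` [set w | r <= `|w|])); last exact: wd' st.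
  + by move=> x [].
  + by move=> x /in_itvccP/inT/wEr.
  + exact/in_itvccP.
  + exact: GE.
  + exact: hV (wEr s (inT s st)).
- move=> j s st; have [hV hVc] := VC1 j; have Ns := wEr s (inT s st).
  have [[Llin [C hC]] _] := hV _ Ns.
  have Gcvg : (fun x => G x (w x)) @ within `[t1, t] (nbhs s) --> G s (w s).
    apply: (ode_cvg Gc); [by move=> x /in_itvccP/andP[h _]; exact: le_trans h|exact/in_itvccP|].
    exact: wc st.
  apply/cvgr_normP => e e0.
  have K0 : 0 < `|G s (w s)| + 1 by rewrite ltr_wpDl.
  have C0 : 0 < `|C| + 1 by rewrite ltr_wpDl.
  have e1 : 0 < e / 2 / (`|G s (w s)| + 1) by rewrite !divr_gt0.
  have e2 : 0 < e / 2 / (`|C| + 1) by rewrite !divr_gt0.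
  have /near_withinP[d d0 hd] := hVc _ Ns _ e1.
  have d2 : 0 < d / 2 by rewrite divr_gt0.
  have /cvgr_normP/(_ _ d2) h1 := wc t01 tT st.
  move/cvgr_normP: Gcvg => Gcvg; have h2 := Gcvg _ ltr01; have h3 := Gcvg _ e2.
  apply: filterS3 (filterI (near_within_self _ s) h1) h2 h3 => x [Jx wx] Gx Gx2.
  have dd : d / 2 < d by lra.
  have xt : t1 <= x <= t by apply/in_itvccP.
  have h := hd (w x) (wEr x (inT x xt)) (le_lt_trans wx dd) (G x (w x)) (GE _ _).
  have EB (y y1 : Y) : E y -> E y1 -> E (y - y1) by move=> Ea Eb; rewrite -scaleN1r addrC; exact: EP.
  have -> : dV j (w x) (G x (w x)) - dV j (w s) (G s (w s)) =
    (dV j (w x) (G x (w x)) - dV j (w s) (G x (w x))) + dV j (w s) (G x (w x) - G s (w s)).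
    have -> : dV j (w s) (G x (w x) - G s (w s)) = dV j (w s) (G x (w x)) - dV j (w s) (G s (w s)).
      by rewrite -[G x (w x) - _]addrC -scaleN1r Llin// scaleN1r addrC.
    by rewrite subrKA.
  rewrite (le_trans (ler_normD _ _))// [leRHS]splitr lerD//.
    rewrite (le_trans h)// mulrAC ler_pdivrMr// ler_wpM2l//; first by rewrite divr_ge0// ltW.
    by rewrite -[G x _](subrKC (G s (w s))) (le_trans (ler_normD _ _))// lerD2l.
  rewrite (le_trans (hC _ _))//; first exact: EB.
  have hC1 : C <= `|C| + 1 by rewrite (le_trans (ler_norm C))// lerDl.
  rewrite (le_trans (ler_wpM2r (normr_ge0 _) hC1))//.
  by rewrite mulrC -ler_pdivlMr.
- by move=> j s st; rewrite V0 ?Vmax_ge//; have [] := sE s 0 st.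
- by move=> s st; apply: Vmax_eq => // j; apply: V0; have [] := sE s 0 st.
- move=> j s st e; have [Ew rw] := wEr s (inT s st); rewrite V_growth//.
  by case/andP: st => h _; exact: le_trans h.
- by rewrite /u0 (le_trans (ler_norm _))// lerDl.
Qed.

Lemma apriori_bound : exists C : R, forall t, t0 <= t < T -> `|w t| <= C.
Proof.
have [C' hC'] := Gb T_gt0 (addr_gt0 r0 ltr01).
pose C := `|C'|; have hC s u : 0 <= s <= T -> E u -> `|u| <= r + 1 -> `|G s u| <= C.
  by move=> sT Eu ur; rewrite (le_trans (hC' s u sT Eu ur))// ler_norm.
(* So close to T that C (T - t1) < 1: from t1 on, either one visit to the ball of radius r confines
   w to the ball of radius r + 1, or w stays outside the smaller ball. *)
pose t1 := Order.max t0 (T - (C + 1)^-1 / 2).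
have C0 : 0 <= C by exact: normr_ge0.
have C1 : 0 < C + 1 by rewrite ltr_wpDl.
have i0 : 0 < (C + 1)^-1 / 2 by rewrite divr_gt0// invr_gt0.
have t01 : t0 <= t1 by rewrite le_max lexx.
have t1T : t1 < T by rewrite gt_max t0T ltrBlDr ltrDl.
have [B hB] := bounded_on_segment t01 (fun t => wc (lexx t0) t1T).
suff [t2 [B' [t12 t2T hB']]] : exists t2 B' : R, [/\ t1 <= t2, t2 < T & forall t, t2 <= t < T -> `|w t| <= B'].
  have [B2 hB2] := bounded_on_segment (le_trans t01 t12) (fun t => wc (lexx t0) t2T).
  exists (Order.max B2 B') => t /andP[t0t tT]; rewrite le_max.
  have [tt2|t2t] := leP t t2; first by rewrite hB2// t0t.
  by rewrite hB' ?orbT// tT ltW.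
have [[t2 /andP[t12 t2T] wt2]|nex] := pselect (exists2 t2, t1 <= t2 < T & `|w t2| <= r).
  exists t2, (r + 1); split=> // t /andP[t2t tT].
  apply: (@apriori_small C t2 t) => //; first exact: le_trans t12.
  have h : T - t2 <= (C + 1)^-1 / 2.
    have h1 : T - (C + 1)^-1 / 2 <= t1 by rewrite le_max lexx orbT.
    by lra.
  apply: (@le_lt_trans _ _ ((C + 1) * ((C + 1)^-1 / 2))); last first.
    by rewrite mulrA divff ?gt_eqF//; lra.
  by apply: ler_pM => //; rewrite ?lerDl//; lra.
have [|B' hB'] := apriori_large t01 t1T; last by exists t1, B'.
by move=> t tT; rewrite ltNge; apply/negP => wt; apply: nex; exists t.
Qed.
End Apriori.

(** * Solutions of the equation *)

(** Bridge to the punctured difference quotient of [is_solution_on]. *)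
Lemma deriv_within_quotient (R : realType) (V : normedModType R) (J : set R) (g : R -> V) (t : R) (d : V) :
  deriv_within J g t d <-> (fun s : R => (s - t)^-1 *: (g s - g t)) @ within J t^' --> d.
Proof.
have E (s : R) : s != t -> `|(s - t)^-1 *: (g s - g t) - d| = `|s - t|^-1 * `|g s - g t - (s - t) *: d|.
  move=> st; rewrite -normfV -normrZ [in RHS]scalerBr scalerA mulVf ?scale1r//.
  by rewrite subr_eq0.
have P (Pr : R -> Prop) : (\forall s \near within J t^', Pr s) <->
    (\forall s \near within J (nbhs t), s != t -> Pr s).
  split=> /nbhs_ballP[e /= e0 he]; apply/nbhs_ballP; exists e => // s bs.
    by move=> Js st; apply: he.
  by move=> st Js; apply: he.
split=> [gd|/cvgr_normP gd].
  apply/cvgr_normP => e e0; apply/P; apply: filterS (gd e e0) => s hs st.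
  by rewrite E// mulrC ler_pdivrMr// normr_gt0 subr_eq0.
move=> e e0; have /P := gd e e0; apply: filterS => s hs.
have [->|st] := eqVneq s t; first by rewrite !subrr scale0r subrr !normr0 mulr0.
by have := hs st; rewrite E// mulrC ler_pdivrMr// normr_gt0 subr_eq0.
Qed.

Section Solutions.
Context {R : realType} {X Y : completeNormedModType R}.
Variables (S : pencil_data X Y) (f : R -> X -> Y) (M20 : set X) (Md Mw : nat -> set X).
Local Notation A := (opA S).
Local Notation B := (opB S).
Local Notation nu := (nu_of S).
Local Notation K := (scalars S).
Local Notation D := (dom S).
Local Notation PP := (@PP R X Y S).
Local Notation QQ := (@QQ R X Y S).
Local Notation AP := (@AP R X Y S).
Local Notation BP := (@BP R X Y S).
Local Notation sdiag := (@sdiag R X Y S).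
Local Notation swedge := (@swedge R X Y S).
Local Notation slev := (@slev R X Y S).
Local Notation spos := (@spos R X Y S).
Local Notation sall := (@sall R X Y S).
Local Notation shift := (@shift R X Y S).
Local Notation M := (Mtotal S M20 Md Mw).
Local Notation Ainv := (@Ainv R X Y S).
Hypothesis hA : closed_densely_defined K (domA S) A.
Hypothesis hB : closed_densely_defined K (domB S) B.
Hypothesis hdom : domA S `<=` domB S.
Hypothesis hpencil : pencil_regular_of_index S nu.
Hypothesis hroot : canonical_root_system S.
Hypothesis nu_gt0 : (0 < nu)%N.
Hypothesis hstruct : forall (t : R) x, 0 <= t -> dom S x ->
     f t x = Q1 S (f t x) + Q2s S 0 (f t x)
       + \sum_(1 <= s < nu.-1) Q2Sigma S s
           (f t (\sum_(1 <= j < nu) P2sj S j j.+1 x + \sum_(s <= j < nu.-1) P2wedge S j x))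
       + \sum_(1 <= s < nu) Q2sj S s s.+1 (f t (\sum_(s <= j < nu) P2sj S j j.+1 x)).
Hypothesis hM20 : rel_open (D2s S 0) M20.
Hypothesis hMd : forall j, (1 <= j < nu)%N -> rel_open (Ddiag S j) (Md j).
Hypothesis hMw : forall j, (1 <= j < nu.-1)%N -> rel_open (Dwedge S j) (Mw j).
Variables (xd dxd xw dxw : nat -> R -> X) (zeta : R -> X -> X).
Let xS t := \sum_(1 <= j < nu) xd j t + \sum_(1 <= j < nu.-1) xw j t.
Let dS t := \sum_(1 <= j < nu) dxd j t + \sum_(1 <= j < nu.-1) dxw j t.
Hypothesis xdP : forall s, (1 <= s < nu)%N -> forall t : R, 0 <= t ->
  [/\ Md s (xd s t), deriv_within (Rplus R) (xd s) t (dxd s t),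
     QQ (sdiag s) (f t (xd s t + \sum_(s.+1 <= j < nu) xd j t)) = B (xd s t) &
     forall z, Md s z -> QQ (sdiag s) (f t (z + \sum_(s.+1 <= j < nu) xd j t)) = B z -> z = xd s t].
Hypothesis dxdC : forall s, Ccurve (Ddiag S s) 0 (dxd s).
Hypothesis xwP : forall s, (1 <= s < nu.-1)%N -> forall t : R, 0 <= t ->
  [/\ Mw s (xw s t), deriv_within (Rplus R) (xw s) t (dxw s t),
     QQ (swedge s) (f t (\sum_(1 <= j < nu) xd j t + \sum_(s.+1 <= j < nu.-1) xw j t + xw s t)) =
       B (xw s t) + A (dxd s.+1 t + dxw s.+1 t) &
     forall z, Mw s z ->
       QQ (swedge s) (f t (\sum_(1 <= j < nu) xd j t + \sum_(s.+1 <= j < nu.-1) xw j t + z)) =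
       B z + A (dxd s.+1 t + dxw s.+1 t) -> z = xw s t].
Hypothesis dxwC : forall s, Ccurve (Dwedge S s) 0 (dxw s).
Hypothesis dxd_out : forall s, (nu <= s)%N -> dxd s = fun=> 0.
Hypothesis dxw_out : forall s, (nu.-1 <= s)%N -> dxw s = fun=> 0.
Hypothesis zetaP : forall (t : R) x, 0 <= t -> D1 S x ->
  [/\ M20 (zeta t x), QQ (slev 0) (f t (x + zeta t x + xS t)) = B (zeta t x) + A (dxd 1 t + dxw 1 t) &
    forall z, M20 z -> QQ (slev 0) (f t (x + z + xS t)) = B z + A (dxd 1 t + dxw 1 t) -> z = zeta t x].
Hypothesis zeta_reg : forall (t : R) x (e : R), 0 <= t -> D1 S x -> 0 < e ->
  exists d L : R, [/\ 0 < d, 0 < L & forall s y y',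
    0 <= s -> `|s - t| < d -> D1 S y -> D1 S y' -> `|y - x| < d -> `|y' - x| < d ->
    `|zeta s y - zeta t x| <= e /\ `|zeta s y - zeta s y'| <= L * `|y - y'|].
Let h1 (t : R) x z := Q1 S (f t (x + z + xS t)).
Let G := ode_field h1 zeta Ainv (B \o Ainv).
Hypothesis h1c : jointly_continuous (D1 S) M20 h1.
Hypothesis Gc : ode_continuous 0 G.
Hypothesis Gl : ode_lipschitz 0 G.

Let lA : linear_operator K (domA S) A. Proof. by case: hA. Qed.
Let lB : linear_operator K (domB S) B. Proof. by case: hB. Qed.
Let bP s := PP_bounded hroot s.
Let bQ s := QQ_bounded hroot s.

Let Ainv_D1 y : D1 S (Ainv y).
Proof. by apply/(D1P hA hB hroot); have [] := AinvP hA hB hdom hpencil hroot y. Qed.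

Let Ddiag_fix s x : Ddiag S s x -> PP (sdiag s) x = x.
Proof. by rewrite DdiagE. Qed.

Let Dwedge_fix s x : Dwedge S s x -> PP (swedge s) x = x.
Proof. by rewrite DwedgeE. Qed.

Let Md_fix s x : (1 <= s < nu)%N -> Md s x -> PP (sdiag s) x = x.
Proof. by move=> hs /(rel_open_sub (hMd hs)); exact: Ddiag_fix. Qed.

Let Mw_fix s x : (1 <= s < nu.-1)%N -> Mw s x -> PP (swedge s) x = x.
Proof. by move=> hs /(rel_open_sub (hMw hs)); exact: Dwedge_fix. Qed.

Let M20_fix x : M20 x -> PP (slev 0) x = x.
Proof. by move=> /(rel_open_sub hM20); rewrite D2sE. Qed.

(** Each summand is fixed by the projectors whose predicate contains its own and annihilated by
    those with a disjoint one. *)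
Lemma components (x1 z : X) (yd yw : nat -> X) : D1 S x1 -> M20 z ->
  (forall j, (1 <= j < nu)%N -> PP (sdiag j) (yd j) = yd j) ->
  (forall j, (1 <= j < nu.-1)%N -> PP (swedge j) (yw j) = yw j) ->
  let x := x1 + z + (\sum_(1 <= j < nu) yd j + \sum_(1 <= j < nu.-1) yw j) in
  [/\ P1 S x = x1, PP (slev 0) x = z,
    forall j, (1 <= j < nu)%N -> PP (sdiag j) x = yd j &
    forall j, (1 <= j < nu.-1)%N -> PP (swedge j) x = yw j].
Proof.
move=> E1 Mz hd hw x.
have PPx s : PP s x = PP s z + (\sum_(1 <= j < nu) PP s (yd j) + \sum_(1 <= j < nu.-1) PP s (yw j)).
  by rewrite /x !(blinD (bP s)) !(blin_sum (bP s)) (PP_D1 hA hB)// add0r.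
have zs := M20_fix Mz.
have sum0 (F : nat -> X) a b : (forall j, (a <= j < b)%N -> F j = 0) -> \sum_(a <= j < b) F j = 0.
  by move=> F0; rewrite big_nat_cond big1// => j /andP[/F0].
have sum1 (F : nat -> X) a b k : (a <= k < b)%N -> (forall j, (a <= j < b)%N -> j != k -> F j = 0) ->
   \sum_(a <= j < b) F j = F k.
  move=> kab F0; rewrite (bigD1_seq k) ?mem_index_iota ?iota_uniq//= big_nat_cond big1 ?addr0//.
  by move=> j /andP[/F0 h]; exact: h.
have eqX (a b c : X) : b = 0 -> c = 0 -> a + (b + c) = a by move=> -> ->; rewrite !addr0.
have Pall : PP sall x = z + (\sum_(1 <= j < nu) yd j + \sum_(1 <= j < nu.-1) yw j).
  rewrite PPx; congr (_ + (_ + _)); first exact: (Pfixed hroot zs).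
    rewrite big_nat_cond [RHS]big_nat_cond; apply: eq_bigr => j /andP[jn _].
    exact: (Pfixed hroot (hd j jn)).
  rewrite big_nat_cond [RHS]big_nat_cond; apply: eq_bigr => j /andP[jn _].
  exact: (Pfixed hroot (hw j jn)).
split.
- by rewrite P1E// Pall /x; lincomb_eq.
- rewrite PPx zs; apply: eqX; apply: sum0 => j jn.
    by apply: (Pdisjoint hroot (hd j jn)) => i l /andP[/eqP-> _]; rewrite /slev; lia.
  by apply: (Pdisjoint hroot (hw j jn)) => i l /andP[/eqP-> _]; rewrite /slev; lia.
- move=> k kn; rewrite PPx (Pdisjoint hroot zs); last first.
    by move=> i l /eqP->; rewrite /sdiag; lia.
  rewrite add0r (sum0 (fun j => PP (sdiag k) (yw j))) ?addr0; last first.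
    move=> j jn; apply: (Pdisjoint hroot (hw j jn)) => i l /andP[/eqP-> h].
    by rewrite /sdiag negb_and; case: eqP => //= jk; lia.
  rewrite (sum1 _ _ _ k)//; first exact: hd.
  move=> j jn jk; apply: (Pdisjoint hroot (hd j jn)) => i l /andP[/eqP-> h].
  by rewrite /sdiag (negbTE jk).
- move=> k kn; rewrite PPx (Pdisjoint hroot zs); last first.
    by move=> i l /eqP->; rewrite /swedge; lia.
  rewrite add0r (sum0 (fun j => PP (swedge k) (yd j))) ?add0r; last first.
    move=> j jn; apply: (Pdisjoint hroot (hd j jn)) => i l /andP[/eqP-> /eqP h].
    by rewrite /swedge negb_and h; case: eqP => //= jk; lia.
  rewrite (sum1 _ _ _ k)//; first exact: hw.
  move=> j jn jk; apply: (Pdisjoint hroot (hw j jn)) => i l /andP[/eqP-> h].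
  by rewrite /swedge (negbTE jk).
Qed.

Let xd_fix j (t : R) : 0 <= t -> (1 <= j < nu)%N -> PP (sdiag j) (xd j t) = xd j t.
Proof. by move=> t0 jn; apply: Md_fix => //; have [] := xdP jn t0. Qed.

Let xw_fix j (t : R) : 0 <= t -> (1 <= j < nu.-1)%N -> PP (swedge j) (xw j t) = xw j t.
Proof. by move=> t0 jn; apply: Mw_fix => //; have [] := xwP jn t0. Qed.

Let xS_in (t : R) : 0 <= t -> Msum S 1 Md Mw (xS t).
Proof.
move=> t0; exists (\sum_(1 <= j < nu) xd j t); first by apply: famsumI => j jn; have [] := xdP jn t0.
by exists (\sum_(1 <= j < nu.-1) xw j t) => //; apply: famsumI => j jn; have [] := xwP jn t0.
Qed.

Let xS_deriv (t : R) : 0 <= t -> deriv_within (Rplus R) xS t (dS t).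
Proof.
have sumd a b (F dF : nat -> R -> X) : (forall j, (a <= j < b)%N -> deriv_within (Rplus R) (F j) t (dF j t)) ->
    deriv_within (Rplus R) (fun t => \sum_(a <= j < b) F j t) t (\sum_(a <= j < b) dF j t).
  move=> h; pose F' j := if (a <= j < b)%N then F j else fun=> 0.
  pose dF' j := if (a <= j < b)%N then dF j t else 0.
  have -> : \sum_(a <= j < b) dF j t = \sum_(a <= j < b) dF' j.
    by apply: eq_big_nat => j jn; rewrite /dF' jn.
  have -> : (fun s => \sum_(a <= j < b) F j s) = (fun s => \sum_(a <= j < b) F' j s).
    by apply/funext => s; apply: eq_big_nat => j jn; rewrite /F' jn.
  apply: deriv_within_sum => j; rewrite /F' /dF'; case: ifP => [/h//|_].
  exact: deriv_within_cst.
move=> t0; apply: deriv_withinD; apply: sumd => j jn; first by have [] := xdP jn t0.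
by have [] := xwP jn t0.
Qed.

Let dS_C : Ccurve (setT : set X) 0 dS.
Proof.
apply: CcurveD; apply: Ccurve_sum => // j _; first exact: Ccurve_subset (dxdC j).
exact: Ccurve_subset (dxwC j).
Qed.

Let dS_spos (t : R) : 0 <= t -> PP spos (dS t) = dS t.
Proof.
move=> t0; apply: (@Msum_spos R X Y S hA hB hroot 1) => //.
exists (\sum_(1 <= j < nu) dxd j t); first by apply: famsumI => j jn; exact: Ccurve_in (dxdC j) t0.
by exists (\sum_(1 <= j < nu.-1) dxw j t) => //; apply: famsumI => j jn; exact: Ccurve_in (dxwC j) t0.
Qed.

Let A_dS (t : R) : 0 <= t -> A (dS t) = A (dxd 1 t + dxw 1 t) + \sum_(1 <= s < nu.-1) A (dxd s.+1 t + dxw s.+1 t).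
Proof.
move=> t0; have Dd j := fixed_dom lA lB hroot (Ddiag_fix (Ccurve_in (dxdC j) t0)).
have Dw j := fixed_dom lA lB hroot (Dwedge_fix (Ccurve_in (dxwC j) t0)).
have Dsum (F : nat -> X) a b : (forall j, D (F j)) -> D (\sum_(a <= j < b) F j) /\
    A (\sum_(a <= j < b) F j) = \sum_(a <= j < b) A (F j).
  move=> DF; elim: (index_iota a b) => [|j r [h1' h2']].
    by rewrite !big_nil (opA0 lA lB); split=> //; exact: dom0.
  by rewrite !big_cons (A_D lA)// h2'; split=> //; exact: (domD lA lB).
have [D1' A1'] := Dsum (fun j => dxd j t) 1%N nu Dd.
have [D2' A2'] := Dsum (fun j => dxw j t) 1%N nu.-1 Dw.
rewrite /dS (A_D lA)// A1' A2'.
under [in RHS]eq_bigr do rewrite (A_D lA)//.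
rewrite big_split /= (A_D lA)// addrACA; congr (_ + _).
  case: (ltnP 1 nu) => nu1.
    by rewrite big_ltn// big_add1.
  by rewrite !big_geq//; [rewrite dxd_out// (opA0 lA lB) addr0|lia].
case: (ltnP 1 nu) => nu1; last by rewrite !big_geq//; [rewrite dxw_out// ?(opA0 lA lB) ?addr0//; lia|lia|lia].
transitivity (\sum_(1 <= j < nu) A (dxw j t)); last by rewrite (big_ltn nu1) big_add1.
rewrite [RHS](@big_cat_nat _ _ _ nu.-1)//=; [|lia|lia].
rewrite [X in _ = _ + X]big_nat_cond [X in _ = _ + X]big1 ?addr0// => j /andP[/andP[jn _] _].
by rewrite dxw_out// (opA0 lA lB).
Qed.

(** The structure hypothesis at a decomposed state: each projected term sees only the components
    that occur in its own equation, which is what makes the system triangular. *)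
Lemma struct_components (t : R) (x1 z : X) (yd yw : nat -> X) : 0 <= t -> D1 S x1 -> M20 z ->
  (forall j, (1 <= j < nu)%N -> Md j (yd j)) -> (forall j, (1 <= j < nu.-1)%N -> Mw j (yw j)) ->
  let x := x1 + z + (\sum_(1 <= j < nu) yd j + \sum_(1 <= j < nu.-1) yw j) in
  f t x = Q1 S (f t x) + QQ (slev 0) (f t x) +
    \sum_(1 <= s < nu.-1) QQ (swedge s)
       (f t (\sum_(1 <= j < nu) yd j + \sum_(s.+1 <= j < nu.-1) yw j + yw s)) +
    \sum_(1 <= s < nu) QQ (sdiag s) (f t (yd s + \sum_(s.+1 <= j < nu) yd j)).
Proof.
move=> t0 E1 Mz hd hw x.
have [_ _ cd cw] := components E1 Mz (fun j jn => Md_fix jn (hd j jn)) (fun j jn => Mw_fix jn (hw j jn)).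
have Mx : M x.
  exists (x1 + z); first by exists x1 => //; exists z.
  exists (\sum_(1 <= j < nu) yd j + \sum_(1 <= j < nu.-1) yw j) => //.
  exists (\sum_(1 <= j < nu) yd j); first exact: famsumI.
  by exists (\sum_(1 <= j < nu.-1) yw j) => //; exact: famsumI.
rewrite {1}(hstruct t0 (total_dom hA hB hroot hM20 hMd hMw Mx)) Q2s_QQ//; congr (_ + _ + _).
  apply: eq_big_nat => s /andP[s1 sn]; rewrite Q2Sigma_QQ//; congr (QQ _ (f t _)).
  rewrite (@eq_big_nat _ _ _ 1 nu _ yd); last by move=> j jn; rewrite P2sj_PP// cd.
  rewrite (@eq_big_nat _ _ _ s nu.-1 _ yw); last first.
    by move=> j /andP[sj jn]; rewrite P2wedge_PP// cw// (leq_trans s1 sj).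
  by rewrite (big_ltn sn); lincomb_eq.
apply: eq_big_nat => s /andP[s1 sn]; rewrite Q2sj_QQ//; congr (QQ _ (f t _)).
rewrite (@eq_big_nat _ _ _ s nu _ yd); last first.
  by move=> j /andP[sj jn]; rewrite P2sj_PP// cd// (leq_trans s1 sj).
by rewrite (big_ltn sn).
Qed.

Lemma Q1_Q1 y : Q1 S (Q1 S y) = Q1 S y.
Proof.
rewrite !Q1E// (blinB (bQ _)) QQ_QQ// [X in _ - (_ - X)](@eq_QQ _ _ _ _ _ sall) ?subrr ?subr0//.
Qed.

Let G_Q1 (t : R) w : Q1 S (G t w) = G t w.
Proof.
have [Dw Pw _] := AinvP hA hB hdom hpencil hroot w.
have P1w : P1 S (Ainv w) = Ainv w by rewrite P1E// Pw subr0.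
rewrite /G /ode_field (blinB (Q1_bounded hroot)) /h1 Q1_Q1 /=; congr (_ - _).
by rewrite -(B_P1 hA hB hroot Dw) P1w.
Qed.

Lemma A_M20 z : M20 z -> A z = 0.
Proof.
move=> /M20_fix Pz; rewrite (A_fixed lA lB hroot Pz) /AP /proj_sum /gsum big1// => p /andP[_ /eqP ->].
by rewrite A_phi1// actYr0.
Qed.

Let A_xS (t : R) : 0 <= t -> PP spos (xS t) = xS t /\ A (xS t) = AP spos (xS t).
Proof.
move=> t0; suff h : PP spos (xS t) = xS t by split=> //; exact: A_fixed h.
apply: (@Msum_spos R X Y S hA hB hroot 1) => //; apply: Msum_sub; [exact: hMd|exact: hMw|by []|exact: xS_in].
Qed.

Let bL := Ainv_bounded hA hB hdom hpencil hroot.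

Lemma zeta_cvg (J : set R) (y : R -> X) (t : R) : J `<=` Rplus R -> 0 <= t -> (forall s, J s -> D1 S (y s)) ->
  D1 S (y t) -> y @ within J (nbhs t) --> y t ->
  (fun s => zeta s (y s)) @ within J (nbhs t) --> zeta t (y t).
Proof.
move=> JR t0 yE yEt /cvgr_normP yc; apply/cvgr_normP => e e0.
have [d [L [d0 _ hd]]] := zeta_reg t0 yEt e0.
have d2 : 0 < d / 2 by rewrite divr_gt0.
apply: filterS3 (near_within_self J t) (near_within_ball J t d0) (yc _ d2) => s Js st ys.
have yd : `|y s - y t| < d by apply: le_lt_trans ys _; lra.
by have [] := hd s (y s) (y s) (JR _ Js) st (yE s Js) (yE s Js) yd yd.
Qed.

Lemma solution_exists (t0 : R) (x01 : X) (w : R -> Y) : 0 <= t0 -> D1 S x01 -> w t0 = A x01 ->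
  ode_sol G `[t0, +oo[ w ->
  exists x : R -> X, [/\ is_solution_on S f `[t0, +oo[ x, forall t : R, t0 <= t -> M (x t) & P1 S (x t0) = x01].
Proof.
move=> t00 E01 w0 wd; pose J : set R := `[t0, +oo[%classic.
have JP (t : R) : J t <-> t0 <= t by rewrite /J /= in_itv/= andbT.
have JR : J `<=` Rplus R by move=> t /JP; exact: le_trans.
pose x t := Ainv (w t) + zeta t (Ainv (w t)) + xS t; exists x.
have xM (t : R) : t0 <= t -> M (x t).
  move=> tt; have t0' := le_trans t00 tt; have [Mz _ _] := zetaP t0' (Ainv_D1 (w t)).
  exists (Ainv (w t) + zeta t (Ainv (w t))).
    by exists (Ainv (w t)) => //; exists (zeta t (Ainv (w t))).
  by exists (xS t) => //; exact: xS_in.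
have comp (t : R) : 0 <= t -> P1 S (x t) = Ainv (w t).
  move=> t0'; have [Mz _ _] := zetaP t0' (Ainv_D1 (w t)).
  by have [] := components (Ainv_D1 (w t)) Mz (fun j => @xd_fix j t t0') (fun j => @xw_fix j t t0').
have xD (t : R) : J t -> D (x t).
  by move=> /JP tt; apply: (total_dom hA hB hroot hM20 hMd hMw); exact: xM.
(* The curve w is not assumed to stay in Y_1; only Q_1 w enters x, because [Ainv] contains Q_1. *)
have Ax (t : R) : J t -> A (x t) = Q1 S (w t) + AP spos (xS t).
  move=> Jt; have t0' := JR _ Jt; have [Mz _ _] := zetaP t0' (Ainv_D1 (w t)).
  have [DL _ AL] := AinvP hA hB hdom hpencil hroot (w t); have [Px AxS] := A_xS t0'.
  have Dz := fixed_dom lA lB hroot (M20_fix Mz); have Dx := fixed_dom lA lB hroot Px.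
  by have Dxz := domD lA lB DL Dz; rewrite /x (A_D lA)// (A_D lA)// AL A_M20// addr0 AxS.
have wc (t : R) : J t -> w @ within J (nbhs t) --> w t by move=> /wd; exact: deriv_within_cvg.
have Lc (t : R) : J t -> (fun s => Ainv (w s)) @ within J (nbhs t) --> Ainv (w t).
  by move=> Jt; apply: (blin_cvg bL _ (wc t Jt)).
pose dAx (t : R) := Q1 S (G t (w t)) + AP spos (dS t).
split=> //; last first.
  rewrite comp//; apply: (Ainv_unique hA hB hroot); have [D01 P01] := (D1P hA hB hroot x01).1 E01 => //.
  by rewrite w0 -(A_P1 hA hB hroot D01) P1E// P01 subr0.
split=> //.
  apply/subspace_continuousP => t Jt; apply: cvgD.
    apply: cvgD; first exact: Lc.
    apply: (zeta_cvg JR); [exact: JR|by move=> *; exact: Ainv_D1|exact: Ainv_D1|exact: Lc].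
  apply: (cvg_within_subset JR); exact: deriv_within_cvg (xS_deriv (JR _ Jt)).
have Axd (t : R) : J t -> deriv_within J (fun s => A (x s)) t (dAx t).
  move=> Jt; apply: (@eq_deriv_within _ _ J (fun s => Q1 S (w s) + AP spos (xS s))) => //.
    by move=> s Js; rewrite Ax.
  apply: deriv_withinD; first exact: (deriv_within_blin (Q1_bounded hroot) (wd t Jt)).
  apply: (deriv_within_blin (AP_bounded hroot spos)); apply: (deriv_within_subset JR).
  exact: xS_deriv (JR _ Jt).
exists dAx; split.
- by move=> t Jt _; apply/deriv_within_quotient; exact: Axd.
- apply/subspace_continuousP => t [Jt _]; apply: (@cvg_within_subset _ _ _ J); first by move=> s [].
  apply: cvgD.
    apply: (blin_cvg (Q1_bounded hroot)); apply: (ode_cvg Gc) => //; exact: wc.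
  apply: (blin_cvg (AP_bounded hroot spos)); apply: (cvg_within_subset JR).
  exact: Ccurve_cvg dS_C (JR _ Jt).
move=> t Jt _; have t0' := JR _ Jt; have [Mz ez _] := zetaP t0' (Ainv_D1 (w t)).
have hd j : (1 <= j < nu)%N -> Md j (xd j t) by move=> jn; have [] := xdP jn t0'.
have hw j : (1 <= j < nu.-1)%N -> Mw j (xw j t) by move=> jn; have [] := xwP jn t0'.
have [DL _ _] := AinvP hA hB hdom hpencil hroot (w t); have [Px _] := A_xS t0'.
have Dz := fixed_dom lA lB hroot (M20_fix Mz); have Dx := fixed_dom lA lB hroot Px.
have Bsum (F : nat -> X) a b : (forall j, (a <= j < b)%N -> D (F j)) -> D (\sum_(a <= j < b) F j) /\
    B (\sum_(a <= j < b) F j) = \sum_(a <= j < b) B (F j).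
  move=> DF; rewrite big_nat_cond [\sum_(_ <= _ < _) B _]big_nat_cond.
  elim: (index_iota a b) => [|j r [h1' h2']].
    by rewrite !big_nil (opB0 lA lB); split=> //; exact: dom0.
  rewrite !big_cons; case: ifP => // /andP[/DF DFj _].
  by rewrite (B_D lB)// h2'; split=> //; exact: (domD lA lB).
have [D1' B1'] := Bsum (fun j => xd j t) 1%N nu (fun j jn => fixed_dom lA lB hroot (xd_fix t0' jn)).
have [D2' B2'] := Bsum (fun j => xw j t) 1%N nu.-1 (fun j jn => fixed_dom lA lB hroot (xw_fix t0' jn)).
have BxS : B (xS t) = \sum_(1 <= j < nu) B (xd j t) + \sum_(1 <= j < nu.-1) B (xw j t).
  by rewrite /xS (B_D lB)// B1' B2'.
rewrite /dAx G_Q1 -(A_fixed lA lB hroot (dS_spos t0')) A_dS//.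
rewrite [RHS](struct_components t0' (Ainv_D1 (w t)) Mz hd hw) -/(xS t) -/(x t).
rewrite (_ : QQ (slev 0) (f t (x t)) = B (zeta t (Ainv (w t))) + A (dxd 1 t + dxw 1 t))//.
rewrite [X in _ = _ + X + _](@eq_big_nat _ _ _ 1 nu.-1 _ (fun s => B (xw s t) + A (dxd s.+1 t + dxw s.+1 t))); last first.
  by move=> s sn; have [_ _ -> _] := xwP sn t0'.
rewrite [X in _ = _ + X](@eq_big_nat _ _ _ 1 nu _ (fun s => B (xd s t))); last first.
  by move=> s sn; have [_ _ -> _] := xdP sn t0'.
have DLz := domD lA lB DL Dz.
rewrite {2}/x (B_D lB)// (B_D lB)// BxS big_split /= /G /ode_field /h1 -/(x t) /=.
by lincomb_eq.
Qed.

Lemma total_decomp x : M x ->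
  [/\ D1 S (P1 S x), M20 (PP (slev 0) x),
    forall j, (1 <= j < nu)%N -> Md j (PP (sdiag j) x),
    forall j, (1 <= j < nu.-1)%N -> Mw j (PP (swedge j) x) &
    x = P1 S x + PP (slev 0) x +
      (\sum_(1 <= j < nu) PP (sdiag j) x + \sum_(1 <= j < nu.-1) PP (swedge j) x)].
Proof.
move=> [_ [x1 E1 [z Mz <-]] [_ [_ [yd hd <-] [_ [yw hw <-] <-]] <-]].
have [-> -> cd cw] := components E1 Mz (fun j jn => Md_fix jn (hd j jn)) (fun j jn => Mw_fix jn (hw j jn)).
split=> // [j jn|j jn|]; first by rewrite cd//; exact: hd.
  by rewrite cw//; exact: hw.
by congr (_ + (_ + _)); apply: eq_big_nat => j jn; rewrite ?cd ?cw.
Qed.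

Lemma QQ_disjoint (s r : 'I_(nker S) -> nat -> bool) y : (forall i l, s i l -> ~~ r i l) -> QQ r (QQ s y) = 0.
Proof.
move=> sr; rewrite QQ_QQ// /QQ /proj_sum /gsum big1// => p /andP[_].
by case: (boolP (s p.1 p.2)) => [/sr/negbTE->|]; rewrite ?andbF.
Qed.

Lemma QQ_Q1 r y : QQ r (Q1 S y) = 0.
Proof.
rewrite Q1E// (blinB (bQ r)) QQ_QQ// [X in _ - X](@eq_QQ _ _ _ _ _ r) ?subrr// => i l _.
by rewrite andbT.
Qed.

Let QQ_idem r y : QQ r (QQ r y) = QQ r y.
Proof. by rewrite QQ_QQ//; apply: eq_QQ => i l _; rewrite andbb. Qed.

Section Uniqueness.
Variables (t0 : R) (x01 : X) (x : R -> X) (w : R -> Y).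
Hypothesis t00 : 0 <= t0.
Let J : set R := `[t0, +oo[%classic.
Hypothesis xsol : is_solution_on S f J x.
Hypothesis xM : forall t : R, t0 <= t -> M (x t).
Hypothesis x0 : P1 S (x t0) = x01.
Hypothesis w0 : w t0 = A x01.
Hypothesis wd : ode_sol G J w.

Let JP (t : R) : J t <-> t0 <= t.
Proof. by rewrite /J /= in_itv/= andbT. Qed.

Let JR : J `<=` Rplus R.
Proof. by move=> t /JP; exact: le_trans. Qed.

Let Mx (t : R) : J t -> M (x t). Proof. by move=> /JP; exact: xM. Qed.

Let Dx (t : R) : J t -> D (x t).
Proof. by move=> /Mx; exact: (total_dom hA hB hroot hM20 hMd hMw). Qed.

Let xc (t : R) : J t -> x @ within J (nbhs t) --> x t.
Proof. by have [/subspace_continuousP h _ _] := xsol; exact: h. Qed.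

(** The equation is required for t > 0 only; identities between components reach t = 0 by
    continuity. *)
Let extend (g g' : R -> X) :
  (forall t : R, J t -> g @ within J (nbhs t) --> g t) ->
  (forall t : R, J t -> g' @ within J (nbhs t) --> g' t) ->
  (forall t : R, J t -> 0 < t -> g t = g' t) -> forall t : R, J t -> g t = g' t.
Proof.
move=> gc gc' gg t Jt; have [t0'|] := ltP 0 t; first exact: gg.
move=> t0'; apply/eqP; rewrite -subr_eq0 -normr_le0; apply/ler_addgt0Pl => e e0.
have e2 : 0 < e / 2 by rewrite divr_gt0.
have /cvgr_normP/(_ _ e2) h := gc t Jt; have /cvgr_normP/(_ _ e2) h' := gc' t Jt.
have : \forall s \near within J (nbhs t), `|g s - g t| <= e / 2 /\ `|g' s - g' t| <= e / 2.
  exact: filterI.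
move=> /near_withinP[d d0 hd]; have := JR Jt; rewrite /Rplus /= => t1.
have Js : J (t + d / 2) by apply/JP; move/JP: Jt => ?; lra.
have [|hs hs'] := hd _ Js; first by rewrite addrAC subrr add0r gtr0_norm; lra.
have es : g (t + d / 2) = g' (t + d / 2) by apply: gg => //; lra.
rewrite addr0; have -> : g t - g' t = (g' (t + d / 2) - g' t) - (g (t + d / 2) - g t) by rewrite es; lincomb_eq.
by rewrite (le_trans (ler_normB _ _))// [leRHS]splitr lerD.
Qed.

Let dae (t : R) : J t -> 0 < t -> exists v, v + B (x t) = f t (x t) /\
  forall Q : Y -> Y, bounded_linear_on setT Q -> deriv_within J (fun s => Q (A (x s))) t (Q v).
Proof.
move=> Jt t0'; have [_ _ [dAx [h1' _ h3]]] := xsol; exists (dAx t); split; first exact: h3.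
by move=> Q bQ'; apply: (deriv_within_blin bQ'); apply/deriv_within_quotient; exact: h1'.
Qed.

Let dunique (g : R -> Y) (t : R) d d' : J t -> deriv_within J g t d -> deriv_within J g t d' -> d = d'.
Proof.
move=> Jt; apply: deriv_within_unique => e e0; exists (t + e / 2).
  by apply/JP; move/JP: Jt => ?; lra.
by rewrite addrAC subrr add0r gtr0_norm; lra.
Qed.

Let xst (t : R) : J t -> x t = P1 S (x t) + PP (slev 0) (x t) +
      (\sum_(1 <= j < nu) PP (sdiag j) (x t) + \sum_(1 <= j < nu.-1) PP (swedge j) (x t)).
Proof. by move=> /Mx/total_decomp[]. Qed.

Let fst' (t : R) : J t -> f t (x t) = Q1 S (f t (x t)) + QQ (slev 0) (f t (x t)) +
    \sum_(1 <= s < nu.-1) QQ (swedge s) (f t (\sum_(1 <= j < nu) PP (sdiag j) (x t) +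
       \sum_(s.+1 <= j < nu.-1) PP (swedge j) (x t) + PP (swedge s) (x t))) +
    \sum_(1 <= s < nu) QQ (sdiag s) (f t (PP (sdiag s) (x t) + \sum_(s.+1 <= j < nu) PP (sdiag j) (x t))).
Proof.
move=> Jt; have [h1' h2' h3' h4' _] := total_decomp (Mx Jt).
by have := struct_components (JR Jt) h1' h2' h3' h4'; rewrite -xst.
Qed.

Let sum1 (F : nat -> Y) a b k : (a <= k < b)%N -> (forall j, (a <= j < b)%N -> j != k -> F j = 0) ->
   \sum_(a <= j < b) F j = F k.
Proof.
move=> kab F0; rewrite (bigD1_seq k) ?mem_index_iota ?iota_uniq//= big_nat_cond big1 ?addr0//.
by move=> j /andP[/F0 h]; exact: h.
Qed.

Let sum0 (F : nat -> Y) a b : (forall j, (a <= j < b)%N -> F j = 0) -> \sum_(a <= j < b) F j = 0.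
Proof. by move=> F0; rewrite big_nat_cond big1// => j /andP[/F0]. Qed.

Let Qdiag_f k (t : R) : J t -> (1 <= k < nu)%N -> QQ (sdiag k) (f t (x t)) =
  QQ (sdiag k) (f t (PP (sdiag k) (x t) + \sum_(k.+1 <= j < nu) PP (sdiag j) (x t))).
Proof.
move=> Jt kn; rewrite [in LHS]fst'// 3!(blinD (bQ _)) QQ_Q1.
rewrite (QQ_disjoint (s := slev 0)); last by move=> i l /eqP->; rewrite /sdiag; lia.
rewrite 2!(blin_sum (bQ _)).
rewrite (sum0 (F := fun j => QQ (sdiag k) (QQ (swedge j) _))); last first.
  move=> j jn; apply: QQ_disjoint => i l /andP[/eqP-> h].
  by rewrite /sdiag negb_and; case: eqP => //= jk; lia.
rewrite (sum1 kn) ?QQ_idem ?add0r// => j jn jk; apply: QQ_disjoint => i l /andP[/eqP-> h].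
by rewrite /sdiag (negbTE jk).
Qed.

Let Qwedge_f k (t : R) : J t -> (1 <= k < nu.-1)%N -> QQ (swedge k) (f t (x t)) =
  QQ (swedge k) (f t (\sum_(1 <= j < nu) PP (sdiag j) (x t) +
       \sum_(k.+1 <= j < nu.-1) PP (swedge j) (x t) + PP (swedge k) (x t))).
Proof.
move=> Jt kn; rewrite [in LHS]fst'// 3!(blinD (bQ _)) QQ_Q1.
rewrite (QQ_disjoint (s := slev 0)); last by move=> i l /eqP->; rewrite /swedge; lia.
rewrite 2!(blin_sum (bQ _)).
rewrite (sum0 (F := fun j => QQ (swedge k) (QQ (sdiag j) _))); last first.
  move=> j jn; apply: QQ_disjoint => i l /andP[/eqP-> /eqP h].
  by rewrite /swedge negb_and h; case: eqP => //= jk; lia.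
rewrite (sum1 kn) ?QQ_idem ?add0r ?addr0// => j jn jk; apply: QQ_disjoint => i l /andP[/eqP-> h].
by rewrite /swedge (negbTE jk).
Qed.

Let PPc s (t : R) : J t -> (fun r => PP s (x r)) @ within J (nbhs t) --> PP s (x t).
Proof. by move=> Jt; apply: (blin_cvg (bP s) _ (xc Jt)). Qed.

Let diag_eq s : (1 <= s < nu)%N -> forall t : R, J t -> PP (sdiag s) (x t) = xd s t.
Proof.
suff h n : forall s, (1 <= s < nu)%N -> (nu - n <= s)%N -> forall t : R, J t -> PP (sdiag s) (x t) = xd s t.
  by move=> sn; apply: (h nu) => //; rewrite subnn.
elim: n => [|n IH] k kn nk; first by lia.
apply: extend; first exact: PPc.
  move=> t Jt; apply: (cvg_within_subset JR).
  by have [_ h _ _] := xdP kn (JR Jt); exact: deriv_within_cvg h.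
move=> t Jt t0'; have [v [ev dv]] := dae Jt t0'.
have [_ _ _ hu] := xdP kn (JR Jt); have [_ _ hd _ _] := total_decomp (Mx Jt).
apply: hu; first exact: hd.
(* Applied to A x, this projector would read level k + 1 of chains of length k + 1, whose last level
   is k; so the projected derivative is that of the zero curve. *)
have v0 : QQ (sdiag k) v = 0.
  apply: (dunique Jt (dv _ (bQ _))); apply: (@eq_deriv_within _ _ J (fun=> 0)) => //; last exact: deriv_within_cst.
  move=> r Jr; rewrite QQ_Aop//; last exact: Dx.
  rewrite /AP /proj_sum /gsum big1// => p /andP[vp /andP[h1' /andP[h2' h3']]].
  by move: vp; rewrite /valid; lia.
have e := congr1 (QQ (sdiag k)) ev; rewrite (blinD (bQ _)) v0 add0r (QQ_Bop hroot _ (Dx Jt)) Qdiag_f// in e.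
rewrite B_PP// e; congr (QQ _ (f t (_ + _))); apply: eq_big_nat => j /andP[kj jn].
by rewrite IH//; lia.
Qed.

(** Padding by zero: at levels without such components the projections of x vanish too, so the
    identities hold for all s >= 1. *)
Let xdz s := if (s < nu)%N then xd s else fun=> 0.
Let xwz s := if (s < nu.-1)%N then xw s else fun=> 0.

Let PP_out s (y : X) : (forall i l, (l < @mult R X Y S i)%N -> ~~ s i l) -> PP s y = 0.
Proof.
by move=> h; rewrite /PP /proj_sum /gsum big1// => p /andP[vp]; rewrite (negbTE (h _ _ vp)).
Qed.

Let diag_eqz s : (1 <= s)%N -> forall t : R, J t -> PP (sdiag s) (x t) = xdz s t.
Proof.
move=> s1 t Jt; rewrite /xdz; case: ltnP => sn; first by apply: diag_eq; rewrite // s1.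
apply: PP_out => i l lm; have := mult_le hroot i; rewrite /sdiag negb_and; case: eqP => //= ls; lia.
Qed.

(** The projection of A x consists of the components of level s + 1, already identified with known
    curves. The derivative supplied by the solution and that of the known curves are therefore
    derivatives of one curve, hence equal. *)
Let shift_deriv s r (t : R) v : J t -> 0 < t ->
  (forall i l, (l < @mult R X Y S i)%N -> shift r i l = (l == s.+1)) ->
  (forall t : R, J t -> PP (swedge s.+1) (x t) = xwz s.+1 t) ->
  (forall Q : Y -> Y, bounded_linear_on setT Q -> deriv_within J (fun s => Q (A (x s))) t (Q v)) ->
  QQ r v = A (dxd s.+1 t + dxw s.+1 t).
Proof.
move=> Jt t0' hr hw dv; have tR := JR Jt.
have [-> _] := A_ddw lA lB hroot (Ccurve_in (dxdC s.+1) tR) (Ccurve_in (dxwC s.+1) tR).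
apply: (dunique Jt (dv _ (bQ _))).
apply: (@eq_deriv_within _ _ J (fun t => AP (sdiag s.+1) (xdz s.+1 t) + AP (swedge s.+1) (xwz s.+1 t))) => //.
  move=> t' Jt'; rewrite QQ_Aop//; last exact: Dx.
  rewrite -diag_eqz// -hw// !AP_PP// /AP /proj_sum gsumD; last first.
    by move=> p /andP[/andP[/eqP h1' /eqP h2'] _]; rewrite /swedge h2' ltnn !andbF.
  apply: eq_gsum => p vp /=; rewrite hr// !andbb /sdiag /swedge.
  by move: vp; rewrite /valid; case: eqP => //= ->; lia.
apply: deriv_withinD; apply: (deriv_within_blin (AP_bounded hroot _)).
  rewrite /xdz; case: ltnP => sn; last by rewrite dxd_out//; exact: deriv_within_cst.
  by apply: (deriv_within_subset JR); have [] := xdP (s := s.+1) sn tR.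
rewrite /xwz; case: ltnP => sn; last by rewrite dxw_out//; exact: deriv_within_cst.
by apply: (deriv_within_subset JR); have [] := xwP (s := s.+1) sn tR.
Qed.

Let wedge_eqz s : (1 <= s)%N -> forall t : R, J t -> PP (swedge s) (x t) = xwz s t.
Proof.
suff h n : forall s, (1 <= s)%N -> (nu - n <= s)%N -> forall t : R, J t -> PP (swedge s) (x t) = xwz s t.
  by move=> sn; apply: (h nu) => //; rewrite subnn.
elim: n => [|n IH] k k1 nk t Jt.
  rewrite /xwz ifF; last by lia.
  apply: PP_out => i l lm; have := mult_le hroot i; rewrite /swedge negb_and; case: eqP => //= ls; lia.
rewrite /xwz; case: ltnP => kn; last first.
  apply: PP_out => i l lm; have := mult_le hroot i; rewrite /swedge negb_and; case: eqP => //= ls; lia.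
have kn' : (1 <= k < nu.-1)%N by rewrite k1.
move: t Jt; apply: extend; first exact: PPc.
  move=> t Jt; apply: (cvg_within_subset JR).
  by have [_ h _ _] := xwP kn' (JR Jt); exact: deriv_within_cvg h.
move=> t Jt t0'; have [v [ev dv]] := dae Jt t0'.
have [_ _ _ hu] := xwP kn' (JR Jt); have [_ _ _ hw _] := total_decomp (Mx Jt).
apply: hu; first exact: hw.
have vE : QQ (swedge k) v = A (dxd k.+1 t + dxw k.+1 t).
  apply: (shift_deriv Jt t0') => // [i l lm|t' Jt']; last by apply: IH => //; lia.
  by rewrite /shift /swedge; case: l lm => //= l lm; rewrite eqSS; case: eqP => //= <-.
have e := congr1 (QQ (swedge k)) ev; rewrite (blinD (bQ _)) vE (QQ_Bop hroot _ (Dx Jt)) Qwedge_f// in e.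
rewrite B_PP// [RHS]addrC e; congr (QQ _ (f t (_ + _ + _))); apply: eq_big_nat => j /andP[kj jn].
  by rewrite diag_eq// kj.
by rewrite IH//; [rewrite /xwz jn|lia|lia].
Qed.

Let xS_eq (t : R) : J t -> x t = P1 S (x t) + PP (slev 0) (x t) + xS t.
Proof.
move=> Jt; rewrite {1}xst//; congr (_ + (_ + _)); apply: eq_big_nat => j jn; first exact: diag_eq.
by case/andP: jn => j1 jn; rewrite wedge_eqz// /xwz jn.
Qed.

Let P1x_D1 (t : R) : J t -> D1 S (P1 S (x t)).
Proof. by move=> /Mx/total_decomp[]. Qed.

Let P1c (t : R) : J t -> (fun r => P1 S (x r)) @ within J (nbhs t) --> P1 S (x t).
Proof. by move=> Jt; apply: (blin_cvg (P1_bounded hroot) _ (xc Jt)). Qed.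

Let zeta_eq (t : R) : J t -> PP (slev 0) (x t) = zeta t (P1 S (x t)).
Proof.
move: t; apply: extend; first exact: PPc.
  by move=> t Jt; apply: (zeta_cvg JR (JR Jt)); [exact: P1x_D1|exact: P1x_D1|exact: P1c].
move=> t Jt t0'; have [v [ev dv]] := dae Jt t0'.
have [_ _ hu] := zetaP (JR Jt) (P1x_D1 Jt); have [_ Mz _ _ _] := total_decomp (Mx Jt).
apply: hu => //; rewrite -xS_eq//.
have vE : QQ (slev 0) v = A (dxd 1 t + dxw 1 t).
  apply: (shift_deriv Jt t0') => // [i l lm|t' Jt']; last exact: wedge_eqz.
  by rewrite /shift /slev; case: l lm.
have e := congr1 (QQ (slev 0)) ev; rewrite (blinD (bQ _)) vE (QQ_Bop hroot _ (Dx Jt)) in e.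
by rewrite B_PP// [RHS]addrC e.
Qed.

Let u t := A (P1 S (x t)).

Let Ainv_u (t : R) : J t -> Ainv (u t) = P1 S (x t).
Proof.
move=> Jt; have [DP PP0] := (D1P hA hB hroot _).1 (P1x_D1 Jt).
apply: (Ainv_unique hA hB hroot) => //.
by rewrite /u -(A_P1 hA hB hroot DP) [P1 S (P1 S _)]P1E// PP0 subr0.
Qed.

Let u_deriv (t : R) : J t -> 0 < t -> deriv_within J u t (G t (u t)).
Proof.
move=> Jt t0'; have [v [ev dv]] := dae Jt t0'.
have -> : G t (u t) = Q1 S v.
  rewrite /G /ode_field /= Ainv_u// -zeta_eq// /h1 -xS_eq//.
  rewrite (B_P1 hA hB hroot (Dx Jt)) -ev (blinD (Q1_bounded hroot)); lincomb_eq.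
apply: (@eq_deriv_within _ _ J (fun s => Q1 S (A (x s)))) => //; last exact: dv (Q1_bounded hroot).
by move=> s Js; rewrite /u (A_P1 hA hB hroot (Dx Js)).
Qed.

Let clA : closed [set p : X * Y | D p.1 /\ p.2 = A p.1].
Proof. by rewrite (dom_domA hdom); case: hA. Qed.

(* For t0 = 0 the equation gives no derivative at 0; continuity of A x1 at 0
   follows from the boundedness of its derivative and the closedness of A. *)
Let u_cvg (t : R) : J t -> u @ within J (nbhs t) --> u t.
Proof.
move=> Jt; have [t0'|] := ltP 0 t; first exact: deriv_within_cvg (u_deriv Jt t0').
move=> tle; have t0E : t = 0 by apply/eqP; rewrite eq_le tle; exact: (JR Jt).
have t00' : t0 = 0 by apply/eqP; rewrite eq_le t00 andbT -t0E; apply/JP.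
pose g t := h1 t (P1 S (x t)) (PP (slev 0) (x t)).
have Jsub a b : 0 <= a -> `[a, b] `<=` J.
  by move=> a0 y /in_itvccP/andP[ay _]; apply/JP; rewrite t00'; exact: le_trans ay.
have gc (s : R) : J s -> g @ within J (nbhs s) --> g s.
  move=> Js; have [h1' h2' _ _ _] := total_decomp (Mx Js).
  apply/cvgr_normP => e e0; have [d d0 hd] := h1c (JR Js) h1' h2' e0.
  have d2 : 0 < d / 2 by rewrite divr_gt0.
  have /cvgr_normP/(_ _ d2) c1 := P1c Js; have /cvgr_normP/(_ _ d2) c2 := @PPc (slev 0) s Js.
  apply: filterS3 (filterI (near_within_self J s) (near_within_ball J s d0)) c1 c2 => y [Jy ys] y1 y2.
  have [h1y h2y _ _ _] := total_decomp (Mx Jy).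
  by apply: hd => //; [exact: JR|lra|lra].
have [C hC] := bounded_on_segment ler01 (fun s s01 => cvg_within_subset (Jsub 0 1 (lexx 0))
  (gc s (Jsub 0 1 (lexx 0) s ((in_itvccP 0 1 s).2 s01)))).
have [|l [h [k [h0 hl]]]] := linear_ode_limit (B_Ainv_bounded hA hB hdom hpencil hroot) ltr01 (u := u) (g := g) _ hC.
  move=> s /andP[s0 s1]; have Js : J s by apply: (Jsub 0 1 (lexx 0)); apply/in_itvccP; rewrite ltW.
  apply: (deriv_within_subset (Jsub 0 1 (lexx 0))); have := u_deriv Js s0.
  by rewrite /G /ode_field /= Ainv_u// -zeta_eq.
suff lE : l = u t.
  apply/cvgr_normP => e e0; have k0 : 0 < `|k| + 1 by rewrite ltr_wpDl.
  apply/near_withinP; exists (Order.min h (e / (`|k| + 1))); first by rewrite lt_min h0 divr_gt0.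
  move=> s Js; have s0 := JR Js; rewrite /Rplus /= in s0.
  rewrite t0E subr0 ger0_norm// lt_min => /andP[sh se].
  have [->|sn0] := eqVneq s 0; first by rewrite subrr normr0 ltW.
  have {}s0 : 0 < s by rewrite lt_neqAle eq_sym sn0.
  rewrite -t0E -lE (le_trans (hl s _))//; first by rewrite s0 ltW.
  move: se; rewrite ltr_pdivlMr// => /ltW; apply: le_trans; rewrite mulrC ler_wpM2l//; first exact: ltW.
  by rewrite (le_trans (ler_norm k))// lerDl.
have near0 (e : R) : 0 < e -> \forall z \near 0^'+, 0 < z < e.
  move=> e0; near=> z; apply/andP; split; near: z; [exact: nbhs_right_gt|exact: nbhs_right_lt].
have : [set p : X * Y | D p.1 /\ p.2 = A p.1] (P1 S (x t), l).
  apply: (closed_cvg (F := 0^'+) (u_ := fun s => (P1 S (x s), u s)) _ clA).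
    apply: filterS (near0 1 ltr01) => s /andP[s0 _] /=; split=> //.
    by have [] := (D1P hA hB hroot _).1 (P1x_D1 (Jsub 0 s (lexx 0) s ((in_itvccP 0 s s).2 (introT andP (conj (ltW s0) (lexx s)))))).
  apply: cvg_pair.
    apply/cvgr_normP => e e0; have /cvgr_normP/(_ _ e0)/near_withinP[d d0 hd] := P1c Jt.
    apply: filterS (near0 d d0) => s /andP[s0 sd]; apply: hd.
      by apply: (Jsub 0 s (lexx 0)); apply/in_itvccP; rewrite ltW//= lexx.
    by rewrite t0E subr0 gtr0_norm.
  apply/cvgr_normP => e e0; have k0 : 0 < `|k| + 1 by rewrite ltr_wpDl.
  have m0 : 0 < Order.min h (e / (`|k| + 1)) by rewrite lt_min h0 divr_gt0.
  apply: filterS (near0 _ m0) => s /andP[s0]; rewrite lt_min => /andP[sh se].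
  rewrite (le_trans (hl s _))//; first by rewrite s0 ltW.
  move: se; rewrite ltr_pdivlMr// => /ltW; apply: le_trans; rewrite mulrC ler_wpM2l//; first exact: ltW.
  by rewrite (le_trans (ler_norm k))// lerDl.
by case.
Unshelve. all: by end_near. Qed.

(** Both A P_1 x and w solve the reduced equation with the same initial value. Since t0 may be 0,
    uniqueness is used in the form that asks only for continuity at the left endpoint. *)
Lemma solution_components (t : R) : J t ->
  x t = Ainv (w t) + zeta t (Ainv (w t)) + xS t.
Proof.
move=> Jt; have tt := (JP t).1 Jt; suff e : u t = w t.
  by rewrite -e Ainv_u// -zeta_eq// -xS_eq.
have sub : `[t0, t] `<=` J by move=> s /in_itvccP/andP[? _]; apply/JP.
apply: (ode_unique Gl t00 tt) => [s|s|s|s||]; last by rewrite tt lexx.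
- move=> /in_itvccP st; apply: (cvg_within_subset sub); exact: u_cvg (sub _ st).
- move=> /in_itvccP st; apply: (cvg_within_subset sub); exact: deriv_within_cvg (wd (sub _ st)).
- move=> /andP[ts st]; have Js : J s by apply: sub; apply/in_itvccP; rewrite (ltW ts).
  by apply: (deriv_within_subset sub); apply: u_deriv => //; exact: le_lt_trans ts.
- move=> /andP[ts st]; have Js : J s by apply: sub; apply/in_itvccP; rewrite (ltW ts).
  by apply: (deriv_within_subset sub); exact: wd.
by rewrite /u x0 w0.
Qed.
End Uniqueness.
End Solutions.

(** * Global existence and uniqueness for the differential-algebraic equation *)

Lemma ex_unique_iff (T : Type) (P Q : T -> Prop) : (forall z, P z <-> Q z) ->
  (exists! z, P z) -> exists! z, Q z.
Proof.
move=> PQ [z [Pz zU]]; exists z; split; first exact/PQ.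
by move=> z' /PQ; exact: zU.
Qed.

Theorem theorem4p8 (R : realType) (X Y : completeNormedModType R)
  (S : pencil_data X Y) (f : R -> X -> Y)
  (M20 : set X) (Md Mw : nat -> set X)
  (hA : closed_densely_defined (scalars S) (domA S) (opA S))
  (hB : closed_densely_defined (scalars S) (domB S) (opB S))
  (hrange : closed (opA S @` domA S))
  (hdom : domA S `<=` domB S)
  (hdom0 : exists2 x, dom S x & x != 0)
  (hpencil : pencil_regular_of_index S (nu_of S))
  (hroot : canonical_root_system S)
  (hf : {within Rplus R `*` dom S, continuous (fun p : R * X => f p.1 p.2)})
  (hstruct : forall (t : R) x, 0 <= t -> dom S x ->
     f t x = Q1 S (f t x) + Q2s S 0 (f t x)
       + \sum_(1 <= s < (nu_of S).-1) Q2Sigma S s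
           (f t (\sum_(1 <= j < nu_of S) P2sj S j j.+1 x
                 + \sum_(s <= j < (nu_of S).-1) P2wedge S j x))
       + \sum_(1 <= s < nu_of S) Q2sj S s s.+1
           (f t (\sum_(s <= j < nu_of S) P2sj S j j.+1 x)))
  (hM20 : rel_open (D2s S 0) M20)
  (hMd : forall j, (1 <= j < nu_of S)%N -> rel_open (Ddiag S j) (Md j))
  (hMw : forall j, (1 <= j < (nu_of S).-1)%N -> rel_open (Dwedge S j) (Mw j))
  (hCdiag : forall s, (1 <= s < (nu_of S).-1)%N ->
     Ck_on (nu_of S).-2 (Rplus R `*` famsum s (nu_of S) Md)
       ([set: R] `*` famsum s (nu_of S) (Ddiag S))
       (fun p : R * X => Q2sj S s s.+1 (f p.1 p.2)))
  (hCSigma : forall s, (1 <= s < (nu_of S).-1)%N ->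
     Ck_on s (Rplus R `*` Msum S s Md Mw)
       ([set: R] `*` Msum S s (Ddiag S) (Dwedge S))
       (fun p : R * X => Q2Sigma S s (f p.1 p.2)))
  (hClast : (2 <= nu_of S)%N ->
     Ck_on (nu_of S).-1 (Rplus R `*` Md (nu_of S).-1)
       ([set: R] `*` D2s S (nu_of S).-1)
       (fun p : R * X => Q2s S (nu_of S).-1 (f p.1 p.2)))
  (h1a : (2 <= nu_of S)%N -> forall (t : R), 0 <= t ->
     exists! z, Md (nu_of S).-1 z /\ F2last S f t z = 0)
  (h1b : forall s, (1 <= s < (nu_of S).-1)%N ->
     forall (t : R) (xd : nat -> X), 0 <= t ->
     (forall j, (s.+1 <= j < nu_of S)%N -> Md j (xd j)) ->
     exists! z, Md s z /\ F2diag S f s t z xd = 0)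
  (h1c : (3 <= nu_of S)%N -> forall (t : R) (xd : nat -> X) d, 0 <= t ->
     (forall j, (1 <= j < nu_of S)%N -> Md j (xd j)) ->
     D2s S (nu_of S).-1 d ->
     exists! z, Mw (nu_of S).-2 z /\ F2Sigma_last S f t xd z d = 0)
  (h1d : forall s, (1 <= s < (nu_of S).-2)%N ->
     forall (t : R) (xd xw : nat -> X) d dw, 0 <= t ->
     (forall j, (1 <= j < nu_of S)%N -> Md j (xd j)) ->
     (forall i, (s.+1 <= i < (nu_of S).-1)%N -> Mw i (xw i)) ->
     Ddiag S s.+1 d -> Dwedge S s.+1 dw ->
     exists! z, Mw s z /\ F2Sigma S f s t xd z xw d dw = 0)
  (h1e : forall (t : R) x1 xS d dw, 0 <= t -> D1 S x1 -> Msum S 1 Md Mw xS ->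
     Ddiag S 1 d -> Dwedge S 1 dw ->
     exists! z, M20 z /\ F20 S f t x1 z xS d dw = 0)
  (h2a : (2 <= nu_of S)%N -> forall (t : R) z, 0 <= t -> Md (nu_of S).-1 z ->
     F2last S f t z = 0 ->
     exists L : X -> Y,
       frechet_within (Md (nu_of S).-1) (D2s S (nu_of S).-1)
         (fun x => Q2s S (nu_of S).-1 (f t x)) z L /\
       boundedly_invertible (D2s S (nu_of S).-1) (Y2s S (nu_of S).-1)
         (fun h => L (P2s S (nu_of S).-1 h)
                   - Q2s S (nu_of S).-1 (opB S (P2s S (nu_of S).-1 h))))
  (h2b : forall s, (1 <= s < (nu_of S).-1)%N ->
     forall (t : R) (xd : nat -> X), 0 <= t ->
     (forall i, (s <= i < nu_of S)%N -> Md i (xd i)) ->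
     F2diag S f s t (xd s) xd = 0 ->
     exists L : X -> Y,
       frechet_within (famsum s (nu_of S) Md) (famsum s (nu_of S) (Ddiag S))
         (fun x => Q2sj S s s.+1 (f t x)) (\sum_(s <= i < nu_of S) xd i) L /\
       boundedly_invertible (Ddiag S s) (Ydiag S s)
         (fun h => L (P2sj S s s.+1 h)
                   - Q2sj S s s.+1 (opB S (P2sj S s s.+1 h))))
  (h2c : (3 <= nu_of S)%N -> forall (t : R) (xd : nat -> X) z d, 0 <= t ->
     (forall j, (1 <= j < nu_of S)%N -> Md j (xd j)) ->
     Mw (nu_of S).-2 z -> D2s S (nu_of S).-1 d ->
     F2Sigma_last S f t xd z d = 0 ->
     exists L : X -> Y,
       frechet_within (Msum S (nu_of S).-2 Md Mw)
         (Msum S (nu_of S).-2 (Ddiag S) (Dwedge S))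
         (fun x => Q2Sigma S (nu_of S).-2 (f t x))
         (\sum_(1 <= j < nu_of S) xd j + z) L /\
       boundedly_invertible (Dwedge S (nu_of S).-2) (Y2Sigma S (nu_of S).-2)
         (fun h => L (P2wedge S (nu_of S).-2 h)
                   - Q2Sigma S (nu_of S).-2 (opB S (P2wedge S (nu_of S).-2 h))))
  (h2d : forall s, (1 <= s < (nu_of S).-2)%N ->
     forall (t : R) (xd xw : nat -> X) d dw, 0 <= t ->
     (forall j, (1 <= j < nu_of S)%N -> Md j (xd j)) ->
     (forall i, (s <= i < (nu_of S).-1)%N -> Mw i (xw i)) ->
     Ddiag S s.+1 d -> Dwedge S s.+1 dw ->
     F2Sigma S f s t xd (xw s) xw d dw = 0 ->
     exists L : X -> Y,
       frechet_within (Msum S s Md Mw) (Msum S s (Ddiag S) (Dwedge S))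
         (fun x => Q2Sigma S s (f t x))
         (\sum_(1 <= j < nu_of S) xd j + \sum_(s <= i < (nu_of S).-1) xw i) L /\
       boundedly_invertible (Dwedge S s) (Y2Sigma S s)
         (fun h => L (P2wedge S s h) - Q2Sigma S s (opB S (P2wedge S s h))))
  (h2e :
     ([/\ loc_lipschitz_x1_x20 S (Mtotal S M20 Md Mw)
            (fun t x => Q1 S (f t x)),
          loc_lipschitz_x1_x20 S (Mtotal S M20 Md Mw)
            (fun t x => Q2s S 0 (f t x)) &
          forall (th : R) x1h x20h xSh dh dwh, 0 <= th -> D1 S x1h -> M20 x20h ->
            Msum S 1 Md Mw xSh -> Ddiag S 1 dh -> Dwedge S 1 dwh ->
            F20 S f th x1h x20h xSh dh dwh = 0 ->
            exists (Z : X -> Y) (Zinv : Y -> X)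
              (k : 'rV[R]_5 -> R -> R) (l r : R),
            [/\ bounded_linear_on (D2s S 0) Z /\
                  is_bounded_inverse (D2s S 0) (Y2s S 0) Z Zinv,
                0 < r,
                forall (delta : 'rV[R]_5) (eps : R),
                  (forall i, 0 < delta 0 i <= r) -> 0 < eps <= r ->
                  forall (t : R) x1 xS d dw x' x'',
                  Uball (Rplus R) th (delta 0 0) t ->
                  Uball (D1 S) x1h (delta 0 1) x1 ->
                  Uball (D2Sigma S) xSh (delta 0 2) xS ->
                  Uball (Ddiag S 1) dh (delta 0 3) d ->
                  Uball (Dwedge S 1) dwh (delta 0 4) dw ->
                  Uball (D2s S 0) x20h eps x' ->
                  Uball (D2s S 0) x20h eps x'' ->
                  `|F20 S f t x1 x' xS d dw - F20 S f t x1 x'' xS d dw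
                     - Z (x' - x'')| <= k delta eps * `|x' - x''|,
                (fun p : 'rV[R]_5 * R => k p.1 p.2)
                  @ within [set p : 'rV[R]_5 * R | (forall i, 0 < p.1 0 i) /\ 0 < p.2]
                      (nbhs ((0, 0) : 'rV[R]_5 * R)) --> l &
                l < (opnorm (Y2s S 0) Zinv)^-1]])
     \/
     exists dQ1f dQ20f : R * X -> X -> Y,
       [/\ forall (t : R) x, 0 <= t -> Mtotal S M20 Md Mw x ->
             frechet_within (Mtotal S M20 Md Mw) (dom S)
               (fun y => Q1 S (f t y)) x (dQ1f (t, x)) /\
             frechet_within (Mtotal S M20 Md Mw) (dom S)
               (fun y => Q2s S 0 (f t y)) x (dQ20f (t, x)),
           op_continuous_on (Rplus R `*` Mtotal S M20 Md Mw) (dom S) dQ1f,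
           op_continuous_on (Rplus R `*` Mtotal S M20 Md Mw) (dom S) dQ20f &
           forall (th : R) x1h x20h xSh dh dwh, 0 <= th -> D1 S x1h -> M20 x20h ->
             Msum S 1 Md Mw xSh -> Ddiag S 1 dh -> Dwedge S 1 dwh ->
             F20 S f th x1h x20h xSh dh dwh = 0 ->
             boundedly_invertible (D2s S 0) (Y2s S 0)
               (fun h => dQ20f (th, x1h + x20h + xSh) (P2s S 0 h)
                         - Q2s S 0 (opB S (P2s S 0 h)))])
  (h3 : forall a1 a2 : R, 0 < a1 -> 0 < a2 -> exists C : R,
     forall (t : R) x1 x20 xS, 0 <= t <= a1 -> D1 S x1 -> M20 x20 ->
       Msum S 1 Md Mw xS -> `|x1| <= a2 ->
       `|Q1 S (f t (x1 + x20 + xS))| <= C)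
  (h4 : exists (r : R) (m : nat) (V : 'I_m -> Y -> R) (dV : 'I_m -> Y -> Y -> R)
          (U psi : R -> R),
     [/\ 0 < r /\ (0 < m)%N,
         forall i, [/\ {within Y1 S, continuous (V i)},
                       forall w, Y1 S w -> 0 <= V i w &
                       C1_on (Y1 S `&` [set w | r <= `|w|]) (Y1 S) (V i) (dV i)],
         {within Rplus R, continuous U} /\ (forall (u : R), 0 <= u -> 0 <= U u),
         (forall (t : R), 0 <= t -> 0 <= psi t) /\
           (forall a : R, 0 <= a ->
              lebesgue_measure.-integrable `[0, a] (EFin \o psi)) &
         [/\ forall u0 : R, 0 < u0 ->
               (\int[lebesgue_measure]_(u in `[u0, +oo[) ((U u)%:E^-1) = +oo)%E,
             forall C : R, exists b : R, forall w, Y1 S w -> b <= `|w| ->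
               C <= Vmax V w &
             forall (t : R) x20 xS w (j : 'I_m), 0 <= t -> M20 x20 ->
               Msum S 1 Md Mw xS -> Y1 S w -> r <= `|w| ->
               Vmax V w = V j w ->
               dV j w (Q1 S (f t (Atilde_inv S w + x20 + xS))
                       - Q1 S (opB S (Atilde_inv S w)))
                 <= U (Vmax V w) * psi t]]) :
  forall (t0 : R) (x01 : X), 0 <= t0 -> D1 S x01 ->
    let is_global_solution (x : R -> X) :=
      [/\ is_solution_on S f `[t0, +oo[ x,
          forall (t : R), t0 <= t -> Mtotal S M20 Md Mw (x t) &
          P1 S (x t0) = x01] in
    exists2 x, is_global_solution x &
      forall x', is_global_solution x' -> forall (t : R), t0 <= t -> x' t = x t.
Proof.
pose nu := nu_of S; rewrite -/nu in hCdiag hCSigma hClast h1a h1b h1c h1d h2a h2b h2c h2d *.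
have [lA _ _] := hA; have [lB _ _] := hB.
have nu0 : (0 < nu)%N.
  by move: hpencil; rewrite /pencil_regular_of_index; case: (scalars S) => [|? ?] [].
have nuE : nu.-1.+1 = nu by exact: prednK.
have eQ s : Q2sj S s s.+1 = QQ (S := S) (sdiag s).
  by apply/funext => y; rewrite (Q2sj_QQ hroot).
have eW s : Q2Sigma S s = QQ (S := S) (swedge s).
  by apply/funext => y; rewrite (Q2Sigma_QQ hroot).
(* Every chain that reaches the last level has length nu, so the projectors of index 2(nu-1) are
   diagonal ones; this merges the separately stated conditions a and b. *)
have eQlast : Q2s S nu.-1 = QQ (S := S) (sdiag nu.-1).
  by apply/funext => y; rewrite (Q2s_QQ hroot) (slev_last_Q hroot).
have ePlast : P2s S nu.-1 = P2sj S nu.-1 nu.-1.+1.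
  by apply/funext => x; rewrite (P2s_PP hroot) (P2sj_PP hroot) (slev_last_P hroot).
have eDlast : D2s S nu.-1 = Ddiag S nu.-1 by rewrite /D2s /Ddiag ePlast.
have eYlast : Y2s S nu.-1 = Ydiag S nu.-1 by rewrite /Y2s /Ydiag eQlast eQ.
have fam1 (E : nat -> set X) : famsum nu.-1 nu E = E nu.-1 by rewrite -{2}nuE famsum1.
have sub0P (V : zmodType) (a b : V) : (a - b = 0) <-> (a = b).
  by split=> [/eqP|->]; rewrite ?subrr// subr_eq0 => /eqP.
have Cdiag s : (1 <= s < nu)%N -> Ck_on (if s == nu.-1 then nu.-1 else nu.-2)
    (Rplus R `*` famsum s nu Md) ([set: R] `*` famsum s nu (Ddiag S))
    (fun p : R * X => QQ (S := S) (sdiag s) (f p.1 p.2)).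
  move=> sn; case: eqP => [sl|/eqP sl].
    by rewrite sl !fam1 -eDlast -eQlast; apply: hClast; lia.
  by rewrite -eQ; apply: hCdiag; lia.
have Udiag s : (1 <= s < nu)%N -> forall (t : R) (xd : nat -> X), 0 <= t ->
    (forall j, (s.+1 <= j < nu)%N -> Md j (xd j)) ->
    exists! z, Md s z /\ QQ (S := S) (sdiag s) (f t (z + \sum_(s.+1 <= j < nu) xd j)) = opB S z.
  move=> sn t xd t0 hxd; have [sl|/eqP sl] := eqVneq s nu.-1.
    have nu2 : (2 <= nu)%N by lia.
    rewrite sl; apply: ex_unique_iff (h1a nu2 t t0) => z.
    by rewrite /F2last -/nu eQlast big_geq ?addr0 ?nuE// sub0P.
  apply: ex_unique_iff (h1b s _ t xd t0 hxd) => [z|]; last by lia.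
  by rewrite /F2diag -/nu eQ sub0P.
have Idiag s : (1 <= s < nu)%N -> forall (t : R) (xd : nat -> X), 0 <= t ->
    (forall i, (s <= i < nu)%N -> Md i (xd i)) ->
    QQ (S := S) (sdiag s) (f t (\sum_(s <= j < nu) xd j)) = opB S (xd s) ->
    exists L : X -> Y,
      frechet_within (famsum s nu Md) (famsum s nu (Ddiag S))
        (fun x => QQ (S := S) (sdiag s) (f t x)) (\sum_(s <= i < nu) xd i) L /\
      boundedly_invertible (Ddiag S s) (Ydiag S s)
        (fun h => L (P2sj S s s.+1 h) - Q2sj S s s.+1 (opB S (P2sj S s s.+1 h))).
  move=> sn t xd t0 hxd e; have [sl|/eqP sl] := eqVneq s nu.-1.
    have nu2 : (2 <= nu)%N by lia.
    have sumE : \sum_(s <= i < nu) xd i = xd nu.-1 by rewrite sl -{2}nuE big_nat1.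
    rewrite sumE sl in e *; rewrite !fam1 -eDlast -eYlast -ePlast eQ -eQlast.
    apply: h2a => //; first by rewrite -sl; apply: hxd; lia.
    by rewrite /F2last -/nu eQlast e subrr.
  rewrite -eQ; apply: h2b => //; first by lia.
  by rewrite /F2diag -/nu -big_ltn; [rewrite eQ e subrr|lia].
have [xd xdS] := diag_curves lA lB hroot hMd Cdiag Udiag Idiag.
pose kd s := if s == nu.-1 then nu.-1 else nu.-2.
(* Outside the range of levels the derivative curve is set to 0, so that later sums and membership
   statements make sense for every index. *)
have exdxd s : exists dx : R -> X, [/\ (nu <= s)%N -> dx = fun=> 0, Ccurve (Ddiag S s) 0 dx &
    (1 <= s < nu)%N -> (forall t : R, 0 <= t -> deriv_within (Rplus R) (xd s) t (dx t)) /\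
      Ccurve (Ddiag S s) (kd s).-1 dx].
  have [sn|sn] := boolP (1 <= s < nu)%N; last first.
    by exists (fun=> 0); split=> //; apply: Ccurve_cst; exact: Ddiag0.
  have [xC _] := xdS s sn; have k0 : (0 < kd s)%N by rewrite /kd; case: eqP; lia.
  move: xC; rewrite -/(kd s) -(prednK k0) => -[_ [dx h1 h2]]; exists dx; split=> //; first by lia.
  exact: CcurveW (leq0n _) h2.
have [dxd dxdP] := choice exdxd.
have Cwedge s : (1 <= s < nu.-1)%N -> Ck_on s (Rplus R `*` Msum S s Md Mw)
    ([set: R] `*` Msum S s (Ddiag S) (Dwedge S)) (fun p : R * X => QQ (S := S) (swedge s) (f p.1 p.2)).
  by move=> sn; rewrite -eW; exact: hCSigma.
(* Hence condition c, which contains no wedge derivative, is the case s = nu - 2 of condition d. *)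
have dw_last d : Dwedge S nu.-1 d -> d = 0.
  by rewrite DwedgeE// => /= <-; exact: swedge_last.
have Uwedge s : (1 <= s < nu.-1)%N ->
    forall (t : R) (xd xw : nat -> X) d dw, 0 <= t ->
    (forall j, (1 <= j < nu)%N -> Md j (xd j)) ->
    (forall i, (s.+1 <= i < nu.-1)%N -> Mw i (xw i)) ->
    Ddiag S s.+1 d -> Dwedge S s.+1 dw ->
    exists! z, Mw s z /\
      QQ (S := S) (swedge s) (f t (\sum_(1 <= j < nu) xd j + (z + \sum_(s.+1 <= i < nu.-1) xw i))) =
        opB S z + opA S (d + dw).
  move=> sn t xd' xw' d dw t0 hxd hxw hd hdw.
  have [sl|/eqP sl] := eqVneq s nu.-2.
    have nu3 : (3 <= nu)%N by lia.
    have s1 : s.+1 = nu.-1 by lia.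
    rewrite s1 in hd hdw; rewrite (dw_last _ hdw) addr0 s1 sl.
    rewrite -eDlast in hd; apply: ex_unique_iff (h1c nu3 t xd' d t0 hxd hd) => z.
    rewrite /F2Sigma_last -/nu eW (@big_geq _ _ _ nu.-1 nu.-1)// addr0 -addrA -opprD sub0P.
    by [].
  apply: ex_unique_iff (h1d s _ t xd' xw' d dw t0 hxd hxw hd hdw) => [z|]; last by lia.
  by rewrite /F2Sigma -/nu eW -addrA -opprD sub0P.
have Iwedge s : (1 <= s < nu.-1)%N ->
    forall (t : R) (xd xw : nat -> X) d dw, 0 <= t ->
    (forall j, (1 <= j < nu)%N -> Md j (xd j)) ->
    (forall i, (s <= i < nu.-1)%N -> Mw i (xw i)) ->
    Ddiag S s.+1 d -> Dwedge S s.+1 dw ->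
    QQ (S := S) (swedge s) (f t (\sum_(1 <= j < nu) xd j + \sum_(s <= i < nu.-1) xw i)) =
      opB S (xw s) + opA S (d + dw) ->
    exists L : X -> Y,
      frechet_within (Msum S s Md Mw) (Msum S s (Ddiag S) (Dwedge S))
        (fun x => QQ (S := S) (swedge s) (f t x))
        (\sum_(1 <= j < nu) xd j + \sum_(s <= i < nu.-1) xw i) L /\
      boundedly_invertible (Dwedge S s) (Y2Sigma S s)
        (fun h => L (P2wedge S s h) - Q2Sigma S s (opB S (P2wedge S s h))).
  move=> sn t xd' xw' d dw t0 hxd hxw hd hdw e.
  have [sl|/eqP sl] := eqVneq s nu.-2.
    have nu3 : (3 <= nu)%N by lia.
    have s1 : s.+1 = nu.-1 by lia.
    rewrite s1 in hd hdw; rewrite (dw_last _ hdw) addr0 in e.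
    have sumE : \sum_(s <= i < nu.-1) xw' i = xw' s by rewrite -s1 big_nat1.
    rewrite sumE -eW in e *; rewrite -eDlast in hd.
    subst s; apply: (h2c nu3 t xd' (xw' nu.-2) d t0 hxd) => //; first by apply: hxw; lia.
    by rewrite /F2Sigma_last -/nu e; lincomb_eq.
  rewrite -eW in e *; have sn' : (1 <= s < nu.-2)%N by lia.
  apply: (h2d s sn' t xd' xw' d dw) => //.
  by rewrite /F2Sigma -/nu -big_ltn; [rewrite e; lincomb_eq|lia].
have hxd j : (1 <= j < nu)%N -> Ccurve (Ddiag S j) nu.-2 (xd j) /\ forall t : R, 0 <= t -> Md j (xd j t).
  move=> jn; have [xC xP] := xdS j jn; split=> [|t /xP[]//].
  by apply: CcurveW xC; case: eqP; lia.
have hdxd s : (1 <= s < nu.-1)%N -> Ccurve (Ddiag S s.+1) s (dxd s.+1).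
  move=> sn; have [_ _ h] := dxdP s.+1; have [|_ xC] := h; first by lia.
  by apply: CcurveW xC; rewrite /kd; case: eqP; lia.
have [xw [dxw0 [dxw0_out dxw0C dxw0_d xwS]]] :=
  wedge_curves lA lB hroot hMd hMw Cwedge Uwedge Iwedge hxd hdxd.
(* [wedge_curves] controls the levels from 1 on; level 0 receives the zero curve so that membership
   can be stated for all s. *)
pose dxw s := if s is s'.+1 then dxw0 s'.+1 else fun=> (0 : X).
have dxwC s : Ccurve (Dwedge S s) 0 (dxw s).
  case: s => [|s]; first by apply: Ccurve_cst; exact: Dwedge0.
  exact: CcurveW (leq0n _) (dxw0C s.+1 isT).
have dxw_out s : (nu.-1 <= s)%N -> dxw s = fun=> 0.
  by case: s => // s; exact: dxw0_out.
have dxdC s : Ccurve (Ddiag S s) 0 (dxd s) by have [] := dxdP s.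
have dxd_out s : (nu <= s)%N -> dxd s = fun=> 0 by have [] := dxdP s.
have xdP s : (1 <= s < nu)%N -> forall t : R, 0 <= t ->
    [/\ Md s (xd s t), deriv_within (Rplus R) (xd s) t (dxd s t),
     QQ (S := S) (sdiag s) (f t (xd s t + \sum_(s.+1 <= j < nu) xd j t)) = opB S (xd s t) &
     forall z, Md s z -> QQ (S := S) (sdiag s) (f t (z + \sum_(s.+1 <= j < nu) xd j t)) = opB S z -> z = xd s t].
  move=> sn t t0; have [_ /(_ t t0)[k1 k2 k3]] := xdS s sn.
  by have [_ _ /(_ sn)[k4 _]] := dxdP s; split=> //; exact: k4.
have xwP s : (1 <= s < nu.-1)%N -> forall t : R, 0 <= t ->
    [/\ Mw s (xw s t), deriv_within (Rplus R) (xw s) t (dxw s t),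
     QQ (S := S) (swedge s) (f t (\sum_(1 <= j < nu) xd j t + \sum_(s.+1 <= j < nu.-1) xw j t + xw s t)) =
       opB S (xw s t) + opA S (dxd s.+1 t + dxw s.+1 t) &
     forall z, Mw s z ->
       QQ (S := S) (swedge s) (f t (\sum_(1 <= j < nu) xd j t + \sum_(s.+1 <= j < nu.-1) xw j t + z)) =
       opB S z + opA S (dxd s.+1 t + dxw s.+1 t) -> z = xw s t].
  move=> sn t t0; have [_ /(_ t t0)[k1 k2 k3]] := xwS s sn; split=> //.
  + by have := dxw0_d s sn t t0; case: (s) sn.
pose xS t := \sum_(1 <= j < nu) xd j t + \sum_(1 <= j < nu.-1) xw j t.
have xSM (t : R) : 0 <= t -> Msum S 1 Md Mw (xS t).
  move=> t0; exists (\sum_(1 <= j < nu) xd j t); first by apply: famsumI => j jn; have [] := xdP j jn t t0.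
  by exists (\sum_(1 <= j < nu.-1) xw j t) => //; apply: famsumI => j jn; have [] := xwP j jn t t0.
have xSc (t : R) : 0 <= t -> xS @ within (Rplus R) (nbhs t) --> xS t.
  move=> t0; have sumc a b (F : nat -> R -> X) : (forall j, (a <= j < b)%N -> F j @ within (Rplus R) (nbhs t) --> F j t) ->
      (fun t => \sum_(a <= j < b) F j t) @ within (Rplus R) (nbhs t) --> \sum_(a <= j < b) F j t.
    move=> h; rewrite (_ : (fun t => _) = fun s => \sum_(a <= j < b) (if (a <= j < b)%N then F j else fun=> 0) s).
      rewrite (@eq_big_nat _ _ _ a b _ (fun j => (if (a <= j < b)%N then F j else fun=> 0) t)); last first.
        by move=> j ->.
      by apply: cvg_sumr => j; case: ifP => [/h//|_]; exact: cvg_cst.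
    by apply/funext => s; apply: eq_big_nat => j ->.
  apply: cvgD; apply: sumc => j jn.
    by have [_ h _ _] := xdP j jn t t0; exact: deriv_within_cvg h.
  by have [_ h _ _] := xwP j jn t t0; exact: deriv_within_cvg h.
pose d t := dxd 1%N t; pose dw t := dxw 1%N t.
have dE (t : R) : 0 <= t -> Ddiag S 1 (d t) /\ Dwedge S 1 (dw t).
  by move=> t0; split; [exact: Ccurve_in (dxdC _) t0|exact: Ccurve_in (dxwC _) t0].
pose lam t := opA S (d t + dw t).
have lamE (t : R) : 0 <= t -> lam t = AP (S := S) (sdiag 1) (d t) + AP (S := S) (swedge 1) (dw t) /\
    QQ (S := S) (slev 0) (lam t) = lam t.
  move=> t0; have [h1 h2] := dE t t0; have [e1 e2] := A_ddw lA lB hroot h1 h2; split=> //.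
  rewrite /lam -e2 QQ_QQ//; apply: eq_QQ => i l _; rewrite /slev /swedge.
  by case: (l == 0)%N.
have M20B z : M20 z -> opB S z = BP (S := S) (slev 0) z.
  move=> /(rel_open_sub hM20); rewrite D2sE// => Pz; exact: B_fixed Pz.
have exzeta (p : R * X) : exists z, 0 <= p.1 -> D1 S p.2 ->
    [/\ M20 z, QQ (S := S) (slev 0) (f p.1 (p.2 + z + xS p.1)) = opB S z + lam p.1,
        F20 S f p.1 p.2 z (xS p.1) (d p.1) (dw p.1) = 0 &
      forall z', M20 z' -> QQ (S := S) (slev 0) (f p.1 (p.2 + z' + xS p.1)) = opB S z' + lam p.1 -> z' = z].
  case: p => t x /=; have [t0|] := boolP (0 <= t); last by exists 0.
  have [Dx|] := pselect (D1 S x); last by exists 0.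
  have [h1 h2] := dE t t0; have [z [[Mz ez] zU]] := h1e t x (xS t) (d t) (dw t) t0 Dx (xSM t t0) h1 h2.
  have FE z' : (F20 S f t x z' (xS t) (d t) (dw t) = 0) <->
      (QQ (S := S) (slev 0) (f t (x + z' + xS t)) = opB S z' + lam t).
    by rewrite /F20 !(Q2s_QQ hroot) -/(lam t) (lamE t t0).2 -addrA -opprD sub0P.
  exists z => _ _; split=> //; first exact/FE.
  by move=> z' Mz' /FE ez'; rewrite (zU z').
have [zt ztP] := choice exzeta; pose zeta t x := zt (t, x).
have zetaP (t : R) x : 0 <= t -> D1 S x -> [/\ M20 (zeta t x),
    QQ (S := S) (slev 0) (f t (x + zeta t x + xS t)) = opB S (zeta t x) + opA S (dxd 1%N t + dxw 1%N t) &
    forall z, M20 z -> QQ (S := S) (slev 0) (f t (x + z + xS t)) = opB S z + opA S (dxd 1%N t + dxw 1%N t) -> z = zeta t x].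
  by move=> t0 Dx; have [] := ztP (t, x) t0 Dx.
have zetaM (t : R) x : 0 <= t -> D1 S x -> M20 (zeta t x) /\ F20 S f t x (zeta t x) (xS t) (d t) (dw t) = 0.
  by move=> t0 Dx; have [] := ztP (t, x) t0 Dx.
have bQ := QQ_bounded hroot; have bQ1 := Q1_bounded hroot.
pose g1 := slice_Q1 S f xS; pose g0 := slice_Q20 S f xS.
have Q20E : Q2s S 0 = QQ (S := S) (slev 0) by apply/funext => y; exact: Q2s_QQ.
have c1 : jointly_continuous (D1 S) M20 g1.
  exact: (h_continuous hA hB hroot hf hM20 hMd hMw xSM xSc bQ1).
have c0 : jointly_continuous (D1 S) M20 g0.
  exact: (h_continuous hA hB hroot hf hM20 hMd hMw xSM xSc (bQ _)).
have [l1 l0 con] : [/\ jointly_lipschitz (D1 S) M20 g1, jointly_lipschitz (D1 S) M20 g0 &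
    contractive (D1 S) (D2s S 0) M20 (Y2s S 0) g0 (BP (S := S) (slev 0)) zeta].
  case: h2e => [[L1 L0 hc]|[dQ1 [dQ0 [dP cQ1 cQ0 inv]]]].
    split; first exact: (h_lipschitz hA hB hroot hM20 hMd hMw xSM xSc L1).
      by rewrite /g0 /slice_Q20 -Q20E; exact: (h_lipschitz hA hB hroot hM20 hMd hMw xSM xSc L0).
    exact: (contractive_lip hA hB hroot hM20 hMd hMw xSM xSc dE zetaM hc).
  have dP1 (t : R) x : 0 <= t -> Mtotal S M20 Md Mw x ->
      frechet_within (Mtotal S M20 Md Mw) (dom S) (fun y => Q1 S (f t y)) x (dQ1 (t, x)).
    by move=> t0 Mx; have [] := dP t x t0 Mx.
  have dP0 (t : R) x : 0 <= t -> Mtotal S M20 Md Mw x ->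
      frechet_within (Mtotal S M20 Md Mw) (dom S) (fun y => Q2s S 0 (f t y)) x (dQ0 (t, x)).
    by move=> t0 Mx; have [] := dP t x t0 Mx.
  split; first exact: (h_lipschitz_diff hA hB hroot hM20 hMd hMw xSM xSc dP1 cQ1).
    by rewrite /g0 /slice_Q20 -Q20E; exact: (h_lipschitz_diff hA hB hroot hM20 hMd hMw xSM xSc dP0 cQ0).
  exact: (contractive_diff hA hB hroot hM20 hMd hMw xSM xSc dE zetaM dP0 cQ0 inv).
have bP := PP_bounded hroot; have bBP := BP_bounded hroot.
have E0cl : closed (D2s S 0) by rewrite D2sE//; exact: closed_fixed.
have E00 : D2s S 0 0 by rewrite D2sE//; exact: (blin0 (bP _)).
have E0P (a : R) x y : D2s S 0 x -> D2s S 0 y -> D2s S 0 (a *: x + y).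
  by rewrite D2sE//; exact: fixed_lin.
have F00 : Y2s S 0 0 by rewrite Y2sE//; exact: (blin0 (bQ _)).
have F0P (a : R) (x y : Y) : Y2s S 0 x -> Y2s S 0 y -> Y2s S 0 (a *: x + y).
  by rewrite Y2sE//; exact: fixed_lin.
have F0Q y : Y2s S 0 (QQ (S := S) (slev 0) y).
  by rewrite Y2sE//= QQ_QQ//; apply: eq_QQ => i l _; rewrite andbb.
have KF z : D2s S 0 z -> Y2s S 0 (BP (S := S) (slev 0) z) by move=> _; rewrite Y2sE//=; exact: QBP.
have lamF (t : R) : 0 <= t -> Y2s S 0 (lam t) by move=> t0; rewrite Y2sE//=; have [] := lamE t t0.
have lamc (t : R) : 0 <= t -> lam @ within (Rplus R) (nbhs t) --> lam t.
  move=> t0; have bA := AP_bounded hroot.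
  have C : Ccurve setT 0 (fun s => AP (S := S) (sdiag 1) (d s) + AP (S := S) (swedge 1) (dw s)).
    by apply: CcurveD; [apply: (Ccurve_blin (bA _)) (dxdC 1%N)|apply: (Ccurve_blin (bA _)) (dxwC 1%N)].
  by apply: (Ccurve_cvg (eq_Ccurve _ C) t0) => s s0; have [] := lamE s s0.
have zetaP0 (t : R) x : 0 <= t -> D1 S x -> [/\ M20 (zeta t x),
    g0 t x (zeta t x) = BP (S := S) (slev 0) (zeta t x) + lam t &
    forall z, M20 z -> g0 t x z = BP (S := S) (slev 0) z + lam t -> z = zeta t x].
  move=> t0 Dx; have [k1 k2 k3] := zetaP t x t0 Dx; split=> //; first by rewrite -M20B.
  by move=> z Mz ez; apply: k3 => //; rewrite M20B.
have reg (t : R) x (e : R) := @zeta_regular R X Y (D1 S) (D2s S 0) M20 (Y2s S 0) g0 (BP (S := S) (slev 0)) lam zeta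
  E0cl E0P F00 F0P hM20 KF (fun t x z => F0Q _) lamF lamc c0 l0 zetaP0 con t x e.
have bL := Ainv_bounded hA hB hdom hpencil hroot; have bBL := B_Ainv_bounded hA hB hdom hpencil hroot.
have AinvD w : D1 S (Ainv S w) by apply/(D1P hA hB hroot); have [] := AinvP hA hB hdom hpencil hroot w.
pose G := ode_field g1 zeta (Ainv S) (opB S \o Ainv S).
have Gc : ode_continuous 0 G.
  exact: (ode_field_continuous E0cl E0P F00 F0P hM20 KF (fun t x z => F0Q _) lamF lamc c0 c1 l0 zetaP0 con bL bBL AinvD).
have Gl : ode_lipschitz 0 G.
  exact: (ode_field_lipschitz E0cl E0P F00 F0P hM20 KF (fun t x z => F0Q _) lamF lamc c0 l0 l1 zetaP0 con bL bBL AinvD).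
have Y1P y : Y1 S y <-> Q1 S y = y.
  split=> [[z _ <-]|e]; first exact: (Q1_Q1 hroot).
  by exists y.
have AinvQ1 w : Ainv S (Q1 S w) = Ainv S w by rewrite /Ainv (Q1_Q1 hroot).
have GQ1 (t : R) w : G t (Q1 S w) = G t w by rewrite /G /ode_field /= AinvQ1.
have Q1BA w : Q1 S (opB S (Ainv S w)) = opB S (Ainv S w).
  have [DL PL _] := AinvP hA hB hdom hpencil hroot w.
  by rewrite -(B_P1 hA hB hroot DL) (P1E hroot) PL subr0.
have Q1G (t : R) w : Q1 S (G t w) = G t w.
  by rewrite /G /ode_field (blinB bQ1) /= Q1BA /g1 /slice_Q1 (Q1_Q1 hroot).
(* Condition 3 bounds Q_1 f and the product of B with the inverse of A is bounded, so G is bounded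
   on bounded sets; this turns a bound on the solution into the bound on slopes required by
   [ode_global]. *)
have Gb (a b : R) : 0 < a -> 0 < b -> exists C : R, forall t u, 0 <= t <= a -> Y1 S u -> `|u| <= b -> `|G t u| <= C.
  move=> a0 b0; have [CA CA0 hCA] := blin_bound bL; have [CB CB0 hCB] := blin_bound bBL.
  have [C hC] := h3 a (CA * b) a0 (mulr_gt0 CA0 b0); exists (C + CB * b) => t u ta _ ub.
  have [Mz _ _] := zetaP t (Ainv S u) (andP ta).1 (AinvD u).
  rewrite (le_trans (ler_normB _ _))// lerD//.
    apply: hC => //; first exact: xSM (andP ta).1.
    by rewrite (le_trans (hCA u))// ler_pM2l.
  by rewrite (le_trans (hCB u))// ler_pM2l.
have Y1lin (a : R) (x y : Y) : Y1 S x -> Y1 S y -> Y1 S (a *: x + y).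
  by move=> /Y1P ex /Y1P ey; apply/Y1P; rewrite (blinP bQ1) ex ey.
move=> t0 x01 t00 Dx01 is_global.
have [D01 P01] := (D1P hA hB hroot x01).1 Dx01.
have [w w0 wd] : exists2 w, w t0 = opA S x01 & ode_sol G `[t0, +oo[ w.
  apply: (ode_global Gc Gl t00) => T w t0T w0 wd.
  (* The properties of the functionals are given on Y_1 only, so the bound is proved for Q_1 w,
     which solves the same equation because G factors through Q_1 and takes values in Y_1. *)
  have vd : ode_sol G `[t0, T[ (Q1 S \o w).
    by move=> t tT /=; rewrite GQ1 -Q1G; exact: (deriv_within_blin bQ1 (wd t tT)).
  have [r [m [V [dV [U [psi [[r0 m0] hV [Uc U0] [psi0 psi_int] [U_div V_co V_gr]]]]]]]] := h4.
  have [C hC] : exists C : R, forall t, t0 <= t < T -> `|(Q1 S \o w) t| <= C.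
    apply: (@apriori_bound R Y (Y1 S) G r m V dV U psi Y1lin _ Gc Gb r0 m0 _ _ Uc U0 psi0 psi_int U_div V_co) => //.
    - by move=> t u; apply/Y1P.
    - by move=> i; have [] := hV i.
    - by move=> i u; have [_ + _] := hV i; apply.
    - move=> t u j tp Yu ru e; have [Mz _ _] := zetaP t (Ainv S u) tp (AinvD u).
      have uE : Atilde_inv S u = Ainv S u by rewrite /Ainv ((Y1P u).1 Yu).
      have := V_gr t (zeta t (Ainv S u)) (xS t) u j tp Mz (xSM t tp) Yu ru e.
      by rewrite uE Q1BA.
    - by move=> t tT; apply/Y1P; exact: (Q1_Q1 hroot).
  have T0 : 0 < T by exact: le_lt_trans t00 t0T.
  have C1 : 0 < `|C| + 1 by rewrite ltr_wpDl.
  have [C' hC'] := Gb T (`|C| + 1) T0 C1; exists C' => t /[dup] tT /andP[tt tT'].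
  rewrite -GQ1; apply: hC'; first by rewrite (le_trans t00 tt) ltW.
    by apply/Y1P; exact: (Q1_Q1 hroot).
  by rewrite (le_trans (hC t tT))// (le_trans (ler_norm C))// lerDl.
have [x [xs xM x0]] := solution_exists hA hB hdom hpencil hroot nu0 hstruct hM20 hMd hMw xdP dxdC xwP dxwC
  dxd_out dxw_out zetaP reg Gc t00 Dx01 w0 wd.
exists x; first by split.
move=> x' [x's x'M x'0] t tt.
have Jt : `[t0, +oo[%classic t by rewrite /= in_itv/= tt.
have uniq := @solution_components R X Y S f M20 Md Mw hA hB hdom hpencil hroot nu0 hstruct hM20 hMd hMw
  xd dxd xw dxw zeta xdP dxdC xwP dxwC dxd_out dxw_out zetaP reg c1 Gl t0 x01.
by rewrite (uniq x w t00 xs xM x0 w0 wd t Jt) (uniq x' w t00 x's x'M x'0 w0 wd t Jt).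
Qed.
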